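(* Let $bc\in\{per,ap,dir\}$ and let $m$ be the number from the description of the spectrum of $L_{bc}$ given in the context ($m\in\mathbb{Z}_+$ if $bc\in\{per,ap\}$, $m\in\mathbb{N}$ if $bc=dir$). The operator $-L_{bc}$ is sectorial and it generates an analytic semigroup of operators $T:\mathbb{R}_+\to\mathrm{End}\,L_2[0,\omega]$. This semigroup is similar to a semigroup $\widetilde T:\mathbb{R}_+\to\mathrm{End}\,L_2[0,\omega]$ of the form $$\widetilde T(t)=\widetilde T_{(m)}(t)\oplus\widetilde T^{(m)}(t),\quad t\in\mathbb{R}_+,$$ acting in $L_2[0,\omega]=\mathcal{H}_{(m)}\oplus\mathcal{H}^{(m)}$. Here $\mathcal{H}_{(m)}=\mathrm{Im}\,\mathbb{P}_{(m)}$, $\mathcal{H}^{(m)}=\mathrm{Im}\,(I-\mathbb{P}_{(m)})$ for $bc\in\{per,ap\}$, and $\mathcal{H}_{(m)}=\mathrm{Im}\,P_{(m)}$, $\mathcal{H}^{(m)}=\mathrm{Im}\,(I-P_{(m)})$ for $bc=dir$. For $bc=dir$ the semigroup $\widetilde T^{(m)}:\mathbb{R}_+\to\mathrm{End}\,\mathcal{H}^{(m)}$ is represented as $$\widetilde T^{(m)}(t)x=\sum_{s\ge m+1}e^{-\widetilde\lambda_{s,dir}t}P_{s,dir}x,\quad x\in L_2[0,\omega],$$ where $\widetilde\lambda_{s,dir}$, $s\ge m+1$, are the eigenvalues of $L_{dir}$ described in the context.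
   Context: $\mathbb{Z}_+=\mathbb{N}\cup\{0\}$, $\mathbb{R}_+=[0,\infty)$; $\mathrm{End}\,H$ is the algebra of bounded linear operators on $H$; $I$ is the identity operator. Let $k>1$ be an integer, $\omega>0$, $q\in L_2[0,\omega]$ complex-valued. $L_2[0,\omega]$ is the complex Hilbert space with inner product $(x,y)=\frac1\omega\int_0^\omega x(\tau)\overline{y(\tau)}\,d\tau$. $H^{2k}[0,\omega]$ is the Sobolev space of $y\in L_2[0,\omega]$ that are $2k$ times differentiable with $y^{(2k-1)}$ absolutely continuous and $y^{(2k)}\in L_2[0,\omega]$. $L_{bc}y=(-1)^ky^{(2k)}-qy$ with domain $\{y\in H^{2k}[0,\omega]: y\text{ satisfies } bc\}$, where: $bc=per$: $y^{(j)}(0)=y^{(j)}(\omega)$, $0\le j\le 2k-1$; $bc=ap$: $y^{(j)}(0)=-y^{(j)}(\omega)$, $0\le j\le 2k-1$; $bc=dir$: $y^{(2i)}(0)=y^{(2i)}(\omega)=0$, $0\le i\le k-1$. Put $\theta=0$ for $per$, $\theta=1$ for $ap$. Sectorial is used here in the convention in which the operator is itself the generator: its resolvent set contains a sector $\{\lambda\ne a:|\arg(\lambda-a)|<\varphi\}$ with $a\in\mathbb{R}$, $\varphi\in(\pi/2,\pi)$, on which the resolvent norm is at most $M/|\lambda-a|$. Semigroups $T,\widetilde T$ are similar if there is a boundedly invertible $U\in\mathrm{End}\,L_2[0,\omega]$ with $T(t)U=U\widetilde T(t)$ for all $t\in\mathbb{R}_+$. Projections. For $bc\in\{per,ap\}$: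 $e_n(t)=e^{-i\pi(2n+\theta)t/\omega}$, $n\in\mathbb{Z}$; $\mathbb{P}_nx=(x,e_{-n-\theta})e_{-n-\theta}+(x,e_n)e_n$, $n\in\mathbb{Z}_+$ (with $\mathbb{P}_0x=(x,e_0)e_0$ if $\theta=0$); $\mathbb{P}_{(m)}=\sum_{j=0}^m\mathbb{P}_j$. For $bc=dir$: $e_{n,dir}(t)=\sqrt2\sin(\pi nt/\omega)$, $P_{n,dir}x=(x,e_{n,dir})e_{n,dir}$, $n\in\mathbb{N}$; $P_{(m)}=\sum_{j=1}^mP_{j,dir}$. Fourier coefficients. $q_l=\frac1\omega\int_0^\omega q(t)e^{-i2\pi lt/\omega}dt$, $l\in\mathbb{Z}$, so that $q(t)=\sum_{l\in\mathbb{Z}}q_le^{i2\pi lt/\omega}$; $\widetilde q_l=\frac{\sqrt2}{\omega}\int_0^\omega q(t)\cos\frac{\pi lt}{\omega}dt$, $l\in\mathbb{N}$. The number $m$ and the spectrum. The following is known and fixes $m$. The operator $L_{bc}$ has discrete spectrum. For $bc\in\{per,ap\}$ there exists $m\in\mathbb{Z}_+$ such that $\sigma(L_{bc})=\sigma_{(m)}\cup\{\widetilde\lambda_n^{\mp}:n\ge m+1\}$, where $\sigma_{(m)}$ is a finite set with at most $2m+1$ points and, for $n\ge m+1$, $$\begin{aligned}\widetilde\lambda_n^{\mp}=&\Big(\frac{\pi(2n+\theta)}{\omega}\Big)^{2k}-q_0-\frac{2\omega^{2k}}{\pi^{2k}}\sum_{j\ge1,\,j\ne n}\frac{q_{n-j}q_{j-n}}{(2j+\theta)^{2k}-(2n+\theta)^{2k}}\\&\mp\Big(q_{-2n-\theta}+\frac{\omega^{2k}}{\pi^{2k}}\sum_{j\in\mathbb{Z},\,j\ne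 n,\,j\ne-n-\theta}\frac{q_{-n-j-\theta}q_{j-n}}{(2j+\theta)^{2k}-(2n+\theta)^{2k}}\Big)^{1/2}\\&\cdot\Big(q_{2n+\theta}+\frac{\omega^{2k}}{\pi^{2k}}\sum_{j\in\mathbb{Z},\,j\ne n,\,j\ne-n-\theta}\frac{q_{n+j+\theta}q_{n-j}}{(2j+\theta)^{2k}-(2n+\theta)^{2k}}\Big)^{1/2}+\xi_{bc}(n),\end{aligned}$$ with $|\xi_{bc}(n)|\le C\alpha_n/n^{4k-3}$ for a constant $C>0$ and a square summable sequence $(\alpha_n)$. For $bc=dir$ there exists $m\in\mathbb{N}$ such that $\sigma(L_{dir})=\sigma_{(m)}\cup\{\widetilde\lambda_{n,dir}:n\ge m+1\}$, where $\sigma_{(m)}$ is a finite set with at most $m$ points and, for $n\ge m+1$, $$\widetilde\lambda_{n,dir}=\Big(\frac{\pi n}{\omega}\Big)^{2k}-\frac1\omega\int_0^\omega q(t)\,dt+\frac1\omega\int_0^\omega q(t)\cos\frac{2\pi n}{\omega}t\,dt-\frac{\omega^{2k}}{2\pi^{2k}}\sum_{j\ge1,\,j\ne n}\frac{(\widetilde q_{|n-j|}-\widetilde q_{n+j})^2}{j^{2k}-n^{2k}}+\eta_{dir}(n),$$ with $|\eta_{dir}(n)|\le C\beta_n/n^{4k-3}$ for a constant $C>0$ and a square summable sequence $(\beta_n)$. *)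

(* Defs.v *)
From HB Require Import structures.
From mathcomp Require Import all_boot all_order all_algebra.
From mathcomp Require Import generic_quotient ring_quotient.
From mathcomp Require Import all_classical all_reals all_analysis measurable_realfun.
From mathcomp Require Import complex.

Set Implicit Arguments.
Unset Strict Implicit.
Unset Printing Implicit Defensive.

Import Order.TTheory GRing.Theory Num.Theory.
Import numFieldNormedType.Exports.

Local Notation Re := complex.Re.
Local Notation Im := complex.Im.

Local Open Scope classical_set_scope.
Local Open Scope complex_scope.
Local Open Scope ring_scope.

Section ComplexL2.
Context d (T : measurableType d) (R : realType).
Variable mu : {measure set T -> \bar R}.

Let one_le2 : (1 <= 2%:E :> \bar R)%E.
Proof. by rewrite lee_fin ler1n. Qed.

Let two_gt0 : (0 < 2%:E :> \bar R)%E.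
Proof. by rewrite lte_fin. Qed.

Definition sqint : {pred T -> R[i]} :=
  [pred f : T -> R[i] | ((fun t : T => Re (f t) : R) \in Lfun mu 2%:E) &&
            ((fun t : T => Im (f t) : R) \in Lfun mu 2%:E)].

Lemma sqint_submod_closed : submod_closed sqint.
Proof.
have [L0 LD] := Lfun_submod_closed mu one_le2.
split=> [|a f g]; first by rewrite inE; apply/andP; split; exact: L0.
rewrite !inE => /andP[rf imf] /andP[rg img].
have zL (c : R) (h : T -> R) : h \in Lfun mu 2%:E -> (c \*: h) \in Lfun mu 2%:E.
  by move=> hL; rewrite -[X in X \in _]addr0; exact: LD.
have DL (h1 h2 : T -> R) : h1 \in Lfun mu 2%:E -> h2 \in Lfun mu 2%:E ->
    h1 \+ h2 \in Lfun mu 2%:E.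
  by move=> h1L h2L; rewrite -[h1]scale1r; exact: LD.
have pt t : (a *: f + g) t = a * f t + g t by [].
apply/andP; split.
- rewrite (_ : (fun t => _) =
      (Re a \*: (fun t => Re (f t))) \+
      (((- Im a) \*: (fun t => Im (f t))) \+ (fun t => Re (g t)))).
    by apply: (DL _ _); [exact: zL | apply: (DL _ _) => //; exact: zL].
  apply/funext => t; rewrite pt /= /GRing.scale /=.
  by case: a (f t) (g t) {pt} => [a1 a2] [f1 f2] [g1 g2] /=; rewrite mulNr addrA.
- rewrite (_ : (fun t => _) =
      (Re a \*: (fun t => Im (f t))) \+
      ((Im a \*: (fun t => Re (f t))) \+ (fun t => Im (g t)))).
    by apply: (DL _ _); [exact: zL | apply: (DL _ _) => //; exact: zL].
  apply/funext => t; rewrite pt /= /GRing.scale /=.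
  by case: a (f t) (g t) {pt} => [a1 a2] [f1 f2] [g1 g2] /=; rewrite addrA.
Qed.

HB.instance Definition _ :=
  GRing.isSubmodClosed.Build _ _ sqint sqint_submod_closed.

Record sqint_fun := SqintFun { sqint_val :> T -> R[i]; _ : sqint_val \in sqint }.
HB.instance Definition _ := [isSub for sqint_val].
HB.instance Definition _ := [Choice of sqint_fun by <:].
HB.instance Definition _ := [SubChoice_isSubLmodule of sqint_fun by <:].


Definition ae_zero : {pred sqint_fun} :=
  [pred f : sqint_fun | `[< {ae mu, forall t, f t = 0} >]].

Lemma ae_zeroP (f : sqint_fun) :
  reflect {ae mu, forall t, f t = 0} (f \in ae_zero).
Proof. exact: asboolP. Qed.

Lemma ae_zero_zmod_closed : zmod_closed ae_zero.
Proof.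
split=> [|f g /ae_zeroP f0 /ae_zeroP g0]; apply/ae_zeroP.
  exact: (aeW mu).
by apply: filterS2 f0 g0 => t f0 g0; rewrite -[LHS]/(f t - g t) f0 g0 subr0.
Qed.

HB.instance Definition _ :=
  GRing.isZmodClosed.Build _ ae_zero ae_zero_zmod_closed.

Lemma ae_zeroZ a (f : sqint_fun) : f \in ae_zero -> a *: f \in ae_zero.
Proof.
move=> /ae_zeroP f0; apply/ae_zeroP; apply: filterS f0 => t /= f0.
by rewrite -[LHS]/(a * f t) f0 mulr0.
Qed.

Definition cL2 : Type := Quotient.quot (ae_zero : zmodClosed _).
HB.instance Definition _ := GRing.Zmodule.on cL2.

Local Open Scope quotient_scope.

Definition cL2_class (f : sqint_fun) : cL2 :=
  \pi_(Quotient.quot (ae_zero : zmodClosed _)) f.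

Definition cL2_repr (x : cL2) : sqint_fun :=
  repr (x : Quotient.quot (ae_zero : zmodClosed _)).

Lemma cL2_reprK : cancel cL2_repr cL2_class.
Proof. exact: reprK. Qed.

Lemma cL2_classD (f g : sqint_fun) : cL2_class (f + g) = cL2_class f + cL2_class g.
Proof. exact: raddfD. Qed.

Lemma cL2_class_eqP (f g : sqint_fun) : reflect {ae mu, forall t, f t = g t}
  (cL2_class f == cL2_class g).
Proof.
rewrite -Quotient.idealrBE; apply: (iffP (ae_zeroP _)); apply: filterS => t /=.
  by move=> fg0; apply/eqP; rewrite -subr_eq0; apply/eqP.
by move=> fg; rewrite -[LHS]/(f t - g t) fg subrr.
Qed.

Definition cL2_scale a (x : cL2) : cL2 := cL2_class (a *: cL2_repr x).

Lemma cL2_classZ a (f : sqint_fun) : cL2_class (a *: f) = cL2_scale a (cL2_class f).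
Proof.
apply/eqP/cL2_class_eqP.
have /eqP/cL2_class_eqP := cL2_reprK (cL2_class f).
by apply: filterS => t ft; rewrite -[LHS]/(a * f t) -ft.
Qed.

Lemma cL2_scaleA a b x : cL2_scale a (cL2_scale b x) = cL2_scale (a * b) x.
Proof. by rewrite -[x]cL2_reprK -!cL2_classZ scalerA. Qed.

Lemma cL2_scale1 : left_id 1 cL2_scale.
Proof. by move=> x; rewrite -[x]cL2_reprK -!cL2_classZ scale1r. Qed.

Lemma cL2_scaleDr : right_distributive cL2_scale +%R.
Proof.
move=> a x y; rewrite -[x]cL2_reprK -[y]cL2_reprK.
by rewrite -cL2_classD -!cL2_classZ scalerDr cL2_classD.
Qed.

Lemma cL2_scaleDl x : {morph cL2_scale^~ x : a b / a + b}.
Proof.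
by move=> a b; rewrite -[x]cL2_reprK -!cL2_classZ scalerDl cL2_classD.
Qed.

HB.instance Definition _ := GRing.Zmodule_isLmodule.Build R[i] cL2
  cL2_scaleA cL2_scale1 cL2_scaleDr cL2_scaleDl.

(* `|_| on R[i] is R[i]-valued *)
Definition modulus (f : T -> R[i]) (t : T) : R := Re `|f t|.

Lemma modulusE (f : T -> R[i]) t :
  modulus f t = Num.sqrt (Re (f t) ^+ 2 + Im (f t) ^+ 2).
Proof. by rewrite /modulus normc_def. Qed.

Lemma modulus_ge0 f t : 0 <= modulus f t.
Proof. by rewrite modulusE sqrtr_ge0. Qed.

Lemma modulusC f t : (modulus f t)%:C = `|f t|.
Proof. by rewrite modulusE normc_def. Qed.

Lemma measurable_modulus (f : sqint_fun) : measurable_fun setT (modulus f).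
Proof.
have /andP[/andP[mr _] /andP[mi _]] : (f : T -> R[i]) \in sqint := valP f.
rewrite !inE/= in mr mi.
rewrite (_ : modulus f = Num.sqrt \o
    ((fun t => Re (f t) ^+ 2) \+ (fun t => Im (f t) ^+ 2))).
  apply: (@measurableT_comp _ _ _ _ _ _ (@Num.sqrt R)).
    by apply: continuous_measurable_fun; exact: sqrt_continuous.
  by apply: measurable_funD; apply: measurable_funX.
by apply/funext => t; rewrite modulusE.
Qed.

Lemma le_Lnorm2 (f g : T -> R) : measurable_fun setT f ->
  measurable_fun setT g -> (forall t, 0 <= f t <= g t) ->
  ('N[mu]_2%:E[EFin \o f] <= 'N[mu]_2%:E[EFin \o g])%E.
Proof.
move=> mf mg fg; rewrite unlock gt0_ler_poweR//.
- by rewrite in_itv/= leey integral_ge0.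
- by rewrite in_itv/= leey integral_ge0.
have mp (h : T -> R) : measurable_fun setT h ->
    measurable_fun setT (fun x => (`|(EFin \o h) x| `^ 2)%E).
  move=> mh; apply: (@measurableT_comp _ _ _ _ _ _ (fun x => x `^ 2)%E).
    exact: measurable_poweR.
  by apply: measurableT_comp => //; exact/measurable_EFinP.
apply: ge0_le_integral => //; [by move=> *; exact: poweR_ge0|exact: mp|exact: mp|move=> t _ /=].
have /andP[f0 fgt] := fg t.
rewrite lee_fin !ger0_norm ?(le_trans f0)//.
by apply: ge0_ler_powR; rewrite ?nnegrE// (le_trans f0).
Qed.

Lemma modulus_Lfun (f : sqint_fun) : modulus f \in Lfun mu 2%:E.
Proof.
have /andP[rf imf] : (f : T -> R[i]) \in sqint := valP f.
have [/andP[mr fr] /andP[mi fi]] := (rf, imf).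
rewrite !inE/= in mr mi fr fi.
apply/andP; split; rewrite inE/=; first exact: measurable_modulus.
rewrite /finite_norm.
apply: (@le_lt_trans _ _ ('N[mu]_2%:E[EFin \o
    ((fun t => `|Re (f t)|) \+ (fun t => `|Im (f t)|))%R])%E).
  apply: le_Lnorm2; first exact: measurable_modulus.
    by apply: measurable_funD; apply: measurableT_comp.
  move=> t; rewrite modulus_ge0 modulusE /=.
  rewrite -(ler_pXn2r (n:=2))// ?nnegrE ?sqrtr_ge0 ?addr_ge0//.
  rewrite sqr_sqrtr ?addr_ge0 ?sqr_ge0// sqrrD -!normrX.
  rewrite !(ger0_norm (sqr_ge0 _)) lerD2r lerDl.
  by rewrite mulrn_wge0 ?mulr_ge0.
apply: le_lt_trans; first apply: eminkowski => //.
- by apply: measurableT_comp.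
- by apply: measurableT_comp.
have E (h : T -> R) : ('N[mu]_2%:E[EFin \o (fun t => `|h t|)%R] = 'N[mu]_2%:E[EFin \o h])%E.
  by rewrite -[RHS]Lnorm_abse.
by rewrite !E lte_add_pinfty.
Qed.

Definition sq_norm (f : sqint_fun) : R := fine 'N[mu]_2%:E[EFin \o modulus f].

Lemma sq_normE f : (sq_norm f)%:E = 'N[mu]_2%:E[EFin \o modulus f]%E.
Proof.
have /andP[_] := modulus_Lfun f; rewrite inE => fin.
by rewrite fineK// ge0_fin_numE ?Lnorm_ge0.
Qed.

Lemma sq_norm_triangle f g : sq_norm (f + g) <= sq_norm f + sq_norm g.
Proof.
rewrite -lee_fin EFinD !sq_normE.
have mf := measurable_modulus.
apply: le_trans (eminkowski _ (mf f) (mf g) one_le2).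
apply: le_Lnorm2 => //; first exact: measurable_funD.
move=> t; rewrite modulus_ge0 /= -lecR rmorphD /= !modulusC.
exact: ler_normD.
Qed.

Lemma sq_normZ a f : sq_norm (a *: f) = Re `|a| * sq_norm f.
Proof.
have a0 : 0 <= Re `|a| by rewrite normc_def sqrtr_ge0.
apply/EFin_inj; rewrite EFinM !sq_normE.
have [m me] : exists m : LfunType mu one_le2, m = modulus f :> (T -> R).
  by exists (Lfun_Sub one_le2 (modulus_Lfun f)).
rewrite -me -[in RHS](ger0_norm a0) -LnormZ; apply: eq_Lnorm => t /=.
rewrite me; congr EFin; apply: complexI.
by rewrite modulusC -[LHS]/(`|a * f t|) normrM rmorphM /= modulusC.
Qed.

Lemma sq_norm_eq (f g : sqint_fun) :
  {ae mu, forall t, f t = g t} -> sq_norm f = sq_norm g.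
Proof.
move=> fg; rewrite /sq_norm unlock; congr (fine (_ `^ _)%E).
have mp (h : sqint_fun) :
    measurable_fun setT (fun x => (`|(EFin \o modulus h) x| `^ 2)%E).
  apply: (@measurableT_comp _ _ _ _ _ _ (fun x => x `^ 2)%E).
    exact: measurable_poweR.
  apply: measurableT_comp => //; apply/measurable_EFinP.
  exact: measurable_modulus.
apply: ae_eq_integral => //; try exact: mp.
by apply: filterS fg => t fgt _; rewrite /= /modulus fgt.
Qed.

Lemma sq_norm_eq0 f : sq_norm f = 0 -> f \in ae_zero.
Proof.
move=> f0; apply/ae_zeroP.
have N0 : 'N[mu]_2%:E[EFin \o modulus f]%E = 0 by rewrite -sq_normE f0.
have mf : measurable_fun setT (EFin \o modulus f).
  exact/measurable_EFinP/measurable_modulus.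
have := Lnorm_eq0_eq0 mf two_gt0 N0; apply: filterS => t /(_ I) [ft0].
by apply/eqP; rewrite -normr_eq0 -modulusC ft0.
Qed.

Definition cL2_norm (x : cL2) : R[i] := (sq_norm (cL2_repr x))%:C.

Lemma cL2_norm_class f : cL2_norm (cL2_class f) = (sq_norm f)%:C.
Proof.
congr (_%:C); apply: sq_norm_eq; apply/cL2_class_eqP.
by rewrite cL2_reprK.
Qed.

Lemma cL2_normD x y : cL2_norm (x + y) <= cL2_norm x + cL2_norm y.
Proof.
rewrite -[x]cL2_reprK -[y]cL2_reprK -cL2_classD !cL2_norm_class.
by rewrite -rmorphD lecR sq_norm_triangle.
Qed.

Lemma cL2_normZ a x : cL2_norm (a *: x) = `|a| * cL2_norm x.
Proof.
rewrite -[x]cL2_reprK -[_ *: _]cL2_classZ !cL2_norm_class sq_normZ rmorphM /=.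
exact: erefl.
Qed.

Lemma cL2_norm_eq0 x : cL2_norm x = 0 -> x = 0.
Proof.
rewrite -[x]cL2_reprK cL2_norm_class => /complexI/sq_norm_eq0 /ae_zeroP x0.
rewrite -[RHS](raddf0 (\pi_(Quotient.quot (ae_zero : zmodClosed _)))).
by apply/eqP/cL2_class_eqP.
Qed.

HB.instance Definition _ := Lmodule_isNormed.Build R[i] cL2
  cL2_normD cL2_normZ cL2_norm_eq0.

End ComplexL2.

Section ComplexFunctions.
Variable R : realType.

Definition expi (x : R) : R[i] := cos x +i* sin x.

Definition cexp (z : R[i]) : R[i] := (expR (Re z))%:C * expi (Im z).

Definition cintegral d (T : measurableType d) (mu : {measure set T -> \bar R})
    (D : set T) (f : T -> R[i]) : R[i] :=
  (\int[mu]_(t in D) Re (f t)) +i* (\int[mu]_(t in D) Im (f t)).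

Definition csum (P : pred nat) (f : nat -> R[i]) : R[i] :=
  limn (fun N => \sum_(0 <= j < N | P j) Re (f j)) +i*
  limn (fun N => \sum_(0 <= j < N | P j) Im (f j)).

Definition csumZ (P : pred int) (f : int -> R[i]) : R[i] :=
  csum (P \o Posz) (f \o Posz) + csum (P \o Negz) (f \o Negz).

(* The set of z <> a with |arg (z - a)| < phi, for phi <= pi. *)
Definition sector (a : R[i]) (phi : R) : set R[i] :=
  [set z | exists r psi : R,
     [/\ 0 < r, `|psi| < phi & z = a + r%:C * expi psi]].

End ComplexFunctions.

Section Operators.
Variables (R : realType) (V : normedModType R[i]).

(* Bounded linear operators on a linear subspace W of V; only the values of S
   on W matter, and End V is the case W = setT. *)
Definition bounded_operator_on (W : set V) (S : V -> V) : Prop :=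
  [/\ forall x, W x -> W (S x),
      forall (a : R[i]) x y, W x -> W y -> S (a *: x + y) = a *: S x + S y &
      exists M : R, forall x, W x -> `|S x| <= M%:C * `|x|].

Definition bounded_operator : (V -> V) -> Prop := bounded_operator_on setT.

(* Strongly continuous semigroups t >= 0 |-> T t on W. *)
Definition semigroup_on (W : set V) (T : R -> V -> V) : Prop :=
  [/\ forall t, 0 <= t -> bounded_operator_on W (T t),
      forall x, W x -> T 0 x = x,
      forall s t x, 0 <= s -> 0 <= t -> W x -> T (s + t) x = T s (T t x) &
      forall x, W x -> T t x @[t --> 0^'+] --> x].

Definition semigroup : (R -> V -> V) -> Prop := semigroup_on setT.

Definition analytic_semigroup (T : R -> V -> V) : Prop :=
  semigroup T /\
  exists (delta : R) (S : R[i] -> V -> V),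
    [/\ 0 < delta <= pi / 2,
        forall (t : R) x, 0 <= t -> S t%:C x = T t x,
        forall z, sector 0 delta z -> bounded_operator (S z),
        forall z w x, sector 0 delta z -> sector 0 delta w ->
          S (z + w) x = S z (S w x) &
        (* complex differentiability in operator norm, and strong continuity
           at 0 in every smaller sector *)
        (forall z, sector 0 delta z ->
          exists2 D, bounded_operator D & forall e : R, 0 < e ->
            exists2 eta : R, 0 < eta & forall h : R[i], h != 0 ->
              `|h| < eta%:C -> forall x,
              `|h^-1 *: (S (z + h) x - S z x) - D x| <= e%:C * `|x|) /\
        (forall delta' : R, 0 < delta' < delta -> forall x (e : R), 0 < e ->
          exists2 eta : R, 0 < eta & forall z, sector 0 delta' z ->
            `|z| < eta%:C -> `|S z x - x| <= e%:C)].

(* Unbounded operators are given by their graphs. *)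
Definition graph_opp (A : set (V * V)) : set (V * V) :=
  [set p | A (p.1, - p.2)].

Definition generator (T : R -> V -> V) : set (V * V) :=
  [set p | (t^-1)%:C *: (T t p.1 - p.1) @[t --> 0^'+] --> p.2].

(* S is the bounded inverse of lam - A : D(A) -> V. *)
Definition is_resolvent (A : set (V * V)) (lam : R[i]) (S : V -> V) : Prop :=
  bounded_operator S /\ forall x y, S y = x <-> A (x, lam *: x - y).

Definition spectrum (A : set (V * V)) : set R[i] :=
  [set lam | ~ exists S, is_resolvent A lam S].

Definition sectorial (A : set (V * V)) : Prop :=
  exists a phi M : R, pi / 2 < phi < pi /\
    forall lam, sector a%:C phi lam ->
      exists2 S, is_resolvent A lam S &
        forall x, `|S x| <= M%:C / `|lam - a%:C| * `|x|.

Definition similar_semigroups (T T' : R -> V -> V) : Prop :=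
  exists U U' : V -> V,
    [/\ bounded_operator U, bounded_operator U', cancel U U', cancel U' U &
        forall t x, 0 <= t -> T t (U x) = U (T' t x)].

(* T = T1 (+) T2 with respect to V = Im P (+) Im (1 - P). *)
Definition semigroup_direct_sum (P : V -> V) (T1 T2 T : R -> V -> V) : Prop :=
  [/\ semigroup_on (range P) T1,
      semigroup_on (range (fun x => x - P x)) T2 &
      forall t x, 0 <= t -> T t x = T1 t (P x) + T2 t (x - P x)].

End Operators.

Section L2Interval.
Variables (R : realType) (omega : R).

(* dt / omega on [0, omega], so that inner x y below is the normalized inner
   product and the norm of L2 is the corresponding one. *)
Definition itv_measure : {measure set (measurableTypeR R) -> \bar R} :=
  mscale `|omega^-1|%:nng
    (mrestr (@lebesgue_measure R) (measurable_itv `[0, omega])).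

Definition L2 : Type := cL2 itv_measure.
HB.instance Definition _ := NormedModule.on L2.

Definition inner (x y : L2) : R[i] :=
  cintegral itv_measure setT (fun t => cL2_repr x t * (cL2_repr y t)^*).

(* The class of f; junk value 0 when f is not square integrable. *)
Definition L2_of (f : R -> R[i]) : L2 :=
  cL2_class (insubd (0 : sqint_fun itv_measure) f).

Definition represents (f : R -> R[i]) (x : L2) : Prop :=
  {ae itv_measure, forall t, cL2_repr x t = f t}.

Definition line_proj (e x : L2) : L2 := inner x e *: e.

(* f'(t) = l, where f is regarded as a function on [0, omega] *)
Definition is_deriv (f : R -> R[i]) (t : R) (l : R[i]) : Prop :=
  let dq s := ((s - t)^-1)%:C * (f s - f t) in
  Re (dq s) @[s --> within `[0, omega] t^'] --> Re l /\
  Im (dq s) @[s --> within `[0, omega] t^'] --> Im l.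

Definition abs_continuous (f : R -> R[i]) : Prop :=
  forall e : R, 0 < e -> exists2 d : R, 0 < d &
    forall (n : nat) (u v : nat -> R),
      (forall i, (i < n)%N -> [/\ 0 <= u i, u i <= v i & v i <= omega]) ->
      trivIset `I_n (fun i => `]u i, v i[%classic) ->
      \sum_(0 <= i < n) (v i - u i) < d ->
      \sum_(0 <= i < n) `|f (v i) - f (u i)| < e%:C.

(* y 0 is in the Sobolev space H^N on [0, omega], y j being its j-th
   derivative (j <= N; almost everywhere for j = N). *)
Definition sobolev (N : nat) (y : nat -> R -> R[i]) : Prop :=
  [/\ forall j t, (j < N.-1)%N -> t \in `[0, omega] ->
        is_deriv (y j) t (y j.+1 t),
      abs_continuous (y N.-1),
      {ae itv_measure, forall t, is_deriv (y N.-1) t (y N t)} &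
      exists g : L2, represents (y N) g].

End L2Interval.

Inductive boundary_condition := per | ap | dir.

(* The value at dir is irrelevant. *)
Definition theta (bc : boundary_condition) : int :=
  match bc with per => 0 | ap => 1 | dir => 0 end.

Section HighOrder.
Variables (R : realType) (bc : boundary_condition) (k : nat) (omega : R).
Variable q : R -> R[i].

Definition satisfies_bc (y : nat -> R -> R[i]) : Prop :=
  match bc with
  | per => forall j, (j < 2 * k)%N -> y j 0 = y j omega
  | ap => forall j, (j < 2 * k)%N -> y j 0 = - y j omega
  | dir => forall i, (i < k)%N -> y (2 * i)%N 0 = 0 /\ y (2 * i)%N omega = 0
  end.

Definition L_bc : set (L2 omega * L2 omega) :=
  [set p | exists y : nat -> R -> R[i],
     [/\ sobolev omega (2 * k) y, satisfies_bc y, represents (y 0%N) p.1 &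
         represents (fun t => (-1) ^+ k * y (2 * k)%N t - q t * y 0%N t) p.2]].

Definition e_ (n : int) : L2 omega :=
  L2_of omega (fun t => expi (- (pi * (2 * n + theta bc)%:~R * t / omega))).

Definition e_dir (n : nat) : L2 omega :=
  L2_of omega (fun t => (Num.sqrt 2 * sin (pi * n%:R * t / omega))%:C).

Definition P_dir (n : nat) : L2 omega -> L2 omega := line_proj (e_dir n).

Definition PP (n : nat) (x : L2 omega) : L2 omega :=
  if (n == 0) && (theta bc == 0) then line_proj (e_ 0) x
  else line_proj (e_ (- n%:Z - theta bc)) x + line_proj (e_ n%:Z) x.

Definition P_upto (m : nat) (x : L2 omega) : L2 omega :=
  match bc with
  | dir => \sum_(1 <= j < m.+1) P_dir j x
  | _ => \sum_(0 <= j < m.+1) PP j x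
  end.

Definition fourier (l : int) : R[i] :=
  (omega^-1)%:C * cintegral lebesgue_measure `[0, omega]
    (fun t => q t * expi (- (2 * pi * l%:~R * t / omega))).

Definition fourier_cos (l : nat) : R[i] :=
  (Num.sqrt 2 / omega)%:C * cintegral lebesgue_measure `[0, omega]
    (fun t => q t * (cos (pi * l%:R * t / omega))%:C).

(* The explicit part of the n-th pair of eigenvalues, with sign - for
   upper := true and + for upper := false. *)
Definition lambda_per_ap (upper : bool) (n : nat) : R[i] :=
  let th := theta bc in
  let n := n%:Z in
  let c : R[i] := ((omega / pi) ^+ (2 * k))%:C in
  let den (j : int) : R[i] :=
    ((2 * j + th) ^+ (2 * k) - (2 * n + th) ^+ (2 * k))%:~R in
  let off : pred int := [pred j : int | (j != n) && (j != - n - th)] in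
  ((pi * (2 * n + th)%:~R / omega) ^+ (2 * k))%:C - fourier 0
  - 2 * c * csum [pred j : nat | (1 <= j)%N && (j%:Z != n)]
      (fun j => fourier (n - j%:Z) * fourier (j%:Z - n) / den j%:Z)
  + (-1) ^+ upper
    * sqrtc (fourier (- 2 * n - th) + c * csumZ off
        (fun j => fourier (- n - j - th) * fourier (j - n) / den j))
    * sqrtc (fourier (2 * n + th) + c * csumZ off
        (fun j => fourier (n + j + th) * fourier (n - j) / den j)).

Definition lambda_dir (n : nat) : R[i] :=
  ((pi * n%:R / omega) ^+ (2 * k))%:C
  - (omega^-1)%:C * cintegral lebesgue_measure `[0, omega] q
  + (omega^-1)%:C * cintegral lebesgue_measure `[0, omega]
      (fun t => q t * (cos (2 * pi * n%:R / omega * t))%:C)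
  - (omega ^+ (2 * k) / (2 * pi ^+ (2 * k)))%:C
    * csum [pred j : nat | (1 <= j)%N && (j != n)]
      (fun j => (fourier_cos `|n%:Z - j%:Z|%N - fourier_cos (n + j)) ^+ 2
                / (j%:R ^+ (2 * k) - n%:R ^+ (2 * k))).

(* |rem n| <= C alpha_n / n^(4k-3) for n > m, with alpha square summable *)
Definition small_remainder (m : nat) (rem : nat -> R[i]) : Prop :=
  exists (C : R) (alpha : nat -> R),
    [/\ 0 < C, cvgn (series (fun n => alpha n ^+ 2)) &
        forall n, (m < n)%N ->
          `|rem n| <= (C * alpha n / n%:R ^+ (4 * k - 3))%:C].

(* m is a number for which the spectrum of L_bc is known up to at most 2m+1
   (m for dir) points and small remainders. For dir, lam n (n > m) are the
   corresponding eigenvalues; for per and ap, lam is not used and the remainder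
   may depend on the sign in lambda_per_ap. *)
Definition spectral_description (m : nat) (lam : nat -> R[i]) : Prop :=
  match bc with
  | dir =>
    [/\ (0 < m)%N,
        small_remainder m (fun n => lam n - lambda_dir n) &
        exists2 sigma_m : set R[i], (sigma_m #<= `I_m)%card &
          spectrum L_bc = sigma_m `|` [set lam n | n in [set n | (m < n)%N]]]
  | _ =>
    exists lam2 : bool -> nat -> R[i],
    [/\ forall b, small_remainder m (fun n => lam2 b n - lambda_per_ap b n) &
        exists2 sigma_m : set R[i], (sigma_m #<= `I_(2 * m + 1))%card &
          spectrum L_bc = sigma_m `|`
            [set lam2 b n | b in [set: bool] & n in [set n | (m < n)%N]]]
  end.

End HighOrder.

Arguments L_bc {R} bc k omega q.
Arguments spectral_description {R} bc k omega q m lam.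

(* Main.v *)
(* In the trigonometric basis e_0, e_1, ... attached to bc the operator is A - B, with A
   diagonal with entries mu_i = (pi n_i / omega)^(2k) and B x = sum_i x_i q e_i, which is
   bounded from absolutely summable coordinates to L^2. Put all i below a cutoff in one block,
   and elsewhere let i and j share a block when mu_i = mu_j. The sum of (mu_i - mu_j)^(-2)
   over i, j in different blocks tends to 0 as the cutoff grows; then a contraction yields
   U = 1 + Y with |Y| <= 1/2 and a bounded block diagonal K such that (A - B) U = U (A + K).
   After the finite part of A below the cutoff is moved into K, the two summands of
   A + K = A' + K' commute, so that exp(-t A') exp(-t K') is a semigroup, with an analytic
   extension to the right half plane. In the Dirichlet case the blocks beyond the cutoff are
   singletons, and the semigroup is diagonal there, with exponents rho_s. An eigenvalue
   at bounded distance of mu_s is equal to rho_s when s is large, because the remaining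
   points close to mu_s belong to the resolvent set. *)
Require Import Defs.
From mathcomp Require Import finmap.
From mathcomp Require Import all_boot all_order all_algebra.
From mathcomp Require Import all_classical all_reals all_analysis.
From mathcomp Require Import complex ring lra zify measurable_realfun.

Set Implicit Arguments.
Unset Strict Implicit.
Unset Printing Implicit Defensive.

Import Order.TTheory GRing.Theory Num.Theory.
Import numFieldNormedType.Exports.

Local Open Scope classical_set_scope.
Local Open Scope complex_scope.
Local Open Scope ring_scope.

(** * Square summable families and real-valued norms *)

(** The obstacle: q is only square integrable, so multiplication by q is not even defined on all of
    L^2. The basis functions are bounded by 2, so the columns q e_j have bounded norms and B acts on
    absolutely summable coordinates; Cauchy-Schwarz against the inverse gaps leads back from L^2 to
    that space. Hence two norms: a correction y_j is measured by the sum of the moduli of its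
    coordinates, relative to g_j, the l^2 norm of the inverse gaps seen from j. Gaps seen from j are
    at least of order max(m, j) for a cutoff m, so the sum of the g_j^2 is O(1/m), and Y maps L^2
    into the domain of B. The intertwining alone gives one inclusion of domains. Equality follows
    because, for one large tau, A - B + tau is injective and A + K + tau is onto. The general bound
    on K grows like m, as does the gap at the cutoff. To recognise the Dirichlet eigenvalues, a
    bound of order sqrt m on the finite block replaces it. A given m may be too small for the
    contraction; it is enlarged by moving finitely many eigenvalues into the exceptional set. *)

Section Sums.
Variable R : realType.
Implicit Types (r a b : nat -> R) (M e : R).

(* For r >= 0: the series of r converges, with sum at most M. *)
Definition sbd r M := forall N, \sum_(0 <= i < N) r i <= M.

Lemma sbd_ge0 r M : sbd r M -> 0 <= M.
Proof. by move=> /(_ 0%N); rewrite big_geq. Qed.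

Lemma sbd_le r a M : (forall i, r i <= a i) -> sbd a M -> sbd r M.
Proof. by move=> ra aM N; apply: le_trans (aM N); apply: ler_sum. Qed.

Lemma sbd_leM r M M' : M <= M' -> sbd r M -> sbd r M'.
Proof. by move=> MM h N; apply: le_trans MM. Qed.

Lemma sbdD r a M M' : sbd r M -> sbd a M' -> sbd (fun i => r i + a i) (M + M').
Proof. by move=> h1 h2 N; rewrite big_split lerD. Qed.

Lemma sbdZ r M (k : R) : 0 <= k -> sbd r M -> sbd (fun i => k * r i) (k * M).
Proof. by move=> k0 h N; rewrite -mulr_sumr ler_wpM2l. Qed.

Lemma sum_nat_mono r m n n' : (forall i, 0 <= r i) -> (n <= n')%N ->
  \sum_(m <= i < n) r i <= \sum_(m <= i < n') r i.
Proof.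
move=> r0 nn'; have [mn|nm] := leqP m n.
  by rewrite (big_cat_nat (n:=n) (p:=n'))//= lerDl sumr_ge0.
by rewrite big_geq ?(ltnW nm)// sumr_ge0.
Qed.

Lemma sbd_window r M m n : (forall i, 0 <= r i) -> sbd r M ->
  \sum_(m <= i < n) r i <= M.
Proof.
move=> r0 h; have [mn|nm] := leqP m n; last first.
  by rewrite big_geq ?(ltnW nm)//; exact: sbd_ge0 h.
apply: le_trans (h n); rewrite [leRHS](big_cat_nat (n:=m) (p:=n))//= lerDr.
exact: sumr_ge0.
Qed.

Lemma sbd_tail r M e : (forall i, 0 <= r i) -> sbd r M -> 0 < e ->
  exists N0, forall m n, (N0 <= m)%N -> \sum_(m <= i < n) r i <= e.
Proof.
move=> r0 h e0; apply: contrapT => /forallNP no.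
(* Windows with sum above e exist arbitrarily far out; n of them placed one after the other give a
   partial sum of at least n e, which finally exceeds M. *)
have grow (n : nat) : exists N, e *+ n <= \sum_(0 <= i < N) r i.
  elim: n => [|n [N IH]]; first by exists 0%N; rewrite big_geq.
  have /existsNP[m /existsNP[n' /not_implyP[Nm /negP]]] := no N.
  rewrite -ltNge => en'; exists n'.
  have mn' : (m <= n')%N.
    by rewrite leqNgt; apply/negP => /ltnW nm; rewrite big_geq// ltNge ltW in en'.
  rewrite (big_cat_nat (n:=m) (p:=n'))//= mulrSr lerD//; last exact: ltW.
  by apply: le_trans IH _; apply: sum_nat_mono.
have [N] := grow (Num.bound (M / e)).
apply/negP; rewrite -ltNge; apply: le_lt_trans (h N) _.
rewrite -mulr_natr mulrC -ltr_pdivrMr// archi_boundP// divr_ge0 ?(ltW e0)//.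
exact: sbd_ge0 h.
Qed.

Lemma cauchy_schwarz_sum (I : Type) (s : seq I) (P : pred I) (f g : I -> R) (A B : R) :
  0 <= A -> 0 <= B ->
  \sum_(i <- s | P i) f i ^+ 2 <= A ^+ 2 ->
  \sum_(i <- s | P i) g i ^+ 2 <= B ^+ 2 ->
  \sum_(i <- s | P i) f i * g i <= A * B.
Proof.
move=> A0 B0 fA gB; apply/ler_addgt0Pl => e e0.
(* A or B may vanish, while the weights of the mean inequality below divide by them. Both are raised
   by d, which changes A B by at most d (A + B + 1) <= e. *)
pose d := Num.min 1 (e / (A + B + 1)).
have d0 : 0 < d by rewrite lt_min ltr01/= divr_gt0//; lra.
have dd : d * (A + B + 1) <= e.
  by rewrite -ler_pdivlMr; [rewrite ge_min lexx orbT|lra].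
have d1 : d <= 1 by rewrite ge_min lexx.
set A' := A + d; set B' := B + d.
have A'0 : 0 < A' by rewrite /A'; lra.
have B'0 : 0 < B' by rewrite /B'; lra.
apply: (@le_trans _ _ (A' * B')); last by rewrite /A' /B'; nra.
apply: (@le_trans _ _ (\sum_(i <- s | P i) (B' / A' / 2 * f i ^+ 2 + A' / B' / 2 * g i ^+ 2))).
  apply: ler_sum => i _.
  have -> : B' / A' / 2 * f i ^+ 2 + A' / B' / 2 * g i ^+ 2 =
     f i * g i + (A' * B')^-1 / 2 * (B' * f i - A' * g i) ^+ 2.
    by field; rewrite !gt_eqF.
  by rewrite lerDl mulr_ge0 ?sqr_ge0// divr_ge0// invr_ge0 mulr_ge0 ?ltW.
rewrite big_split/= -!mulr_sumr.
have h1 : B' / A' / 2 * \sum_(i <- s | P i) f i ^+ 2 <= B' / A' / 2 * A' ^+ 2.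
  rewrite ler_wpM2l ?divr_ge0 ?(ltW A'0) ?(ltW B'0)//.
  by apply: le_trans fA _; rewrite /A'; nra.
have h2 : A' / B' / 2 * \sum_(i <- s | P i) g i ^+ 2 <= A' / B' / 2 * B' ^+ 2.
  rewrite ler_wpM2l ?divr_ge0 ?(ltW A'0) ?(ltW B'0)//.
  by apply: le_trans gB _; rewrite /B'; nra.
apply: le_trans (lerD h1 h2) _.
have -> : B' / A' / 2 * A' ^+ 2 + A' / B' / 2 * B' ^+ 2 = A' * B' by field; rewrite !gt_eqF.
by [].
Qed.

Lemma sum_sqr_le_sqr_sum r N : (forall i, 0 <= r i) ->
  \sum_(0 <= i < N) r i ^+ 2 <= (\sum_(0 <= i < N) r i) ^+ 2.
Proof.
move=> r0; elim: N => [|N IH]; first by rewrite !big_geq// expr0n.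
rewrite !big_nat_recr//=.
have s0 : 0 <= \sum_(0 <= i < N) r i by apply: sumr_ge0.
by have := r0 N; nra.
Qed.

Lemma sbd_cs r a (A B : R) : (forall i, 0 <= r i) -> 0 <= A -> 0 <= B ->
  sbd (fun i => r i ^+ 2) (A ^+ 2) -> sbd (fun i => a i ^+ 2) (B ^+ 2) ->
  sbd (fun i => r i * a i) (A * B).
Proof. by move=> _ A0 B0 h1 h2 N; apply: cauchy_schwarz_sum. Qed.

Lemma sbd_geom (x : R) : 0 <= x -> sbd (fun i => x * 2^-1 ^+ i) (2 * x).
Proof.
move=> x0 N; suff -> : \sum_(0 <= i < N) x * 2^-1 ^+ i = 2 * x - 2 * x * 2^-1 ^+ N.
  by rewrite gerBl mulr_ge0// ?mulr_ge0// exprn_ge0.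
elim: N => [|N IH]; first by rewrite big_geq// expr0; lra.
by rewrite big_nat_recr//= IH exprS; lra.
Qed.

Lemma geom_small (x e : R) : 0 < e -> exists n, x * 2^-1 ^+ n < e.
Proof.
move=> e0; have hb (n : nat) : n%:R <= 2 ^+ n :> R.
  by rewrite -natrX ler_nat ltnW// ltn_expl.
set n := Num.bound (`|x| / e); exists n.
have h1 : `|x| / e < n%:R by rewrite archi_boundP// divr_ge0// ltW.
have h2 : `|x| < e * 2 ^+ n.
  by move: h1; rewrite ltr_pdivrMr// => /lt_le_trans; apply; rewrite mulrC ler_pM2l.
rewrite exprVn ltr_pdivrMr ?exprn_gt0//; exact: le_lt_trans (ler_norm _) h2.
Qed.

End Sums.

(** * Real-valued norms and limits of sequences *)

Section Nrm.
Variable R : realType.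
Implicit Type V : normedZmodType R[i].

(* [`|x|] is R[i]-valued. *)
Definition nrm V (x : V) : R := complex.Re `|x|.

Lemma nrmE V (x : V) : `|x| = (nrm x)%:C.
Proof.
have := normr_ge0 x; rewrite /nrm lecE => /andP[/eqP/= h _].
by case: `|x| h => a b /= ->.
Qed.

Lemma nrm_ge0 V (x : V) : 0 <= nrm x.
Proof. by rewrite -lecR -nrmE normr_ge0. Qed.
Hint Resolve nrm_ge0 : core.

Lemma nrmD V (x y : V) : nrm (x + y) <= nrm x + nrm y.
Proof. by rewrite -lecR rmorphD/= -!nrmE ler_normD. Qed.

Lemma nrmN V (x : V) : nrm (- x) = nrm x.
Proof. by rewrite /nrm normrN. Qed.

Lemma nrmB V (x y : V) : nrm (x - y) <= nrm x + nrm y.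
Proof. by rewrite -(nrmN y) nrmD. Qed.

Lemma nrm_sym V (x y : V) : nrm (x - y) = nrm (y - x).
Proof. by rewrite -nrmN opprB. Qed.

Lemma nrm0 V : nrm (0 : V) = 0.
Proof. by rewrite /nrm normr0. Qed.

Lemma nrm_eq0 V (x : V) : (nrm x == 0) = (x == 0).
Proof. by rewrite -[RHS]normr_eq0 nrmE -[LHS](inj_eq (@complexI R)). Qed.

Lemma nrm_le0 V (x : V) : nrm x <= 0 -> x = 0.
Proof. by move=> h; apply/eqP; rewrite -nrm_eq0 eq_le h nrm_ge0. Qed.

Lemma nrm_tri V (z x y : V) : nrm (x - y) <= nrm (x - z) + nrm (z - y).
Proof. by rewrite (le_trans _ (nrmD _ _))// addrA subrK. Qed.

Lemma nrm_diff V (x y : V) : nrm x - nrm y <= nrm (x - y).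
Proof. by rewrite lerBlDr; have := nrmD (x - y) y; rewrite subrK. Qed.

Lemma nrm_sum V (I : Type) (s : seq I) (P : pred I) (f : I -> V) :
  nrm (\sum_(i <- s | P i) f i) <= \sum_(i <- s | P i) nrm (f i).
Proof.
elim/big_rec2: _ => [|i x y _ h]; first by rewrite nrm0.
by apply: le_trans (nrmD _ _) _; rewrite lerD2l.
Qed.

Lemma nrmM (x y : R[i]) : nrm (x * y) = nrm x * nrm y.
Proof. by apply: (@complexI R); rewrite rmorphM/= -!nrmE normrM. Qed.

Lemma nrmV (x : R[i]) : nrm x^-1 = (nrm x)^-1.
Proof. by apply: (@complexI R); rewrite fmorphV/= -!nrmE normfV. Qed.

Lemma nrmX (x : R[i]) n : nrm (x ^+ n) = nrm x ^+ n.
Proof. by apply: (@complexI R); rewrite rmorphXn/= -!nrmE normrX. Qed.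

Lemma nrm_real (x : R) : nrm x%:C = `|x|.
Proof. by rewrite /nrm normc_def/= expr0n/= addr0 sqrtr_sqr. Qed.

Lemma nrm1 : nrm (1 : R[i]) = 1.
Proof. by rewrite /nrm normr1. Qed.

Lemma nrm_conj (x : R[i]) : nrm (x^*) = nrm x.
Proof. by case: x => a b; rewrite /nrm !normc_def/= sqrrN. Qed.

Lemma nrm_sqr (z : R[i]) : nrm z ^+ 2 = complex.Re z ^+ 2 + complex.Im z ^+ 2.
Proof. by rewrite /nrm normc_def/= sqr_sqrtr// addr_ge0 ?sqr_ge0. Qed.

Lemma Re_nrm (z : R[i]) : `|complex.Re z| <= nrm z.
Proof.
rewrite -(ler_pXn2r (n:=2))// ?nnegrE//; rewrite nrm_sqr real_normK ?num_real//.
by rewrite lerDl sqr_ge0.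
Qed.

Lemma Im_nrm (z : R[i]) : `|complex.Im z| <= nrm z.
Proof.
rewrite -(ler_pXn2r (n:=2))// ?nnegrE//; rewrite nrm_sqr real_normK ?num_real//.
by rewrite lerDr sqr_ge0.
Qed.

Lemma nrm_ReIm (z : R[i]) : nrm z <= `|complex.Re z| + `|complex.Im z|.
Proof.
rewrite -(ler_pXn2r (n:=2))// ?nnegrE// ?addr_ge0//.
rewrite nrm_sqr sqrrD !real_normK ?num_real// -addrA lerD2l lerDr.
by rewrite mulrn_wge0// mulr_ge0.
Qed.

(** Tolerances are real here, whereas the filter-based limit in a normed module over [R[i]] takes
    them in [R[i]]; [tends_cvg] converts back. *)
Definition tends V (u : nat -> V) (l : V) := forall e : R, 0 < e ->
  exists N, forall n, (N <= n)%N -> nrm (u n - l) <= e.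

Lemma tends_cst V (l : V) : tends (fun=> l) l.
Proof. by move=> e e0; exists 0%N => n _; rewrite subrr nrm0 ltW. Qed.

Lemma tendsD V (u v : nat -> V) l l' : tends u l -> tends v l' ->
  tends (fun n => u n + v n) (l + l').
Proof.
move=> hu hv e e0; have e2 : 0 < e / 2 by lra.
have [N1 h1] := hu _ e2; have [N2 h2] := hv _ e2.
exists (maxn N1 N2) => n; rewrite geq_max => /andP[n1 n2].
rewrite opprD addrACA; apply: le_trans (nrmD _ _) _.
by have := h1 _ n1; have := h2 _ n2; lra.
Qed.

Lemma tends_squeeze V V' (u : nat -> V) (l : V) (v : nat -> V') l' (M : R) :
  (forall n, nrm (u n - l) <= M * nrm (v n - l')) -> tends v l' -> tends u l.
Proof.
move=> uv hv e e0.
have M1 : 0 < `|M| + 1 by have := normr_ge0 M; lra.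
have [N h] := hv (e / (`|M| + 1)) (divr_gt0 e0 M1).
exists N => n /h; rewrite ler_pdivlMr// => hn; apply: le_trans (uv n) _.
apply: le_trans hn; rewrite mulrC ler_wpM2l//; have := ler_norm M; lra.
Qed.

Lemma tendsN V (u : nat -> V) l : tends u l -> tends (fun n => - u n) (- l).
Proof.
by apply: (tends_squeeze (M := 1)) => n; rewrite mul1r -opprD nrmN.
Qed.

Lemma tendsB V (u v : nat -> V) l l' : tends u l -> tends v l' ->
  tends (fun n => u n - v n) (l - l').
Proof. by move=> hu hv; apply: tendsD => //; apply: tendsN. Qed.

Lemma tends_uniq V (u : nat -> V) l l' : tends u l -> tends u l' -> l = l'.
Proof.
move=> h1 h2; apply/eqP; rewrite -subr_eq0; apply/eqP/nrm_le0.
apply/ler_addgt0Pl => e e0; rewrite addr0.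
have e2 : 0 < e / 2 by lra.
have [N1 {}h1] := h1 _ e2; have [N2 {}h2] := h2 _ e2.
have := h1 _ (leq_maxl N1 N2); have := h2 _ (leq_maxr N1 N2).
have := nrm_tri (u (maxn N1 N2)) l l'; rewrite (nrm_sym l (u _)); lra.
Qed.

Lemma tends_eq V (u v : nat -> V) l : (forall n, u n = v n) -> tends u l -> tends v l.
Proof. by move=> uv; rewrite (_ : u = v)//; apply/funext. Qed.

Lemma tends_nrm_le V (u : nat -> V) l (M : R) :
  (forall n, nrm (u n) <= M) -> tends u l -> nrm l <= M.
Proof.
move=> hM hu; apply/ler_addgt0Pl => e e0.
have [N h] := hu _ e0; have := h _ (leqnn N); have := hM N.
have := nrm_diff l (u N); rewrite (nrm_sym l (u N)); lra.
Qed.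

Lemma tends_shift V (u : nat -> V) l : tends u l -> tends (fun n => u n.+1) l.
Proof. by move=> hu e /hu[N h]; exists N => n Nn; apply: h; rewrite ltnW. Qed.

Lemma tends_scal (u : nat -> R[i]) l (a : R[i]) : tends u l -> tends (fun n => a * u n) (a * l).
Proof. by apply: (tends_squeeze (M := nrm a)) => n; rewrite -mulrBr nrmM. Qed.

Definition cauchy_seq V (u : nat -> V) := forall e : R, 0 < e ->
  exists N, forall m n, (N <= m)%N -> (m <= n)%N -> nrm (u n - u m) <= e.

End Nrm.
#[export] Hint Extern 0 (is_true (0 <= nrm _)) => solve [apply: nrm_ge0] : core.
Arguments tends {R V}.
Arguments cauchy_seq {R V}.

(** * Coordinates with values in l^2 *)

Section Coordinates.
Variables (R : realType) (V : normedModType R[i]).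
Implicit Types (x y : V) (u : nat -> V) (M e : R) (a : nat -> R[i]).

(** What the operator theory needs of an orthonormal basis, without the inner product. [c_bessel]
    and [c_pars] are the two halves of Parseval's identity, expressed by partial sums; [c_synth] is
    the Riesz-Fischer property. *)
Record l2coord (c : nat -> V -> R[i]) : Prop := L2coord {
  c_lin : forall i (k : R[i]) x y, c i (k *: x + y) = k * c i x + c i y;
  c_bessel : forall x, sbd (fun i => nrm (c i x) ^+ 2) (nrm x ^+ 2);
  c_pars : forall x M, 0 <= M -> sbd (fun i => nrm (c i x) ^+ 2) (M ^+ 2) ->
    nrm x <= M;
  c_synth : forall a M, sbd (fun i => nrm (a i) ^+ 2) M ->
    exists x, forall i, c i x = a i;
  c_complete : forall u, cauchy_seq u -> exists l, tends u l }.

Record blin (S : V -> V) (M : R) : Prop := Blin {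
  bl_lin : forall (k : R[i]) x y, S (k *: x + y) = k *: S x + S y;
  bl_ge0 : 0 <= M;
  bl_bd : forall x, nrm (S x) <= M * nrm x }.

Section LinFacts.
Variables (S : V -> V) (M : R) (hS : blin S M).

Lemma bl0 : S 0 = 0.
Proof. by have := bl_lin hS (-1) 0 0; rewrite scaler0 addr0 scaleN1r addNr. Qed.
Lemma blD x y : S (x + y) = S x + S y.
Proof. by have := bl_lin hS 1 x y; rewrite !scale1r. Qed.
Lemma blZ (k : R[i]) x : S (k *: x) = k *: S x.
Proof. by have := bl_lin hS k x 0; rewrite bl0 !addr0. Qed.
Lemma blN x : S (- x) = - S x.
Proof. by rewrite -scaleN1r blZ scaleN1r. Qed.
Lemma blB x y : S (x - y) = S x - S y.
Proof. by rewrite blD blN. Qed.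
Lemma bl_sum (I : Type) (s : seq I) (P : pred I) (f : I -> V) :
  S (\sum_(i <- s | P i) f i) = \sum_(i <- s | P i) S (f i).
Proof. by elim/big_rec2: _ => [|i x z _ <-]; [exact: bl0|rewrite blD]. Qed.
Lemma bl_tends u l : tends u l -> tends (fun n => S (u n)) (S l).
Proof. by apply: (tends_squeeze (M := M)) => n; rewrite -blB; exact: bl_bd. Qed.
Lemma bl_le M' : M <= M' -> blin S M'.
Proof.
move=> MM; split; [exact: bl_lin hS|exact: le_trans (bl_ge0 hS) MM|move=> x].
by apply: le_trans (bl_bd hS x) _; rewrite ler_wpM2r.
Qed.
Lemma bl_comp S' M' : blin S' M' -> blin (fun x => S (S' x)) (M * M').
Proof.
move=> h'; split=> [k x y||x]; first by rewrite (bl_lin h') (bl_lin hS).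
  by rewrite mulr_ge0 ?(bl_ge0 hS) ?(bl_ge0 h').
apply: le_trans (bl_bd hS _) _; rewrite -mulrA ler_wpM2l ?(bl_ge0 hS)//.
exact: bl_bd h' _.
Qed.
Lemma bl_add S' M' : blin S' M' -> blin (fun x => S x + S' x) (M + M').
Proof.
move=> h'; split=> [k x y||x].
- by rewrite (bl_lin h') (bl_lin hS) scalerDr addrACA.
- by rewrite addr_ge0 ?(bl_ge0 hS) ?(bl_ge0 h').
- apply: le_trans (nrmD _ _) _; rewrite mulrDl lerD//; [exact: bl_bd hS _|exact: bl_bd h' _].
Qed.
Lemma bl_opp : blin (fun x => - S x) M.
Proof.
split=> [k x y||x]; first by rewrite (bl_lin hS) opprD scalerN.
  exact: bl_ge0 hS.
by rewrite nrmN; exact: bl_bd hS _.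
Qed.
End LinFacts.

Lemma nrmZ (k : R[i]) x : nrm (k *: x) = nrm k * nrm x.
Proof. by apply: (@complexI R); rewrite rmorphM/= -!nrmE normrZ. Qed.

Lemma bl_id : blin id 1.
Proof. by split=> // x; rewrite mul1r. Qed.
Lemma bl_scal (k : R[i]) : blin (fun x => k *: x) (nrm k).
Proof.
split=> // [b x y|x]; last by rewrite nrmZ.
by rewrite scalerDr !scalerA mulrC.
Qed.

Lemma bounded_blin S M : blin S M -> bounded_operator S.
Proof.
move=> h; split=> // [a x y _ _|]; first exact: bl_lin h _ _ _.
by exists M => x _; rewrite !nrmE -rmorphM/= lecR; exact: bl_bd h x.
Qed.

Variable c : nat -> V -> R[i].
Hypothesis C : l2coord c.

Lemma c0 i : c i 0 = 0.
Proof. by have := c_lin C i (-1) 0 0; rewrite scaler0 addr0 mulN1r addNr. Qed.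
Lemma cD i x y : c i (x + y) = c i x + c i y.
Proof. by have := c_lin C i 1 x y; rewrite scale1r mul1r. Qed.
Lemma cZ i (k : R[i]) x : c i (k *: x) = k * c i x.
Proof. by have := c_lin C i k x 0; rewrite c0 !addr0. Qed.
Lemma cN i x : c i (- x) = - c i x.
Proof. by rewrite -scaleN1r cZ mulN1r. Qed.
Lemma cB i x y : c i (x - y) = c i x - c i y.
Proof. by rewrite cD cN. Qed.
Lemma c_sum i (I : Type) (s : seq I) (P : pred I) (f : I -> V) :
  c i (\sum_(j <- s | P j) f j) = \sum_(j <- s | P j) c i (f j).
Proof. by elim/big_rec2: _ => [|j x z _ <-]; [exact: c0|rewrite cD]. Qed.
Lemma c_le i x : nrm (c i x) <= nrm x.
Proof.
rewrite -(ler_pXn2r (n:=2))// ?nnegrE//.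
apply: le_trans (c_bessel C x i.+1); rewrite big_nat_recr//= lerDr.
by apply: sumr_ge0 => j _; rewrite sqr_ge0.
Qed.
Lemma c_inj x y : (forall i, c i x = c i y) -> x = y.
Proof.
move=> h; apply/eqP; rewrite -subr_eq0; apply/eqP/nrm_le0/(c_pars C) => // N.
rewrite big1// => i _; by rewrite cB h subrr nrm0 expr0n.
Qed.
Lemma c_tends i u l : tends u l -> tends (fun n => c i (u n)) (c i l).
Proof.
by apply: (tends_squeeze (M := 1)) => n; rewrite -cB mul1r; exact: c_le.
Qed.

(* Junk value 0 if no vector has the coordinates [a]. *)
Definition synth a : V := xget 0 [set x | forall i, c i x = a i].

Lemma synthE a M : sbd (fun i => nrm (a i) ^+ 2) M -> forall i, c i (synth a) = a i.
Proof. by move=> /(c_synth C)[x hx]; rewrite /synth; case: xgetP => [y _ //|/(_ x)]. Qed.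

Definition ee j := synth (fun i => (i == j)%:R).

Lemma c_ee i j : c i (ee j) = (i == j)%:R.
Proof.
rewrite (@synthE _ 1)// => N; case: (ltnP j N) => [jN|Nj].
  rewrite (bigD1_seq j) ?iota_uniq ?mem_index_iota//= eqxx nrm1 expr1n big1 ?addr0//.
  by move=> l /negPf ->; rewrite nrm0 expr0n.
rewrite big_nat big1// => l /andP[_ lN]; rewrite ltn_eqF ?(leq_trans lN)//.
by rewrite nrm0 expr0n.
Qed.

Lemma sum_delta (P : pred nat) N i (f : nat -> R[i]) :
  \sum_(0 <= j < N | P j) f j * (i == j)%:R = if (i < N)%N && P i then f i else 0.
Proof.
rewrite big_mkcond/=; case: (ltnP i N) => [iN|Ni]/=.
  rewrite (bigD1_seq i) ?iota_uniq ?mem_index_iota//= eqxx mulr1 big1 ?addr0//.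
  by move=> l; rewrite eq_sym => /negPf ->; rewrite mulr0 if_same.
rewrite big_nat big1// => l /andP[_ lN]; rewrite gtn_eqF ?(leq_trans lN)//.
by rewrite mulr0 if_same.
Qed.

Definition trunc N x := \sum_(0 <= i < N) c i x *: ee i.

Lemma c_trunc i N x : c i (trunc N x) = if (i < N)%N then c i x else 0.
Proof.
rewrite c_sum; under eq_bigr do rewrite cZ c_ee.
by rewrite (sum_delta xpredT) andbT.
Qed.

Lemma trunc_tends x : tends (fun N => trunc N x) x.
Proof.
move=> e e0; have h0 i : 0 <= nrm (c i x) ^+ 2 by exact: sqr_ge0.
have [N0 hN] := sbd_tail h0 (c_bessel C x) (exprn_gt0 2 e0).
exists N0 => n Nn; rewrite nrm_sym; apply: (c_pars C) => [|N]; first exact: ltW.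
apply: le_trans (hN n N Nn).
have cc i : c i (x - trunc n x) = if (i < n)%N then 0 else c i x.
  by rewrite cB c_trunc; case: ifP; rewrite ?subrr ?subr0.
have [nN|Nn'] := leqP n N.
  rewrite (big_cat_nat (n:=n) (p:=N))//= big_nat big1 ?add0r => [|i /andP[_ iN]].
    by rewrite !big_nat ler_sum// => i /andP[iN _]; rewrite cc ltnNge iN.
  by rewrite cc iN nrm0 expr0n.
rewrite [leRHS]big_geq ?(ltnW Nn')// big_nat big1// => i /andP[_ iN].
by rewrite cc (ltn_trans iN)// nrm0 expr0n.
Qed.

(** The junk value is 0 when the partial sums diverge; [vserP] provides convergence under a summable
    bound. *)
Definition vser u : V := xget 0 [set s | tends (fun N => \sum_(0 <= j < N) u j) s].

Lemma vser_tends u s : tends (fun N => \sum_(0 <= j < N) u j) s -> vser u = s.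
Proof.
by move=> h; rewrite /vser; case: xgetP => [y _ /= hy|/(_ s)//]; exact: tends_uniq hy h.
Qed.

Lemma vserP u (r : nat -> R) M : (forall j, nrm (u j) <= r j) -> sbd r M ->
  tends (fun N => \sum_(0 <= j < N) u j) (vser u).
Proof.
move=> ur rM; have r0 j : 0 <= r j by apply: le_trans (ur j).
suff : cauchy_seq (fun N => \sum_(0 <= j < N) u j).
  by move=> /(c_complete C)[s hs]; rewrite (vser_tends hs).
move=> e e0; have [N h] := sbd_tail r0 rM e0; exists N => m n Nm mn.
rewrite (big_cat_nat (n:=m) (p:=n))//= addrAC subrr add0r.
apply: le_trans (nrm_sum _ _ _) _; apply: le_trans (h m n Nm).
by apply: ler_sum.
Qed.

Lemma vser_le u (r : nat -> R) M : (forall j, nrm (u j) <= r j) -> sbd r M ->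
  nrm (vser u) <= M.
Proof.
move=> ur rM; apply: tends_nrm_le (vserP ur rM) => N.
apply: le_trans (nrm_sum _ _ _) _; apply: le_trans (rM N).
by apply: ler_sum.
Qed.

(** J is the geometric series of S. Its linearity and the second identity follow from the first one,
    because [1 - S] is injective. *)
Lemma neumann S : blin S 2^-1 -> exists J, [/\ blin J 2,
  forall x, J (x - S x) = x & forall x, J x - S (J x) = x].
Proof.
move=> hS.
have it n x : nrm (iter n S x) <= nrm x * 2^-1 ^+ n.
  elim: n => [|n IH]; first by rewrite expr0 mulr1.
  rewrite iterS exprS mulrCA; apply: le_trans (bl_bd hS _) _.
  by rewrite ler_wpM2l// invr_ge0.
have geo x : sbd (fun n => nrm x * 2^-1 ^+ n) (2 * nrm x) by exact: sbd_geom.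
pose J x := vser (fun n => iter n S x).
have Jeq x : J x - S (J x) = x.
  have h := vserP (fun n => it n x) (geo x).
  have h2 := tendsB h (bl_tends hS h).
  apply: tends_uniq h2 _ => e e0; have [n hn] := geom_small (nrm x) e0.
  exists n => m nm.
  have -> : \sum_(0 <= j < m) iter j S x -
      S (\sum_(0 <= j < m) iter j S x) = x - iter m S x.
    elim: m {nm} => [|m IH]; first by rewrite !big_geq// (bl0 hS) subr0 subrr.
    by rewrite !big_nat_recr//= (blD hS) opprD addrACA IH addrA subrK.
  rewrite addrAC subrr add0r.
  rewrite nrmN; apply: le_trans (it m x) _; apply: ltW; apply: le_lt_trans hn.
  by rewrite ler_wpM2l// ler_wiXn2l// ?invr_ge0 ?invf_le1 ?ler1n.
have inj x y : x - S x = y - S y -> x = y.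
  move=> h; apply/eqP; rewrite -subr_eq0; apply/eqP/nrm_le0.
  have E : x - y = S (x - y).
    move/eqP: h; rewrite subr_eq => /eqP h.
    by rewrite (blB hS) {1}h addrAC (addrAC y) subrr add0r addrC.
  by have := bl_bd hS (x - y); rewrite -E; have := nrm_ge0 (x - y); lra.
exists J; split=> //; last by move=> x; apply: inj; rewrite Jeq.
split=> // [k x y|x]; last exact: vser_le (fun n => it n x) (geo x).
by apply: inj; rewrite Jeq (bl_lin hS) opprD addrACA -scalerBr !Jeq.
Qed.

(** Absolutely summable coordinates, that is, for a trigonometric basis, an absolutely convergent
    Fourier series. These vectors form the domain of multiplication by q. *)
Definition Wb x M := sbd (fun i => nrm (c i x)) M.

Lemma Wb_nrm x M : Wb x M -> nrm x <= M.
Proof.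
move=> h; apply: (c_pars C) => [|N]; first exact: sbd_ge0 h.
apply: le_trans (sum_sqr_le_sqr_sum _ _) _ => //.
by rewrite ler_pXn2r// nnegrE ?sumr_ge0// (sbd_ge0 h).
Qed.
Lemma WbD x y M M' : Wb x M -> Wb y M' -> Wb (x + y) (M + M').
Proof.
by move=> h h'; apply: sbd_le (sbdD h h') => i; rewrite cD nrmD.
Qed.
Lemma WbZ (k : R[i]) x M : Wb x M -> Wb (k *: x) (nrm k * M).
Proof. by move=> h; apply: sbd_le (sbdZ (nrm_ge0 k) h) => i; rewrite cZ nrmM. Qed.
Lemma WbN x M : Wb x M -> Wb (- x) M.
Proof. by apply: sbd_le => i; rewrite cN nrmN. Qed.
Lemma WbB x y M M' : Wb x M -> Wb y M' -> Wb (x - y) (M + M').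
Proof. by move=> h h'; apply: WbD => //; apply: WbN. Qed.
Lemma Wb0 : Wb 0 0.
Proof. by move=> N; rewrite big1// => i _; rewrite c0 nrm0. Qed.
Lemma Wb_le x M M' : M <= M' -> Wb x M -> Wb x M'.
Proof. exact: sbd_leM. Qed.
Lemma Wb_sum (I : Type) (s : seq I) (P : pred I) (f : I -> V) (r : I -> R) :
  (forall j, P j -> Wb (f j) (r j)) ->
  Wb (\sum_(j <- s | P j) f j) (\sum_(j <- s | P j) r j).
Proof.
move=> h; elim/big_rec2: _ => [|j M x Pj hx]; first exact: Wb0.
by apply: WbD => //; exact: h.
Qed.
Lemma Wb_ee j : Wb (ee j) 1.
Proof.
move=> N; case: (ltnP j N) => [jN|Nj].
  rewrite (bigD1_seq j) ?iota_uniq ?mem_index_iota//= c_ee eqxx nrm1 big1 ?addr0//.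
  by move=> l /negPf lj; rewrite c_ee lj nrm0.
rewrite big_nat big1// => l /andP[_ lN]; rewrite c_ee ltn_eqF ?(leq_trans lN)//.
by rewrite nrm0.
Qed.
(** Each coordinate is continuous in the norm of V, and a bound on [Wb] concerns finitely many of
    them at a time. *)
Lemma Wb_lim u x M : (forall n, Wb (u n) M) -> tends u x -> Wb x M.
Proof.
move=> h hu N; apply/ler_addgt0Pl => e e0.
have N1 : 0 < N.+1%:R :> R by rewrite ltr0n.
have [n0 hn] := hu (e / N.+1%:R) (divr_gt0 e0 N1).
apply: (@le_trans _ _ (\sum_(0 <= i < N) (e / N.+1%:R + nrm (c i (u n0))))).
  apply: ler_sum => i _; rewrite -lerBlDr; apply: le_trans (nrm_diff _ _) _.
  by rewrite -cB; apply: le_trans (c_le _ _) _; rewrite nrm_sym; exact: hn.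
rewrite big_split/= lerD//.
  by rewrite sumr_const_nat subn0 -[_ *+ N]mulr_natr mulrAC ler_pdivrMr// ler_wpM2l ?(ltW e0)// ler_nat.
exact: h.
Qed.
Lemma Wb_vser u (r : nat -> R) M : (forall j, Wb (u j) (r j)) -> sbd r M ->
  Wb (vser u) M.
Proof.
move=> h rM; have ur j : nrm (u j) <= r j by exact: Wb_nrm.
apply: Wb_lim (vserP ur rM) => N; apply: Wb_le (rM N) _.
by apply: Wb_sum => j _; exact: h.
Qed.

Lemma Wb_tail x M e : Wb x M -> 0 < e ->
  exists N0, forall N, (N0 <= N)%N -> Wb (x - trunc N x) e.
Proof.
move=> h e0; have [N0 hN] := sbd_tail (fun i => nrm_ge0 (c i x)) h e0.
exists N0 => n Nn N; apply: le_trans (hN n N Nn).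
have cc i : c i (x - trunc n x) = if (i < n)%N then 0 else c i x.
  by rewrite cB c_trunc; case: ifP; rewrite ?subrr ?subr0.
have [nN|Nn'] := leqP n N.
  rewrite (big_cat_nat (n:=n) (p:=N))//= big_nat big1 ?add0r => [|i /andP[_ iN]].
    by rewrite !big_nat ler_sum// => i /andP[iN _]; rewrite cc ltnNge iN.
  by rewrite cc iN nrm0.
rewrite [leRHS]big_geq ?(ltnW Nn')// big_nat big1// => i /andP[_ iN].
by rewrite cc (ltn_trans iN)// nrm0.
Qed.

(** The operator with columns [y j]. It is used with square summable columns, on all of V, and with
    merely bounded columns, on absolutely summable coordinates. *)
Definition colop (y : nat -> V) x := vser (fun j => c j x *: y j).

(** The limits are arguments because the two kinds of columns converge for different reasons. *)
Lemma colop_lin (y : nat -> V) x1 x2 x3 s1 s2 (k : R[i]) :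
  x3 = k *: x1 + x2 ->
  tends (fun N => \sum_(0 <= j < N) c j x1 *: y j) s1 ->
  tends (fun N => \sum_(0 <= j < N) c j x2 *: y j) s2 ->
  tends (fun N => \sum_(0 <= j < N) c j x3 *: y j) (k *: s1 + s2).
Proof.
move=> -> h1 h2; have := tendsD (bl_tends (bl_scal k) h1) h2.
apply: tends_eq => n; rewrite scaler_sumr -big_split/=; apply: eq_bigr => j _.
by rewrite cD cZ scalerDl scalerA.
Qed.

Lemma sum_scal_ee (N : nat) (P : pred nat) j (y : nat -> V) :
  \sum_(0 <= i < N | P i) c i (ee j) *: y i = if (j < N)%N && P j then y j else 0.
Proof.
rewrite big_mkcond/=; case: (ltnP j N) => [jN|Nj]/=.
  rewrite (bigD1_seq j) ?iota_uniq ?mem_index_iota//= c_ee eqxx scale1r big1 ?addr0//.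
  by move=> l /negPf lj; rewrite c_ee lj scale0r if_same.
rewrite big_nat big1// => l /andP[_ lN]; rewrite c_ee ltn_eqF ?(leq_trans lN)//.
by rewrite scale0r if_same.
Qed.

Lemma tends_colop_ee (y : nat -> V) j :
  tends (fun N => \sum_(0 <= i < N) c i (ee j) *: y i) (y j).
Proof.
move=> e e0; exists j.+1 => n jn.
by rewrite (sum_scal_ee n xpredT) jn/= subrr nrm0 ltW.
Qed.

Lemma colop_ee (y : nat -> V) j : colop y (ee j) = y j.
Proof. exact: vser_tends (tends_colop_ee y j). Qed.

Section ColopL2.
Variables (y : nat -> V) (r : nat -> R) (G : R).
Hypotheses (r0 : forall j, 0 <= r j) (yr : forall j, Wb (y j) (r j)) (G0 : 0 <= G)
  (rG : sbd (fun j => r j ^+ 2) (G ^+ 2)).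

Lemma colopL2_sbd x : sbd (fun j => nrm (c j x) * r j) (nrm x * G).
Proof. by apply: sbd_cs => //; exact: c_bessel C x. Qed.

Lemma colopL2_nrm x j : nrm (c j x *: y j) <= nrm (c j x) * r j.
Proof. by rewrite nrmZ ler_wpM2l//; exact: Wb_nrm (yr j). Qed.

Lemma colopL2_tends x : tends (fun N => \sum_(0 <= j < N) c j x *: y j) (colop y x).
Proof. exact: (vserP (colopL2_nrm x) (colopL2_sbd x)). Qed.

Lemma colopL2_blin : blin (colop y) G.
Proof.
split=> // [k x1 x2|x]; last first.
  by rewrite mulrC; exact: (vser_le (colopL2_nrm x) (colopL2_sbd x)).
by apply: vser_tends; apply: colop_lin => //; exact: colopL2_tends.
Qed.

(** Cauchy-Schwarz between the coordinates of x and the column bounds. This is why 1 + Y preserves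
    absolutely summable coordinates. *)
Lemma colopL2_W x : Wb (colop y x) (G * nrm x).
Proof.
rewrite mulrC; apply: Wb_vser (colopL2_sbd x) => j; exact: WbZ.
Qed.
End ColopL2.

Section ColopW.
Variables (b : nat -> V) (beta : R).
Hypotheses (hb : forall j, nrm (b j) <= beta).

Lemma beta_ge0 : 0 <= beta. Proof. exact: le_trans (hb 0%N). Qed.

Lemma colopW_sbd x M : Wb x M -> sbd (fun j => nrm (c j x) * beta) (beta * M).
Proof.
move=> h; apply: sbd_le (sbdZ beta_ge0 h) => i; by rewrite mulrC.
Qed.

Lemma colopW_nrm x j : nrm (c j x *: b j) <= nrm (c j x) * beta.
Proof. by rewrite nrmZ ler_wpM2l. Qed.

Lemma colopW_tends x M : Wb x M ->
  tends (fun N => \sum_(0 <= j < N) c j x *: b j) (colop b x).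
Proof. by move=> h; exact: (vserP (colopW_nrm x) (colopW_sbd h)). Qed.

Lemma colopW_le x M : Wb x M -> nrm (colop b x) <= beta * M.
Proof. by move=> h; exact: (vser_le (colopW_nrm x) (colopW_sbd h)). Qed.

Lemma colopW_lin (k : R[i]) x1 x2 M1 M2 : Wb x1 M1 -> Wb x2 M2 ->
  colop b (k *: x1 + x2) = k *: colop b x1 + colop b x2.
Proof.
move=> h1 h2; apply: vser_tends; apply: colop_lin => //.
  exact: colopW_tends h1.
exact: colopW_tends h2.
Qed.

Lemma colopWD x1 x2 M1 M2 : Wb x1 M1 -> Wb x2 M2 ->
  colop b (x1 + x2) = colop b x1 + colop b x2.
Proof. by move=> h1 h2; have := colopW_lin 1 h1 h2; rewrite !scale1r. Qed.
Lemma colop0 : colop b 0 = 0.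
Proof.
apply: vser_tends => e e0; exists 0%N => n _; rewrite big1 ?subrr ?nrm0 ?ltW// => i _.
by rewrite c0 scale0r.
Qed.
Lemma colopWZ (k : R[i]) x M : Wb x M -> colop b (k *: x) = k *: colop b x.
Proof. by move=> h; have := colopW_lin k h Wb0; rewrite colop0 !addr0. Qed.
Lemma colopWB x1 x2 M1 M2 : Wb x1 M1 -> Wb x2 M2 ->
  colop b (x1 - x2) = colop b x1 - colop b x2.
Proof.
by move=> h1 h2; have := colopW_lin (-1) h2 h1; rewrite !scaleN1r !(addrC (- _)).
Qed.
Lemma colopW_sum (I : Type) (s : seq I) (P : pred I) (f : I -> V) (r : I -> R) :
  (forall j, Wb (f j) (r j)) ->
  colop b (\sum_(j <- s | P j) f j) = \sum_(j <- s | P j) colop b (f j).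
Proof.
move=> h; elim: s => [|j s IH]; first by rewrite !big_nil colop0.
rewrite !big_cons; case: ifP => // Pj; rewrite -IH.
by apply: colopWD; [exact: h|apply: Wb_sum => i _; exact: h].
Qed.
End ColopW.

Section Diagonal.
Variables (a : nat -> R[i]) (M : R).
Hypotheses (M0 : 0 <= M) (aM : forall i, nrm (a i) <= M).

Definition dg x := synth (fun i => a i * c i x).

Lemma c_dg i x : c i (dg x) = a i * c i x.
Proof.
apply: (@synthE _ (M ^+ 2 * nrm x ^+ 2)) => N.
apply: le_trans (sbdZ (sqr_ge0 M) (c_bessel C x) N); apply: ler_sum => j _.
by rewrite nrmM exprMn ler_wpM2r ?sqr_ge0// ler_pXn2r// nnegrE.
Qed.

Lemma dg_blin : blin dg M.
Proof.
split=> // [k x y|x].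
  by apply: c_inj => i; rewrite cD cZ !c_dg (c_lin C) mulrDr mulrCA.
apply: (c_pars C); first by rewrite mulr_ge0.
rewrite exprMn => N; apply: le_trans (sbdZ (sqr_ge0 M) (c_bessel C x) N).
apply: ler_sum => j _.
by rewrite c_dg nrmM exprMn ler_wpM2r ?sqr_ge0// ler_pXn2r// nnegrE.
Qed.
End Diagonal.

End Coordinates.

(** * Block diagonalization by a fixed point *)

Section BlockDiagonalization.
Variables (R : realType) (V : normedModType R[i]).
Variable c : nat -> V -> R[i].
Hypothesis C : l2coord c.
Variables (mu : nat -> R) (same : rel nat) (D : nat) (g : nat -> R) (G : R).
Variables (b : nat -> V) (beta : R).
Hypothesis same_refl : reflexive same.
Hypothesis same_sym : symmetric same.
Hypothesis same_trans : transitive same.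
Hypothesis same_D : forall i j, same i j -> (i < j + D)%N.
Hypothesis mu_same : forall i j, ~~ same i j -> mu i != mu j.
Hypothesis g0 : forall j, 0 <= g j.
Hypothesis gap : forall j,
  sbd (fun i => if same i j then 0 else ((mu i - mu j)^-1) ^+ 2) (g j ^+ 2).
Hypothesis G0 : 0 <= G.
Hypothesis gG : sbd (fun j => g j ^+ 2) (G ^+ 2).
Hypothesis hb : forall j, nrm (b j) <= beta.
Hypothesis betaG : beta * G <= 8^-1.

Local Notation B := (colop c b).
Local Notation e_ := (ee c).
Local Notation Wb := (Wb c).
Implicit Types (y z : nat -> V) (u v x : V).

Let beta0 : 0 <= beta. Proof. exact: beta_ge0 hb. Qed.

Lemma g_le j : g j <= G.
Proof.
rewrite -(ler_pXn2r (n:=2))// ?nnegrE//.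
by apply: le_trans (gG j.+1); rewrite big_nat_recr//= lerDr sumr_ge0// => i _; rewrite sqr_ge0.
Qed.

Lemma g_sbd (k : R) : sbd (fun j => (k * g j) ^+ 2) ((k * G) ^+ 2).
Proof.
move=> N; rewrite exprMn; apply: le_trans (sbdZ (sqr_ge0 k) gG N).
by apply: ler_sum => i _; rewrite exprMn.
Qed.

(* [gam j] inverts A - mu j outside the block of j. Applying A - B to e_j + y_j
   and asking for a combination of the e_i + y_i with i in the block of j gives,
   outside that block, y_j = Psi y j. *)
Definition gam_coef j u i : R[i] := if same i j then 0 else c i u / (mu i - mu j)%:C.
Definition gam j u := synth c (gam_coef j u).

(** Cauchy-Schwarz against the inverse gaps: a vector of V becomes absolutely summable, so B can be
    applied to it again. *)
Lemma gam_coef_sbd j u : sbd (fun i => nrm (gam_coef j u i)) (nrm u * g j).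
Proof.
have := sbd_cs (fun i => nrm_ge0 (c i u)) (nrm_ge0 u) (g0 j) (c_bessel C u)
  (a := fun i => if same i j then 0 else `|(mu i - mu j)^-1|).
have h : sbd (fun i => (if same i j then 0 else `|(mu i - mu j)^-1|) ^+ 2) (g j ^+ 2).
  apply: sbd_le (gap j) => i; case: ifP => _; first by rewrite expr0n.
  by rewrite real_normK ?num_real.
move=> /(_ h); apply: sbd_le => i; rewrite /gam_coef; case: ifP => _.
  by rewrite nrm0 mulr0.
by rewrite nrmM nrmV nrm_real normfV.
Qed.

Lemma c_gam j u i : c i (gam j u) = gam_coef j u i.
Proof.
apply: (synthE C (M := (nrm u * g j) ^+ 2)) => N.
apply: le_trans (sum_sqr_le_sqr_sum _ _) _ => //.
rewrite ler_pXn2r// ?nnegrE ?sumr_ge0//; first exact: gam_coef_sbd.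
by rewrite mulr_ge0.
Qed.

Lemma gam_W j u : Wb (gam j u) (nrm u * g j).
Proof. by apply: sbd_le (gam_coef_sbd j u) => i; rewrite c_gam. Qed.

Lemma gamB j u v : gam j (u - v) = gam j u - gam j v.
Proof.
apply: (c_inj C) => i; rewrite (cB C) !c_gam /gam_coef (cB C).
by case: ifP => _; rewrite ?subrr// mulrBl.
Qed.

Lemma sum_same_le N (P : pred nat) (u : V) y (k : R) : 0 <= k ->
  (forall i, nrm (y i) <= k * g i) ->
  nrm (\sum_(0 <= i < N | P i) c i u *: y i) <= nrm u * (k * G).
Proof.
move=> k0 hy; apply: le_trans (nrm_sum _ _ _) _.
apply: (@le_trans _ _ (\sum_(0 <= i < N | P i) nrm (c i u) * (k * g i))).
  by apply: ler_sum => i _; rewrite nrmZ ler_wpM2l.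
have mk (f : nat -> R) A : sbd (fun i => f i ^+ 2) (A ^+ 2) ->
    \sum_(0 <= i < N | P i) f i ^+ 2 <= A ^+ 2.
  move=> h; apply: le_trans (h N); rewrite big_mkcond ler_sum// => i _.
  by case: ifP => // _; rewrite sqr_ge0.
apply: cauchy_schwarz_sum; rewrite ?mulr_ge0//.
  exact: mk (c_bessel C u).
exact: mk (@g_sbd k).
Qed.

Definition zcol y j := B (e_ j + y j).
(** With z_j = [zcol y j], the coordinates inside the block force the combination mu_j (e_j + y_j)
    minus the sum of c_i(z_j) (e_i + y_i) over the block; the remaining coordinates then say y_j =
    [Psi y j]. *)
Definition Psi y j :=
  gam j (zcol y j - \sum_(0 <= i < j + D | same i j) c i (zcol y j) *: y i).

Definition small y := forall j, Wb (y j) (4 * beta * g j).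

Lemma zcol_W y j : small y -> Wb (e_ j + y j) (1 + 4 * beta * g j).
Proof. by move=> hy; apply: WbD => //; exact: Wb_ee. Qed.

Lemma zcol_le y j : small y -> nrm (zcol y j) <= 2 * beta.
Proof.
move=> hy; apply: le_trans (colopW_le C hb (zcol_W j hy)) _.
have := g_le j; have := g0 j; have := betaG; have := beta0; nra.
Qed.

Lemma zcolB y y' j : small y -> small y' ->
  zcol y j - zcol y' j = B (y j - y' j).
Proof.
move=> h h'; rewrite -(colopWB C hb (zcol_W j h) (zcol_W j h')); congr B.
by rewrite opprD addrACA subrr add0r.
Qed.

(** Here |z_j| <= 2 beta, and the sum over the block is at most 2 beta * 4 beta G <= beta because
    beta G <= 1/8. The total 3 beta fits into the radius 4 beta of [small]. *)
Lemma Psi_small y : small y -> small (Psi y).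
Proof.
move=> hy j; apply: Wb_le (gam_W _ _); rewrite ler_wpM2r//.
apply: le_trans (nrmB _ _) _.
have h1 := zcol_le j hy.
have h2 := @sum_same_le (j + D) (same^~ j) (zcol y j) y (4 * beta)
  (mulr_ge0 (ler0n _ _) beta0) (fun i => Wb_nrm C (hy i)).
have h3 := nrm_ge0 (zcol y j).
have := betaG; have := beta0; have := G0; nra.
Qed.

(** The change of z_j is at most eta / 8, its effect on the sum over the block at most eta / 16, and
    the change of the y_i in that sum contributes at most eta / 4. Together this is 7/16 of eta. *)
Lemma Psi_contract y y' (eta : R) : 0 <= eta -> small y -> small y' ->
  (forall j, Wb (y j - y' j) (eta * g j)) ->
  forall j, Wb (Psi y j - Psi y' j) (eta / 2 * g j).
Proof.
move=> eta0 hy hy' hd j; rewrite -gamB; apply: Wb_le (gam_W _ _); rewrite ler_wpM2r//.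
set z := zcol y j; set z' := zcol y' j.
have zz : nrm (z - z') <= beta * (eta * g j).
  rewrite /z /z' zcolB//.
  have h := colopW_le C hb (hd j).
  exact: h.
have z'2 : nrm z' <= 2 * beta by exact: zcol_le.
rewrite opprD addrACA opprK.
have -> : - (\sum_(0 <= i < j + D | same i j) c i z *: y i) +
     \sum_(0 <= i < j + D | same i j) c i z' *: y' i =
   - (\sum_(0 <= i < j + D | same i j) c i (z - z') *: y i +
     \sum_(0 <= i < j + D | same i j) c i z' *: (y i - y' i)).
  rewrite -big_split/= -!sumrN -big_split/=; apply: eq_bigr => i _.
  by rewrite (cB C) scalerBl scalerBr addrA subrK opprB addrC.
apply: le_trans (nrmB _ _) _.
have h1 := @sum_same_le (j + D) (same^~ j) (z - z') y (4 * beta)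
  (mulr_ge0 (ler0n _ _) beta0) (fun i => Wb_nrm C (hy i)).
have h2 := @sum_same_le (j + D) (same^~ j) z' (fun i => y i - y' i) eta
  eta0 (fun i => Wb_nrm C (hd i)).
have h3 := nrmD (\sum_(0 <= i < j + D | same i j) c i (z - z') *: y i)
  (\sum_(0 <= i < j + D | same i j) c i z' *: (y i - y' i)).
apply: le_trans (lerD (lexx _) h3) _.
have gj : beta * (eta * g j) <= eta / 8.
  have : beta * g j <= 8^-1 by apply: le_trans betaG; rewrite ler_wpM2l// g_le.
  by move=> ?; nra.
have n0 := nrm_ge0 (z - z'); have n0' := nrm_ge0 z'.
have k1 : nrm (z - z') * (4 * beta * G) <= eta / 16.
  have : 4 * beta * G <= 2^-1 by have := betaG; lra.
  have : 0 <= 4 * beta * G by rewrite !mulr_ge0.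
  by move=> ? ?; nra.
have k2 : nrm z' * (eta * G) <= eta / 4.
  have : nrm z' * G <= 4^-1.
    by have : nrm z' * G <= 2 * beta * G by [rewrite ler_wpM2r|]; have := betaG; lra.
  by move=> ?; nra.
lra.
Qed.

Definition Yit n := iter n Psi (fun=> 0).

Lemma Yit_small n : small (Yit n).
Proof.
elim: n => [|n IH]; last exact: Psi_small.
by move=> j; apply: Wb_le (Wb0 C); rewrite !mulr_ge0.
Qed.

Lemma Yit_step n j : Wb (Yit n.+1 j - Yit n j) (4 * beta * 2^-1 ^+ n * g j).
Proof.
elim: n j => [|n IH] j.
  by rewrite expr0 mulr1 subr0; exact: Yit_small.
rewrite exprSr mulrA; apply: (@Psi_contract (Yit n.+1) (Yit n)) => //;
  try exact: (Yit_small n.+1); try exact: (Yit_small n).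
by rewrite mulr_ge0 ?exprn_ge0 ?invr_ge0// mulr_ge0.
Qed.

(** The limit of the iteration, column by column, as the series of its increments, which decrease
    geometrically. *)
Definition Yfix j := vser (fun n => Yit n.+1 j - Yit n j).

Lemma sum_Yit n j : \sum_(0 <= i < n) (Yit i.+1 j - Yit i j) = Yit n j.
Proof. by rewrite telescope_sumr// subr0. Qed.

Let geo j : sbd (fun n => 4 * beta * 2^-1 ^+ n * g j) (2 * (4 * beta * g j)).
Proof.
apply: sbd_le (sbd_geom (x := 4 * beta * g j) _) => [i|]; last by rewrite !mulr_ge0.
by rewrite mulrAC.
Qed.

Lemma Yfix_tends j : tends (fun n => Yit n j) (Yfix j).
Proof.
have := vserP C (fun n => Wb_nrm C (Yit_step n j)) (geo j).
by apply: tends_eq => n; rewrite sum_Yit.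
Qed.

Lemma Yfix_small : small Yfix.
Proof. by move=> j; apply: (Wb_lim C (fun n => Yit_small n j)); exact: Yfix_tends. Qed.

Lemma Yfix_near n j : Wb (Yfix j - Yit n j) (8 * beta * 2^-1 ^+ n * g j).
Proof.
have st m : Wb (Yit (m + n) j - Yit n j) (8 * beta * 2^-1 ^+ n * g j).
  have -> : Yit (m + n) j - Yit n j = \sum_(0 <= i < m) (Yit (i + n).+1 j - Yit (i + n) j).
    by rewrite (telescope_sumr (fun i => Yit (i + n) j)).
  apply: Wb_le (Wb_sum C _ (fun i _ => Yit_step (i + n) j)).
  have k0 : 0 <= 4 * beta * 2^-1 ^+ n * g j by rewrite !mulr_ge0 ?exprn_ge0 ?invr_ge0.
  have := sbd_geom k0 m; rewrite !mulrA -[2 * 4]natrM; apply: le_trans.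
  by apply: ler_sum => i _; rewrite exprD; lra.
apply: (Wb_lim C (u := fun m => Yit (m + n) j - Yit n j)) => //.
apply: tendsB; last exact: tends_cst.
move=> e /(Yfix_tends j)[N hN]; exists N => m Nm; apply: hN.
exact: leq_trans (leq_addr _ _).
Qed.

Lemma YfixE j : Yfix j = Psi Yfix j.
Proof.
apply: tends_uniq (tends_shift (Yfix_tends j)) _ => e e0.
have [n hn] := geom_small (4 * beta * g j) e0.
exists n => m nm; rewrite -[Yit m.+1]/(Psi (Yit m)) nrm_sym.
have k0 : 0 <= 8 * beta * 2^-1 ^+ m by rewrite !mulr_ge0 ?exprn_ge0 ?invr_ge0.
have := Psi_contract k0 Yfix_small (Yit_small m) (Yfix_near m) j.
move=> /(Wb_nrm C)/le_trans; apply; apply: le_trans (ltW hn).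
have : 2^-1 ^+ m <= 2^-1 ^+ n :> R.
  by rewrite ler_wiXn2l// ?invr_ge0 ?invf_le1 ?ler1n.
have : 0 <= 4 * beta * g j by rewrite !mulr_ge0.
by move=> ? ?; nra.
Qed.

Local Notation zc := (zcol Yfix).

Definition Yop := colop c Yfix.
Definition Uop v := v + Yop v.

Lemma Yop_blin : blin Yop 2^-1.
Proof.
apply: (bl_le (M := 4 * beta * G)); last by have := betaG; lra.
apply: (colopL2_blin C (r := fun j => 4 * beta * g j) Yfix_small _ (g_sbd _)).
by rewrite !mulr_ge0.
Qed.

Lemma Yop_W v : Wb (Yop v) (2^-1 * nrm v).
Proof.
apply: (Wb_le (M := 4 * beta * G * nrm v)).
  by rewrite ler_wpM2r//; have := betaG; lra.
apply: (colopL2_W C (r := fun j => 4 * beta * g j) Yfix_small _ (g_sbd _)).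
by rewrite !mulr_ge0.
Qed.

Lemma Uop_blin : blin Uop (1 + 2^-1).
Proof.
have h := bl_add (bl_id V) Yop_blin.
exact: h.
Qed.

Lemma Uop_inv : exists J, [/\ blin J 2, cancel Uop J & cancel J Uop].
Proof.
have [J [h1 h2 h3]] := neumann C (bl_opp Yop_blin); exists J; split=> // x.
  by rewrite -[RHS]h2 opprK.
by rewrite -[RHS]h3 opprK.
Qed.

Lemma Uop_inj : injective Uop.
Proof. by have [J [_ h _]] := Uop_inv; exact: can_inj h. Qed.

(** The j-th column of K is minus the part of z_j inside the block of j, see [Kop_ee]. Rows are used
    for the definition because a row meets its block in a finite sum. *)
Definition kco v i : R[i] := - \sum_(0 <= j < i + D | same j i) c i (zc j) * c j v.
Definition Kop v := synth c (kco v).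
Definition Kbound : R := 4 * beta * D%:R.

Let D1 : 1 <= D%:R :> R.
Proof. by rewrite ler1n; have := same_D (same_refl 0%N). Qed.

Lemma same_count i : \sum_(0 <= j < i + D | same j i) 1 <= (2 * D)%:R :> R.
Proof.
rewrite (big_cat_nat (n := i - D))//=; last by rewrite leq_subLR addnCA leq_addr.
rewrite big_nat_cond big1 ?add0r => [|j /andP[/andP[_ ji] sji]]; last first.
  have := same_D (etrans (esym (same_sym _ _)) sji); rewrite -ltn_subLR => [|]; lia.
rewrite big_mkcond; apply: (@le_trans _ _ (\sum_(i - D <= j < i + D) 1)).
  by apply: ler_sum => j _; case: ifP.
rewrite sumr_const_nat ler_nat; lia.
Qed.

Lemma kco_sqr v i : nrm (kco v i) ^+ 2 <=
  (2 * D)%:R * \sum_(0 <= j < i + D | same j i) (nrm (c i (zc j)) * nrm (c j v)) ^+ 2.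
Proof.
rewrite nrmN; set S := \sum_(_ <= _ < _ | _) _ ^+ 2.
have S0 : 0 <= S by apply: sumr_ge0 => j _; rewrite sqr_ge0.
have h : nrm (\sum_(0 <= j < i + D | same j i) c i (zc j) * c j v) <=
    Num.sqrt (2 * D)%:R * Num.sqrt S.
  apply: le_trans (nrm_sum _ _ _) _.
  have := @cauchy_schwarz_sum R nat (index_iota 0 (i + D)) (same^~ i) (fun=> 1)
    (fun j => nrm (c i (zc j)) * nrm (c j v)) (Num.sqrt (2 * D)%:R) (Num.sqrt S).
  rewrite !sqrtr_ge0 !sqr_sqrtr//.
  move=> /(_ isT isT _ (lexx _)) h; apply: le_trans (h _); last first.
    by under eq_bigr do rewrite expr1n; exact: same_count.
  by apply: ler_sum => j _; rewrite mul1r nrmM.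
apply: le_trans (_ : (Num.sqrt (2 * D)%:R * Num.sqrt S) ^+ 2 <= _).
  by rewrite ler_pXn2r// nnegrE ?mulr_ge0 ?sqrtr_ge0.
by rewrite exprMn !sqr_sqrtr.
Qed.

(** A row has at most 2 D entries in its block, and a column has norm at most 2 beta. Cauchy-Schwarz
    in the rows and an exchange of sums give 2 D (2 beta)^2 = 8 D beta^2, which is at most [Kbound]
    squared as D >= 1. *)
Lemma kco_sbd v : sbd (fun i => nrm (kco v i) ^+ 2) ((Kbound * nrm v) ^+ 2).
Proof.
move=> N.
apply: (@le_trans _ _ ((2 * D)%:R * \sum_(0 <= i < N) \sum_(0 <= j < N + D)
    (nrm (c i (zc j)) * nrm (c j v)) ^+ 2)).
  rewrite mulr_sumr big_nat [leRHS]big_nat; apply: ler_sum => i /andP[_ iN].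
  apply: le_trans (kco_sqr v i) _; rewrite ler_wpM2l//.
  apply: (@le_trans _ _ (\sum_(0 <= j < i + D) (nrm (c i (zc j)) * nrm (c j v)) ^+ 2)).
    by rewrite big_mkcond; apply: ler_sum => j _; case: ifP => // _; rewrite sqr_ge0.
  by apply: sum_nat_mono => [j|]; rewrite ?sqr_ge0// leq_add2r ltnW.
rewrite exchange_big/=.
have h : \sum_(0 <= j < N + D) \sum_(0 <= i < N) (nrm (c i (zc j)) * nrm (c j v)) ^+ 2
    <= (2 * beta) ^+ 2 * nrm v ^+ 2.
  apply: le_trans (sbdZ (sqr_ge0 (2 * beta)) (c_bessel C v) (N + D)).
  apply: ler_sum => j _; under eq_bigr do rewrite exprMn.
  rewrite -mulr_suml ler_wpM2r ?sqr_ge0//; apply: le_trans (c_bessel C (zc j) N) _.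
  rewrite ler_pXn2r// ?nnegrE ?mulr_ge0//; apply: zcol_le; exact: Yfix_small.
apply: le_trans (ler_wpM2l (ler0n _ _) h) _.
rewrite /Kbound natrM !exprMn; have := sqr_ge0 beta; have := sqr_ge0 (nrm v).
set p := nrm v ^+ 2; set q := beta ^+ 2; set d := D%:R => p0 q0.
have pq : 0 <= q * p by rewrite mulr_ge0.
have -> : 2 * d * (2 ^+ 2 * q * p) = 8 * d * (q * p) by ring.
have -> : 4 ^+ 2 * q * d ^+ 2 * p = 16 * d ^+ 2 * (q * p) by ring.
by rewrite ler_wpM2r//; have : 1 <= d := D1; nra.
Qed.

Lemma c_Kop v i : c i (Kop v) = kco v i.
Proof. exact: (synthE C (kco_sbd v)). Qed.

Lemma Kbound_ge0 : 0 <= Kbound. Proof. by rewrite !mulr_ge0. Qed.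

Lemma Kop_blin : blin Kop Kbound.
Proof.
split=> [k u v||v]; last 2 first.
- exact: Kbound_ge0.
- apply: (c_pars C); first by rewrite mulr_ge0// Kbound_ge0.
  by move=> N; under eq_bigr do rewrite c_Kop; exact: kco_sbd.
apply: (c_inj C) => i; rewrite (c_lin C) !c_Kop /kco mulrN mulr_sumr -opprD -big_split/=.
by congr (- _); apply: eq_bigr => j _; rewrite (c_lin C) mulrDr mulrCA.
Qed.

Lemma Kop_ee j : Kop (e_ j) = - \sum_(0 <= l < j + D | same l j) c l (zc j) *: e_ l.
Proof.
apply: (c_inj C) => i; rewrite c_Kop (cN C) (c_sum C); congr (- _).
under eq_bigr do rewrite (c_ee C) eq_sym.
under [in RHS]eq_bigr do rewrite (cZ C) (c_ee C).
rewrite (sum_delta (same^~ i) _ j (fun j => c i (zc j))).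
rewrite (sum_delta (same^~ j) _ i (fun l => c l (zc j))).
rewrite (same_sym j i); case sij : (same i j); rewrite ?andbF// !andbT.
by rewrite !same_D// same_sym.
Qed.

Lemma c_Yfix_same i j : same i j -> c i (Yfix j) = 0.
Proof. by move=> h; rewrite YfixE c_gam /gam_coef h. Qed.

Definition hcol j := (mu j)%:C *: e_ j + Kop (e_ j).

(** This is (A - B) U e_j = U (A + K) e_j in coordinate i. Inside the block, y_j has no coordinates
    and the definition of K remains; outside, it is the fixed point equation multiplied by mu_i -
    mu_j. *)
Lemma column_eq i j : (mu i)%:C * c i (e_ j + Yfix j) = c i (zc j) + c i (Uop (hcol j)).
Proof.
have hY : Yop (hcol j) = (mu j)%:C *: Yfix j -
    \sum_(0 <= l < j + D | same l j) c l (zc j) *: Yfix l.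
  rewrite (blD Yop_blin) (blZ Yop_blin) Kop_ee (blN Yop_blin) (bl_sum Yop_blin).
  rewrite /Yop (colop_ee C); congr (_ - _); apply: eq_bigr => l _.
  by rewrite -/(Yop _) (blZ Yop_blin) /Yop (colop_ee C).
rewrite /Uop hY !(cD C) !(cN C) !(cZ C) (c_ee C) (c_sum C) c_Kop /kco.
under eq_bigr do rewrite (c_ee C) eq_sym.
rewrite (sum_delta (same^~ i) _ j (fun j => c i (zc j))).
under eq_bigr do rewrite (cZ C).
rewrite (same_sym j i); case sij : (same i j).
  rewrite (c_Yfix_same sij) same_D; last by rewrite same_sym.
  rewrite /= mulr0 addr0 big1 => [|l slj].
    rewrite subrr addr0; case: eqP => [->|_]; last by rewrite !mulr0 sub0r subrr.
    by rewrite [RHS]addrC subrK.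
  by rewrite c_Yfix_same ?mulr0// (same_trans sij)// same_sym.
have ij : (i == j) = false.
  by apply/negP => /eqP ij; rewrite ij same_refl in sij.
rewrite ij andbF mulr0 add0r oppr0 !add0r.
have E : c i (Yfix j) = (c i (zc j) -
   \sum_(0 <= l < j + D | same l j) c l (zc j) * c i (Yfix l)) / (mu i - mu j)%:C.
  rewrite [in LHS]YfixE c_gam /gam_coef sij (cB C) (c_sum C).
  by under eq_bigr do rewrite (cZ C).
have mij : (mu i - mu j)%:C != 0 :> R[i].
  by rewrite (inj_eq (@complexI R) _ 0) subr_eq0 mu_same// sij.
set S := \sum_(_ <= _ < _ | _) _ in E *.
have : c i (Yfix j) * (mu i - mu j)%:C = c i (zc j) - S by rewrite E divfK.
rewrite rmorphB mulrBr => /eqP; rewrite subr_eq => /eqP h.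
by rewrite mulrC h; ring.
Qed.

(* h = (A - B) x; the domain is the set of x with absolutely summable coordinates. *)
Definition Lrel x h := (exists M, Wb x M) /\
  forall i, c i h = (mu i)%:C * c i x - c i (B x).

Definition Arel v w := forall i, c i w = (mu i)%:C * c i v.

Lemma Lrel_lin (k : R[i]) x h x' h' : Lrel x h -> Lrel x' h' ->
  Lrel (k *: x + x') (k *: h + h').
Proof.
move=> [[M hM] hx] [[M' hM'] hx']; split.
  by exists (nrm k * M + M'); apply: WbD => //; apply: WbZ.
move=> i; rewrite (colopW_lin C hb k hM hM') !(c_lin C) hx hx'; ring.
Qed.

(** For truncations of v this is a finite combination of [column_eq]. A is unbounded, but a single
    coordinate of each term passes to the limit; for the term with B this holds since the
    truncations converge also in the norm of absolutely summable coordinates. *)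
Lemma Lrel_Uop v w M : Wb v M -> Arel v w -> Lrel (Uop v) (Uop (w + Kop v)).
Proof.
move=> hM hw; have WU u N : Wb u N -> Wb (Uop u) (N + 2^-1 * nrm u).
  by move=> h; apply: WbD => //; exact: Yop_W.
split=> [|i]; first by exists (M + 2^-1 * nrm v); exact: WU.
pose vN N := trunc c N v.
have t1 : tends (fun N => (mu i)%:C * c i (Uop (vN N))) ((mu i)%:C * c i (Uop v)).
  apply: tends_scal; apply: (c_tends C); apply: (bl_tends Uop_blin).
  exact: trunc_tends.
have t2 : tends (fun N => c i (B (Uop (vN N)))) (c i (B (Uop v))).
  apply: (c_tends C) => e e0.
  have b1 : 0 < 2 * beta + 1 by have := beta0; lra.
  have [N0 hN] := Wb_tail C hM (divr_gt0 e0 b1).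
  exists N0 => N NN; have h1 := hN N NN.
  have h2 : Wb (vN N) (M + e / (2 * beta + 1)).
    by rewrite -[vN N](subKr v); exact: WbB.
  rewrite nrm_sym -(colopWB C hb (WU _ _ hM) (WU _ _ h2)) -(blB Uop_blin).
  apply: le_trans (colopW_le C hb (WU _ _ h1)) _.
  have := Wb_nrm C h1; set q := e / _ => hq.
  have E : q * (2 * beta + 1) = e by rewrite divfK// gt_eqF.
  have := ltW (divr_gt0 e0 b1); rewrite -/q => q0.
  have := nrm_ge0 (v - trunc c N v); have := beta0; rewrite /vN; nra.
have t3 : tends (fun N => c i (Uop (trunc c N w + Kop (vN N)))) (c i (Uop (w + Kop v))).
  apply: (c_tends C); apply: (bl_tends Uop_blin); apply: tendsD.
    exact: trunc_tends.
  by apply: (bl_tends Kop_blin); exact: trunc_tends.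
apply: tends_uniq t3 _; apply: tends_eq (tendsB t1 t2) => N; apply/eqP.
rewrite subr_eq eq_sym; apply/eqP.
have -> : Uop (vN N) = \sum_(0 <= j < N) c j v *: (e_ j + Yfix j).
  rewrite (bl_sum Uop_blin); apply: eq_bigr => j _.
  by rewrite (blZ Uop_blin) /Uop /Yop (colop_ee C).
have -> : trunc c N w + Kop (vN N) = \sum_(0 <= j < N) c j v *: hcol j.
  rewrite (bl_sum Kop_blin) -big_split/=; apply: eq_bigr => j _.
  by rewrite (blZ Kop_blin) hw scalerDr scalerA mulrC.
have HW j := WbZ C (c j v) (zcol_W j Yfix_small).
rewrite (colopW_sum C hb _ _ HW).
rewrite (bl_sum Uop_blin) !(c_sum C) mulr_sumr -big_split/=; apply: eq_bigr => j _.
rewrite (colopWZ C hb _ (zcol_W j Yfix_small)) (blZ Uop_blin) !(cZ C).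
by rewrite -mulrDr addrC -column_eq mulrCA.
Qed.

Hypothesis mu0 : forall i, 0 <= mu i.
Variable sigma : R.
Hypothesis mu_sum : sbd (fun i => (1 + mu i)^-1) sigma.

Let sigma0 : 0 <= sigma. Proof. exact: sbd_ge0 mu_sum. Qed.

Lemma mu_tau_sum (tau : R) : 1 <= tau ->
  sbd (fun i => ((mu i + tau)^-1) ^+ 2) (sigma / tau).
Proof.
move=> t1; have t0 : 0 < tau by lra.
rewrite mulrC; apply: sbd_le (sbdZ (_ : 0 <= tau^-1) mu_sum) => [i|]; last first.
  by rewrite invr_ge0 ltW.
have m := mu0 i; rewrite exprVn -invfM lef_pV2 ?posrE.
- by nra.
- by apply: exprn_gt0; lra.
- by apply: mulr_gt0; lra.
Qed.

(** The coordinates of v + w are (1 + mu_i) c_i(v); dividing by 1 + mu_i costs a square summable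
    factor. *)
Lemma Arel_W v w : Arel v w -> exists M, Wb v M.
Proof.
move=> hw; exists (nrm (v + w) * Num.sqrt sigma).
have h := @mu_tau_sum 1 (lexx _); rewrite divr1 in h.
have h' : sbd (fun i => (mu i + 1)^-1 ^+ 2) (Num.sqrt sigma ^+ 2) by rewrite sqr_sqrtr.
apply: sbd_le (sbd_cs (fun i => nrm_ge0 (c i (v + w))) (nrm_ge0 _)
  (sqrtr_ge0 _) (c_bessel C (v + w)) h') => i.
have m := mu0 i; rewrite (cD C) hw.
have -> : c i v + (mu i)%:C * c i v = (mu i + 1)%:C * c i v.
  by rewrite rmorphD rmorph1; ring.
rewrite nrmM nrm_real ger0_norm; last lra.
  by rewrite mulrAC mulfV ?mul1r// gt_eqF//; lra.
Qed.

(** The equation reads (mu_i + tau) c_i(x) = c_i(B x). As beta sqrt(sigma / tau) <= 1/2, any bound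
    on the sum of the |c_i(x)| can be halved, again and again. *)
Lemma Lrel_inj (tau : R) x : 1 <= tau -> 4 * beta ^+ 2 * sigma <= tau ->
  Lrel x (- tau%:C *: x) -> x = 0.
Proof.
move=> t1 tau4 [[M hM] hx].
have bs : beta * Num.sqrt (sigma / tau) <= 2^-1.
  rewrite -(ler_pXn2r (n:=2))// ?nnegrE ?mulr_ge0 ?sqrtr_ge0//.
  rewrite exprMn sqr_sqrtr ?divr_ge0//; last lra.
  rewrite mulrA ler_pdivrMr; last lra.
  by have := tau4; lra.
have half N : Wb x N -> Wb x (N / 2).
  move=> hN; have n := colopW_le C hb hN.
  have h' : sbd (fun i => (mu i + tau)^-1 ^+ 2) (Num.sqrt (sigma / tau) ^+ 2).
    by rewrite sqr_sqrtr ?divr_ge0//; [exact: mu_tau_sum|lra].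
  have h := sbd_cs (fun i => nrm_ge0 (c i (B x))) (nrm_ge0 _)
    (sqrtr_ge0 _) (c_bessel C (B x)) h'.
  have N0 : 0 <= N := sbd_ge0 hN.
  have s0 := sqrtr_ge0 (sigma / tau).
  apply: (sbd_leM (M := nrm (B x) * Num.sqrt (sigma / tau))).
    apply: le_trans (_ : beta * N * Num.sqrt (sigma / tau) <= _).
      by rewrite ler_wpM2r.
    by rewrite mulrAC mulrC ler_wpM2l.
  apply: sbd_le h => i; have m := mu0 i.
  have -> : c i (B x) = (mu i + tau)%:C * c i x.
    have := hx i; rewrite (cZ C) => /eqP; rewrite eq_sym subr_eq => /eqP.
    rewrite rmorphD => hh; apply/eqP; rewrite -subr_eq0; apply/eqP.
    by rewrite mulrDl hh; ring.
  rewrite nrmM nrm_real ger0_norm; last lra.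
  by rewrite mulrAC mulfV ?mul1r// gt_eqF//; lra.
have all n : Wb x (M * 2^-1 ^+ n).
  by elim: n => [|n IH]; [rewrite expr0 mulr1|rewrite exprSr mulrA; exact: half].
apply: nrm_le0; apply/ler_addgt0Pl => e e0; rewrite addr0.
have [n hn] := geom_small M e0.
exact: le_trans (Wb_nrm C (all n)) (ltW hn).
Qed.

(** It solves (A + K + tau) v = f: the operator (A + tau)^-1 K has norm at most [Kbound] / tau <=
    1/2, so a Neumann series applies. *)
Lemma AK_surj (tau : R) f : 1 <= tau -> 2 * Kbound <= tau ->
  exists v, Arel v (f - Kop v - tau%:C *: v).
Proof.
move=> t1 tK; have t0 : 0 < tau by lra.
pose a i : R[i] := ((mu i + tau)^-1)%:C.
have mt i : 0 < mu i + tau by have := mu0 i; lra.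
have aM i : nrm (a i) <= tau^-1.
  rewrite /a nrm_real ger0_norm ?invr_ge0 ?(ltW (mt i))// lef_pV2 ?posrE//.
  by have := mu0 i; lra.
have ti0 : 0 <= tau^-1 by rewrite invr_ge0 ltW.
have hD := dg_blin C ti0 aM.
have hS : blin (fun x => - dg c a (Kop x)) 2^-1.
  have h := bl_opp (bl_comp hD Kop_blin); apply: (bl_le h).
  by rewrite mulrC ler_pdivrMr//; lra.
have [J [_ _ hJ]] := neumann C hS.
exists (J (dg c a f)) => i; set v := J _.
have := congr1 (c i) (hJ (dg c a f)); rewrite -/v opprK (cD C) !(c_dg C ti0 aM).
rewrite !(cB C) (cZ C) => h.
have -> : c i f = c i (Kop v) + (mu i + tau)%:C * c i v.
  have nz : (mu i + tau)%:C != 0 :> R[i] by rewrite (inj_eq (@complexI R) _ 0) gt_eqF.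
  have ma : (mu i + tau)%:C * a i = 1 by rewrite /a fmorphV mulfV.
  by rewrite -[LHS]mul1r -ma -mulrA -h mulrDr mulrA ma mul1r addrC.
by rewrite rmorphD; ring.
Qed.

(** By [Lrel_Uop], A - B extends U (A + K) U^-1. After adding tau, the larger operator is injective
    and the smaller one is onto, so the two coincide. *)
Lemma Lrel_UopE v h : Lrel (Uop v) (Uop h) <-> Arel v (h - Kop v).
Proof.
split=> [hL|hA]; last first.
  by have [M hM] := Arel_W hA; have := Lrel_Uop hM hA; rewrite subrK.
pose tau := Num.max 1 (Num.max (4 * beta ^+ 2 * sigma) (2 * Kbound)).
have t1 : 1 <= tau by rewrite le_max lexx.
have t2 : 4 * beta ^+ 2 * sigma <= tau by rewrite !le_max lexx orbT.
have t3 : 2 * Kbound <= tau by rewrite !le_max lexx !orbT.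
(* v0 solves (A + K + tau) v0 = tau v + h, the equation that v has to satisfy; injectivity then
   gives v = v0. *)
have [v0 hv0] := AK_surj (tau%:C *: v + h) t1 t3.
have [M hM] := Arel_W hv0.
have := Lrel_Uop hM hv0 => hL0.
have hd := Lrel_lin (-1) hL0 hL.
have E : v = v0.
  apply/eqP; rewrite -subr_eq0; apply/eqP/Uop_inj; rewrite (bl0 Uop_blin).
  apply: (Lrel_inj t1 t2); move: hd.
  rewrite !scaleN1r !(addrC (- _)) -!(blB Uop_blin) -(blZ Uop_blin).
  congr (Lrel _ (Uop _)); rewrite addrAC subrK scalerBr !scaleNr.
  by rewrite opprK opprB addrCA opprD (addrC (- _) (- h)) (addrA h) subrr add0r addrC.
by move: hv0; rewrite -E addrAC (addrC _ h) addrK.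
Qed.

Lemma Kop_comm (a : nat -> R[i]) M : 0 <= M -> (forall i, nrm (a i) <= M) ->
  (forall i j, same i j -> a i = a j) -> forall v, dg c a (Kop v) = Kop (dg c a v).
Proof.
move=> M0 aM ha v; apply: (c_inj C) => i; rewrite (c_dg C M0 aM) !c_Kop /kco mulrN.
congr (- _); rewrite mulr_sumr; apply: eq_bigr => j sji.
by rewrite (c_dg C M0 aM) mulrCA (ha j i sji).
Qed.

Lemma c_Kop_single v i : (forall j, same j i -> j = i) ->
  c i (Kop v) = - c i (zc i) * c i v.
Proof.
move=> h; rewrite c_Kop /kco mulNr; congr (- _).
rewrite (big_rem i)/= ?same_refl; last by rewrite mem_index_iota/= same_D.
rewrite big_seq_cond big1 ?addr0// => j /andP[jr sji].
have ij := h j sji; rewrite {}ij in jr.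
by rewrite (mem_rem_uniq _ (iota_uniq _ _)) inE eqxx in jr.
Qed.

Lemma nrm_Kop_ee j : nrm (Kop (e_ j)) <= 2 * beta.
Proof.
rewrite Kop_ee nrmN; apply: le_trans (zcol_le j Yfix_small).
apply: (c_pars C) => // N; apply: le_trans (c_bessel C (zc j) N).
apply: ler_sum => i _; rewrite (c_sum C).
under eq_bigr do rewrite (cZ C) (c_ee C).
rewrite (sum_delta (same^~ j) _ i (fun l => c l (zc j))).
by case: ifP => // _; rewrite nrm0 expr0n sqr_ge0.
Qed.

Lemma c_zc_le i j : nrm (c i (zc j)) <= 2 * beta.
Proof. by apply: le_trans (c_le C _ _) (zcol_le j Yfix_small). Qed.

End BlockDiagonalization.

(** * The exponential of a bounded operator *)

Section TriangularSums.
Variables (R : realType) (V : normedZmodType R[i]).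

Lemma triangle_sum (W : nmodType) (f : nat -> nat -> W) N :
  \sum_(0 <= n < N) \sum_(0 <= i < n.+1) f (n - i)%N i =
  \sum_(0 <= k < N) \sum_(0 <= l < N - k) f k l.
Proof.
elim: N => [|N IH]; first by rewrite !big_geq.
rewrite big_nat_recr//= IH [RHS]big_nat_recr//= subSnn big_nat1.
have -> : \sum_(0 <= i < N.+1) f (N - i)%N i =
    \sum_(0 <= k < N) f k (N - k)%N + f N 0%N.
  rewrite big_nat_rev/= big_nat_recr//= add0n subSS subnn subn0; congr (_ + _).
  rewrite big_nat [RHS]big_nat; apply: eq_bigr => k /andP[_ kN].
  by rewrite subSS subKn// ltnW.
rewrite addrA -big_split/=; congr (_ + _).
rewrite big_nat [RHS]big_nat; apply: eq_bigr => k /andP[_ kN].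
by rewrite subSn ?(ltnW kN)// big_nat_recr.
Qed.

Lemma square_minus_triangle (W : zmodType) (f : nat -> nat -> W) N :
  \sum_(0 <= k < N) \sum_(0 <= l < N) f k l -
  \sum_(0 <= n < N) \sum_(0 <= i < n.+1) f (n - i)%N i =
  \sum_(0 <= k < N) \sum_(N - k <= l < N) f k l.
Proof.
rewrite triangle_sum -sumrB; apply: eq_bigr => k _.
by rewrite (big_cat_nat (n := N - k))//= ?leq_subr// addrAC subrr add0r.
Qed.

(** Both differences are sums over the same corner of the square, so domination may be used term by
    term. Errors of Cauchy products of vectors are thereby reduced to scalar ones. *)
Lemma square_triangle_le (f : nat -> nat -> V) (g : nat -> nat -> R) N :
  (forall k l, nrm (f k l) <= g k l) ->
  nrm (\sum_(0 <= k < N) \sum_(0 <= l < N) f k l -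
       \sum_(0 <= n < N) \sum_(0 <= i < n.+1) f (n - i)%N i) <=
  \sum_(0 <= k < N) \sum_(0 <= l < N) g k l -
       \sum_(0 <= n < N) \sum_(0 <= i < n.+1) g (n - i)%N i.
Proof.
move=> fg; rewrite !square_minus_triangle; apply: le_trans (nrm_sum _ _ _) _.
by apply: ler_sum => k _; apply: le_trans (nrm_sum _ _ _) _; apply: ler_sum.
Qed.

End TriangularSums.

Section ExpSeries.
Variable R : realType.
Implicit Types (x y a : R) (z w : R[i]).

Definition ec (F : fieldType) (x : F) n := x ^+ n / (n`!)%:R.

Lemma ecD (F : numFieldType) (x y : F) n :
  ec (x + y) n = \sum_(0 <= i < n.+1) ec x (n - i) * ec y i.
Proof.
rewrite /ec exprDn big_mkord mulr_suml; apply: eq_bigr => i _.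
have in_ : (i <= n)%N by rewrite -ltnS.
have f0 k : (k`!)%:R != 0 :> F by rewrite pnatr_eq0 -lt0n fact_gt0.
rewrite -mulr_natr; have := bin_fact in_ => /(congr1 (fun k => k%:R : F)).
rewrite !natrM => h; have b0 : 'C(n, i)%:R != 0 :> F by rewrite pnatr_eq0 -lt0n bin_gt0.
by rewrite -h; field; rewrite !f0 b0.
Qed.

Lemma ec_ge0 x n : 0 <= x -> 0 <= ec x n.
Proof. by move=> x0; rewrite divr_ge0// exprn_ge0. Qed.

Lemma series_ec x N : \sum_(0 <= n < N) ec x n = series (exp_coeff x) N.
Proof. by rewrite /series/=. Qed.

Lemma ec_cvg x : series (exp_coeff x) @ \oo --> expR x.
Proof. exact: is_cvg_series_exp_coeff. Qed.

Lemma cvgn_eps (u : nat -> R) (l : R) : u @ \oo --> l ->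
  forall e, 0 < e -> exists N, forall n, (N <= n)%N -> `|u n - l| <= e.
Proof.
move=> /cvgrPdist_le h e e0; have := h _ e0; rewrite nearE/= => -[N _ hN].
by exists N => n Nn; rewrite distrC; exact: hN.
Qed.

Lemma sbd_ec x : 0 <= x -> sbd (ec x) (expR x).
Proof.
move=> x0 N; rewrite series_ec; have h := @ec_cvg x.
rewrite -(cvg_lim _ h)//; apply: nondecreasing_cvgn_le; last exact: is_cvg_series_exp_coeff.
apply/nondecreasing_seqP => n; rewrite -!series_ec big_nat_recr//= lerDl.
exact: ec_ge0.
Qed.

(** The addition formula of the real exponential, read as a limit for the error of Cauchy products;
    it is the dominating error for complex numbers and for operators. *)
Lemma ec_square_triangle x y (e : R) : 0 < e -> exists N0, forall N, (N0 <= N)%N ->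
  \sum_(0 <= k < N) \sum_(0 <= l < N) ec x k * ec y l -
       \sum_(0 <= n < N) \sum_(0 <= i < n.+1) ec x (n - i)%N * ec y i <= e.
Proof.
move=> e0.
have h : (fun N => series (exp_coeff x) N * series (exp_coeff y) N
    - series (exp_coeff (x + y)) N) @ \oo --> (0 : R).
  rewrite -(subrr (expR (x + y))) {1}expRD; apply: cvgB; last exact: ec_cvg.
  by apply: cvgM; exact: ec_cvg.
have [N hN] := cvgn_eps h e0; exists N => n Nn.
have := hN n Nn; rewrite subr0 -!series_ec => /(le_trans (ler_norm _)).
rewrite mulr_suml; under eq_bigr do rewrite mulr_sumr.
by under [X in _ - X]eq_bigr do rewrite ecD.
Qed.

Lemma ec_tail2 x : 0 <= x -> sbd (fun n => ec x n.+2) (x ^+ 2 * expR x).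
Proof.
move=> x0; apply: sbd_le (sbdZ (sqr_ge0 x) (sbd_ec x0)) => n.
rewrite /ec !exprS -mulrA expr0 mulr1 -!mulrA.
do 2 (rewrite ler_wpM2l//).
rewrite ler_wpM2l ?exprn_ge0// lef_pV2 ?posrE ?ltr0n ?fact_gt0//.
by rewrite ler_nat; apply: leq_fact; lia.
Qed.

Lemma ec_C x n : ec x%:C n = (ec x n)%:C.
Proof. by rewrite /ec rmorphM rmorphXn fmorphV/= rmorph_nat. Qed.

Lemma nrm_ec z n : nrm (ec z n) = ec (nrm z) n.
Proof. by rewrite /ec nrmM nrmV nrmX -(rmorph_nat (real_complex R)) nrm_real normr_nat. Qed.

Lemma tends_C (u : nat -> R) (l : R) : u @ \oo --> l -> tends (fun n => (u n)%:C) l%:C.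
Proof.
move=> h e e0; have [N hN] := cvgn_eps h e0; exists N => n /hN.
by rewrite -rmorphB nrm_real.
Qed.

Lemma cexp_real a : cexp a%:C = (expR a)%:C.
Proof.
have e0 : expi 0 = 1 :> R[i] by rewrite /expi cos0 sin0.
by rewrite /cexp/= e0 mulr1.
Qed.

Lemma cexp_eval a x : cexp (a +i* x) = (expR a)%:C * expi x.
Proof. by []. Qed.

Lemma expiD x y : expi (x + y) = expi x * expi y.
Proof. by rewrite /expi cosD sinD; congr (_ +i* _); rewrite addrC. Qed.

Lemma cexpD z w : cexp (z + w) = cexp z * cexp w.
Proof.
case: z w => [a x] [b y]; have -> : a +i* x + (b +i* y) = (a + b) +i* (x + y) by [].
rewrite !cexp_eval.
by rewrite expRD rmorphM expiD mulrACA.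
Qed.

Lemma nrm_expi x : nrm (expi x) = 1.
Proof.
by rewrite /nrm normc_def/= cos2Dsin2 sqrtr1.
Qed.

Lemma nrm_cexp z : nrm (cexp z) = expR (complex.Re z).
Proof. by rewrite /cexp nrmM nrm_real nrm_expi mulr1 gtr0_norm ?expR_gt0. Qed.

Lemma cexp0 : cexp (0 : R[i]) = 1.
Proof. by rewrite -[0]/(0%:C) cexp_real expR0. Qed.

Lemma series_expi x : tends (fun N => \sum_(0 <= n < N) ec (0 +i* x) n) (expi x).
Proof.
have E n : ec (0 +i* x) n = (cos_coeff x n) +i* (sin_coeff x n).
  have im2 k : (0 +i* x) ^+ (k.*2) = ((-1) ^+ k * x ^+ k.*2)%:C :> R[i].
    rewrite -mul2n exprM; have -> : (0 +i* x) ^+ 2 = (- x ^+ 2)%:C :> R[i].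
      by rewrite expr2; apply/eqP; rewrite eq_complex/= !mul0r !mulr0 sub0r addr0 !eqxx.
    by rewrite mul2n -mul2n exprM -exprNn rmorphXn.
  have fC : ((n`!)%:R)^-1 = ((n`!%:R)^-1)%:C :> R[i] by rewrite fmorphV/= rmorph_nat.
  rewrite /ec fC cos_coeffE sin_coeffE/=; move: (_^-1) => r.
  rewrite -(odd_double_half n); set k := n./2; case: (odd n).
    rewrite add1n/= odd_double/= doubleK uphalf_double exprS im2 [x ^+ _.+1]exprS.
    by apply/eqP; rewrite eq_complex/=; apply/andP; split; apply/eqP; ring.
  rewrite add0n/= odd_double/= doubleK im2.
  by apply/eqP; rewrite eq_complex/=; apply/andP; split; apply/eqP; ring.
have hc : series (cos_coeff x) @ \oo --> cos x by rewrite unlock; exact: is_cvg_series_cos_coeff.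
have hs : series (sin_coeff x) @ \oo --> sin x by rewrite unlock; exact: is_cvg_series_sin_coeff.
move=> e e0; have e2 : 0 < e / 2 by lra.
have [N1 h1] := cvgn_eps hc e2; have [N2 h2] := cvgn_eps hs e2.
exists (maxn N1 N2) => n; rewrite geq_max => /andP[n1 n2].
apply: le_trans (nrm_ReIm _) _; have := h1 n n1; have := h2 n n2.
have -> : \sum_(0 <= n0 < n) ec (0 +i* x) n0 =
    (series (cos_coeff x) n) +i* (series (sin_coeff x) n).
  rewrite /series/=; elim: n {n1 n2} => [|n IH]; first by rewrite !big_geq.
  by rewrite !big_nat_recr//= IH E.
by move=> /=; lra.
Qed.

Lemma exp_partial_mul (z w : R[i]) (e : R) : 0 < e -> exists N0, forall N, (N0 <= N)%N ->
  nrm ((\sum_(0 <= k < N) ec z k) * (\sum_(0 <= l < N) ec w l) -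
       \sum_(0 <= n < N) ec (z + w) n) <= e.
Proof.
move=> e0; have [N0 hN] := ec_square_triangle (nrm z) (nrm w) e0.
exists N0 => N /hN; apply: le_trans.
rewrite mulr_suml; under eq_bigr do rewrite mulr_sumr.
under [X in _ - X]eq_bigr do rewrite ecD.
apply: (square_triangle_le (f := fun k l => ec z k * ec w l)
  (g := fun k l => ec (nrm z) k * ec (nrm w) l)) => k l.
by rewrite nrmM !nrm_ec.
Qed.

Lemma tendsM (u v : nat -> R[i]) (l l' : R[i]) : tends u l -> tends v l' ->
  tends (fun n => u n * v n) (l * l').
Proof.
move=> hu hv.
have E n : u n * v n = l * v n + (u n - l) * l' + (u n - l) * (v n - l') by ring.
have -> : l * l' = l * l' + 0 * l' + 0 * 0 by ring.
have h0 : tends (fun n => u n - l) 0.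
  by have := tendsB hu (tends_cst l); rewrite subrr.
apply: (tends_eq (u := fun n => l * v n + (u n - l) * l' + (u n - l) * (v n - l'))).
  by move=> n; rewrite -E.
apply: tendsD; first apply: tendsD.
- exact: tends_scal.
- by rewrite mulrC; apply: (tends_eq (u := fun n => l' * (u n - l)));
    [move=> n; rewrite mulrC|exact: tends_scal].
- move=> e e0; rewrite mul0r.
  have [N1 h1] := hu _ e0; have [N2 h2] := hv _ ltr01.
  exists (maxn N1 N2) => n; rewrite geq_max => /andP[n1 n2].
  rewrite subr0 nrmM -[e]mulr1; apply: ler_pM => //; [exact: h1|exact: h2].
Qed.

(** [cexp] is defined by the real exponential, cosine and sine. The series of the real and of the
    imaginary part of z are multiplied by means of [exp_partial_mul]. *)
Lemma tends_cexp (z : R[i]) : tends (fun N => \sum_(0 <= n < N) ec z n) (cexp z).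
Proof.
case: z => a x; rewrite cexp_eval.
have h1 : tends (fun N => \sum_(0 <= n < N) ec a%:C n) (expR a)%:C.
  apply: tends_eq (tends_C (@ec_cvg a)) => n.
  by rewrite -series_ec rmorph_sum/=; apply: eq_bigr => i _; rewrite ec_C.
have h2 := tendsM h1 (series_expi x).
have -> : a +i* x = a%:C + (0 +i* x).
  by apply/eqP; rewrite eq_complex/= addr0 add0r !eqxx.
move=> e e0; have e2 : 0 < e / 2 by lra.
have [N1 {}h1] := h2 _ e2; have [N2 {}h2] := exp_partial_mul a%:C (0 +i* x) e2.
exists (maxn N1 N2) => n; rewrite geq_max => /andP[n1 n2].
apply: le_trans (nrm_tri ((\sum_(0 <= k < n) ec a%:C k) *
  (\sum_(0 <= l < n) ec (0 +i* x) l)) _ _) _.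
by rewrite [e]splitr lerD//; [rewrite nrm_sym; exact: h2|exact: h1].
Qed.

Lemma cexp_bound2 (z : R[i]) : nrm (cexp z - 1 - z) <= nrm z ^+ 2 * expR (nrm z).
Proof.
have h := tends_shift (tends_shift (tends_cexp z)).
have := tendsB (tendsB h (tends_cst 1)) (tends_cst z).
apply: tends_nrm_le => N; rewrite big_nat_recl// big_nat_recl//=.
have -> : ec z 0 = 1 by rewrite /ec expr0 fact0 divr1.
have -> : ec z 1 = z by rewrite /ec expr1 divr1.
have -> : 1 + (z + \sum_(0 <= i < N) ec z i.+2) - 1 - z =
  \sum_(0 <= i < N) ec z i.+2 by ring.
apply: le_trans (nrm_sum _ _ _) _; apply: le_trans (ec_tail2 (nrm_ge0 z) N).
by apply: ler_sum => n _; rewrite nrm_ec.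
Qed.

End ExpSeries.

(** * Exponential series with an operator argument *)

Section OperatorExponential.
Variables (R : realType) (V : normedModType R[i]) (c : nat -> V -> R[i]).
Hypothesis C : l2coord c.
Variables (L : V -> V) (kb : R).
Hypothesis hL : blin L kb.
Implicit Types (z w : R[i]) (x : V).

Let kb0 : 0 <= kb. Proof. exact: bl_ge0 hL. Qed.

Lemma iter_blin n : blin (iter n L) (kb ^+ n).
Proof.
elim: n => [|n IH]; first by rewrite expr0; exact: bl_id.
by rewrite exprS; have h := bl_comp hL IH; exact: h.
Qed.

Definition fterm z x n := ec z n *: iter n L x.
Definition fpart z N x := \sum_(0 <= n < N) fterm z x n.
Definition fexp z x := vser (fterm z x).

Lemma fterm_le z x n : nrm (fterm z x n) <= ec (nrm z * kb) n * nrm x.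
Proof.
rewrite nrmZ nrm_ec /ec exprMn.
rewrite [leRHS](_ : _ = nrm z ^+ n / n`!%:R * (kb ^+ n * nrm x)); last by ring.
rewrite ler_wpM2l ?divr_ge0 ?exprn_ge0//.
exact: bl_bd (iter_blin n) x.
Qed.

Let a0 z : 0 <= nrm z * kb. Proof. by rewrite mulr_ge0. Qed.

Lemma fterm_sbd z x : sbd (fun n => ec (nrm z * kb) n * nrm x) (expR (nrm z * kb) * nrm x).
Proof.
rewrite [X in sbd _ X]mulrC; apply: sbd_le (sbdZ (nrm_ge0 x) (sbd_ec (a0 z))) => n.
by rewrite mulrC.
Qed.

Lemma fexp_tends z x : tends (fun N => fpart z N x) (fexp z x).
Proof. exact: (vserP C (fterm_le z x) (fterm_sbd z x)). Qed.

Lemma fpart_blin z N : blin (fpart z N) (expR (nrm z * kb)).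
Proof.
split=> [k x y||x]; last 2 first.
- exact: expR_ge0.
- apply: le_trans (nrm_sum _ _ _) _; apply: le_trans (fterm_sbd z x N).
  by apply: ler_sum => n _; exact: fterm_le.
rewrite /fpart scaler_sumr -big_split/=; apply: eq_bigr => n _.
by rewrite /fterm (bl_lin (iter_blin n)) scalerDr !scalerA mulrC.
Qed.

Lemma fexp_blin z : blin (fexp z) (expR (nrm z * kb)).
Proof.
split=> [k x y||x]; last 2 first.
- exact: expR_ge0.
- by apply: tends_nrm_le (fexp_tends z x) => N; exact: bl_bd (fpart_blin z N) x.
apply: tends_uniq (fexp_tends z _) _.
have := tendsD (bl_tends (bl_scal V k) (fexp_tends z x)) (fexp_tends z y).
by apply: tends_eq => N; rewrite (bl_lin (fpart_blin z N)).
Qed.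

(** Partial sums are compared in three steps: the limit of the inner exponential, that of the outer
    one, and the error of the Cauchy product, which is dominated by its scalar analogue at |z| kb
    and |w| kb. *)
Lemma fexpD z w x : fexp (z + w) x = fexp z (fexp w x).
Proof.
apply: tends_uniq (fexp_tends _ _) _ => e e0.
have e3 : 0 < e / 3 by lra.
pose E := expR (nrm z * kb); have E0 : 0 < E := expR_gt0 _.
have X1 : 0 < nrm x + 1 by have := nrm_ge0 x; lra.
have [N1 h1] := fexp_tends z (fexp w x) e3.
have [N2 h2] := fexp_tends w x (divr_gt0 e3 E0).
have [N3 h3] := ec_square_triangle (nrm z * kb) (nrm w * kb) (divr_gt0 e3 X1).
exists (maxn N1 (maxn N2 N3)) => N; rewrite !geq_max => /and3P[n1 n2 n3].
have k1 := h1 N n1.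
have k2 : nrm (fpart z N (fpart w N x) - fpart z N (fexp w x)) <= e / 3.
  rewrite -(blB (fpart_blin z N)); apply: le_trans (bl_bd (fpart_blin z N) _) _.
  by rewrite mulrC -ler_pdivlMr//; exact: h2.
have k3 : nrm (fpart z N (fpart w N x) - fpart (z + w) N x) <= e / 3.
  pose f k l := (ec z k * ec w l) *: iter (k + l) L x.
  have -> : fpart z N (fpart w N x) = \sum_(0 <= k < N) \sum_(0 <= l < N) f k l.
    apply: eq_bigr => k _; rewrite /fterm (bl_sum (iter_blin k)) scaler_sumr.
    by apply: eq_bigr => l _; rewrite (blZ (iter_blin k)) scalerA -iterD.
  have -> : fpart (z + w) N x = \sum_(0 <= n < N) \sum_(0 <= i < n.+1) f (n - i)%N i.
    apply: eq_bigr => n _; rewrite /fterm ecD scaler_suml big_nat [RHS]big_nat.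
    by apply: eq_bigr => i /andP[_ ni]; rewrite /f subnK.
  apply: le_trans (square_triangle_le (g := fun k l =>
    ec (nrm z * kb) k * ec (nrm w * kb) l * nrm x) _ _) _ => [k l|].
    rewrite nrmZ nrmM !nrm_ec /ec !exprMn.
    have := bl_bd (iter_blin (k + l)) x; rewrite exprD => h.
    rewrite [leRHS](_ : _ = (nrm z ^+ k / k`!%:R * (nrm w ^+ l / l`!%:R)) *
      (kb ^+ k * kb ^+ l * nrm x)); last by ring.
    by rewrite ler_wpM2l// !mulr_ge0 ?exprn_ge0 ?invr_ge0.
  under eq_bigr do rewrite -mulr_suml.
  under [X in _ - X]eq_bigr do rewrite -mulr_suml.
  rewrite -!mulr_suml -mulrBl.
  apply: le_trans (ler_wpM2r (nrm_ge0 x) (h3 N n3)) _.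
  by rewrite mulrAC ler_pdivrMr// ler_wpM2l ?(ltW e3)//; lra.
have t1 := nrm_tri (fpart z N (fpart w N x)) (fpart (z + w) N x) (fexp z (fexp w x)).
have t2 := nrm_tri (fpart z N (fexp w x)) (fpart z N (fpart w N x)) (fexp z (fexp w x)).
rewrite nrm_sym in k3.
lra.
Qed.

Lemma fexp_bound2 z x : nrm (fexp z x - x - z *: L x) <=
  (nrm z * kb) ^+ 2 * expR (nrm z * kb) * nrm x.
Proof.
have h := tends_shift (tends_shift (fexp_tends z x)).
have := tendsB (tendsB h (tends_cst x)) (tends_cst (z *: L x)).
apply: tends_nrm_le => N; rewrite /fpart big_nat_recl// big_nat_recl//=.
have -> : fterm z x 0 = x by rewrite /fterm /ec expr0 fact0 divr1 scale1r.
have -> : fterm z x 1 = z *: L x by rewrite /fterm /ec expr1 divr1.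
rewrite [x + _]addrC addrK [z *: _ + _]addrC addrK.
apply: le_trans (nrm_sum _ _ _) _.
rewrite mulrC; apply: le_trans (sbdZ (nrm_ge0 x) (ec_tail2 (a0 z)) N).
by apply: ler_sum => n _; rewrite mulrC; exact: fterm_le.
Qed.

Lemma fexp0 x : fexp 0 x = x.
Proof.
have := fexp_bound2 0 x; rewrite scale0r subr0 nrm0 mul0r expr0n/= !mul0r.
by move=> /nrm_le0/eqP; rewrite subr_eq0 => /eqP.
Qed.

Lemma fexp_comm S M z x : blin S M -> (forall x, S (L x) = L (S x)) ->
  S (fexp z x) = fexp z (S x).
Proof.
move=> hS SL; have it n y : S (iter n L y) = iter n L (S y).
  by elim: n => //= n IH; rewrite SL IH.
apply: tends_uniq (bl_tends hS (fexp_tends z x)) _.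
apply: tends_eq (fexp_tends z (S x)) => N.
by rewrite (bl_sum hS); apply: eq_bigr => n _; rewrite (blZ hS) it.
Qed.

(** If coordinate i is an eigenfunctional of L, the operator series becomes the scalar one there.
    This makes the semigroup explicit on blocks of size one. *)
Lemma c_fexp i (kappa : R[i]) z x : (forall y, c i (L y) = kappa * c i y) ->
  c i (fexp z x) = cexp (z * kappa) * c i x.
Proof.
move=> h; have it n y : c i (iter n L y) = kappa ^+ n * c i y.
  by elim: n => [|n IH]; rewrite ?expr0 ?mul1r//= h IH exprS mulrA.
apply: tends_uniq (c_tends C i (fexp_tends z x)) _.
rewrite mulrC; have := tends_scal (c i x) (tends_cexp (z * kappa)).
apply: tends_eq => N; rewrite (c_sum C) mulr_sumr; apply: eq_bigr => n _.
by rewrite (cZ C) it /ec exprMn; ring.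
Qed.

End OperatorExponential.

(** * The semigroup of a diagonal operator plus a commuting bounded one *)

Lemma cancel_summand (Z : zmodType) (a b y n : Z) : (a + b - y) - (a - n) = b - (y - n).
Proof.
rewrite [a + b]addrC !opprB [n - a]addrC addrA (addrAC _ _ (- a)) addrK.
by rewrite [n - y]addrC addrA.
Qed.

Section DiagonalPlusBounded.
Variables (R : realType) (V : normedModType R[i]) (c : nat -> V -> R[i]).
Hypothesis C : l2coord c.
Implicit Types (x y v : V) (z w lam : R[i]).

(** Dominated convergence for diagonal operators: the tail of x is small uniformly by the bound M,
    and finitely many coordinates remain. The parameter is a complex number with nonnegative real
    part in [Ez_cont], a positive time in [gen_limP]. *)
Lemma dg_small (P : Type) (good : P -> Prop) (sz : P -> R) (a : P -> nat -> R[i]) (M : R) :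
  0 <= M -> (forall p i, good p -> nrm (a p i) <= M) ->
  (forall i (e : R), 0 < e -> exists2 eta : R, 0 < eta &
     forall p, good p -> sz p <= eta -> nrm (a p i) <= e) ->
  forall x (e : R), 0 < e -> exists2 eta : R, 0 < eta &
    forall p, good p -> sz p <= eta -> nrm (dg c (a p) x) <= e.
Proof.
move=> M0 aM ha x e e0.
have e2 : 0 < e / (2 * (M + 1)) by rewrite divr_gt0//; lra.
have [N hN] := trunc_tends C x e2.
have e3 : 0 < e / (2 * (nrm x + 1)) by rewrite divr_gt0//; have := nrm_ge0 x; lra.
have [eta eta0 heta] : exists2 eta : R, 0 < eta & forall p, good p -> sz p <= eta ->
    forall i, (i < N)%N -> nrm (a p i) <= e / (2 * (nrm x + 1)).
  elim: (N) => [|n [eta1 h1 IH]]; first by exists 1.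
  have [eta2 h2 h] := ha n _ e3.
  exists (Num.min eta1 eta2) => [|p gp]; first by rewrite lt_min h1 h2.
  rewrite le_min => /andP[p1 p2] i; rewrite ltnS leq_eqVlt => /predU1P[->|]; last exact: IH.
  exact: h.
exists eta => // p gp sp; have aMp i : nrm (a p i) <= M by exact: aM.
have hD := dg_blin C M0 aMp.
rewrite -(subrK (trunc c N x) x) (blD hD) [e]splitr.
apply: le_trans (nrmD _ _) (lerD _ _).
  apply: le_trans (bl_bd hD _) _; rewrite nrm_sym.
  apply: le_trans (ler_wpM2l M0 (hN _ (leqnn N))) _.
  by rewrite mulrA ler_pdivrMr; [nra|lra].
apply: (c_pars C) => [|n]; first by rewrite divr_ge0// ltW.
have x1 : 0 < nrm x + 1 by have := nrm_ge0 x; lra.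
apply: (@le_trans _ _ ((e / (2 * (nrm x + 1))) ^+ 2 * nrm x ^+ 2)).
  apply: le_trans (sbdZ (sqr_ge0 _) (c_bessel C x) n); apply: ler_sum => i _.
  rewrite (c_dg C M0 aMp) (c_trunc C); case: ifP => iN; last first.
    by rewrite mulr0 nrm0 expr0n mulr_ge0 ?sqr_ge0.
  rewrite nrmM exprMn ler_wpM2r ?sqr_ge0// ler_pXn2r// ?nnegrE ?(ltW e3)//.
  exact: heta.
rewrite -exprMn ler_pXn2r// ?nnegrE ?mulr_ge0 ?(ltW e3) ?divr_ge0 ?(ltW e0)//.
  by rewrite mulrAC ler_pdivrMr; [nra|lra].
by rewrite invr_ge0; lra.
Qed.

(** The equation y - K x = d x is x + d^-1 K x = d^-1 y. Only d^-1 K has to be small, not 1 / rho: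
    in [simple_resolvent] rho may be arbitrarily small. *)
Lemma dg_resolvent (d : nat -> R[i]) (rho : R) K kb : blin K kb -> 0 < rho ->
  (forall i, rho <= nrm (d i)) ->
  blin (fun x => dg c (fun i => (d i)^-1) (K x)) 2^-1 ->
  exists S, blin S (2 / rho) /\
    forall x y, S y = x <-> forall i, c i (y - K x) = d i * c i x.
Proof.
move=> hK rho0 hd hRK.
have ri0 : 0 <= rho^-1 by rewrite invr_ge0 ltW.
have d0 i : d i != 0.
  by rewrite -nrm_eq0 gt_eqF// (lt_le_trans rho0).
have ai i : nrm (d i)^-1 <= rho^-1.
  by rewrite nrmV lef_pV2 ?posrE// (lt_le_trans rho0).
have hR := dg_blin C ri0 ai; set Rl := dg c _ in hRK hR.
have [J [hJ J1 J2]] := neumann C (bl_opp hRK).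
exists (fun y => J (Rl y)); split; first by have h := bl_comp hJ hR; exact: h.
have key x y : (forall i, c i (y - K x) = d i * c i x) <-> x + Rl (K x) = Rl y.
  split=> [h|h].
    apply: (c_inj C) => i; rewrite (cD C) !(c_dg C ri0 ai).
    have := h i; rewrite (cB C) => /eqP; rewrite subr_eq => /eqP ->.
    by rewrite mulrDr mulrA mulVf// mul1r.
  move=> i; have := congr1 (c i) h; rewrite (cD C) !(c_dg C ri0 ai) (cB C) => h'.
  have -> : c i x = (d i)^-1 * (c i y - c i (K x)) by rewrite mulrBr -h' addrK.
  by rewrite mulrA mulfV// mul1r.
move=> x y; rewrite key; split=> [<-|h].
  by have := J2 (Rl y); rewrite opprK.
by rewrite -h; have := J1 x; rewrite opprK.
Qed.

Variables (nu : nat -> R) (K : V -> V) (kb : R).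
Hypothesis nu0 : forall i, 0 <= nu i.
Hypothesis hK : blin K kb.
Hypothesis hcomm : forall (f : R -> R[i]) (M : R), 0 <= M ->
  (forall i, nrm (f (nu i)) <= M) ->
  forall x, dg c (fun i => f (nu i)) (K x) = K (dg c (fun i => f (nu i)) x).

Let kb0 : 0 <= kb. Proof. exact: bl_ge0 hK. Qed.
Let NK x := - K x.
Let hNK : blin NK kb. Proof. exact: bl_opp hK. Qed.

(* The graph of diag nu + K, and exp (- z diag nu) exp (- z K). *)
Definition Grel v h := forall i, c i (h - K v) = (nu i)%:C * c i v.

Definition Ez z := dg c (fun i => cexp (- z * (nu i)%:C)).
Definition Tz z x := Ez z (fexp (fun x => - K x) z x).

Local Notation Re := complex.Re.

Lemma Re_mulC z (r : R) : Re (z * r%:C) = Re z * r.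
Proof. by case: z => a b /=; rewrite mulr0 subr0. Qed.
Lemma Re_N z : Re (- z) = - Re z. Proof. by case: z. Qed.
Lemma Re_D z w : Re (z + w) = Re z + Re w. Proof. by case: z; case: w. Qed.

Lemma Ez_coef_le z i : 0 <= Re z -> nrm (cexp (- z * (nu i)%:C)) <= 1.
Proof.
move=> z0; rewrite nrm_cexp Re_mulC Re_N -expR0 ler_expR mulNr oppr_le0.
by rewrite mulr_ge0.
Qed.

Lemma Ez_blin z : 0 <= Re z -> blin (Ez z) 1.
Proof. by move=> z0; apply: dg_blin => // i; exact: Ez_coef_le. Qed.

Lemma c_Ez z x i : 0 <= Re z -> c i (Ez z x) = cexp (- z * (nu i)%:C) * c i x.
Proof. by move=> z0; apply: (c_dg C (M := 1)) => // j; exact: Ez_coef_le. Qed.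

Lemma Ez_comm z x : 0 <= Re z -> Ez z (K x) = K (Ez z x).
Proof.
move=> z0; apply: (hcomm (f := fun t => cexp (- z * t%:C)) (M := 1)) => // i.
exact: Ez_coef_le.
Qed.

Lemma EzD z w x : 0 <= Re z -> 0 <= Re w -> Ez (z + w) x = Ez z (Ez w x).
Proof.
move=> z0 w0; apply: (c_inj C) => i; rewrite !c_Ez// ?Re_D ?addr_ge0//.
by rewrite opprD mulrDl cexpD mulrA.
Qed.

Lemma Ez_fexp z w x : 0 <= Re z ->
  Ez z (fexp NK w x) = fexp NK w (Ez z x).
Proof.
move=> z0; apply: (fexp_comm C hNK w x (Ez_blin z0)) => y.
by rewrite /NK (blN (Ez_blin z0)) Ez_comm.
Qed.

Lemma Tz_blin z : 0 <= Re z -> blin (Tz z) (expR (nrm z * kb)).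
Proof.
move=> z0; have h := bl_comp (Ez_blin z0) (fexp_blin C hNK z).
by rewrite mul1r in h.
Qed.

Lemma TzD z w x : 0 <= Re z -> 0 <= Re w -> Tz (z + w) x = Tz z (Tz w x).
Proof.
by move=> z0 w0; rewrite /Tz EzD// (fexpD C hNK) -[in RHS]Ez_fexp.
Qed.

Lemma Tz0 x : Tz 0 x = x.
Proof.
rewrite /Tz (fexp0 C hNK); apply: (c_inj C) => i.
by rewrite c_Ez// oppr0 mul0r cexp0 mul1r.
Qed.

Lemma cexp_sub1 z : nrm z <= 1 -> nrm (cexp z - 1) <= nrm z * (1 + expR 1).
Proof.
move=> z1; have := cexp_bound2 z; have := nrmD (cexp z - 1 - z) z; rewrite subrK.
have : expR (nrm z) <= expR 1 :> R by rewrite ler_expR.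
have := expR_gt0 (nrm z); have := nrm_ge0 z.
set p := nrm z in z1 *; set E := expR p; set F := expR 1 => p0 E0 EF h1 h2.
apply: le_trans h1 _; rewrite mulrDr mulr1 addrC lerD2l; apply: le_trans h2 _.
by rewrite expr2 -mulrA ler_wpM2l//; nra.
Qed.

Lemma Ez_cont x (e : R) : 0 < e -> exists2 eta : R, 0 < eta &
  forall z, 0 <= Re z -> nrm z <= eta -> nrm (Ez z x - x) <= e.
Proof.
pose a z i := cexp (- z * (nu i)%:C) - 1.
have a2 z i : 0 <= Re z -> nrm (a z i) <= 2.
  by move=> z0; apply: le_trans (nrmB _ _) _; rewrite nrm1; have := Ez_coef_le i z0; lra.
have := @dg_small _ (fun z => 0 <= Re z) (@nrm _ _) a 2 (ler0n _ _) a2.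
move=> H e0.
have [|eta eta0 h] := H _ x e e0.
  move=> i d d0; have n1 : 0 < nu i + 1 by have := nu0 i; lra.
  have F0 : 0 < 1 + expR 1 :> R by have := expR_gt0 (1 : R); lra.
  exists (Num.min (nu i + 1)^-1 (d / ((nu i + 1) * (1 + expR 1)))).
    by rewrite lt_min invr_gt0 n1/= divr_gt0// mulr_gt0.
  move=> z z0; rewrite le_min => /andP[z1 z2].
  have zn : nrm (- z * (nu i)%:C) <= nrm z * (nu i + 1).
    rewrite nrmM nrmN nrm_real ger0_norm// ler_wpM2l//; lra.
  have zn1 : nrm z * (nu i + 1) <= 1 by rewrite -ler_pdivlMr// div1r.
  apply: le_trans (cexp_sub1 (le_trans zn zn1)) _.
  apply: le_trans (ler_wpM2r (ltW F0) zn) _.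
  by rewrite -mulrA -ler_pdivlMr// mulr_gt0.
exists eta => // z z0 ze; apply: le_trans (h z z0 ze).
suff -> : Ez z x - x = dg c (a z) x by [].
apply: (c_inj C) => i; rewrite (cB C) c_Ez// (c_dg C (M := 2))//.
  by rewrite /a mulrBl mul1r.
by move=> j; exact: a2.
Qed.

Lemma fexp_sub1 z x : nrm z * kb <= 1 ->
  nrm (fexp NK z x - x) <= nrm z * (kb * (1 + expR 1) * nrm x).
Proof.
move=> z1; have h1 := fexp_bound2 C hNK z x.
have := nrmD (fexp NK z x - x - z *: NK x) (z *: NK x); rewrite subrK => h2.
apply: le_trans h2 _.
have h3 : nrm (z *: NK x) <= nrm z * kb * nrm x.
  by rewrite nrmZ -mulrA ler_wpM2l//; exact: bl_bd hNK x.
apply: le_trans (lerD h1 h3) _.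
have E : expR (nrm z * kb) <= expR 1 by rewrite ler_expR.
have E0 := expR_gt0 (nrm z * kb).
set p := nrm z * kb in z1 E E0 *.
have p0 : 0 <= p by rewrite mulr_ge0.
rewrite !mulrA -/p -mulrDl ler_wpM2r// mulrDr mulr1 [leRHS]addrC lerD2r.
by rewrite expr2 -mulrA ler_wpM2l//; nra.
Qed.

Lemma fexp_cont x (e : R) : 0 < e -> exists2 eta : R, 0 < eta &
  forall z, nrm z <= eta -> nrm (fexp NK z x - x) <= e.
Proof.
move=> e0; set Q := kb * (1 + expR 1) * nrm x.
have F0 : 0 < 1 + expR 1 :> R by have := expR_gt0 (1 : R); lra.
have Q0 : 0 <= Q by rewrite !mulr_ge0// ltW.
have k1 : 0 < kb + 1 by rewrite ltr_wpDl.
have Q1 : 0 < Q + 1 by lra.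
exists (Num.min (kb + 1)^-1 (e / (Q + 1))).
  by rewrite lt_min invr_gt0 k1/= divr_gt0.
move=> z; rewrite le_min => /andP[z1 z2].
have zk : nrm z * kb <= 1.
  apply: le_trans (_ : nrm z * (kb + 1) <= 1); first by rewrite ler_wpM2l//; lra.
  by rewrite -ler_pdivlMr// div1r.
apply: le_trans (fexp_sub1 x zk) _; rewrite -/Q.
apply: le_trans (_ : nrm z * (Q + 1) <= e); first by rewrite ler_wpM2l//; lra.
by rewrite -ler_pdivlMr.
Qed.

Lemma Tz_cont x (e : R) : 0 < e -> exists2 eta : R, 0 < eta &
  forall z, 0 <= Re z -> nrm z <= eta -> nrm (Tz z x - x) <= e.
Proof.
move=> e0; have e2 : 0 < e / 2 by lra.
have [eta1 p1 h1] := Ez_cont x e2; have [eta2 p2 h2] := fexp_cont x e2.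
exists (Num.min eta1 eta2) => [|z z0]; first by rewrite lt_min p1 p2.
rewrite le_min => /andP[z1 z2].
apply: le_trans (nrm_tri (Ez z x) _ _) _; rewrite [e]splitr lerD//; last exact: h1.
rewrite /Tz -(blB (Ez_blin z0)); apply: le_trans (bl_bd (Ez_blin z0) _) _.
by rewrite mul1r; exact: h2.
Qed.

Lemma expR_sqr (s : R) : 0 <= s -> s ^+ 2 * expR (- s) <= 2.
Proof.
move=> s0; have := sbd_ec s0 3; rewrite !big_nat_recr//= big_geq// add0r.
rewrite /ec !factS fact0 !muln1 expr0 expr1 !divr1 => h.
have {}h : 1 + s + s ^+ 2 / 2 <= expR s := h.
rewrite expRN ler_pdivrMr ?expR_gt0//.
by lra.
Qed.

Lemma expR_lin (s : R) : 0 <= s -> s * expR (- s) <= 1.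
Proof.
move=> s0; rewrite expRN ler_pdivrMr ?expR_gt0// mul1r.
by have := expR_ge1Dx s; lra.
Qed.

Lemma AE_coef_le z i : 0 < Re z ->
  nrm (- (nu i)%:C * cexp (- z * (nu i)%:C)) <= (Re z)^-1.
Proof.
move=> z0; rewrite nrmM nrmN nrm_real nrm_cexp Re_mulC Re_N ger0_norm//.
rewrite -[leRHS]mul1r ler_pdivlMr// mulrAC [nu i * _]mulrC mulNr.
by apply: expR_lin; rewrite mulr_ge0// ltW.
Qed.

(** After extracting exp(-z n), the second order remainder costs |h|^2 n^2 exp(|h| n). Since |h| <=
    r / 2, a factor exp(-r n / 2) is left, and n^2 exp(-r n / 2) <= 8 / r^2 by [expR_sqr]. *)
Lemma E2_coef_le z h i : 0 < Re z -> nrm h <= Re z / 2 ->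
  nrm (cexp (- (z + h) * (nu i)%:C) - cexp (- z * (nu i)%:C)
       - h * (- (nu i)%:C * cexp (- z * (nu i)%:C))) <= nrm h ^+ 2 * (8 / Re z ^+ 2).
Proof.
move=> z0 hz; set r := Re z in z0 hz *; set n := nu i.
have -> : cexp (- (z + h) * n%:C) - cexp (- z * n%:C) - h * (- n%:C * cexp (- z * n%:C))
  = cexp (- z * n%:C) * (cexp (- h * n%:C) - 1 - (- h * n%:C)).
  by rewrite opprD mulrDl cexpD; ring.
rewrite nrmM nrm_cexp Re_mulC Re_N -/r.
apply: le_trans (ler_wpM2l (expR_ge0 _) (cexp_bound2 _)) _.
rewrite nrmM nrmN nrm_real ger0_norm; last exact: nu0.
have n0 : 0 <= n := nu0 i.
rewrite exprMn -mulrA mulrCA ler_wpM2l ?sqr_ge0// mulrCA -expRD.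
have le1 : - r * n + nrm h * n <= - (r / 2 * n).
  by rewrite -mulrDl -mulNr ler_wpM2r//; lra.
apply: (@le_trans _ _ (n ^+ 2 * expR (- (r / 2 * n)))).
  by rewrite ler_wpM2l ?sqr_ge0// ler_expR.
have s0 : 0 <= r / 2 * n by rewrite !mulr_ge0// ltW.
rewrite ler_pdivlMr ?exprn_gt0//; have := expR_sqr s0.
by rewrite exprMn => h2; nra.
Qed.

(** For Re z > 0 the factor exp(-z nu) absorbs powers of nu, so the diagonal part has a derivative
    in operator norm; the exponential of K is entire. *)
Lemma Tz_diff z : 0 < Re z -> exists2 D, (exists M, blin D M) &
  forall e : R, 0 < e -> exists2 eta : R, 0 < eta & forall h : R[i], h != 0 ->
    nrm h < eta -> forall x, nrm (h^-1 *: (Tz (z + h) x - Tz z x) - D x) <= e * nrm x.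
Proof.
move=> z0; have z0' := ltW z0; set r := Re z in z0 z0'.
have ri0 : 0 <= r^-1 by rewrite invr_ge0.
have hAE : forall i, nrm (- (nu i)%:C * cexp (- z * (nu i)%:C)) <= r^-1.
  by move=> i; exact: AE_coef_le.
pose AE := dg c (fun i => - (nu i)%:C * cexp (- z * (nu i)%:C)).
have AEb : blin AE r^-1 := dg_blin C ri0 hAE.
have hF := fexp_blin C hNK z.
exists (fun x => Ez z (fexp NK z (NK x)) + AE (fexp NK z x)).
  exists (1 * (expR (nrm z * kb) * kb) + r^-1 * expR (nrm z * kb)).
  have h1 := bl_comp (Ez_blin z0') (bl_comp hF hNK).
  by have h2 := bl_add h1 (bl_comp AEb hF); exact: h2.
move=> e e0.
pose C2 := 8 / r ^+ 2; have C20 : 0 <= C2 by rewrite divr_ge0// sqr_ge0.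
pose Q := (kb ^+ 2 * expR kb + C2 + kb * (r^-1 + C2)) * expR (nrm z * kb).
have q0 : 0 <= kb ^+ 2 * expR kb + C2 + kb * (r^-1 + C2).
  apply: addr_ge0; last by rewrite mulr_ge0 ?addr_ge0.
  by apply: addr_ge0 => //; rewrite mulr_ge0 ?sqr_ge0 ?expR_ge0.
have Q0 : 0 <= Q by rewrite mulr_ge0 ?expR_ge0.
have Q1 : 0 < Q + 1 by lra.
exists (Num.min (Num.min 1 (r / 2)) (e / (Q + 1))).
  by rewrite !lt_min ltr01 !divr_gt0.
move=> h h0; rewrite !lt_min => /andP[/andP[hl1 hl2] hl3] x.
have hn0 : 0 < nrm h by rewrite lt_neqAle nrm_ge0 eq_sym nrm_eq0 h0.
set y := fexp NK z x.
have ReD : 0 <= Re (z + h).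
  rewrite Re_D; have := Re_nrm h; have := ler_norm (- Re h); rewrite normrN.
  by rewrite -/r; lra.
have E2 i : nrm (cexp (- (z + h) * (nu i)%:C) - cexp (- z * (nu i)%:C)
       - h * (- (nu i)%:C * cexp (- z * (nu i)%:C))) <= nrm h ^+ 2 * C2.
  by apply: E2_coef_le => //; exact: ltW.
have hC20 : 0 <= nrm h ^+ 2 * C2 by rewrite mulr_ge0// sqr_ge0.
have E2v u : nrm (Ez (z + h) u - Ez z u - h *: AE u) <= nrm h ^+ 2 * C2 * nrm u.
  have := bl_bd (dg_blin C hC20 E2) u; congr (nrm _ <= _).
  apply: (c_inj C) => i; rewrite (c_dg C hC20 E2) !(cB C) !c_Ez// (cZ C) (c_dg C ri0 hAE).
  by ring.
have E1v u : nrm (Ez (z + h) u - Ez z u) <= nrm h * (r^-1 + C2) * nrm u.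
  have := nrmD (Ez (z + h) u - Ez z u - h *: AE u) (h *: AE u); rewrite subrK.
  move=> /le_trans; apply; apply: le_trans (lerD (E2v u) (lexx _)) _.
  rewrite nrmZ; apply: le_trans (lerD (lexx _) (ler_wpM2l (nrm_ge0 h) (bl_bd AEb u))) _.
  rewrite (mulrA (nrm h) r^-1) -mulrDl ler_wpM2r// mulrDr [leRHS]addrC lerD2r expr2 -mulrA ler_wpM2l//.
  by rewrite -[leRHS]mul1r ler_wpM2r// ltW.
pose G := fexp NK h y - y - h *: NK y.
have hG : nrm G <= nrm h ^+ 2 * (kb ^+ 2 * expR kb) * nrm y.
  apply: le_trans (fexp_bound2 C hNK h y) _; rewrite ler_wpM2r// exprMn -mulrA.
  rewrite ler_wpM2l ?sqr_ge0// ler_wpM2l ?sqr_ge0// ler_expR.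
  by rewrite -[leRHS]mul1r ler_wpM2r// ltW.
have yx : nrm y <= expR (nrm z * kb) * nrm x := bl_bd hF x.
have Fy : fexp NK z (NK x) = NK y.
  by rewrite -(fexp_comm C hNK z x hNK).
(* Product rule with exact remainders: that of exp(-h K), that of the diagonal factor, and the
   increment of the diagonal factor on the first order term. Each is O(|h|^2). *)
have E : Tz (z + h) x - Tz z x - h *: (Ez z (fexp NK z (NK x)) + AE y) =
   Ez (z + h) G + (Ez (z + h) y - Ez z y - h *: AE y)
   + h *: (Ez (z + h) (NK y) - Ez z (NK y)).
  have hE := Ez_blin ReD.
  rewrite /Tz -/NK [z + h]addrC (fexpD C hNK) -/y Fy [h + z]addrC /G.
  rewrite !(blB hE) (blZ hE).
  by apply: (c_inj C) => i; rewrite !((cD C), (cN C), (cZ C)); ring.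
have nE : nrm (Tz (z + h) x - Tz z x - h *: (Ez z (fexp NK z (NK x)) + AE y)) <=
    nrm h ^+ 2 * (Q * nrm x).
  rewrite E; apply: le_trans (nrmD _ _) _.
  apply: le_trans (lerD (nrmD _ _) (lexx _)) _.
  have b1 : nrm (Ez (z + h) G) <= nrm h ^+ 2 * (kb ^+ 2 * expR kb) * nrm y.
    by apply: le_trans (bl_bd (Ez_blin ReD) G) _; rewrite mul1r.
  have b3 : nrm (h *: (Ez (z + h) (NK y) - Ez z (NK y))) <=
      nrm h ^+ 2 * (kb * (r^-1 + C2)) * nrm y.
    rewrite nrmZ; apply: le_trans (ler_wpM2l (nrm_ge0 h) (E1v (NK y))) _.
    apply: (@le_trans _ _ (nrm h * (nrm h * (r^-1 + C2) * (kb * nrm y)))).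
      rewrite ler_wpM2l// ler_wpM2l ?mulr_ge0 ?addr_ge0//; exact: bl_bd hNK y.
    by rewrite le_eqVlt; apply/orP; left; apply/eqP; ring.
  apply: le_trans (lerD (lerD b1 (E2v y)) b3) _.
  apply: (@le_trans _ _ (nrm h ^+ 2 * (kb ^+ 2 * expR kb + C2 + kb * (r^-1 + C2)) * nrm y)).
    by rewrite le_eqVlt; apply/orP; left; apply/eqP; ring.
  by rewrite -mulrA ler_wpM2l ?sqr_ge0// /Q -mulrA ler_wpM2l.
have -> : h^-1 *: (Tz (z + h) x - Tz z x) - (Ez z (fexp NK z (NK x)) + AE y) =
   h^-1 *: (Tz (z + h) x - Tz z x - h *: (Ez z (fexp NK z (NK x)) + AE y)).
  by rewrite [in RHS]scalerBr scalerA mulVf// scale1r.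
rewrite nrmZ nrmV -ler_pdivlMl ?invr_gt0// invrK; apply: le_trans nE _.
rewrite expr2 -mulrA ler_wpM2l// mulrA ler_wpM2r//.
apply: (@le_trans _ _ (nrm h * (Q + 1))); first by rewrite ler_wpM2l//; lra.
by rewrite -ler_pdivlMr// ltW.
Qed.

Definition gen_lim (T : R -> V -> V) x y := forall e : R, 0 < e ->
  exists2 eta : R, 0 < eta & forall t : R, 0 < t -> t <= eta ->
    nrm (t^-1%:C *: (T t x - x) - y) <= e.

Let ReC (t : R) : Re t%:C = t. Proof. by []. Qed.

Lemma nrm_tC (t : R) : 0 < t -> nrm t%:C = t.
Proof. by move=> t0; rewrite nrm_real gtr0_norm. Qed.

Lemma fexp_part_lim x (e : R) : 0 < e -> exists2 eta : R, 0 < eta &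
  forall t : R, 0 < t -> t <= eta ->
  nrm (Ez t%:C (t^-1%:C *: (fexp NK t%:C x - x)) - NK x) <= e.
Proof.
move=> e0; have e2 : 0 < e / 2 by lra.
have [eta1 p1 h1] := Ez_cont (NK x) e2.
pose Q := kb ^+ 2 * expR kb * nrm x.
have Q0 : 0 <= Q by rewrite !mulr_ge0 ?expR_ge0.
have Q1 : 0 < Q + 1 by lra.
exists (Num.min eta1 (Num.min 1 (e / 2 / (Q + 1)))).
  by rewrite !lt_min p1 ltr01 divr_gt0.
move=> t t0; rewrite !le_min => /and3P[t1 t2 t3].
have tR : 0 <= Re t%:C by rewrite ReC ltW.
apply: le_trans (nrm_tri (Ez t%:C (NK x)) _ _) _; rewrite [e]splitr lerD//; last first.
  by apply: h1 => //; rewrite nrm_tC.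
rewrite -(blB (Ez_blin tR)); apply: le_trans (bl_bd (Ez_blin tR) _) _; rewrite mul1r.
have -> : t^-1%:C *: (fexp NK t%:C x - x) - NK x =
    t^-1%:C *: (fexp NK t%:C x - x - t%:C *: NK x).
  rewrite [in RHS]scalerBr scalerA -rmorphM mulVf ?gt_eqF//.
  by rewrite rmorph1 scale1r.
rewrite nrmZ nrm_real normfV gtr0_norm// -ler_pdivlMl ?invr_gt0// invrK.
apply: le_trans (fexp_bound2 C hNK _ _) _; rewrite nrm_tC// exprMn.
have E : expR (t * kb) <= expR kb.
  by rewrite ler_expR -[leRHS]mul1r ler_wpM2r.
apply: (@le_trans _ _ (t * (t * Q))).
  rewrite /Q expr2 -!mulrA ler_wpM2l ?(ltW t0)// ler_wpM2l ?(ltW t0)//.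
  by do 2 rewrite ler_wpM2l//; rewrite ler_wpM2r.
rewrite ler_wpM2l ?(ltW t0)//.
apply: (@le_trans _ _ (t * (Q + 1))); first by rewrite ler_wpM2l ?(ltW t0)//; lra.
by rewrite -ler_pdivlMr.
Qed.

Lemma Tz_quot (t : R) x : 0 < t ->
  t^-1%:C *: (Tz t%:C x - x) = Ez t%:C (t^-1%:C *: (fexp NK t%:C x - x)) +
    t^-1%:C *: (Ez t%:C x - x).
Proof.
move=> t0; have tR : 0 <= Re t%:C by rewrite ReC ltW.
by rewrite (blZ (Ez_blin tR)) -scalerDr (blB (Ez_blin tR)) addrA subrK.
Qed.

(** The limit determines every coordinate of y by differentiating a scalar exponential. Conversely,
    if diag(nu) x lies in V, the difference quotients converge in norm by [dg_small], because their
    multipliers are bounded by 1. *)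
Lemma gen_limP x y : gen_lim (fun t => Tz t%:C) x y <-> Grel x (- y).
Proof.
split=> [hl i|hG].
  have E : c i (y - NK x) = - (nu i)%:C * c i x.
    apply/eqP; rewrite -subr_eq0; apply/eqP/nrm_le0/ler_addgt0Pl => e e0.
    rewrite addr0; have e3 : 0 < e / 3 by lra.
    have [eta1 p1 h1] := hl _ e3; have [eta2 p2 h2] := fexp_part_lim x e3.
    pose Q := nu i ^+ 2 * expR (nu i) * nrm (c i x).
    have Q0 : 0 <= Q by rewrite !mulr_ge0 ?expR_ge0.
    have Q1 : 0 < Q + 1 by lra.
    pose t := Num.min (Num.min eta1 eta2) (Num.min 1 (e / 3 / (Q + 1))).
    have t0 : 0 < t by rewrite !lt_min p1 p2 ltr01 divr_gt0.
    have tR : 0 <= Re t%:C by rewrite ReC ltW.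
    have t1 : t <= eta1 by rewrite !ge_min lexx.
    have t2 : t <= eta2 by rewrite !ge_min lexx orbT.
    have t3 : t <= 1 by rewrite !ge_min lexx !orbT.
    have t4 : t <= e / 3 / (Q + 1) by rewrite !ge_min lexx !orbT.
    have k1 := h1 t t0 t1; have k2 := h2 t t0 t2.
    have k3 : nrm (t^-1%:C *: (Ez t%:C x - x) - (y - NK x)) <= e / 3 + e / 3.
      apply: le_trans (_ : _ <= nrm (t^-1%:C *: (Tz t%:C x - x) - y) +
        nrm (Ez t%:C (t^-1%:C *: (fexp NK t%:C x - x)) - NK x)) (lerD k1 k2).
      apply: le_trans (nrmB _ _); rewrite Tz_quot// le_eqVlt; apply/orP; left.
      by apply/eqP; congr nrm; rewrite cancel_summand.
    have k4 : nrm (t^-1%:C * (cexp (- t%:C * (nu i)%:C) - 1) * c i x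
        - - (nu i)%:C * c i x) <= e / 3.
      have -> : t^-1%:C * (cexp (- t%:C * (nu i)%:C) - 1) * c i x - - (nu i)%:C * c i x
         = t^-1%:C * (cexp (- t%:C * (nu i)%:C) - 1 - (- t%:C * (nu i)%:C)) * c i x.
        have tt : t^-1%:C * t%:C = 1 :> R[i] by rewrite -rmorphM mulVf ?gt_eqF// rmorph1.
        rewrite -mulrBl; congr (_ * _); rewrite mulNr !opprK [in RHS]mulrDr.
        by rewrite [_ * (t%:C * _)]mulrA tt mul1r.
      rewrite !nrmM nrm_real normfV gtr0_norm// -mulrA -ler_pdivlMl ?invr_gt0// invrK.
      apply: le_trans (ler_wpM2r (nrm_ge0 _) (cexp_bound2 _)) _.
      rewrite nrmM nrmN (nrm_tC t0) nrm_real (ger0_norm (nu0 i)).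
      have E : expR (t * nu i) <= expR (nu i).
        by rewrite ler_expR -[leRHS]mul1r ler_wpM2r.
      apply: (@le_trans _ _ (t * (t * Q))).
        rewrite /Q exprMn expr2 -!mulrA ler_wpM2l ?(ltW t0)// ler_wpM2l ?(ltW t0)//.
        by do 2 rewrite ler_wpM2l//; rewrite ler_wpM2r.
      rewrite ler_wpM2l ?(ltW t0)//.
      apply: (@le_trans _ _ (t * (Q + 1))); first by rewrite ler_wpM2l ?(ltW t0)//; lra.
      by rewrite -ler_pdivlMr.
    have k5 := le_trans (c_le C i _) k3; move: k5.
    rewrite (cB C i (t^-1%:C *: _)) (cZ C) (cB C i (Ez _ _)) c_Ez// => k5.
    apply: le_trans (nrm_tri (t^-1%:C * (cexp (- t%:C * (nu i)%:C) - 1) * c i x) _ _) _.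
    have -> : e = (e / 3 + e / 3) + e / 3 by lra.
    rewrite lerD// nrm_sym; move: k5; congr (nrm (_ - _) <= _).
    by rewrite -mulrA mulrBl mul1r.
  move: E; rewrite /NK opprK (cB C) (cN C) (cD C) => E.
  by rewrite -[RHS]opprK -mulNr -E opprD.
move=> e e0; have e2 : 0 < e / 2 by lra.
have [eta1 p1 h1] := fexp_part_lim x e2.
pose w := - y - K x.
have hw i : c i w = (nu i)%:C * c i x := hG i.
(* The error of the difference quotient at w = diag(nu) x is the multiplier 1 + (exp(-s) - 1) / s
   with s = t nu_i, which lies in [0, 1] and tends to 0. Where nu_i = 0 the coordinate of w
   vanishes, so 0 is a correct value. *)
pose m (t : R) i : R[i] := if nu i == 0 then 0 else
   1 + (t * nu i)^-1%:C * (cexp (- t%:C * (nu i)%:C) - 1).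
have mE (t : R) i : 0 < t -> nu i != 0 ->
    m t i = (1 + (expR (- (t * nu i)) - 1) / (t * nu i))%:C.
  move=> t0 n0; rewrite /m (negPf n0) -rmorphN -rmorphM cexp_real mulNr.
  by rewrite -(rmorph1 (real_complex R)) -rmorphB -rmorphM -rmorphD mulrC.
have m1 t i : 0 < t -> nrm (m t i) <= 1.
  move=> t0; case: (eqVneq (nu i) 0) => n0; first by rewrite /m n0 eqxx nrm0.
  rewrite mE// nrm_real; set s := t * nu i.
  have s0 : 0 < s by rewrite mulr_gt0// lt_neqAle eq_sym n0 nu0.
  have ge : expR (- s) <= 1 by rewrite -expR0 ler_expR oppr_le0 ltW.
  have h := expR_ge1Dx (- s).
  have q1 : (expR (- s) - 1) / s <= 0 by rewrite pmulr_lle0 ?invr_gt0// subr_le0.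
  have q2 : -1 <= (expR (- s) - 1) / s by rewrite ler_pdivlMr//; lra.
  by rewrite ger0_norm; lra.
have [|eta2 p2 h2] := @dg_small R (fun t => 0 < t) id m 1 ler01 m1 _ w _ e2.
  move=> i d d0; have [n0|n0] := eqVneq (nu i) 0.
    by exists 1 => // t _ _; rewrite /m n0 eqxx nrm0 ltW.
  have np : 0 < nu i by rewrite lt_neqAle eq_sym n0 nu0.
  have n1 : 0 < nu i * expR (nu i) by rewrite mulr_gt0 ?expR_gt0.
  exists (Num.min 1 (d / (nu i * expR (nu i)))); first by rewrite lt_min ltr01 divr_gt0.
  move=> t t0; rewrite le_min => /andP[t1 t2].
  have s0 : 0 < t * nu i by rewrite mulr_gt0.
  have nz : (t * nu i)%:C != 0 :> R[i] by rewrite (inj_eq (@complexI R) _ 0) gt_eqF.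
  rewrite /m (negPf n0).
  have -> : 1 + (t * nu i)^-1%:C * (cexp (- t%:C * (nu i)%:C) - 1) =
     (t * nu i)^-1%:C * (cexp (- t%:C * (nu i)%:C) - 1 - (- t%:C * (nu i)%:C)).
    rewrite [in RHS]mulrBr mulNr -rmorphM mulrN opprK.
    by rewrite -[(t * nu i)^-1%:C * (t * nu i)%:C]rmorphM mulVf ?gt_eqF// rmorph1 addrC.
  rewrite nrmM nrm_real normfV gtr0_norm// -ler_pdivlMl ?invr_gt0// invrK.
  apply: le_trans (cexp_bound2 _) _.
  rewrite mulNr nrmN -rmorphM nrm_real gtr0_norm// expr2 -mulrA ler_wpM2l ?(ltW s0)//.
  apply: (@le_trans _ _ (t * (nu i * expR (nu i)))); last by rewrite -ler_pdivlMr.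
  rewrite -mulrA ler_wpM2l ?(ltW t0)// ler_wpM2l// ler_expR.
  by rewrite -[leRHS]mul1r ler_wpM2r.
exists (Num.min eta1 eta2) => [|t t0]; first by rewrite lt_min p1 p2.
rewrite le_min => /andP[t1 t2].
have tR : 0 <= Re t%:C by rewrite ReC ltW.
have E : t^-1%:C *: (Ez t%:C x - x) + w = dg c (m t) w.
  apply: (c_inj C) => i; rewrite (c_dg C ler01); last by move=> j; exact: m1.
  rewrite (cD C) (cZ C) (cB C) c_Ez// hw /m; case: eqP => [->|/eqP n0].
    by rewrite mulr0 cexp0 mul1r subrr mulr0 !mul0r addr0.
  rewrite invfM rmorphM mulrDl mul1r [LHS]addrC; congr (_ + _).
  have nn : (nu i)^-1%:C * (nu i)%:C = 1 :> R[i] by rewrite -rmorphM mulVf ?rmorph1.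
  transitivity (((nu i)^-1%:C * (nu i)%:C) *
      (t^-1%:C * (cexp (- t%:C * (nu i)%:C) - 1) * c i x)); last by rewrite /=; ring.
  by rewrite nn mul1r -mulrA mulrBl mul1r.
rewrite Tz_quot//.
have -> : Ez t%:C (t^-1%:C *: (fexp NK t%:C x - x)) + t^-1%:C *: (Ez t%:C x - x) - y =
   (Ez t%:C (t^-1%:C *: (fexp NK t%:C x - x)) - NK x) + (t^-1%:C *: (Ez t%:C x - x) + w).
  by rewrite /w /NK; apply: (c_inj C) => i; rewrite !((cD C), (cN C)); ring.
rewrite E [e]splitr; apply: le_trans (nrmD _ _) (lerD _ _); [exact: h1|exact: h2].
Qed.

End DiagonalPlusBounded.

(** * Sectoriality, analyticity and generator, transported by a similarity *)

Section SimilarGenerator.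
Variables (R : realType) (V : normedModType R[i]) (c : nat -> V -> R[i]).
Hypothesis C : l2coord c.
Variables (nu : nat -> R) (K : V -> V) (kb : R).
Hypothesis nu0 : forall i, 0 <= nu i.
Hypothesis hK : blin K kb.
Hypothesis hcomm : forall (f : R -> R[i]) (M : R), 0 <= M ->
  (forall i, nrm (f (nu i)) <= M) ->
  forall x, dg c (fun i => f (nu i)) (K x) = K (dg c (fun i => f (nu i)) x).
Variables (L : set (V * V)) (U U' : V -> V) (MU MU' : R).
Hypothesis hU : blin U MU.
Hypothesis hU' : blin U' MU'.
Hypothesis UK : cancel U U'.
Hypothesis U'K : cancel U' U.
Hypothesis hL : forall v h, L (U v, U h) <-> Grel c nu K v h.

Local Notation Re := complex.Re.
Local Notation Tz := (Tz c nu K).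
Implicit Types (x y v : V) (z w lam : R[i]).

Definition Tsim (t : R) x := U (Tz t%:C (U' x)).

Let kb0 : 0 <= kb. Proof. exact: bl_ge0 hK. Qed.
Let MU0 : 0 <= MU. Proof. exact: bl_ge0 hU. Qed.
Let MU'0 : 0 <= MU'. Proof. exact: bl_ge0 hU'. Qed.

Lemma nrm_leC x (e : R) : (`|x| <= e%:C) = (nrm x <= e).
Proof. by rewrite nrmE lecR. Qed.

Lemma nrm_ltC (z : R[i]) (e : R) : (`|z| < e%:C) = (nrm z < e).
Proof. by rewrite nrmE ltcR. Qed.

Lemma hL' x y : L (x, y) <-> Grel c nu K (U' x) (U' y).
Proof. by rewrite -hL !U'K. Qed.

Lemma at_right_cvgP (f : R -> V) l : (f t @[t --> 0^'+] --> l) <->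
  (forall e : R, 0 < e -> exists2 eta : R, 0 < eta & forall t : R, 0 < t -> t <= eta ->
    nrm (f t - l) <= e).
Proof.
split=> [/cvgrPdist_le h e e0|h].
  have eC : 0 < e%:C by rewrite ltcR.
  have := h _ eC; rewrite near_withinE => /nbhs_ballP[d /= d0 hd].
  exists (d / 2) => [|t t0 td]; first by rewrite divr_gt0.
  have := hd t; rewrite /ball/= sub0r normrN gtr0_norm// => /(_ _ t0).
  by rewrite distrC nrm_leC; apply; lra.
apply/cvgrPdist_le => e e0.
have eE : e = (Re e)%:C by move: e0; rewrite ltcE => /andP[/eqP/= ie _]; case: e ie => a b /= ->.
have e1 : 0 < Re e by move: e0; rewrite eE ltcR.
have [eta eta0 heta] := h _ e1.
rewrite near_withinE; apply/nbhs_ballP; exists eta => //= t.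
rewrite /ball/= sub0r normrN => te t0; rewrite eE distrC nrm_leC.
by apply: heta => //; rewrite -[t]gtr0_norm// ltW.
Qed.

(** Law of cosines: the square is s^2 + r^2 + 2 s r cos psi, with cos psi >= cos phi, and cos phi <=
    0 allows the use of 2 s r <= s^2 + r^2. *)
Lemma sector_bound (phi a s r psi : R) : pi / 2 <= phi -> phi <= pi ->
  `|psi| < phi -> 0 <= s -> 0 <= r ->
  (1 + cos phi) * (s ^+ 2 + r ^+ 2) <= nrm (s%:C + r%:C * expi psi) ^+ 2.
Proof.
move=> p1 p2 psi_ s0 r0.
have pi0 := pi_gt0 R.
have cp : cos phi <= cos psi.
  rewrite -(cos_norm psi); case: (eqVneq `|psi| phi) => [->//|_].
  by rewrite ltW// ltr_cos ?in_itv/= ?normr_ge0 ?(ltW psi_) ?p2 ?andbT//; lra.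
have cp0 : cos phi <= 0.
  rewrite -(cos_pihalf R); have [->//|ne] := eqVneq (pi / 2) phi.
  by rewrite ltW// ltr_cos ?in_itv/=; [rewrite lt_neqAle ne p1|lra|lra].
rewrite nrm_sqr/= !mul0r subr0 !addr0 add0r.
have := cos2Dsin2 psi; set C1 := cos psi; set S1 := sin psi => cs.
have -> : (s + r * C1) ^+ 2 + (r * S1) ^+ 2 =
  s ^+ 2 + r ^+ 2 * (C1 ^+ 2 + S1 ^+ 2) + 2 * (s * r) * C1 by ring.
rewrite cs mulr1; have sr : 0 <= s * r by rewrite mulr_ge0.
have : s * r * cos phi <= s * r * C1 by rewrite ler_wpM2l.
have : 0 <= - cos phi * (s - r) ^+ 2 by rewrite mulr_ge0 ?sqr_ge0// oppr_ge0.
by nra.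
Qed.

Lemma sectorial_sim : sectorial (graph_opp L).
Proof.
have pi0 := pi_gt0 R.
pose phi : R := 3 * pi / 4.
have k0 : 0 < 1 + cos phi.
  have : cos pi < cos phi by rewrite ltr_cos ?in_itv/=; rewrite /phi; lra.
  by rewrite cospi; lra.
pose kap := Num.sqrt (1 + cos phi).
have kap0 : 0 < kap by rewrite sqrtr_gt0.
(* With this vertex every point of the sector keeps a distance of at least kap a >= 2 kb from all
   the - nu_i, so that the Neumann series for K converges. *)
pose a := 2 * kb / kap + 1.
have a0 : 0 < a by rewrite ltr_wpDl// !mulr_ge0// invr_ge0 ltW.
exists a, phi, (MU * (2 / kap * MU')); split; first by rewrite /phi; apply/andP; split; lra.
move=> lam [r [psi [r0 hpsi ->]]].
have ra : a%:C + r%:C * expi psi - a%:C = r%:C * expi psi by rewrite addrAC subrr add0r.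
have hd i : kap * Num.max r a <= nrm (a%:C + r%:C * expi psi + (nu i)%:C).
  have -> : a%:C + r%:C * expi psi + (nu i)%:C = (a + nu i)%:C + r%:C * expi psi.
    by apply/eqP; rewrite eq_complex/=; apply/andP; split; apply/eqP; ring.
  have s0 : 0 <= a + nu i by rewrite addr_ge0// ltW.
  rewrite -(ler_pXn2r (n:=2))// ?nnegrE ?mulr_ge0 ?(ltW kap0)//; last first.
    by rewrite le_max (ltW r0).
  apply: le_trans (sector_bound a _ _ hpsi s0 (ltW r0)); [|rewrite /phi; lra..].
  rewrite exprMn sqr_sqrtr ?(ltW k0)// ler_wpM2l ?(ltW k0)//.
  have := nu0 i; have := sqr_ge0 r; have := sqr_ge0 (a + nu i).
  by case: (leP r a) => _; have := a0; nra.
have m0 : 0 < kap * Num.max r a by rewrite mulr_gt0// lt_max r0.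
have mr : kap * r <= kap * Num.max r a by rewrite ler_pM2l// le_max lexx.
have ma : 2 * kb <= kap * Num.max r a.
  apply: le_trans (_ : kap * a <= _); last by rewrite ler_pM2l// le_max lexx orbT.
  by rewrite /a mulrDr mulrCA mulfV ?gt_eqF// mulr1 mulr1; lra.
have hRK : blin (fun x => dg c (fun i => (a%:C + r%:C * expi psi + (nu i)%:C)^-1) (K x)) 2^-1.
  have mi0 : 0 <= (kap * Num.max r a)^-1 by rewrite invr_ge0 ltW.
  have hb i : nrm (a%:C + r%:C * expi psi + (nu i)%:C)^-1 <= (kap * Num.max r a)^-1.
    by rewrite nrmV lef_pV2 ?posrE// (lt_le_trans m0).
  have h := bl_comp (dg_blin C mi0 hb) hK; apply: (bl_le h).
  by rewrite mulrC ler_pdivrMr//; lra.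
have [S [hS SP]] := dg_resolvent C hK m0 hd hRK.
have hUS := bl_comp hU (bl_comp hS hU').
exists (fun y => U (S (U' y))).
  split; first exact: bounded_blin hUS.
  move=> x y; rewrite /graph_opp/= hL'; split=> [h i|h].
    have := (SP (U' x) (U' y)).1; rewrite -{1}h UK => /(_ erefl i).
    rewrite (blN hU') (blB hU') (blZ hU') opprB => e.
    by rewrite addrAC (cB C) e (cZ C); ring.
  apply: (can_inj U'K); rewrite UK; apply/SP => i; have := h i.
  rewrite (blN hU') (blB hU') (blZ hU') opprB => e.
  transitivity ((nu i)%:C * c i (U' x) + (a%:C + r%:C * expi psi) * c i (U' x)).
    by rewrite -e !((cD C), (cN C), (cZ C)); ring.
  by ring.
move=> x; rewrite ra !nrmE -fmorphV/= -!rmorphM/= lecR.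
rewrite nrmM nrm_real nrm_expi mulr1 gtr0_norm//.
apply: le_trans (bl_bd hUS x) _; rewrite ler_wpM2r//.
rewrite [leRHS](_ : _ = MU * (2 / (kap * r) * MU')); last first.
  by field; rewrite !gt_eqF.
rewrite ler_wpM2l// ler_wpM2r// ler_wpM2l// lef_pV2 ?posrE//.
by rewrite mulr_gt0.
Qed.

Lemma sector_Re (delta : R) z : delta <= pi / 2 -> sector 0 delta z -> 0 < Re z.
Proof.
move=> d2 [r [psi [r0 hpsi ->]]]; rewrite add0r /expi /= mul0r subr0 mulr_gt0//.
by rewrite cos_gt0_pihalf// -ltr_norml (lt_le_trans hpsi).
Qed.

Lemma semigroup_Tz : semigroup (fun t => Tz t%:C).
Proof.
have ht (t : R) : 0 <= t -> 0 <= Re t%:C by [].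
split=> [t t0|x _|s t x s0 t0 _|x _].
- exact: bounded_blin (Tz_blin C nu0 hK (ht t t0)).
- exact: (Tz0 C nu0 hK).
- by rewrite rmorphD (TzD C nu0 hK hcomm).
- apply/at_right_cvgP => e e0.
  have [eta eta0 h] := Tz_cont C nu0 hK x e0.
  by exists eta => // t t0 te; apply: h; [exact: ht (ltW t0)|rewrite nrm_tC].
Qed.

Let SU z x := U (Tz z (U' x)).

Let SU_blin z : 0 <= Re z -> blin (SU z) (MU * (expR (nrm z * kb) * MU')).
Proof.
by move=> z0; have h := bl_comp hU (bl_comp (Tz_blin C nu0 hK z0) hU'); exact: h.
Qed.

Let SU_cont x (e : R) : 0 < e -> exists2 eta : R, 0 < eta &
  forall z, 0 <= Re z -> nrm z <= eta -> nrm (SU z x - x) <= e.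
Proof.
move=> e0; have M1 : 0 < MU + 1 by rewrite ltr_wpDl.
have [eta eta0 h] := Tz_cont C nu0 hK (U' x) (divr_gt0 e0 M1).
exists eta => // z z0 ze; rewrite /SU -{2}[x]U'K -(blB hU).
apply: le_trans (bl_bd hU _) _; have := h z z0 ze; rewrite ler_pdivlMr//.
apply: le_trans; rewrite [leRHS]mulrC ler_wpM2r//; lra.
Qed.

Lemma semigroup_Tsim : semigroup Tsim.
Proof.
have ht (t : R) : 0 <= t -> 0 <= Re t%:C by [].
split=> [t t0|x _|s t x s0 t0 _|x _].
- exact: bounded_blin (SU_blin (ht t t0)).
- by rewrite /Tsim (Tz0 C nu0 hK) U'K.
- by rewrite /Tsim UK rmorphD (TzD C nu0 hK hcomm).
- apply/at_right_cvgP => e e0; have [eta eta0 h] := SU_cont x e0.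
  by exists eta => // t t0 te; apply: h; [exact: ht (ltW t0)|rewrite nrm_tC].
Qed.

Lemma analytic_Tsim : analytic_semigroup Tsim.
Proof.
split; first exact: semigroup_Tsim.
have pi0 := pi_gt0 R.
exists (pi / 2), SU; split.
- by rewrite lexx andbT; lra.
- by [].
- move=> z /(sector_Re (lexx _))/ltW z0; exact: bounded_blin (SU_blin z0).
- move=> z w x /(sector_Re (lexx _))/ltW z0 /(sector_Re (lexx _))/ltW w0.
  by rewrite /SU UK (TzD C nu0 hK hcomm).
- split=> [z /(sector_Re (lexx _)) z0|d /andP[d0 d1] x e e0]; last first.
    have [eta eta0 h] := SU_cont x e0; exists eta => // z.
    move=> /(sector_Re (ltW d1))/ltW z0; rewrite nrm_ltC nrm_leC => /ltW.
    exact: h.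
  have [D [M hD] hd] := Tz_diff C nu0 hK z0.
  have hUD := bl_comp hU (bl_comp hD hU').
  exists (fun x => U (D (U' x))); first exact: bounded_blin hUD.
  move=> e e0; have M1 : 0 < MU * MU' + 1 by rewrite ltr_wpDl// mulr_ge0.
  have [eta eta0 h] := hd _ (divr_gt0 e0 M1); exists eta => // k k0.
  rewrite nrm_ltC => kn x; rewrite !nrmE -rmorphM/= lecR.
  have -> : k^-1 *: (SU (z + k) x - SU z x) - U (D (U' x)) =
      U (k^-1 *: (Tz (z + k) (U' x) - Tz z (U' x)) - D (U' x)).
    by rewrite (blB hU) (blZ hU) (blB hU).
  apply: le_trans (bl_bd hU _) _.
  apply: le_trans (ler_wpM2l MU0 (h k k0 kn (U' x))) _.
  have e1 : 0 <= e / (MU * MU' + 1) by rewrite divr_ge0 ?ltW.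
  apply: le_trans (ler_wpM2l MU0 (ler_wpM2l e1 (bl_bd hU' x))) _.
  rewrite mulrCA !mulrA ler_wpM2r// mulrAC -!mulrA mulrA.
  rewrite -mulrA -[leRHS]mulr1 ler_wpM2l ?(ltW e0)//.
  by rewrite mulrC ler_pdivrMr// mul1r; lra.
Qed.

Lemma generator_Tsim : generator Tsim = graph_opp L.
Proof.
have E x y : gen_lim Tsim x y <-> gen_lim (fun t => Tz t%:C) (U' x) (U' y).
  have comm t : t^-1%:C *: (Tsim t x - x) - y =
      U (t^-1%:C *: (Tz t%:C (U' x) - U' x) - U' y).
    by rewrite (blB hU) (blZ hU) (blB hU) !U'K.
  have M1 : 0 < MU + 1 by rewrite ltr_wpDl.
  have M1' : 0 < MU' + 1 by rewrite ltr_wpDl.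
  split=> h e e0.
    have [eta eta0 {}h] := h _ (divr_gt0 e0 M1'); exists eta => // t t0 te.
    have := h t t0 te; rewrite comm ler_pdivlMr//; apply: le_trans.
    rewrite -[X in nrm X <= _]UK; apply: le_trans (bl_bd hU' _) _.
    rewrite [leRHS]mulrC ler_wpM2r//; lra.
  have [eta eta0 {}h] := h _ (divr_gt0 e0 M1); exists eta => // t t0 te.
  have := h t t0 te; rewrite comm ler_pdivlMr//; apply: le_trans.
  apply: le_trans (bl_bd hU _) _; rewrite [leRHS]mulrC ler_wpM2r//; lra.
apply/seteqP; split=> [[x y]|[x y]]; rewrite /generator /graph_opp /=.
  move=> /at_right_cvgP h; apply/hL'; rewrite (blN hU').
  exact/(gen_limP C nu0 hK)/E.
move=> /hL'; rewrite (blN hU') => /(gen_limP C nu0 hK)/E h.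
exact/at_right_cvgP.
Qed.

Lemma similar_Tsim : similar_semigroups Tsim (fun t => Tz t%:C).
Proof.
exists U, U'; split=> //; [exact: bounded_blin hU|exact: bounded_blin hU'|].
by move=> t x t0; rewrite /Tsim UK.
Qed.

(** P commutes with K and with every bounded diagonal operator, hence with the semigroup. Both
    summands can then be the semigroup itself, as only its values on the two ranges matter. *)
Lemma direct_sum_Tz (P : V -> V) (MP : R) : blin P MP -> (forall x, P (P x) = P x) ->
  (forall x, P (K x) = K (P x)) ->
  (forall (a : nat -> R[i]) M, 0 <= M -> (forall i, nrm (a i) <= M) ->
     forall x, dg c a (P x) = P (dg c a x)) ->
  semigroup_direct_sum P (fun t => Tz t%:C) (fun t => Tz t%:C) (fun t => Tz t%:C).
Proof.
move=> hP PP PK Pdg.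
have hNK := bl_opp hK.
have PT (t : R) x : 0 <= t -> Tz t%:C (P x) = P (Tz t%:C x).
  move=> t0; rewrite /Tz /Ez -(fexp_comm C hNK _ x hP) => [|y].
    by apply: (Pdg _ 1) => // i; apply: Ez_coef_le.
  by rewrite (blN hP) PK.
have [h1 h2 h3 h4] := semigroup_Tz.
have sub (Q : V -> V) : (forall (t : R) x, 0 <= t -> Tz t%:C (Q x) = Q (Tz t%:C x)) ->
    semigroup_on (range Q) (fun t => Tz t%:C).
  move=> QT; split=> [t t0|x _|s t x s0 t0 _|x _].
  - have [_ b [M hM]] := h1 t t0; split=> [_ [x _ <-]|a x y _ _|].
    + by rewrite QT//; exists (Tz t%:C x).
    + exact: b.
    + by exists M => x _; exact: hM.
  - exact: h2.
  - exact: h3.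
  - exact: h4.
split; first exact: sub.
- apply: sub => t x t0; have hT := Tz_blin C nu0 hK (t0 : 0 <= Re t%:C).
  by rewrite (blB hT) PT.
- move=> t x t0; have hT := Tz_blin C nu0 hK (t0 : 0 <= Re t%:C).
  by rewrite -(blD hT) addrC subrK.
Qed.

End SimilarGenerator.

(** * Orthonormal bases and completeness of L^2 *)

Section OrthonormalBasis.
Variables (R : realType) (V : normedModType R[i]) (ip : V -> V -> R[i]).
Hypothesis ip_lin : forall (k : R[i]) x y z, ip (k *: x + y) z = k * ip x z + ip y z.
Hypothesis ip_conj : forall x y, ip y x = (ip x y)^*.
Hypothesis ip_nrm : forall x, ip x x = (nrm x ^+ 2)%:C.
Hypothesis complete : forall u : nat -> V, cauchy_seq u -> exists l, tends u l.
Implicit Types (x y z : V).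

Lemma ip0 z : ip 0 z = 0.
Proof. by have := ip_lin (-1) 0 0 z; rewrite scaler0 addr0 mulN1r addNr. Qed.
Lemma ipD x y z : ip (x + y) z = ip x z + ip y z.
Proof. by have := ip_lin 1 x y z; rewrite scale1r mul1r. Qed.
Lemma ipZ (k : R[i]) x z : ip (k *: x) z = k * ip x z.
Proof. by have := ip_lin k x 0 z; rewrite ip0 !addr0. Qed.
Lemma ipN x z : ip (- x) z = - ip x z.
Proof. by rewrite -scaleN1r ipZ mulN1r. Qed.
Lemma ipDr x y z : ip z (x + y) = ip z x + ip z y.
Proof. by rewrite ip_conj ipD rmorphD/= -!ip_conj. Qed.
Lemma ipZr (k : R[i]) x z : ip z (k *: x) = k^* * ip z x.
Proof. by rewrite ip_conj ipZ rmorphM/= -ip_conj. Qed.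
Lemma ip_sum (I : Type) (s : seq I) (P : pred I) (f : I -> V) z :
  ip (\sum_(j <- s | P j) f j) z = \sum_(j <- s | P j) ip (f j) z.
Proof. by elim/big_rec2: _ => [|j x y _ <-]; [exact: ip0|rewrite ipD]. Qed.

Lemma pythagoras x y : ip x y = 0 -> nrm (x + y) ^+ 2 = nrm x ^+ 2 + nrm y ^+ 2.
Proof.
move=> h; apply: (@complexI R); rewrite rmorphD/= -!ip_nrm.
by rewrite ipD !ipDr h (ip_conj x y) h conjC0 addr0 add0r.
Qed.

Variable e : nat -> V.
Hypothesis e_orth : forall i j, ip (e i) (e j) = (i == j)%:R.
Hypothesis e_total : forall x, (forall i, ip x (e i) = 0) -> x = 0.

Lemma nrm_e i : nrm (e i) = 1.
Proof.
apply/eqP; rewrite -(eqrXn2 (n:=2))// expr1n; apply/eqP/(@complexI R).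
by rewrite -ip_nrm e_orth eqxx.
Qed.

Lemma nrm_sum_e (a : nat -> R[i]) m n :
  nrm (\sum_(m <= i < n) a i *: e i) ^+ 2 = \sum_(m <= i < n) nrm (a i) ^+ 2.
Proof.
have [mn|nm] := leqP m n; last by rewrite !big_geq ?nrm0 ?expr0n// ltnW.
rewrite -(subnKC mn); elim: (n - m)%N => [|k IH].
  by rewrite addn0 !big_geq// nrm0 expr0n.
rewrite addnS !big_nat_recr ?leq_addr//= pythagoras.
  by rewrite IH nrmZ nrm_e mulr1.
rewrite ip_sum big_nat big1// => i /andP[_ ik].
by rewrite ipZ ipZr e_orth ltn_eqF// !mulr0.
Qed.

Lemma ip_proj_sum x N i : ip (\sum_(0 <= j < N) ip x (e j) *: e j) (e i) =
  if (i < N)%N then ip x (e i) else 0.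
Proof.
rewrite ip_sum; under eq_bigr do rewrite ipZ e_orth eq_sym.
by have := sum_delta xpredT N i (fun j => ip x (e j)); rewrite andbT.
Qed.

Lemma bessel_split x N :
  nrm x ^+ 2 = nrm (x - \sum_(0 <= j < N) ip x (e j) *: e j) ^+ 2 +
     \sum_(0 <= j < N) nrm (ip x (e j)) ^+ 2.
Proof.
set s := \sum_(0 <= j < N) _ *: _.
transitivity (nrm (x - s) ^+ 2 + nrm s ^+ 2); last by rewrite nrm_sum_e.
rewrite -pythagoras ?subrK//.
have xs i : (i < N)%N -> ip (x - s) (e i) = 0.
  by move=> iN; rewrite ipD ipN ip_proj_sum iN subrr.
rewrite ip_conj /s ip_sum big_nat big1 ?conjC0// => i /andP[_ iN].
by rewrite ipZ (ip_conj _ (e i)) xs// conjC0 mulr0.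
Qed.

Lemma ip_e_le x i : nrm (ip x (e i)) <= nrm x.
Proof.
rewrite -(ler_pXn2r (n:=2))// ?nnegrE//.
have -> := bessel_split x i.+1; rewrite [X in _ <= _ + X]big_nat_recr//= addrA lerDr.
by rewrite addr_ge0 ?sqr_ge0// sumr_ge0// => j _; rewrite sqr_ge0.
Qed.

Lemma basis_synth (a : nat -> R[i]) M : sbd (fun i => nrm (a i) ^+ 2) M ->
  exists2 x, (forall i, ip x (e i) = a i) &
    tends (fun N => \sum_(0 <= i < N) a i *: e i) x.
Proof.
move=> hM; pose s N := \sum_(0 <= i < N) a i *: e i.
have cs : cauchy_seq s.
  move=> d d0; have [N hN] := sbd_tail (fun i => sqr_ge0 (nrm (a i))) hM (exprn_gt0 2 d0).
  exists N => m n Nm mn; rewrite /s (big_cat_nat (n:=m) (p:=n))//= addrAC subrr add0r.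
  by rewrite -(ler_pXn2r (n:=2)) ?nnegrE ?(ltW d0)// nrm_sum_e; exact: hN.
have [x hx] := complete cs; exists x => // i.
apply: (@tends_uniq _ _ (fun N => ip (s N) (e i))).
  apply: (tends_squeeze (M := 1) _ hx) => n.
  by rewrite mul1r; have := ip_e_le (s n - x) i; rewrite ipD ipN.
move=> d d0; exists i.+1 => n iN; rewrite /s ip_sum.
under eq_bigr do rewrite ipZ e_orth eq_sym.
by have := sum_delta xpredT n i a; rewrite iN/= => ->; rewrite subrr nrm0 ltW.
Qed.

Lemma basis_l2coord : l2coord (fun i x => ip x (e i)).
Proof.
split=> //.
- move=> x N; rewrite [leRHS](bessel_split x N) lerDr; exact: sqr_ge0.
(* By totality x is the sum of its Fourier series, and the partial sums have norm at most M. *)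
- move=> x M M0 hM; have [y hy yt] := basis_synth hM.
  have -> : x = y.
    apply/eqP; rewrite -subr_eq0; apply/eqP/e_total => i.
    by rewrite ipD ipN hy subrr.
  apply: tends_nrm_le yt => N.
  by rewrite -(ler_pXn2r (n:=2))// ?nnegrE// nrm_sum_e.
- by move=> a M /basis_synth[x hx _]; exists x.
Qed.

End OrthonormalBasis.

(** * Integrals of complex-valued functions *)

Section ComplexIntegral.
Context d (T : measurableType d) (R : realType).
Variables (mu : {measure set T -> \bar R}) (D : set T).
Hypothesis mD : measurable D.
Local Notation Re := complex.Re.
Local Notation Im := complex.Im.
Implicit Types (f g : T -> R[i]).

Definition cintegrable f := mu.-integrable D (EFin \o (fun x => Re (f x))) /\
  mu.-integrable D (EFin \o (fun x => Im (f x))).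

Lemma ReM (x y : R[i]) : Re (x * y) = Re x * Re y - Im x * Im y.
Proof. by case: x; case: y. Qed.
Lemma ImM (x y : R[i]) : Im (x * y) = Re x * Im y + Im x * Re y.
Proof. by case: x; case: y. Qed.
Lemma ReD (x y : R[i]) : Re (x + y) = Re x + Re y.
Proof. by case: x; case: y. Qed.
Lemma ImD (x y : R[i]) : Im (x + y) = Im x + Im y.
Proof. by case: x; case: y. Qed.
Lemma ReImK (z : R[i]) : Re z +i* Im z = z. Proof. by case: z. Qed.
Lemma complexD (a b c e : R) : (a +i* b) + (c +i* e) = (a + c) +i* (b + e).
Proof. by []. Qed.

Lemma integrable_ext (f g : T -> R) : (forall x, D x -> f x = g x) ->
  mu.-integrable D (EFin \o f) -> mu.-integrable D (EFin \o g).
Proof. by move=> h; apply: eq_integrable => // x /set_mem/h /= ->. Qed.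

Lemma integrable_lin (f g : T -> R) (a b : R) : mu.-integrable D (EFin \o f) ->
  mu.-integrable D (EFin \o g) -> mu.-integrable D (EFin \o (fun x => a * f x + b * g x)).
Proof.
move=> hf hg.
have h := integrableD mD (integrableZl mD a hf) (integrableZl mD b hg).
by apply: eq_integrable h => // x _ /=; rewrite EFinD !EFinM.
Qed.

Lemma Rintegral_lin (f g : T -> R) (a b : R) : mu.-integrable D (EFin \o f) ->
  mu.-integrable D (EFin \o g) -> \int[mu]_(x in D) (a * f x + b * g x) =
   a * \int[mu]_(x in D) f x + b * \int[mu]_(x in D) g x.
Proof.
move=> hf hg.
have h1 : mu.-integrable D (EFin \o (fun x => a * f x)).
  by apply: eq_integrable (integrableZl mD a hf) => // x _ /=; rewrite EFinM.
have h2 : mu.-integrable D (EFin \o (fun x => b * g x)).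
  by apply: eq_integrable (integrableZl mD b hg) => // x _ /=; rewrite EFinM.
by rewrite RintegralD// !RintegralZl.
Qed.

Lemma cintegrable_ext f g : (forall x, D x -> f x = g x) -> cintegrable f -> cintegrable g.
Proof.
move=> h [h1 h2]; split.
  by apply: (integrable_ext _ h1) => x Dx /=; rewrite h.
by apply: (integrable_ext _ h2) => x Dx /=; rewrite h.
Qed.

Lemma eq_cintegral f g : (forall x, D x -> f x = g x) ->
  cintegral mu D f = cintegral mu D g.
Proof.
by move=> h; rewrite /cintegral; congr (_ +i* _); apply: eq_Rintegral => x /set_mem Dx; rewrite h.
Qed.

Lemma cintegrable_lin f g (k : R[i]) : cintegrable f -> cintegrable g ->
  cintegrable (fun x => k * f x + g x).
Proof.
move=> [fr fi] [gr gi]; split.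
  apply: (integrable_ext (f := fun x => 1 * (Re k * Re (f x) + - Im k * Im (f x)) + 1 * Re (g x))).
    by move=> x _ /=; rewrite ReD ReM; ring.
  by apply: integrable_lin => //; apply: integrable_lin.
apply: (integrable_ext (f := fun x => 1 * (Im k * Re (f x) + Re k * Im (f x)) + 1 * Im (g x))).
  by move=> x _ /=; rewrite ImD ImM; ring.
by apply: integrable_lin => //; apply: integrable_lin.
Qed.

Lemma cintegral_lin f g (k : R[i]) : cintegrable f -> cintegrable g ->
  cintegral mu D (fun x => k * f x + g x) = k * cintegral mu D f + cintegral mu D g.
Proof.
move=> [fr fi] [gr gi]; rewrite /cintegral.
rewrite -[RHS]ReImK ReD ImD ReM ImM/=; congr (_ +i* _).
  rewrite (eq_Rintegral mu (g := fun x => 1 * (Re k * Re (f x) + - Im k * Im (f x)) + 1 * Re (g x))).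
    by rewrite !Rintegral_lin ?integrable_lin//; ring.
  by move=> x _ /=; rewrite ReD ReM; ring.
rewrite (eq_Rintegral mu (g := fun x => 1 * (Im k * Re (f x) + Re k * Im (f x)) + 1 * Im (g x))).
  by rewrite !Rintegral_lin ?integrable_lin//; ring.
by move=> x _ /=; rewrite ImD ImM; ring.
Qed.

Lemma cintegral_conj f : cintegrable f ->
  cintegral mu D (fun x => (f x)^*) = (cintegral mu D f)^*.
Proof.
move=> [fr fi]; rewrite /cintegral.
have ReC (z : R[i]) : Re (z^*) = Re z by case: z.
have ImC (z : R[i]) : Im (z^*) = - Im z by case: z.
rewrite -[RHS]ReImK ReC ImC/=; congr (_ +i* _).
  by apply: eq_Rintegral => x _; rewrite ReC.
rewrite (eq_Rintegral mu (g := fun x => -1 * Im (f x))) ?RintegralZl ?mulN1r// => x _.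
by rewrite ImC mulN1r.
Qed.

Lemma cintegrable0 : cintegrable (fun=> 0).
Proof. by split; apply: eq_integrable (integrable0 mu D) => // x. Qed.

Lemma cintegral0 : cintegral mu D (fun=> 0) = 0.
Proof. by rewrite /cintegral/= !(@Rintegral_cst _ _ _ _ D)// !mul0r. Qed.

Lemma cintegrableZ (k : R[i]) f : cintegrable f -> cintegrable (fun x => k * f x).
Proof.
move=> hf; apply: cintegrable_ext (cintegrable_lin k hf cintegrable0) => x _.
by rewrite addr0.
Qed.

Lemma cintegralZ (k : R[i]) f : cintegrable f ->
  cintegral mu D (fun x => k * f x) = k * cintegral mu D f.
Proof.
move=> hf; have := cintegral_lin k hf cintegrable0; rewrite cintegral0 addr0 => <-.
by apply: eq_cintegral => x _; rewrite addr0.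
Qed.

Lemma cintegrableD f g : cintegrable f -> cintegrable g -> cintegrable (fun x => f x + g x).
Proof.
move=> hf hg; apply: cintegrable_ext (cintegrable_lin 1 hf hg) => x _; by rewrite mul1r.
Qed.

Lemma cintegralD f g : cintegrable f -> cintegrable g ->
  cintegral mu D (fun x => f x + g x) = cintegral mu D f + cintegral mu D g.
Proof.
move=> hf hg; have := cintegral_lin 1 hf hg; rewrite mul1r => <-.
by apply: eq_cintegral => x _; rewrite mul1r.
Qed.

Lemma cintegral_ae f g : cintegrable f -> cintegrable g ->
  {ae mu, forall x, D x -> f x = g x} -> cintegral mu D f = cintegral mu D g.
Proof.
move=> [fr fi] [gr gi] fg; rewrite /cintegral /Rintegral; congr (fine _ +i* fine _).
  apply: ae_eq_integral => //; [exact: measurable_int fr|exact: measurable_int gr|].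
  by apply: filterS fg => x h Dx; rewrite h.
apply: ae_eq_integral => //; [exact: measurable_int fi|exact: measurable_int gi|].
by apply: filterS fg => x h Dx; rewrite h.
Qed.

End ComplexIntegral.

(** * Completeness of the complex L^2 space *)

Section L2Complete.
Context d (T : measurableType d) (R : realType).
Variable mu : {measure set T -> \bar R}.
Local Notation Re := complex.Re.
Local Notation Im := complex.Im.

Lemma Lfun2P (f : T -> R) : measurable_fun setT f ->
  (\int[mu]_x ((f x) ^+ 2)%:E < +oo)%E -> f \in Lfun mu 2%:E.
Proof.
move=> mf h; apply/andP; split; rewrite inE//= /finite_norm.
have := powR_Lnorm mu (EFin \o f) (r := 2); rewrite pnatr_eq0/= => /(_ isT) E.
have : ('N[mu]_2%:E[EFin \o f] `^ 2 < +oo)%E.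
  rewrite E; apply: le_lt_trans h; rewrite le_eqVlt; apply/orP; left; apply/eqP.
  by apply: eq_integral => x _ /=; rewrite powR_mulrn// -normrX ger0_norm// sqr_ge0.
case: ('N[mu]_2%:E[EFin \o f])%E (Lnorm_ge0 mu 2%:E (EFin \o f)) => [r||]//=.
  by move=> _ _; exact: ltry.
by move=> _; rewrite /poweR pnatr_eq0.
Qed.

Lemma Lfun2_meas (f : T -> R) : f \in Lfun mu 2%:E -> measurable_fun setT f.
Proof. by move=> /andP[]; rewrite !inE. Qed.

Lemma Lfun2_mul (f g : T -> R) : f \in Lfun mu 2%:E -> g \in Lfun mu 2%:E ->
  mu.-integrable setT (EFin \o (fun x => f x * g x)).
Proof. by move=> hf hg; apply/Lfun1_integrable; exact: Lfun2_mul_Lfun1. Qed.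

Implicit Types (f g : sqint_fun mu).

Lemma sqint_Re f : (fun t => Re (f t)) \in Lfun mu 2%:E.
Proof. by have /andP[] : (f : T -> R[i]) \in sqint mu := valP f. Qed.
Lemma sqint_Im f : (fun t => Im (f t)) \in Lfun mu 2%:E.
Proof. by have /andP[] : (f : T -> R[i]) \in sqint mu := valP f. Qed.

Lemma sq_norm_sqr f : (sq_norm f ^+ 2)%:E =
  (\int[mu]_x ((Re (f x)) ^+ 2 + (Im (f x)) ^+ 2)%:E)%E.
Proof.
have := powR_Lnorm mu (EFin \o modulus f) (r := 2); rewrite pnatr_eq0/= => /(_ isT).
rewrite -sq_normE/= powR_mulrn; last first.
  by rewrite -lee_fin sq_normE Lnorm_ge0.
move=> ->; apply: eq_integral => x _ /=.
rewrite powR_mulrn// ger0_norm ?modulus_ge0// modulusE sqr_sqrtr//.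
by rewrite addr_ge0 ?sqr_ge0.
Qed.

Lemma cintegrable_ip f g : cintegrable mu setT (fun t => f t * (g t)^*).
Proof.
have ReC (z : R[i]) : Re (z^*) = Re z by case: z.
have ImC (z : R[i]) : Im (z^*) = - Im z by case: z.
split.
  apply: (@integrable_ext _ _ _ mu setT measurableT
    (fun t => 1 * (Re (f t) * Re (g t)) + 1 * (Im (f t) * Im (g t)))).
    by move=> x _ /=; rewrite ReM ReC ImC; ring.
  by apply: integrable_lin => //; apply: Lfun2_mul; rewrite ?sqint_Re ?sqint_Im.
apply: (@integrable_ext _ _ _ mu setT measurableT
  (fun t => (-1) * (Re (f t) * Im (g t)) + 1 * (Im (f t) * Re (g t)))).
  by move=> x _ /=; rewrite ImM ReC ImC; ring.
by apply: integrable_lin => //; apply: Lfun2_mul; rewrite ?sqint_Re ?sqint_Im.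
Qed.

Definition cinner (x y : cL2 mu) : R[i] :=
  cintegral mu setT (fun t => cL2_repr x t * (cL2_repr y t)^*).

Lemma repr_class f : {ae mu, forall t, cL2_repr (cL2_class f) t = f t}.
Proof. by apply/cL2_class_eqP; rewrite cL2_reprK. Qed.

Lemma cinner_class f g :
  cinner (cL2_class f) (cL2_class g) = cintegral mu setT (fun t => f t * (g t)^*).
Proof.
apply: cintegral_ae => //; try exact: cintegrable_ip.
by apply: filterS2 (repr_class f) (repr_class g) => t -> ->.
Qed.

Lemma cinner_lin (k : R[i]) (x y z : cL2 mu) :
  cinner (k *: x + y) z = k * cinner x z + cinner y z.
Proof.
rewrite -[x]cL2_reprK -[y]cL2_reprK -[z]cL2_reprK.
rewrite -[k *: _]cL2_classZ -cL2_classD !cinner_class -cintegral_lin//.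
- by apply: eq_cintegral => t _; rewrite mulrA -mulrDl.
- exact: cintegrable_ip.
- exact: cintegrable_ip.
Qed.

Lemma cinner_conj (x y : cL2 mu) : cinner y x = (cinner x y)^*.
Proof.
rewrite /cinner -cintegral_conj//; last exact: cintegrable_ip.
by apply: eq_cintegral => t _; rewrite rmorphM/= conjCK mulrC.
Qed.

Lemma cL2_nrm_class f : nrm (cL2_class f) = sq_norm f.
Proof. by apply: (@complexI R); rewrite -nrmE; exact: cL2_norm_class. Qed.

Lemma cL2_classB f g : cL2_class (f - g) = cL2_class f - cL2_class g.
Proof. by apply/eqP; rewrite eq_sym subr_eq -cL2_classD subrK. Qed.

Lemma sq_norm_ge0 f : 0 <= sq_norm f.
Proof. by rewrite -cL2_nrm_class. Qed.

Lemma sq_norm_parts f (e : R) : sq_norm f <= e ->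
  (\int[mu]_x ((Re (f x)) ^+ 2)%:E <= (e ^+ 2)%:E)%E /\
  (\int[mu]_x ((Im (f x)) ^+ 2)%:E <= (e ^+ 2)%:E)%E.
Proof.
move=> he; have fe : ((sq_norm f ^+ 2)%:E <= (e ^+ 2)%:E)%E.
  have s0 := sq_norm_ge0 f; have e0 := le_trans s0 he.
  by rewrite lee_fin ler_pXn2r ?nnegrE.
have mR := Lfun2_meas (sqint_Re f); have mI := Lfun2_meas (sqint_Im f).
have mS : measurable_fun setT (fun x => ((Re (f x)) ^+ 2 + (Im (f x)) ^+ 2)%:E).
  by apply/measurable_EFinP; apply: measurable_funD; exact: measurable_funX.
split; apply: le_trans fe; rewrite sq_norm_sqr; apply: ge0_le_integral => //.
- by move=> x _; rewrite lee_fin sqr_ge0.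
- by apply/measurable_EFinP; exact: measurable_funX.
- by move=> x _; rewrite lee_fin lerDl sqr_ge0.
- by move=> x _; rewrite lee_fin sqr_ge0.
- by apply/measurable_EFinP; exact: measurable_funX.
- by move=> x _; rewrite lee_fin lerDr sqr_ge0.
Qed.

Lemma cinner_nrm (x : cL2 mu) : cinner x x = (nrm x ^+ 2)%:C.
Proof.
rewrite -[x]cL2_reprK cinner_class cL2_nrm_class; set f := cL2_repr x.
rewrite /cintegral; apply/eqP; rewrite eq_complex/=; apply/andP; split; apply/eqP.
  apply: EFin_inj; rewrite sq_norm_sqr /Rintegral fineK; last first.
    apply: integrable_fin_num => //; exact: (cintegrable_ip f f).1.
  by apply: eq_integral => t _; case: (f t) => a b /=; congr EFin; ring.
rewrite (eq_Rintegral mu (g := fun=> 0)) ?Rintegral_cst ?mul0r// => t _.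
by case: (f t) => a b /=; ring.
Qed.

Lemma real_cauchy_cvg (u : nat -> R) :
  (forall e, 0 < e -> exists N, forall n, (N <= n)%N -> `|u n - u N| <= e) ->
  exists l : R, u @ \oo --> l.
Proof.
move=> h; have : cvgn u; last by move=> c; exists (limn u).
apply/cauchy_cvgP/cauchy_exP => e e0; have [N hN] := h (e / 2) ltac:(lra).
exists (u N); exists N => // n /= Nn; rewrite /ball/= distrC.
by apply: le_lt_trans (hN n Nn) _; lra.
Qed.

Lemma cvgn_eps' (u : nat -> R) (l : R) : u @ \oo --> l ->
  forall e, 0 < e -> exists N, forall n, (N <= n)%N -> `|u n - l| <= e.
Proof.
move=> /cvgrPdist_le h e e0; have := h _ e0; rewrite nearE/= => -[N _ hN].
by exists N => n Nn; rewrite distrC; exact: hN.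
Qed.

(** The weighted sum H of the squared increments has integral at most 2, so it is finite almost
    everywhere. Cauchy-Schwarz bounds (f_n - f_k)^2 by 2 * 2^-k * H, which gives pointwise
    convergence and, after integration, the stated rate. *)
Lemma real_L2_limit (f : nat -> T -> R) : (forall n, measurable_fun setT (f n)) ->
  (forall k, (\int[mu]_x ((f k.+1 x - f k x) ^+ 2)%:E <= ((4^-1) ^+ k)%:E)%E) ->
  exists2 g : T -> R, measurable_fun setT g &
    forall k, (\int[mu]_x ((g x - f k x) ^+ 2)%:E <= (4 * 2^-1 ^+ k)%:E)%E.
Proof.
move=> mf hf.
pose h k x : R := 2 ^+ k * (f k.+1 x - f k x) ^+ 2.
have h0 k x : 0 <= h k x by rewrite mulr_ge0 ?sqr_ge0 ?exprn_ge0.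
have mh k : measurable_fun setT (fun x => (h k x)%:E).
  apply/measurable_EFinP; apply: measurable_funM => //.
  by apply: measurable_funX; apply: measurable_funB.
pose H x := (\sum_(0 <= k <oo) (h k x)%:E)%E.
have mH : measurable_fun setT H.
  by apply: ge0_emeasurable_sum => // k x _ _; rewrite lee_fin.
have H0 x : (0 <= H x)%E by apply: nneseries_ge0 => k _ _; rewrite lee_fin.
have intH : (\int[mu]_x H x <= 2%:E)%E.
  rewrite integral_nneseries//; last by move=> k x _; rewrite lee_fin.
  have le k : (\int[mu]_x (h k x)%:E <= (1 * 2^-1 ^+ k)%:E)%E.
    have -> : (\int[mu]_x (h k x)%:E = (2 ^+ k)%:E * \int[mu]_x ((f k.+1 x - f k x) ^+ 2)%:E)%E.
      rewrite -ge0_integralZl//.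
      - apply/measurable_EFinP; apply: measurable_funX; exact: measurable_funB.
      - by move=> x _; rewrite lee_fin sqr_ge0.
    apply: le_trans (lee_wpmul2l _ (hf k)) _; first by rewrite lee_fin exprn_ge0.
    rewrite -EFinM lee_fin mul1r -exprMn.
    by rewrite le_eqVlt; apply/orP; left; apply/eqP; congr (_ ^+ _); lra.
  apply: lime_le; first by apply: is_cvg_nneseries => k _ _; apply: integral_ge0 => x _; rewrite lee_fin.
  near=> n; apply: (@le_trans _ _ (\sum_(0 <= k < n) (1 * 2^-1 ^+ k)%:E)%E).
    by apply: lee_sum => k _; exact: le.
  by rewrite sumEFin lee_fin; have := sbd_geom (@ler01 R) n; rewrite mulr1.
have iH : mu.-integrable setT H.
  apply/integrableP; split=> //; under eq_integral do rewrite gee0_abs//.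
  exact: le_lt_trans intH (ltry _).
pose A := [set x | (H x < +oo)%E].
have mA : measurable A.
  by rewrite -[A]setTI; apply: emeasurable_fun_infty_o.
have aeA : {ae mu, forall x, A x}.
  have := integrable_ae measurableT iH; apply: filterS => x /(_ I) fx.
  by rewrite /A/= ltey; case: (H x) fx.
have sbA x : A x -> sbd (fun k => h k x) (fine (H x)).
  move=> Ax N; rewrite -lee_fin fineK; last by rewrite ge0_fin_numE.
  rewrite -sumEFin; apply: nneseries_lim_ge => k _; by rewrite lee_fin.
have key x k n : A x -> (k <= n)%N ->
    (f n x - f k x) ^+ 2 <= 2 * 2^-1 ^+ k * fine (H x).
  move=> Ax kn; have F0 : 0 <= fine (H x) by exact: sbd_ge0 (sbA x Ax).
  have -> : f n x - f k x = \sum_(k <= i < n) (f i.+1 x - f i x).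
    by rewrite telescope_sumr.
  have r0 i : 0 <= (2^-1 : R) ^+ i by rewrite exprn_ge0// invr_ge0.
  have c1 : \sum_(k <= i < n) Num.sqrt (2^-1 ^+ i) ^+ 2 <= Num.sqrt (2 * 2^-1 ^+ k) ^+ 2 :> R.
    under eq_bigr do rewrite sqr_sqrtr//.
    rewrite sqr_sqrtr ?mulr_ge0//; have := sbd_geom (r0 k) (n - k)%N.
    rewrite -[X in _ -> \sum_(X <= _ < _) _ <= _]add0n big_addn.
    by apply: le_trans; apply: ler_sum => i _; rewrite exprD mulrC.
  have c2 : \sum_(k <= i < n) Num.sqrt (h i x) ^+ 2 <= Num.sqrt (fine (H x)) ^+ 2.
    under eq_bigr do rewrite sqr_sqrtr//.
    by rewrite sqr_sqrtr//; apply: sbd_window => //; exact: sbA.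
  have := cauchy_schwarz_sum (sqrtr_ge0 _) (sqrtr_ge0 _) c1 c2.
  rewrite -sqrtrM ?mulr_ge0// => cs.
  have le : `|\sum_(k <= i < n) (f i.+1 x - f i x)| <= Num.sqrt (2 * 2^-1 ^+ k * fine (H x)).
    apply: le_trans (ler_norm_sum _ _ _) _; apply: le_trans cs; apply: ler_sum => i _.
    rewrite -sqrtrM// /h mulrA -exprMn mulVf// expr1n mul1r.
    by rewrite sqrtr_sqr.
  have := le; rewrite -(ler_pXn2r (n:=2)) ?nnegrE ?sqrtr_ge0// sqr_sqrtr ?mulr_ge0//.
  by rewrite real_normK ?num_real.
have cv x : A x -> exists l : R, (fun n => f n x) @ \oo --> l.
  move=> Ax; apply: real_cauchy_cvg => e e0.
  have [k hk] := geom_small (2 * fine (H x)) (exprn_gt0 2 e0).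
  exists k => n kn; rewrite -(ler_pXn2r (n:=2)) ?nnegrE ?(ltW e0)//.
  rewrite real_normK ?num_real//; apply: le_trans (key x k n Ax kn) (ltW _).
  by rewrite mulrAC.
(* Setting g = 0 where H is infinite makes it the pointwise limit everywhere of the f_n times the
   indicator of A, hence measurable. *)
pose g x := if pselect (A x) is left Ax then projT1 (cid (cv x Ax)) else 0.
have gP x : A x -> (fun n => f n x) @ \oo --> g x.
  move=> Ax; rewrite /g; case: pselect => // Ax'; exact: projT2 (cid (cv x Ax')).
have gN x : ~ A x -> g x = 0 by move=> nA; rewrite /g; case: pselect.
have mg : measurable_fun setT g.
  apply: (@measurable_fun_cvg _ _ _ _ (fun n x => \1_A x * f n x)) => [m|x _].
    by apply: measurable_funM => //; exact: measurable_indic.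
  rewrite indicE; have [Ax|nA] := pselect (A x).
    by rewrite mem_set//; under eq_cvg do rewrite mul1r; exact: gP.
  by rewrite memNset// gN//; under eq_cvg do rewrite mul0r; exact: cvg_cst.
exists g => // k.
have c0 : 0 < 2 * 2^-1 ^+ k :> R by rewrite mulr_gt0// exprn_gt0// invr_gt0.
apply: (@le_trans _ _ (\int[mu]_x ((2 * 2^-1 ^+ k)%:E * H x))%E).
  apply: ge0_le_integral => //.
  - by move=> x _; rewrite lee_fin sqr_ge0.
  - by apply/measurable_EFinP; apply: measurable_funX; exact: measurable_funB.
  - by apply: emeasurable_funM => //; exact: measurable_cst.
  move=> x _; have [Ax|nA] := pselect (A x); last first.
    have -> : H x = +oo%E.
      by move: nA; rewrite /A/= ltey => /negP; rewrite negbK => /eqP.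
    by rewrite gt0_muley ?lte_fin// leey.
  have F0 : 0 <= fine (H x) by exact: sbd_ge0 (sbA x Ax).
  have -> : H x = (fine (H x))%:E by rewrite fineK// ge0_fin_numE.
  rewrite -EFinM lee_fin; set B := _ * fine _.
  have B0 : 0 <= B by rewrite mulr_ge0// ltW.
  rewrite -[leRHS](sqr_sqrtr B0) -real_normK ?num_real// ler_pXn2r ?nnegrE ?sqrtr_ge0//.
  apply/ler_addgt0Pl => e e0; have [N hN] := cvgn_eps' (gP x Ax) e0.
  have kn : (k <= maxn k N)%N by exact: leq_maxl.
  have h1 := hN _ (leq_maxr k N); have h2 := key x k _ Ax kn.
  have h3 : `|f (maxn k N) x - f k x| <= Num.sqrt B.
    by rewrite -(ler_pXn2r (n:=2)) ?nnegrE ?sqrtr_ge0// sqr_sqrtr// real_normK ?num_real.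
  apply: le_trans (ler_distD (f (maxn k N) x) _ _) _.
  by rewrite lerD// distrC.
rewrite ge0_integralZl//.
apply: (@le_trans _ _ ((2 * 2^-1 ^+ k)%:E * 2%:E)%E).
  by rewrite lee_wpmul2l// lee_fin ltW.
by rewrite -EFinM lee_fin le_eqVlt; apply/orP; left; apply/eqP; ring.
Unshelve. all: by end_near.
Qed.

Lemma cL2_complete (u : nat -> cL2 mu) : cauchy_seq u -> exists l, tends u l.
Proof.
move=> hu.
have sub k : exists N, forall m n, (N <= m)%N -> (m <= n)%N -> nrm (u n - u m) <= 2^-1 ^+ k.
  by apply: hu; rewrite exprn_gt0// invr_gt0.
pose N k := projT1 (cid (sub k)).
have NP k m n : (N k <= m)%N -> (m <= n)%N -> nrm (u n - u m) <= 2^-1 ^+ k.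
  exact: (projT2 (cid (sub k)) m n).
(* Increasing indices along which consecutive terms differ by at most 2^-k, so that [real_L2_limit]
   applies to the real and the imaginary parts. *)
pose s := fix s k := if k is k'.+1 then maxn (s k') (N k'.+1) else N 0%N.
have sN k : (N k <= s k)%N by case: k => [|k] //=; rewrite leq_maxr.
have ss k : (s k <= s k.+1)%N by rewrite /= leq_maxl.
pose f k := cL2_repr (u (s k)).
have step k : sq_norm (f k.+1 - f k) <= 2^-1 ^+ k.
  have -> : sq_norm (f k.+1 - f k) = nrm (u (s k.+1) - u (s k)).
    by rewrite -cL2_nrm_class cL2_classB !cL2_reprK.
  exact: NP (sN k) (ss k).
have e4 k : (2^-1 ^+ k) ^+ 2 = 4^-1 ^+ k :> R.
  by rewrite -exprM mulnC exprM; congr (_ ^+ _); lra.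
have [gr mgr hgr] : exists2 g : T -> R, measurable_fun setT g &
    forall k, (\int[mu]_x ((g x - Re (f k x)) ^+ 2)%:E <= (4 * 2^-1 ^+ k)%:E)%E.
  apply: (@real_L2_limit (fun k x => Re (f k x))) => k; first exact: Lfun2_meas (sqint_Re _).
  rewrite -e4; have [h _] := sq_norm_parts (step k); apply: le_trans h.
  rewrite le_eqVlt; apply/orP; left; apply/eqP; apply: eq_integral => x _.
  by rewrite -[(f k.+1 - f k) x]/(f k.+1 x - f k x) ReD; case: (f k x).
have [gi mgi hgi] : exists2 g : T -> R, measurable_fun setT g &
    forall k, (\int[mu]_x ((g x - Im (f k x)) ^+ 2)%:E <= (4 * 2^-1 ^+ k)%:E)%E.
  apply: (@real_L2_limit (fun k x => Im (f k x))) => k; first exact: Lfun2_meas (sqint_Im _).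
  rewrite -e4; have [_ h] := sq_norm_parts (step k); apply: le_trans h.
  rewrite le_eqVlt; apply/orP; left; apply/eqP; apply: eq_integral => x _.
  by rewrite -[(f k.+1 - f k) x]/(f k.+1 x - f k x) ImD; case: (f k x).
have Lg (g : T -> R) (h : T -> R) : measurable_fun setT g -> h \in Lfun mu 2%:E ->
    (\int[mu]_x ((g x - h x) ^+ 2)%:E <= (4 * 2^-1 ^+ 0)%:E)%E -> g \in Lfun mu 2%:E.
  move=> mg hh hi; have gh : (fun x => g x - h x) \in Lfun mu 2%:E.
    apply: Lfun2P; first by apply: measurable_funB => //; exact: Lfun2_meas.
    exact: le_lt_trans hi (ltry _).
  have one_le2 : (1 <= 2%:E :> \bar R)%E by rewrite lee_fin ler1n.
  have [_ LD] := Lfun_submod_closed mu one_le2.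
  have -> : g = 1 *: (fun x => g x - h x) + h.
    by apply/funext => x; rewrite scale1r /= -[LHS](subrK (h x)).
  exact: LD.
have gS : (fun x => gr x +i* gi x) \in sqint mu.
  apply/andP; split; first exact: Lg mgr (sqint_Re (f 0%N)) (hgr 0%N).
  exact: Lg mgi (sqint_Im (f 0%N)) (hgi 0%N).
pose G := SqintFun gS.
have hG k : nrm (u (s k) - cL2_class G) ^+ 2 <= 8 * 2^-1 ^+ k.
  have -> : u (s k) - cL2_class G = cL2_class (f k - G).
    by rewrite cL2_classB cL2_reprK.
  rewrite cL2_nrm_class -lee_fin sq_norm_sqr.
  under eq_integral do rewrite EFinD.
  have mR : measurable_fun setT (fun x => Re ((f k - G) x)) := Lfun2_meas (sqint_Re _).
  have mI : measurable_fun setT (fun x => Im ((f k - G) x)) := Lfun2_meas (sqint_Im _).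
  rewrite ge0_integralD//; first last.
  - by apply/measurable_EFinP; exact: measurable_funX.
  - by move=> x _; rewrite lee_fin sqr_ge0.
  - by apply/measurable_EFinP; exact: measurable_funX.
  - by move=> x _; rewrite lee_fin sqr_ge0.
  have -> : 8 * 2^-1 ^+ k = 4 * 2^-1 ^+ k + 4 * 2^-1 ^+ k :> R by ring.
  rewrite EFinD leeD//.
    apply: le_trans (hgr k); rewrite le_eqVlt; apply/orP; left; apply/eqP.
    apply: eq_integral => x _; rewrite -[(f k - G) x]/(f k x - (gr x +i* gi x)).
    by rewrite -sqrrN; congr ((_ ^+ 2)%:E); case: (f k x) => a b /=; ring.
  apply: le_trans (hgi k); rewrite le_eqVlt; apply/orP; left; apply/eqP.
  apply: eq_integral => x _; rewrite -[(f k - G) x]/(f k x - (gr x +i* gi x)).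
  by rewrite -sqrrN; congr ((_ ^+ 2)%:E); case: (f k x) => a b /=; ring.
exists (cL2_class G) => e e0; have e2 : 0 < e / 2 by lra.
have [k1 h1] := geom_small 8 (exprn_gt0 2 e2); have [k2 h2] := geom_small 1 e2.
have gle (a b : nat) : (a <= b)%N -> 2^-1 ^+ b <= 2^-1 ^+ a :> R.
  by move=> ab; rewrite ler_wiXn2l// ?invr_ge0 ?invf_le1 ?ler1n.
pose k := maxn k1 k2; exists (s k) => n sn; rewrite [e]splitr.
apply: le_trans (nrm_tri (u (s k)) _ _) (lerD _ _).
  apply: le_trans (NP k _ _ (sN k) sn) _; apply: le_trans (ltW h2).
  by rewrite mul1r gle// leq_maxr.
rewrite -(ler_pXn2r (n:=2)) ?nnegrE ?(ltW e2)//.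
apply: le_trans (hG k) _; apply: le_trans (ltW h1).
by rewrite ler_wpM2l// gle// leq_maxl.
Qed.

End L2Complete.

(** * Absolutely continuous functions *)

Section AbsoluteContinuity.
Variables (R : realType) (omega : R).
Hypothesis omega0 : 0 < omega.
Local Notation lam := (@lebesgue_measure R).
Implicit Types (f g h : R -> R[i]) (t s : R).

Lemma near_within_dnbhs (I : set R) t (P : R -> Prop) :
  (\forall s \near within I t^', P s) <->
  exists2 eta : R, 0 < eta & forall s, `|s - t| < eta -> s != t -> I s -> P s.
Proof.
rewrite near_withinE /dnbhs near_withinE; split.
  move=> /nbhs_ballP[d /= d0 hd]; exists d => // s sd st Is.
  by apply: hd => //; rewrite /ball/= distrC.
move=> [d d0 hd]; apply/nbhs_ballP; exists d => //= s; rewrite /ball/= distrC.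
by move=> sd st Is; exact: hd.
Qed.

(** Multiplying by s - t removes the quotient, the exceptional point s = t and the separation into
    real and imaginary parts. *)
Lemma is_derivP f t l : is_deriv omega f t l <->
  forall e : R, 0 < e -> exists2 eta : R, 0 < eta & forall s, s \in `[0, omega] ->
    `|s - t| < eta -> nrm (f s - f t - (s - t)%:C * l) <= e * `|s - t|.
Proof.
have dqE s : s != t -> f s - f t - (s - t)%:C * l =
    (s - t)%:C * ((s - t)^-1%:C * (f s - f t) - l).
  move=> st; rewrite mulrBr mulrA -rmorphM mulfV ?subr_eq0//.
  by rewrite rmorph1 mul1r.
split=> [[/cvgrPdist_le hr /cvgrPdist_le hi] e e0|hd].
  have e2 : 0 < e / 2 by lra.
  have /near_within_dnbhs[d1 p1 h1] := hr _ e2.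
  have /near_within_dnbhs[d2 p2 h2] := hi _ e2.
  exists (Num.min d1 d2) => [|s sI]; first by rewrite lt_min p1 p2.
  rewrite lt_min => /andP[s1 s2]; have [->|st] := eqVneq s t.
    by rewrite !subrr mul0r subr0 nrm0 normr0 mulr0.
  rewrite dqE// nrmM nrm_real mulrC ler_wpM2r//.
  apply: le_trans (nrm_ReIm _) _; have := h1 s s1 st sI; have := h2 s s2 st sI.
  rewrite !(distrC _ (_ (_ * _))).
  by rewrite !ReD !ImD; case: l {hr hi h1 h2 dqE} => a b /=; lra.
have H (P : R[i] -> R) : (forall z, `|P z| <= nrm z) -> (forall x y, P (x - y) = P x - P y) ->
    P ((s - t)^-1%:C * (f s - f t)) @[s --> within `[0, omega] t^'] --> P l.
  move=> P1 PB; apply/cvgrPdist_le => e e0; have [d d0 h] := hd _ e0.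
  apply/near_within_dnbhs; exists d => // s sd st sI.
  rewrite distrC -PB; apply: le_trans (P1 _) _; have := h s sI sd.
  rewrite dqE// nrmM nrm_real mulrC ler_pM2r// normr_gt0 subr_eq0//.
split; apply: H; [exact: Re_nrm| |exact: Im_nrm|].
  by move=> x y; rewrite ReD; case: y.
by move=> x y; rewrite ImD; case: y.
Qed.

Lemma is_deriv_lin f g t l l' (k : R[i]) : is_deriv omega f t l -> is_deriv omega g t l' ->
  is_deriv omega (fun s => k * f s + g s) t (k * l + l').
Proof.
move=> /is_derivP hf /is_derivP hg; apply/is_derivP => e e0.
have k1 : 0 < nrm k + 1 by have := nrm_ge0 k; lra.
have e2 : 0 < e / 2 / (nrm k + 1) by rewrite !divr_gt0.
have e3 : 0 < e / 2 by lra.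
have [d1 p1 h1] := hf _ e2; have [d2 p2 h2] := hg _ e3.
exists (Num.min d1 d2) => [|s sI]; first by rewrite lt_min p1 p2.
rewrite lt_min => /andP[s1 s2].
have -> : k * f s + g s - (k * f t + g t) - (s - t)%:C * (k * l + l') =
  k * (f s - f t - (s - t)%:C * l) + (g s - g t - (s - t)%:C * l') by ring.
apply: le_trans (nrmD _ _) _; rewrite nrmM [e]splitr mulrDl lerD//; last exact: h2.
apply: le_trans (ler_wpM2l (nrm_ge0 k) (h1 s sI s1)) _.
rewrite mulrA ler_wpM2r// mulrA ler_pdivrMr// mulrC ler_wpM2l ?(ltW e3)//; lra.
Qed.

Definition bounded_on f (M : R) := forall s, s \in `[0, omega] -> nrm (f s) <= M.

Lemma is_derivM f g t l l' (M : R) : t \in `[0, omega] -> bounded_on g M ->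
  is_deriv omega f t l -> is_deriv omega g t l' ->
  is_deriv omega (fun s => f s * g s) t (l * g t + f t * l').
Proof.
move=> tI gM /is_derivP hf /is_derivP hg; apply/is_derivP => e e0.
have M0 : 0 <= M by apply: le_trans (gM t tI).
pose Q := M + nrm (f t) + nrm l * (nrm l' + 1) + 1.
have q1 : 0 <= nrm l * (nrm l' + 1) by rewrite mulr_ge0// addr_ge0.
have Q0 : 0 < Q by rewrite /Q; have := nrm_ge0 (f t); lra.
have e2 : 0 < e / Q by rewrite divr_gt0.
have [d1 p1 h1] := hf _ e2; have [d2 p2 h2] := hg _ e2.
have [d3 p3 h3] := hg _ ltr01.
exists (Num.min (Num.min d1 d2) (Num.min d3 (e / Q))) => [|s sI].
  by rewrite !lt_min p1 p2 p3.
rewrite !lt_min => /andP[/andP[s1 s2] /andP[s3 s4]].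
have -> : f s * g s - f t * g t - (s - t)%:C * (l * g t + f t * l') =
  (f s - f t - (s - t)%:C * l) * g s + f t * (g s - g t - (s - t)%:C * l')
  + (s - t)%:C * l * (g s - g t) by ring.
have b1 : nrm ((f s - f t - (s - t)%:C * l) * g s) <= e / Q * M * `|s - t|.
  rewrite nrmM mulrAC; apply: ler_pM => //; [exact: h1|exact: gM].
have b2 : nrm (f t * (g s - g t - (s - t)%:C * l')) <= e / Q * nrm (f t) * `|s - t|.
  by rewrite nrmM mulrAC mulrC ler_wpM2r//; exact: h2.
have b3 : nrm (g s - g t) <= (nrm l' + 1) * (e / Q).
  have : nrm (g s - g t) <= (nrm l' + 1) * `|s - t|.
    have := nrmD (g s - g t - (s - t)%:C * l') ((s - t)%:C * l'); rewrite subrK.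
    move=> /le_trans; apply; rewrite nrmM nrm_real mulrDl addrC mulrC mul1r lerD2l.
    by have := h3 s sI s3; rewrite mul1r.
  move=> /le_trans; apply; rewrite ler_wpM2l ?(ltW s4)//.
  by have := nrm_ge0 l'; lra.
have b4 : nrm ((s - t)%:C * l * (g s - g t)) <=
    e / Q * (nrm l * (nrm l' + 1)) * `|s - t|.
  rewrite !nrmM nrm_real -mulrA mulrC ler_wpM2r//.
  by apply: le_trans (ler_wpM2l (nrm_ge0 l) b3) _; rewrite le_eqVlt; apply/orP; left; apply/eqP; ring.
apply: le_trans (nrmD _ _) _; apply: le_trans (lerD (nrmD _ _) (lexx _)) _.
apply: le_trans (lerD (lerD b1 b2) b4) _; rewrite -!mulrDl ler_wpM2r// -!mulrDr.
rewrite mulrAC ler_pdivrMr// ler_wpM2l ?(ltW e0)// /Q; lra.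
Qed.

Lemma abs_continuous_nrm f : abs_continuous omega f <->
  forall e : R, 0 < e -> exists2 d : R, 0 < d & forall (n : nat) (u v : nat -> R),
    (forall i, (i < n)%N -> [/\ 0 <= u i, u i <= v i & v i <= omega]) ->
    trivIset `I_n (fun i => `]u i, v i[%classic) ->
    \sum_(0 <= i < n) (v i - u i) < d ->
    \sum_(0 <= i < n) nrm (f (v i) - f (u i)) < e.
Proof.
have E n (u v : nat -> R) : \sum_(0 <= i < n) `|f (v i) - f (u i)| =
    (\sum_(0 <= i < n) nrm (f (v i) - f (u i)))%:C.
  by rewrite rmorph_sum/=; apply: eq_bigr => i _; rewrite nrmE.
split=> h e e0; have [d d0 hd] := h e e0; exists d => // n u v h1 h2 h3.
  by have := hd n u v h1 h2 h3; rewrite E ltcR.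
by rewrite E ltcR; exact: hd.
Qed.

Lemma abs_continuous_lin f g (k : R[i]) : abs_continuous omega f -> abs_continuous omega g ->
  abs_continuous omega (fun s => k * f s + g s).
Proof.
move=> /abs_continuous_nrm hf /abs_continuous_nrm hg; apply/abs_continuous_nrm => e e0.
have k1 : 0 < nrm k + 1 by have := nrm_ge0 k; lra.
have e2 : 0 < e / 2 / (nrm k + 1) by rewrite !divr_gt0.
have e3 : 0 < e / 2 by lra.
have [d1 p1 h1] := hf _ e2; have [d2 p2 h2] := hg _ e3.
exists (Num.min d1 d2) => [|n u v uv tr]; first by rewrite lt_min p1 p2.
rewrite lt_min => /andP[s1 s2].
apply: (@le_lt_trans _ _ ((nrm k + 1) * \sum_(0 <= i < n) nrm (f (v i) - f (u i)) +
   \sum_(0 <= i < n) nrm (g (v i) - g (u i)))).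
  rewrite mulr_sumr -big_split/=; apply: ler_sum => i _.
  have -> : k * f (v i) + g (v i) - (k * f (u i) + g (u i)) =
     k * (f (v i) - f (u i)) + (g (v i) - g (u i)) by ring.
  apply: le_trans (nrmD _ _) _; rewrite lerD2r nrmM ler_wpM2r//; lra.
rewrite [e]splitr ltrD//; last exact: h2.
by rewrite mulrC -ltr_pdivlMr//; exact: h1.
Qed.

Lemma lipschitz_abs_continuous f (M : R) : 0 <= M ->
  (forall s t, s \in `[0, omega] -> t \in `[0, omega] -> nrm (f s - f t) <= M * `|s - t|) ->
  abs_continuous omega f.
Proof.
move=> M0 hM; apply/abs_continuous_nrm => e e0; have M1 : 0 < M + 1 by lra.
exists (e / (M + 1)) => [|n u v uv _ s1]; first by rewrite divr_gt0.
apply: (@le_lt_trans _ _ ((M + 1) * \sum_(0 <= i < n) (v i - u i))); last first.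
  by rewrite mulrC -ltr_pdivlMr.
rewrite mulr_sumr big_nat [leRHS]big_nat; apply: ler_sum => i /andP[_ /uv[a b c]].
have vI : v i \in `[0, omega] by rewrite in_itv/= c (le_trans a b).
have uI : u i \in `[0, omega] by rewrite in_itv/= a (le_trans b c).
apply: le_trans (hM _ _ vI uI) _; rewrite ger0_norm ?subr_ge0// ler_wpM2r ?subr_ge0//; lra.
Qed.

Lemma abs_continuous_uniform f : abs_continuous omega f ->
  forall e : R, 0 < e -> exists2 d : R, 0 < d & forall s t, s \in `[0, omega] ->
    t \in `[0, omega] -> `|s - t| < d -> nrm (f s - f t) <= e.
Proof.
move=> /abs_continuous_nrm h e e0; have [d d0 hd] := h e e0; exists d => //.
suff H s t : s \in `[0, omega] -> t \in `[0, omega] -> t <= s -> `|s - t| < d -> nrm (f s - f t) <= e.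
  move=> s t sI tI; have [ts|/ltW st] := leP t s; first exact: H.
  by rewrite distrC nrm_sym; exact: H.
rewrite !in_itv/= => /andP[s0 s1] /andP[t0 t1] ts; rewrite ger0_norm ?subr_ge0// => sd.
have := hd 1%N (fun=> t) (fun=> s); rewrite !big_nat1 => /(_ _ _ sd)/ltW; apply.
  by move=> i _; split.
by move=> [|i] [|j].
Qed.

Lemma abs_continuous_bounded f : abs_continuous omega f -> exists M, bounded_on f M.
Proof.
move=> /abs_continuous_uniform/(_ _ ltr01)[d d0 h].
have b (n : nat) : exists M, forall s, s \in `[0, omega] -> s <= n%:R * (d / 2) -> nrm (f s) <= M.
  elim: n => [|n [M hM]].
    exists (nrm (f 0)) => s; rewrite in_itv/= mul0r => /andP[s0 _] s1.
    by have -> : s = 0 by apply/eqP; rewrite eq_le s0 s1.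
  have [w|w] := leP (n%:R * (d / 2)) omega; last first.
    exists M => s sI _; apply: hM => //; move: sI; rewrite in_itv/= => /andP[_ s1].
    exact: le_trans s1 (ltW w).
  exists (M + 1) => s sI sn; have [sm|/ltW ms] := leP s (n%:R * (d / 2)).
    by apply: le_trans (hM s sI sm) _; lra.
  have tI : n%:R * (d / 2) \in `[0, omega] by rewrite in_itv/= w mulr_ge0// divr_ge0// ltW.
  have k1 := hM _ tI (lexx _).
  have k2 : nrm (f s - f (n%:R * (d / 2))) <= 1.
    apply: h => //; rewrite ger0_norm ?subr_ge0//.
    move: sn; rewrite -[n.+1%:R]natr1 mulrDl mul1r; lra.
  have := nrmD (f s - f (n%:R * (d / 2))) (f (n%:R * (d / 2))); rewrite subrK; lra.
have [M hM] := b (Num.bound (omega / (d / 2))); exists M => s sI; apply: hM => //.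
move: sI; rewrite in_itv/= => /andP[_ s1]; apply: le_trans s1 _.
have d2 : 0 < d / 2 by lra.
rewrite -ler_pdivrMr//; apply: ltW; apply: archi_boundP.
by rewrite divr_ge0// ltW.
Qed.

Lemma abs_continuousM f g : abs_continuous omega f -> abs_continuous omega g ->
  abs_continuous omega (fun s => f s * g s).
Proof.
move=> hf hg; have [Mf bf] := abs_continuous_bounded hf; have [Mg bg] := abs_continuous_bounded hg.
have zI : 0 \in `[0, omega] by rewrite in_itv/= lexx ltW.
have Mf0 : 0 <= Mf by apply: le_trans (bf 0 zI).
have Mg0 : 0 <= Mg by apply: le_trans (bg 0 zI).
move: hf hg => /abs_continuous_nrm hf /abs_continuous_nrm hg; apply/abs_continuous_nrm => e e0.
have f1 : 0 < Mf + 1 by lra.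
have g1 : 0 < Mg + 1 by lra.
have e2 : 0 < e / 2 / (Mg + 1) by rewrite !divr_gt0.
have e3 : 0 < e / 2 / (Mf + 1) by rewrite !divr_gt0.
have [d1 p1 h1] := hf _ e2; have [d2 p2 h2] := hg _ e3.
exists (Num.min d1 d2) => [|n u v uv tr]; first by rewrite lt_min p1 p2.
rewrite lt_min => /andP[s1 s2].
apply: (@le_lt_trans _ _ ((Mg + 1) * \sum_(0 <= i < n) nrm (f (v i) - f (u i)) +
   (Mf + 1) * \sum_(0 <= i < n) nrm (g (v i) - g (u i)))).
  rewrite !mulr_sumr -big_split/= big_nat [leRHS]big_nat; apply: ler_sum => i /andP[_ /uv[a b c]].
  have vI : v i \in `[0, omega] by rewrite in_itv/= c (le_trans a b).
  have uI : u i \in `[0, omega] by rewrite in_itv/= a (le_trans b c).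
  have -> : f (v i) * g (v i) - f (u i) * g (u i) =
     (f (v i) - f (u i)) * g (v i) + f (u i) * (g (v i) - g (u i)) by ring.
  apply: le_trans (nrmD _ _) _; rewrite !nrmM; apply: lerD.
    by rewrite mulrC ler_wpM2r//; apply: le_trans (bg _ vI) _; lra.
  by rewrite ler_wpM2r//; apply: le_trans (bf _ uI) _; lra.
rewrite [e]splitr ltrD//.
  by rewrite mulrC -ltr_pdivlMr//; exact: h1.
by rewrite mulrC -ltr_pdivlMr//; exact: h2.
Qed.

Lemma null_cover (A : set R) (d : R) : lam.-negligible A -> 0 < d ->
  exists2 O : set R, open O & A `<=` O /\ (lam O < d%:E)%E.
Proof.
move=> [B [mB B0 AB]] d0.
have [|U [oU BU Ud]] := @lebesgue_regularity_outer R B d mB _ d0.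
  by apply: (@eq_ind _ 0%E (fun x => (x < +oo)%E)) => //; rewrite -[RHS]B0.
exists U => //; split; first exact: subset_trans AB BU.
have mU : measurable U by exact: open_measurable.
apply: (@le_lt_trans _ _ (lam (U `\` B) + lam B)%E); last by rewrite B0 adde0.
rewrite -measureU//; last 2 first.
  exact: measurableD.
  by rewrite setDE -setIA setICl setI0.
apply: le_measure; rewrite ?inE//; first by apply: measurableU => //; exact: measurableD.
by move=> x Ux; have [Bx|nB] := pselect (B x); [right|left].
Qed.

Lemma disjoint_itv_length (n : nat) (u v : nat -> R) (O : set R) : measurable O ->
  (forall i, (i < n)%N -> u i <= v i /\ `]u i, v i[ `<=` O) ->
  trivIset `I_n (fun i => `]u i, v i[%classic) ->
  ((\sum_(0 <= i < n) (v i - u i))%:E <= lam O)%E.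
Proof.
move=> mO uv tr.
have -> : ((\sum_(0 <= i < n) (v i - u i)%R)%:E = \sum_(0 <= i < n) lam `]u i, v i[%classic)%E.
  rewrite -sumEFin big_nat [RHS]big_nat; apply: eq_bigr => i /andP[_ /uv[a _]].
  by rewrite lebesgue_measure_itv/= lte_fin; case: ltgtP a => // ->; rewrite subrr.
have mI (i : 'I_n) : measurable (`]u i, v i[%classic : set (measurableTypeR R)).
  exact: measurable_itv.
have E := @measure_bigsetU_ord_cond _ _ _ (lam : {measure set (measurableTypeR R) -> \bar R})
  n xpredT (fun i => `]u i, v i[%classic) (fun i _ => mI i).
rewrite big_mkord -[X in (X <= _)%E]E; last first.
  move=> i j _ _ xy; apply/val_inj; apply: (tr _ _ (ltn_ord i) (ltn_ord j)); exact: xy.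
apply: le_measure; rewrite ?inE//; first exact: bigsetU_measurable.
rewrite -(bigcup_mkord n (fun i => `]u i, v i[%classic)) => x [i /= /uv[_ h] xi]; exact: h.
Qed.

(** The exceptional null set is covered by an open set Q of measure below d. Moving from 0 to omega,
    h grows at rate at most e where its derivative is 0, and elsewhere along finitely many disjoint
    intervals inside Q, on which absolute continuity allows less than e in total. A supremum
    argument takes the place of a covering theorem. *)
Lemma abs_continuous_zero_deriv h : abs_continuous omega h ->
  {ae lam, forall t, t \in `[0, omega] -> is_deriv omega h t 0} -> h omega = h 0.
Proof.
move=> /abs_continuous_nrm hac hae; apply/eqP; rewrite -subr_eq0; apply/eqP/nrm_le0.
have w1 : 0 < omega + 1 by rewrite addr_gt0.
apply/ler_addgt0Pl => e' e'0; rewrite addr0.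
pose e : R := e' / (omega + 1).
have e0 : 0 < e by rewrite divr_gt0.
have [d d0 hd] := hac e e0.
have [Q oQ [AQ Qd]] := null_cover hae d0.
(* A family records the intervals of Q used up to s; their contribution is not estimated until the
   end, when their total length is known to be below d. *)
pose fam s (n : nat) (u v : nat -> R) := [/\
  forall i, (i < n)%N -> [/\ 0 <= u i, u i <= v i, v i <= s & `]u i, v i[ `<=` Q],
  trivIset `I_n (fun i => `]u i, v i[%classic) &
  nrm (h s - h 0) <= e * s + \sum_(0 <= i < n) nrm (h (v i) - h (u i))].
pose S := [set s | 0 <= s <= omega /\ exists n u v, fam s n u v].
have S0 : S 0.
  split; first by rewrite lexx ltW.
  exists 0%N, (fun=> 0), (fun=> 0); split=> [i //|[]//|].
  by rewrite subrr nrm0 mulr0 add0r big_geq.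
have Sub : ubound S omega by move=> s [/andP[]].
have hasS : has_sup S by split; [exists 0|exists omega].
set c := sup S.
have c0 : 0 <= c by apply: ub_le_sup => //; case: hasS.
have cw : c <= omega by apply: ge_sup => //; exists 0.
have cI : c \in `[0, omega] by rewrite in_itv/= c0.
have step : exists2 eta : R, 0 < eta & forall s t, S s -> c - eta < s -> s <= c -> c <= t ->
     t < c + eta -> t <= omega -> S t.
  have [dc|ndc] := pselect (is_deriv omega h c 0).
    have /is_derivP/(_ _ e0)[eta eta0 he] := dc; exists eta => // s t [/andP[s0 s1] [n [u [v [f1 f2 f3]]]]] cs sc ct te tw.
    split; first by rewrite (le_trans c0 ct).
    exists n, u, v; split=> //.
      by move=> i /f1[a b b' b'']; split=> //; exact: le_trans b' (le_trans sc ct).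
    have k1 : nrm (h t - h c) <= e * (t - c).
      have := he t; rewrite mulr0 subr0 ger0_norm ?subr_ge0//; apply; last lra.
      by rewrite in_itv/= tw (le_trans c0 ct).
    have k2 : nrm (h s - h c) <= e * (c - s).
      have := he s; rewrite mulr0 subr0 distrC ger0_norm ?subr_ge0//; apply; last lra.
      by rewrite in_itv/= s0.
    have t1 := nrm_tri (h c) (h t) (h 0); have t2 := nrm_tri (h s) (h c) (h 0).
    rewrite (nrm_sym (h c) (h s)) in t2.
    by move: f3 k1 k2 t1 t2; set X := \sum_(_ <= _ < _) _; lra.
  (* At an exceptional point c the interval from s to t is appended to the family; it lies in Q for
     s and t close to c. *)
  have cQ : Q c by apply: AQ => /=; move=> /(_ cI).
  have /nbhs_ballP[eta /= eta0 he] : nbhs c Q by exact: open_nbhs_nbhs.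
  exists eta => // s t [/andP[s0 s1] [n [u [v [f1 f2 f3]]]]] cs sc ct te tw.
  split; first by rewrite (le_trans c0 ct).
  have st := le_trans sc ct.
  exists n.+1, (fun i => if (i < n)%N then u i else s), (fun i => if (i < n)%N then v i else t).
  split.
  - move=> i; rewrite ltnS leq_eqVlt => /predU1P[->|iN].
      rewrite ltnn; split=> // x; rewrite /= in_itv/= => /andP[x1 x2]; apply: he.
      by rewrite /ball/= ltr_norml; lra.
    by rewrite iN; have [a b b' b''] := f1 i iN; split=> //; exact: le_trans b' st.
  - have dis i x : (i < n)%N -> `]u i, v i[%classic x -> `]s, t[%classic x -> False.
      move=> iN; rewrite /= !in_itv/= => /andP[_ x1] /andP[x2 _].
      by have [_ _ b' _] := f1 i iN; lra.
    move=> i j /=; rewrite (ltnS i n) (ltnS j n) (leq_eqVlt i n) (leq_eqVlt j n).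
    move=> /predU1P[->|iN] /predU1P[->|jN] //; rewrite ?ltnn ?iN ?jN.
    + by move=> [x [x1 x2]]; case: (dis j x jN).
    + by move=> [x [x1 x2]]; case: (dis i x iN).
    + exact: f2.
  rewrite big_nat_recr//= ltnn.
  rewrite (eq_big_nat _ _ (F2 := fun i => nrm (h (v i) - h (u i)))); last first.
    by move=> i /andP[_ iN]; rewrite iN.
  have t1 := nrm_tri (h s) (h t) (h 0).
  have : e * s <= e * t by rewrite ler_wpM2l// ltW.
  by move: f3 t1; set X := \sum_(_ <= _ < _) _; lra.
have [eta eta0 hstep] := step.
have [s Ss cs] := sup_adherent eta0 hasS.
have sc : s <= c by apply: ub_le_sup => //; case: hasS.
have Sc : S c by apply: (hstep s) => //; lra.
have cweq : c = omega.
  apply/eqP; rewrite eq_le cw /= leNgt; apply/negP => cw'.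
  pose t := Num.min omega (c + eta / 2).
  have ct : c < t by rewrite lt_min cw'/=; lra.
  have tw : t <= omega by rewrite ge_min lexx.
  have te : t <= c + eta / 2 by rewrite ge_min lexx orbT.
  have St : S t by apply: (hstep c) => //; lra.
  have : t <= c by apply: ub_le_sup => //; case: hasS.
  by rewrite leNgt ct.
move: Sc; rewrite cweq => -[_ [n [u [v [f1 f2 f3]]]]].
apply: le_trans f3 _.
have lt : \sum_(0 <= i < n) nrm (h (v i) - h (u i)) < e.
  apply: hd => //; first by move=> i /f1[].
  rewrite -lte_fin; apply: le_lt_trans Qd; apply: disjoint_itv_length => //.
    exact: open_measurable.
  by move=> i /f1[].
have : e' = e * omega + e by rewrite -{2}[e]mulr1 -mulrDr /e divfK// gt_eqF.
by move=> ->; rewrite lerD2l ltW.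
Qed.

End AbsoluteContinuity.

(** * Primitives and the fundamental theorem of calculus *)

Section Calculus.
Variables (R : realType) (omega : R).
Hypothesis omega0 : 0 < omega.
Local Notation lam := (@lebesgue_measure R).
Local Notation I := (`[0, omega]%classic : set R).
Implicit Types (f g h : R -> R[i]) (t s : R).

Lemma ae_lamS (P Q : R -> Prop) : (forall t, P t -> Q t) -> {ae lam, forall t, P t} ->
  {ae lam, forall t, Q t}.
Proof. by move=> PQ [N [mN N0 hN]]; exists N; split=> // t /= nQ; apply: hN => /PQ. Qed.

Lemma ae_lamI (P Q : R -> Prop) : {ae lam, forall t, P t} -> {ae lam, forall t, Q t} ->
  {ae lam, forall t, P t /\ Q t}.
Proof.
move=> hP hQ; have hU := negligibleU hP hQ; apply: negligibleS hU => t /= nPQ.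
by have [Pt|nPt] := pselect (P t); [right => Qt; exact: nPQ|left].
Qed.

(** Absolute continuity of the integral of |r| over the union of the intervals. [primB] produces
    half-open intervals and [abs_continuous] open ones; they differ by null sets. *)
Lemma small_integral_disjoint (r : R -> R) : lam.-integrable I (EFin \o r) ->
  forall e : R, 0 < e -> exists2 d : R, 0 < d & forall (n : nat) (u v : nat -> R),
    (forall i, (i < n)%N -> [/\ 0 <= u i, u i <= v i & v i <= omega]) ->
    trivIset `I_n (fun i => `]u i, v i[%classic) ->
    \sum_(0 <= i < n) (v i - u i) < d ->
    \sum_(0 <= i < n) `| \int[lam]_(t in `]u i, v i]) r t | < e.
Proof.
move=> ir e e0; pose f := r \_ I.
have intf : lam.-integrable setT (EFin \o f).
  by rewrite -restrict_EFin -integrable_mkcond.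
have [d [d0 hd]] := integral_normr_continuous intf e0.
exists d => // n u v uv tr sd.
pose F i : set (measurableTypeR R) := `]u i, v i[%classic.
have mF i : measurable (F i) by exact: measurable_itv.
pose A := \big[setU/set0]_(0 <= i < n) F i.
have mA : measurable A by apply: bigsetU_measurable => i _; exact: mF.
have tr' : trivIset [set` index_iota 0 n] F.
  by apply: sub_trivIset tr => i /=; rewrite mem_index_iota.
have lA : (lam A < d%:E)%E.
  apply: (@eq_ind_r _ (\sum_(0 <= i < n) (v i - u i))%:E (fun z => (z < d%:E)%E)).
    by rewrite lte_fin.
  transitivity (\sum_(0 <= i < n) lam (F i))%E.
    have mI' (i : 'I_n) : measurable (F i) by [].
    have := @measure_bigsetU_ord_cond _ _ _ (lam : {measure set (measurableTypeR R) -> \bar R})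
      n xpredT (fun i => F i) (fun i _ => mI' i).
    rewrite /A !big_mkord; apply.
    move=> i j _ _ xy; apply/val_inj; apply: (tr _ _ (ltn_ord i) (ltn_ord j)); exact: xy.
  rewrite -sumEFin big_nat [RHS]big_nat; apply: eq_bigr => i /andP[_ /uv[_ a _]].
  by rewrite /F lebesgue_measure_itv/= lte_fin; case: ltgtP a => // ->; rewrite subrr.
have FI i : (i < n)%N -> F i `<=` I.
  move=> /uv[a _ b] x; rewrite /F /= !in_itv/= => /andP[x1 x2].
  by rewrite (le_trans a (ltW x1)) (le_trans (ltW x2) b).
have iF i : (i < n)%N -> lam.-integrable `]u i, v i] (EFin \o r).
  move=> /uv[a _ b]; apply: (@integrableS _ _ _ lam I) ir => //; try exact: measurable_itv.
  by apply: subset_itv; rewrite bnd_simp.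
apply: le_lt_trans (hd A mA lA); rewrite -lee_fin -sumEFin.
have iA : lam.-integrable A (EFin \o f) by apply: integrableS intf.
rewrite [X in (_ <= X%:E)%E]/Rintegral fineK; last first.
  apply: integrable_fin_num => //.
  by have := integrable_abse iA; apply: eq_integrable => // x _ /=.
rewrite (@ge0_integral_bigsetU _ _ _ _ _ F (fun t => `|f t|%:E) (index_iota 0 n) mF (iota_uniq _ _) tr').
- rewrite big_nat [leRHS]big_nat; apply: lee_sum => i /andP[_ iN].
  rewrite -Rintegral_itv_bndo_bndc; last first.
    apply: (@integrableS _ _ _ lam `]u i, v i]) (iF i iN) => //; try exact: measurable_itv.
    by apply: subset_itv; rewrite bnd_simp.
  have iFo : lam.-integrable (F i) (EFin \o r).
    apply: (@integrableS _ _ _ lam `]u i, v i]) (iF i iN) => //; try exact: measurable_itv.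
    by apply: subset_itv; rewrite bnd_simp.
  apply: le_trans (_ : (\int[lam]_(t in F i) `|r t|)%:E <= _)%E.
    rewrite lee_fin; exact: le_normr_Rintegral.
  rewrite /Rintegral fineK; last first.
    apply: integrable_fin_num => //.
    by have := integrable_abse iFo; apply: eq_integrable => // x _ /=.
  rewrite le_eqVlt; apply/orP; left; apply/eqP; apply: eq_integral => x /set_mem xF.
  by rewrite /f patchE mem_set//; exact: FI xF.
- by apply: measurable_int (integrable_abse iA).
- by move=> x _; rewrite lee_fin.
Qed.

Definition prim g t := cintegral lam `[0, t] g.

Lemma cintegrable_sub f (A : set R) : measurable (A : set (measurableTypeR R)) -> A `<=` I ->
  cintegrable lam I f -> cintegrable lam A f.
Proof. by move=> mA AI [h1 h2]; split; [apply: integrableS h1|apply: integrableS h2]. Qed.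

Lemma primB g s t : cintegrable lam I g -> 0 <= t -> t <= s -> s <= omega ->
  prim g s - prim g t = cintegral lam `]t, s] g.
Proof.
move=> hg t0 ts sw.
have [h1 h2] : cintegrable lam `[0, s] g.
  apply: cintegrable_sub hg; first exact: measurable_itv.
  by apply: subset_itv; rewrite bnd_simp.
rewrite /prim /cintegral -(Rintegral_itvB (x := t) h1) ?bnd_simp//.
by rewrite -(Rintegral_itvB (x := t) h2) ?bnd_simp.
Qed.

Lemma prim0 g : prim g 0 = 0.
Proof.
by rewrite /prim /cintegral set_itv1 /Rintegral !integral_set1.
Qed.

Lemma prim_ac g : cintegrable lam I g -> abs_continuous omega (prim g).
Proof.
move=> hg; have [h1 h2] := hg; apply/abs_continuous_nrm => e e0.
have e2 : 0 < e / 2 by rewrite divr_gt0.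
have [d1 p1 k1] := small_integral_disjoint h1 e2.
have [d2 p2 k2] := small_integral_disjoint h2 e2.
exists (Num.min d1 d2) => [|n u v uv tr]; first by rewrite lt_min p1 p2.
rewrite lt_min => /andP[s1 s2].
have := k1 n u v uv tr s1; have := k2 n u v uv tr s2.
move=> q2 q1; rewrite [e]splitr; apply: le_lt_trans (ltrD q1 q2).
rewrite -big_split/= big_nat [leRHS]big_nat; apply: ler_sum => i /andP[_ /uv[a b c]].
by rewrite primB//; exact: nrm_ReIm.
Qed.

(** At the supremum c of the points reached, the step leads from a point just below c to c itself
    and, if c < b, beyond it. *)
Lemma real_induction (a b : R) (S : set R) : a <= b -> S a ->
  (forall c, a <= c <= b -> exists2 eta : R, 0 < eta & forall s t, a <= s -> S s ->
     c - eta < s -> s <= c -> c <= t -> t < c + eta -> t <= b -> S t) -> S b.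
Proof.
move=> ab Sa step; pose S' := [set s | a <= s <= b /\ S s].
have S'a : S' a by rewrite /S'/= lexx ab.
have Sub : ubound S' b by move=> s [/andP[]].
have hasS : has_sup S' by split; [exists a|exists b].
set c := sup S'.
have c0 : a <= c by apply: ub_le_sup => //; case: hasS.
have cw : c <= b by apply: ge_sup => //; exists a.
have [|eta eta0 hstep] := step c; first by rewrite c0.
have [s [/andP[as_ sb] Ss] cs] := sup_adherent eta0 hasS.
have sc : s <= c.
  apply: ub_le_sup; first by case: hasS.
  by split => //; rewrite as_ sb.
have Sc : S c by apply: (hstep s) => //; lra.
suff <- : c = b by [].
apply/eqP; rewrite eq_le cw /= leNgt; apply/negP => cw'.
pose t := Num.min b (c + eta / 2).
have ct : c < t by rewrite lt_min cw'/=; lra.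
have tw : t <= b by rewrite ge_min lexx.
have te : t <= c + eta / 2 by rewrite ge_min lexx orbT.
have St : S t by apply: (hstep c) => //; lra.
have : t <= c.
  apply: ub_le_sup; first by case: hasS.
  by split=> //; rewrite tw andbT; lra.
by rewrite leNgt ct.
Qed.

(** For complex values no intermediate point has the mean slope. The bound with slope M + e is
    propagated by [real_induction], and e is arbitrary. *)
Lemma mean_value_le f (f' : R -> R[i]) (M a b : R) : 0 <= a -> a <= b -> b <= omega ->
  (forall t, a <= t <= b -> is_deriv omega f t (f' t) /\ nrm (f' t) <= M) ->
  nrm (f b - f a) <= M * (b - a).
Proof.
move=> a0 ab bw hf; have [<-|anb] := eqVneq a b; first by rewrite !subrr nrm0 mulr0.
have ab' : a < b by rewrite lt_neqAle anb.
suff H (e : R) : 0 < e -> nrm (f b - f a) <= (M + e) * (b - a).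
  apply/ler_addgt0Pl => e e0; have ba : 0 < b - a by lra.
  by have := H (e / (b - a)) (divr_gt0 e0 ba); rewrite mulrDl divfK ?gt_eqF// [M * _ + _]addrC.
move=> e0; apply: (@real_induction a b [set s | nrm (f s - f a) <= (M + e) * (s - a)]) => //=.
  by rewrite !subrr nrm0 mulr0.
move=> c cab; have [/is_derivP/(_ _ e0)[eta eta0 hd] hM] := hf c cab.
exists eta => // s t as_ hs cs sc ct tc tb.
have D x : a <= x <= b -> `|x - c| < eta -> nrm (f x - f c) <= (M + e) * `|x - c|.
  move=> xab xc; have xI : x \in `[0, omega] by rewrite in_itv/=; lra.
  have := nrmD (f x - f c - (x - c)%:C * f' c) ((x - c)%:C * f' c); rewrite subrK.
  move=> /le_trans; apply; rewrite mulrDl addrC; apply: lerD; last exact: hd.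
  by rewrite nrmM nrm_real mulrC ler_wpM2r.
have ds : nrm (f s - f c) <= (M + e) * (c - s).
  have := D s; rewrite ler0_norm; last lra.
  by rewrite opprB; apply; lra.
have dt : nrm (f t - f c) <= (M + e) * (t - c).
  have := D t; rewrite ger0_norm; last lra.
  by apply; lra.
apply: le_trans (nrm_tri (f c) (f t) (f a)) _.
apply: le_trans (lerD (lexx _) (nrm_tri (f s) (f c) (f a))) _.
have -> : (M + e) * (t - a) = (M + e) * (t - c) + ((M + e) * (c - s) + (M + e) * (s - a)) by ring.
by apply: lerD => //; apply: lerD => //; rewrite nrm_sym.
Qed.

Lemma bounded_deriv_ac f (f' : R -> R[i]) (M : R) : 
  (forall t, t \in `[0, omega] -> is_deriv omega f t (f' t)) -> bounded_on omega f' M ->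
  abs_continuous omega f.
Proof.
move=> hf hM; have zI : 0 \in `[0, omega] by rewrite in_itv/= lexx ltW.
have M0 : 0 <= M by apply: le_trans (hM 0 zI).
apply: (lipschitz_abs_continuous M0).
suff H s t : s \in `[0, omega] -> t \in `[0, omega] -> t <= s -> nrm (f s - f t) <= M * `|s - t|.
  move=> s t sI tI; have [ts|/ltW st] := leP t s; first exact: H.
  by rewrite distrC nrm_sym; exact: H.
move=> sI tI ts; rewrite ger0_norm ?subr_ge0//; move: sI tI; rewrite !in_itv/= => /andP[s0 s1] /andP[t0 t1].
apply: (mean_value_le (f' := f')) => // x /andP[tx xs].
have xI : x \in `[0, omega] by rewrite in_itv/= (le_trans t0 tx) (le_trans xs s1).
by split; [exact: hf|exact: hM].
Qed.

Lemma ae_interior (P : R -> Prop) : {ae lam, forall t, t \in `]0, omega[ -> P t} ->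
  {ae lam, forall t, t \in `[0, omega] -> P t}.
Proof.
move=> h; have h0 (a : R) : {ae lam, forall t, t != a}.
  exists [set a]; split; [exact: measurable_set1|exact: lebesgue_measure_set1|].
  by move=> t /= /negP; rewrite negbK => /eqP.
apply: ae_lamS (ae_lamI h (ae_lamI (h0 0) (h0 omega))) => t [ht [t0 tw]].
rewrite in_itv/= => /andP[a b]; apply: ht; rewrite in_itv/= !lt_neqAle a b eq_sym t0 tw//.
Qed.

(** Lebesgue differentiation of both parts, for the extension of g by 0 to the line; it is used at
    interior points only, the two endpoints being negligible. *)
Lemma prim_deriv_ae g : cintegrable lam I g ->
  {ae lam, forall t, t \in `[0, omega] -> is_deriv omega (prim g) t (g t)}.
Proof.
move=> hg.
have real (r : R -> R) : lam.-integrable I (EFin \o r) ->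
   {ae lam, forall t, t \in `]0, omega[ ->
     (s - t)^-1 * (\int[lam]_(x in `[0, s]) r x - \int[lam]_(x in `[0, t]) r x)
       @[s --> within I t^'] --> r t}.
  move=> ir; pose f := r \_ I.
  have intf : lam.-integrable setT (EFin \o f).
    by rewrite -restrict_EFin -integrable_mkcond.
  have lf : locally_integrable [set: R] f.
    by apply: open_integrable_locally => //; exact: openT.
  have ifs (y : R) : lam.-integrable [set` Interval (BLeft 0) (BRight y)] (EFin \o f).
    by apply: integrableS intf => //; exact: measurable_itv.
  have := FTC1 ifs lf; apply: ae_lamS => t ht tI.
  have t0 : (BLeft 0%R < BRight t)%E by move: tI; rewrite in_itv/= lte_fin => /andP[].
  have [dt] := ht t0; rewrite derive1E => et.
  have rf s : s \in `[0, omega] -> \int[lam]_(x in `[0, s]) f x = \int[lam]_(x in `[0, s]) r x.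
    rewrite in_itv/= => /andP[s0 sw]; apply: eq_Rintegral => x /set_mem/=.
    rewrite in_itv/= => /andP[x0 xs]; rewrite /f patchE mem_set//= in_itv/= x0.
    by rewrite (le_trans xs sw).
  have tI' : t \in `[0, omega] by move: tI; rewrite !in_itv/= => /andP[/ltW -> /ltW ->].
  have ft : f t = r t by rewrite /f patchE mem_set.
  apply/cvgrPdist_le => e e0.
  have cv : h^-1 *: ((\int[lam]_(x in `[0, (h *: (1:R^o) + t)%R]) f x) - (\int[lam]_(x in `[0, t]) f x)) @[h --> (0:R)^'] --> r t.
    by rewrite -ft -et; exact: dt.
  move: cv => /cvgrPdist_le/(_ _ e0); rewrite /dnbhs near_withinE => /nbhs_ballP[d /= d0 hd].
  apply/near_within_dnbhs; exists d => // s sd st sI.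
  have := hd (s - t); rewrite /ball/= sub0r normrN subr_eq0 => /(_ sd st).
  by rewrite /GRing.scale/= mulr1 subrK !rf.
have [h1 h2] := hg; apply: ae_interior.
apply: ae_lamS (ae_lamI (real _ h1) (real _ h2)) => t [k1 k2] tI.
have k1' := k1 tI; have k2' := k2 tI.
by split; rewrite ?ReM ?ImM; under eq_fun do rewrite ?ReM ?ImM /= mul0r ?subr0 ?addr0.
Qed.

(** The difference of f and [prim g] is absolutely continuous with derivative 0 almost
    everywhere. *)
Lemma ac_FTC f g : abs_continuous omega f -> cintegrable lam I g ->
  {ae lam, forall t, t \in `[0, omega] -> is_deriv omega f t (g t)} ->
  cintegral lam I g = f omega - f 0.
Proof.
move=> acf hg df.
have h1 : abs_continuous omega (fun s => (-1) * prim g s + f s).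
  by apply: abs_continuous_lin => //; exact: prim_ac.
have := abs_continuous_zero_deriv omega0 h1; rewrite prim0 mulr0 add0r => <-.
  by rewrite mulN1r opprD opprK addrCA subrr addr0.
apply: ae_lamS (ae_lamI df (prim_deriv_ae hg)) => t [k1 k2] tI.
have := is_deriv_lin (-1) (k2 tI) (k1 tI).
by rewrite mulN1r addNr.
Qed.

Lemma nrm_cintegral_le f (A : set R) (M : R) : measurable (A : set (measurableTypeR R)) ->
  A `<=` I -> cintegrable lam A f -> (forall t, A t -> nrm (f t) <= M) ->
  nrm (cintegral lam A f) <= 2 * M * fine (lam A).
Proof.
move=> mA AI [h1 h2] hM; apply: le_trans (nrm_ReIm _) _.
have iM : lam.-integrable A (EFin \o cst M).
  apply: (@integrableS _ _ _ lam I) => //.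
  apply: continuous_compact_integrable; first exact: segment_compact.
  by apply: continuous_subspaceT => x; exact: cvg_cst.
have H (r : R -> R) : lam.-integrable A (EFin \o r) -> (forall t, A t -> `|r t| <= M) ->
    `|\int[lam]_(t in A) r t| <= M * fine (lam A).
  move=> hr rM; apply: le_trans (le_normr_Rintegral mA hr) _.
  rewrite -Rintegral_cst//; apply: le_Rintegral => //.
  by have := integrable_abse hr; apply: eq_integrable => // x _ /=.
rewrite -mulrA mulr_natl mulr2n; apply: lerD; apply: H => // t /hM h; apply: le_trans h.
  exact: Re_nrm.
exact: Im_nrm.
Qed.

End Calculus.

(** * The normalized measure on the interval *)

Section ItvMeasure.
Variables (R : realType) (omega : R).
Hypothesis omega0 : 0 < omega.
Local Notation Re := complex.Re.
Local Notation Im := complex.Im.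
Local Notation lam := (@lebesgue_measure R).
Local Notation I := (`[0, omega]%classic : set R).
Local Notation mu := (itv_measure omega).

Let mI : measurable (I : set (measurableTypeR R)).
Proof. exact: measurable_itv. Qed.

Lemma itv_measureE (A : set (measurableTypeR R)) : mu A = ((omega^-1)%:E * lam (A `&` I))%E.
Proof. by rewrite /itv_measure /= /mscale/= /mrestr ger0_norm// invr_ge0 ltW. Qed.

Lemma lamI : lam I = omega%:E.
Proof. by rewrite lebesgue_measure_itv/= lte_fin omega0 -EFinB subr0. Qed.

Lemma itv_measureT : mu setT = 1%E.
Proof. by rewrite itv_measureE setTI lamI -EFinM mulVf ?gt_eqF. Qed.

Lemma ae_itvP (P : R -> Prop) : {ae mu, forall t, P t} <->
  {ae lam, forall t, t \in `[0, omega] -> P t}.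
Proof.
have w0 : (0 < (omega^-1)%:E)%E by rewrite lte_fin invr_gt0.
split=> [[N [mN N0 hN]]|[N [mN N0 hN]]].
  exists (N `&` I); split.
  - exact: measurableI.
  - move: N0; rewrite itv_measureE => /eqP; rewrite mule_eq0 (gt_eqF w0)/= => /eqP h; exact: h.
  - move=> t /= h; have tI : t \in `[0, omega].
      by apply/negPn/negP => /negP nI; apply: h => tI; case: nI.
    by split=> //; apply: hN => Pt; apply: h.
exists (N `|` ~` I); split.
- by apply: measurableU => //; exact: measurableC.
- rewrite itv_measureE.
  have -> : (N `|` ~` I) `&` I = N `&` I by rewrite setIUl setICl setU0.
  suff -> : lam (N `&` I) = 0%E by rewrite mule0.
  have := @le_measure _ _ _ lam (N `&` I) N; rewrite !inE => /(_ (measurableI _ _ mN mI) mN).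
  move=> /(_ (@subIsetl _ _ _)) h; apply/eqP; rewrite eq_le; apply/andP; split; last exact: measure_ge0.
  by apply: le_trans h _; rewrite le_eqVlt; apply/orP; left; apply/eqP; exact: N0.
- move=> t /= nP; have [tI|nI] := pselect (I t); [left|by right].
  by apply: hN => /= h; apply: nP; exact: h.
Qed.

Lemma ge0_itv_integral (F : R -> \bar R) : measurable_fun setT F -> (forall t, (0 <= F t)%E) ->
  (\int[mu]_t F t = (omega^-1)%:E * \int[lam]_(t in I) F t)%E.
Proof.
move=> mF F0; rewrite /itv_measure ge0_integral_mscale//=.
rewrite ger0_norm ?invr_ge0 ?ltW//; congr (_ * _)%E.
have mC : measurable (~` I : set (measurableTypeR R)) by exact: measurableC.
have n0 : mrestr lam mI (~` I) = 0%E.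
  by apply: (eq_trans (y := lam (~` I `&` I))) => //; rewrite setICl measure0.
have E := @ge0_negligible_integral _ _ _ (mrestr lam mI) setT (~` I) F mC measurableT mF (fun x _ => F0 x) n0.
apply: (eq_trans E); rewrite setTD setCK; apply: eq_measure_integral => A mA AI.
by apply: (eq_trans (y := lam (A `&` I))) => //; rewrite setIidl.
Qed.

Lemma itv_integrable (f : R -> R) : measurable_fun (setT : set (measurableTypeR R)) f ->
  mu.-integrable setT (EFin \o f) <-> lam.-integrable I (EFin \o f).
Proof.
move=> mf; have mf' : measurable_fun (setT : set (measurableTypeR R)) (EFin \o f) by exact/measurable_EFinP.
have ma : measurable_fun (setT : set (measurableTypeR R)) (fun t => `|(EFin \o f) t|%E).
  exact: measurableT_comp.
have E := ge0_itv_integral ma (fun t => abse_ge0 _).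
have w0 : 0 < omega^-1 by rewrite invr_gt0.
split=> /integrableP[_ h]; apply/integrableP; split.
- exact: measurable_funTS.
- have h0 : (0 <= \int[lam]_(t in I) `|(EFin \o f) t|)%E by apply: integral_ge0 => x _; exact: abse_ge0.
  move: h; rewrite E; case: (\int[lam]_(t in _) _)%E h0 => [r||]//=.
  + by move=> _ _; exact: ltry.
  + by move=> _; rewrite gt0_muley.
- exact: mf'.
- by rewrite E lte_mul_pinfty// lee_fin ltW.
Qed.

Lemma itv_Rintegral (f : R -> R) : measurable_fun (setT : set (measurableTypeR R)) f ->
  lam.-integrable I (EFin \o f) ->
  \int[mu]_t f t = omega^-1 * \int[lam]_(t in I) f t.
Proof.
move=> mf fi; have mf' : measurable_fun (setT : set (measurableTypeR R)) (EFin \o f) by exact/measurable_EFinP.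
have fp := integrable_pos_fin_num mI fi; have fn := integrable_neg_fin_num mI fi.
rewrite /Rintegral integralE [X in _ = _ * fine X]integralE.
rewrite !ge0_itv_integral//; [|exact: measurable_funeneg|exact: measurable_funepos].
rewrite -muleBr//; last first.
  exact: fin_num_adde_defr fp.
by rewrite fineM// fin_numB fp fn.
Qed.

Definition cmeas (f : R -> R[i]) := measurable_fun (setT : set (measurableTypeR R)) (fun t => Re (f t)) /\
  measurable_fun (setT : set (measurableTypeR R)) (fun t => Im (f t)).

Lemma itv_cintegrable f : cmeas f -> cintegrable mu setT f <-> cintegrable lam I f.
Proof. by move=> [m1 m2]; split=> -[h1 h2]; split; apply/itv_integrable. Qed.

Lemma itv_cintegral f : cmeas f -> cintegrable lam I f ->
  cintegral mu setT f = (omega^-1)%:C * cintegral lam I f.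
Proof.
move=> [m1 m2] [h1 h2]; rewrite /cintegral !itv_Rintegral//.
by apply/eqP; rewrite eq_complex/=; apply/andP; split; apply/eqP; ring.
Qed.

Lemma bounded_sqint f (M : R) : cmeas f -> (forall t, nrm (f t) <= M) -> f \in sqint mu.
Proof.
move=> [m1 m2] hM.
have H (r : R -> R) : measurable_fun (setT : set (measurableTypeR R)) r -> (forall t, `|r t| <= M) ->
    r \in Lfun mu 2%:E.
  move=> mr hr; apply: Lfun2P => //.
  apply: (@le_lt_trans _ _ (\int[mu]_x (cst (M ^+ 2)%:E x))%E); last first.
    by rewrite integral_cst// itv_measureT mule1 ltry.
  apply: ge0_le_integral => //.
  - by move=> x _; rewrite lee_fin sqr_ge0.
  - by apply/measurable_EFinP; exact: measurable_funX.
  - move=> x _; rewrite lee_fin -real_normK ?num_real// ler_pXn2r ?nnegrE//.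
    exact: le_trans (hr x).
by apply/andP; split; apply: H => // t; apply: le_trans (hM t); [exact: Re_nrm|exact: Im_nrm].
Qed.

Lemma cmeas_cont f : continuous (fun t => Re (f t)) -> continuous (fun t => Im (f t)) -> cmeas f.
Proof. by move=> h1 h2; split; exact: continuous_measurable_fun. Qed.

Lemma sqint_cmeas f : f \in sqint mu -> cmeas f.
Proof. by move=> /andP[/Lfun2_meas h1 /Lfun2_meas h2]. Qed.

Lemma cmeasM f g : cmeas f -> cmeas g -> cmeas (fun t => f t * g t).
Proof.
move=> [a b] [a' b']; split.
  apply: (eq_measurable_fun (fun t => Re (f t) * Re (g t) - Im (f t) * Im (g t))).
    by move=> t _; rewrite ReM.
  by apply: measurable_funB; exact: measurable_funM.
apply: (eq_measurable_fun (fun t => Re (f t) * Im (g t) + Im (f t) * Re (g t))).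
  by move=> t _; rewrite ImM.
by apply: measurable_funD; exact: measurable_funM.
Qed.

Lemma cmeas_conj f : cmeas f -> cmeas (fun t => (f t)^*).
Proof.
move=> [a b]; split.
  by apply: (eq_measurable_fun (fun t => Re (f t))) => // t _; case: (f t).
apply: (eq_measurable_fun (fun t => - Im (f t))); last exact: measurableT_comp.
by move=> t _; case: (f t).
Qed.

Lemma sqint_cintegrable f : f \in sqint mu -> cintegrable lam I f.
Proof.
move=> hf; apply/itv_cintegrable; first exact: sqint_cmeas.
have c1 : (fun=> 1 : R[i]) \in sqint mu.
  apply: (@bounded_sqint _ 1) => [|t]; last by rewrite nrm1.
  by split; exact: measurable_cst.
have := cintegrable_ip (SqintFun hf) (SqintFun c1).
by apply: cintegrable_ext => // t _ /=; rewrite rmorph1 mulr1.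
Qed.

Lemma sqint_cintegrableM f g : f \in sqint mu -> g \in sqint mu ->
  cintegrable lam I (fun t => f t * (g t)^*).
Proof.
move=> hf hg; apply/itv_cintegrable.
  by apply: cmeasM; [exact: sqint_cmeas|apply/cmeas_conj/sqint_cmeas].
exact: cintegrable_ip (SqintFun hf) (SqintFun hg).
Qed.

Lemma repr_sqint (x : L2 omega) : (cL2_repr x : R -> R[i]) \in sqint mu.
Proof. exact: valP (cL2_repr x). Qed.

Lemma L2_ofE f (hf : f \in sqint mu) : L2_of omega f = cL2_class (SqintFun hf).
Proof.
rewrite /L2_of; congr cL2_class; apply/val_inj; rewrite insubdK//.
Qed.

Lemma L2_of_repr f : f \in sqint mu -> represents f (L2_of omega f).
Proof. by move=> hf; rewrite /represents L2_ofE; exact: repr_class. Qed.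

Lemma innerE (x y : L2 omega) f g : represents f x -> represents g y ->
  cintegrable lam I (fun t => f t * (g t)^*) ->
  inner x y = (omega^-1)%:C * cintegral lam I (fun t => f t * (g t)^*).
Proof.
move=> /ae_itvP hf /ae_itvP hg hi; have h := sqint_cintegrableM (repr_sqint x) (repr_sqint y).
rewrite /inner itv_cintegral//; last first.
  by apply: cmeasM; [apply/sqint_cmeas/repr_sqint|apply/cmeas_conj/sqint_cmeas/repr_sqint].
congr (_ * _); apply: cintegral_ae => //.
by apply: ae_lamS (ae_lamI hf hg) => t [h1 h2] tI; rewrite h1// h2.
Qed.

Lemma represents_inj f (x y : L2 omega) : represents f x -> represents f y -> x = y.
Proof.
move=> /ae_itvP hf /ae_itvP hg; rewrite -[x]cL2_reprK -[y]cL2_reprK.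
apply/eqP/cL2_class_eqP/ae_itvP.
by apply: ae_lamS (ae_lamI hf hg) => t [h1 h2] tI; rewrite h1// h2.
Qed.

Lemma represents_eq f g (x : L2 omega) : represents f x ->
  {ae lam, forall t, t \in `[0, omega] -> f t = g t} -> represents g x.
Proof.
move=> /ae_itvP hf hg; apply/ae_itvP.
by apply: ae_lamS (ae_lamI hf hg) => t [h1 h2] tI; rewrite h1// h2.
Qed.

Lemma represents_repr (x : L2 omega) : represents (cL2_repr x : R -> R[i]) x.
Proof. exact: (aeW mu). Qed.

End ItvMeasure.

(** * Trigonometric systems *)

Section HalfInterval.
Variable R : realType.
Implicit Types x s t d g : R.

Lemma half_le x : 0 <= x -> x / 2 <= x. Proof. by move=> ?; lra. Qed.

Lemma half_le_sub g x : - (x / 2) <= g - x -> x / 2 <= g. Proof. by move=> ?; lra. Qed.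

Lemma dist_right_half s t x d : 0 < x -> s <= t -> t <= s + x / 2 -> x <= d -> `|t - s| < d.
Proof. by move=> ? ? ? ?; rewrite ger0_norm; lra. Qed.

End HalfInterval.

Section Trigonometric.
Variables (R : realType) (omega : R).
Hypothesis omega0 : 0 < omega.
Local Notation Re := complex.Re.
Local Notation Im := complex.Im.
Local Notation lam := (@lebesgue_measure R).
Local Notation I := (`[0, omega]%classic : set R).
Implicit Types (f g h : R -> R[i]) (t s a : R).

Let mI : measurable (I : set (measurableTypeR R)).
Proof. exact: measurable_itv. Qed.

Definition phi a t : R[i] := expi (a * t).

Lemma phiD a b t : phi (a + b) t = phi a t * phi b t.
Proof. by rewrite /phi mulrDl expiD. Qed.

Lemma phi0 t : phi 0 t = 1.
Proof. by rewrite /phi mul0r /expi cos0 sin0. Qed.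

Lemma phi_conj a t : (phi a t)^* = phi (- a) t.
Proof. by rewrite /phi /expi mulNr cosN sinN. Qed.

Lemma nrm_phi a t : nrm (phi a t) = 1. Proof. exact: nrm_expi. Qed.

Lemma cexp_imag (x : R) : cexp (0 +i* x) = expi x.
Proof. by rewrite /cexp/= expR0 mul1r. Qed.

Lemma phi_deriv a t : is_deriv omega (phi a) t ((0 +i* a) * phi a t).
Proof.
apply/is_derivP => e e0; pose A := `|a| ^+ 2 * expR `|a| + 1.
have A0 : 0 < A by rewrite /A ltr_wpDl// mulr_ge0 ?sqr_ge0// expR_ge0.
exists (Num.min 1 (e / A)) => [|s _]; first by rewrite lt_min ltr01 divr_gt0.
rewrite lt_min => /andP[s1 s2]; set h := s - t in s1 s2 *.
have -> : phi a s - phi a t - h%:C * ((0 +i* a) * phi a t) =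
    phi a t * (cexp (0 +i* (a * h)) - 1 - (0 +i* (a * h))).
  have -> : phi a s = phi a t * expi (a * h) by rewrite /phi -expiD; congr expi; rewrite /h; ring.
  rewrite cexp_imag; have -> : (0 +i* (a * h) : R[i]) = h%:C * (0 +i* a).
    by apply/eqP; rewrite eq_complex/=; apply/andP; split; apply/eqP; ring.
  ring.
rewrite nrmM nrm_phi mul1r; apply: le_trans (cexp_bound2 _) _.
have -> : nrm (0 +i* (a * h)) = `|a| * `|h|.
  by rewrite /nrm normc_def/= expr0n/= add0r sqrtr_sqr normrM.
have ah : expR (`|a| * `|h|) <= expR `|a| by rewrite ler_expR ler_piMr// ltW.
apply: (@le_trans _ _ (A * `|h| * `|h|)).
  rewrite exprMn -[leRHS]mulrA -expr2 mulrAC ler_wpM2r ?sqr_ge0//.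
  by rewrite /A; apply: le_trans (ler_wpM2l (sqr_ge0 _) ah) _; rewrite lerDl.
by rewrite ler_wpM2r// mulrC -ler_pdivlMr// ltW.
Qed.

Lemma nrm_Re_le (z : R[i]) : nrm ((Re z)%:C) <= nrm z.
Proof. by rewrite nrm_real; exact: Re_nrm. Qed.

Lemma nrm_Im_le (z : R[i]) : nrm ((Im z)%:C) <= nrm z.
Proof. by rewrite nrm_real; exact: Im_nrm. Qed.

Lemma is_deriv_Re f t l : is_deriv omega f t l ->
  is_deriv omega (fun s => (Re (f s))%:C) t (Re l)%:C.
Proof.
move=> /is_derivP h; apply/is_derivP => e /h[eta eta0 he]; exists eta => // s sI se.
apply: le_trans (he s sI se); apply: le_trans (nrm_Re_le _).
rewrite le_eqVlt; apply/orP; left; apply/eqP; congr nrm.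
by rewrite !ReD; case: (f t) l {h he} => [? ?] [? ?]; apply/eqP; rewrite eq_complex/=; apply/andP; split; apply/eqP; ring.
Qed.

Lemma is_deriv_Im f t l : is_deriv omega f t l ->
  is_deriv omega (fun s => (Im (f s))%:C) t (Im l)%:C.
Proof.
move=> /is_derivP h; apply/is_derivP => e /h[eta eta0 he]; exists eta => // s sI se.
apply: le_trans (he s sI se); apply: le_trans (nrm_Im_le _).
rewrite le_eqVlt; apply/orP; left; apply/eqP; congr nrm.
by rewrite !ImD; case: (f t) l {h he} => [? ?] [? ?]; apply/eqP; rewrite eq_complex/=; apply/andP; split; apply/eqP; ring.
Qed.

Definition csin a t : R[i] := (sin (a * t))%:C.
Definition ccos a t : R[i] := (cos (a * t))%:C.

Lemma csin_deriv a t : is_deriv omega (csin a) t (a%:C * ccos a t).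
Proof.
have := is_deriv_Im (phi_deriv a t).
have -> : (Im ((0 +i* a) * phi a t))%:C = a%:C * ccos a t :> R[i]; last by [].
by rewrite ImM/= mul0r add0r rmorphM.
Qed.

Lemma ccos_deriv a t : is_deriv omega (ccos a) t (- a%:C * csin a t).
Proof.
have := is_deriv_Re (phi_deriv a t).
have -> : (Re ((0 +i* a) * phi a t))%:C = - a%:C * csin a t :> R[i]; last by [].
by rewrite ReM/= mul0r sub0r rmorphN rmorphM mulNr.
Qed.

Lemma phi_ac a : abs_continuous omega (phi a).
Proof.
apply: (bounded_deriv_ac omega0 (fun t _ => phi_deriv a t) (M := nrm (0 +i* a))) => t _.
by rewrite nrmM nrm_phi mulr1.
Qed.

Lemma csin_ac a : abs_continuous omega (csin a).
Proof.
apply: (bounded_deriv_ac omega0 (fun t _ => csin_deriv a t) (M := `|a|)) => t _.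
by rewrite nrmM !nrm_real ler_piMr// ler_norml cos_le1 cos_geN1.
Qed.

Lemma ccos_ac a : abs_continuous omega (ccos a).
Proof.
apply: (bounded_deriv_ac omega0 (fun t _ => ccos_deriv a t) (M := `|a|)) => t _.
by rewrite nrmM nrmN !nrm_real ler_piMr// ler_norml sin_le1 sin_geN1.
Qed.

Let scal_cont a : continuous (fun t : R => a * t).
Proof. by move=> t; apply: cvgM; [exact: cvg_cst|exact: cvg_id]. Qed.

Lemma cont_cos a : continuous (fun t : R => cos (a * t)).
Proof. by move=> t; apply: continuous_comp; [exact: scal_cont|exact: continuous_cos]. Qed.

Lemma cont_sin a : continuous (fun t : R => sin (a * t)).
Proof. by move=> t; apply: continuous_comp; [exact: scal_cont|exact: continuous_sin]. Qed.

Lemma phi_cmeas a : cmeas (phi a).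
Proof. by apply: cmeas_cont; [exact: cont_cos|exact: cont_sin]. Qed.

Lemma csin_cmeas a : cmeas (csin a).
Proof. by apply: cmeas_cont; [exact: cont_sin|move=> t; exact: cvg_cst]. Qed.

Lemma ac_within f : abs_continuous omega f ->
  {within I, continuous (fun t => Re (f t))} /\ {within I, continuous (fun t => Im (f t))}.
Proof.
move=> /abs_continuous_uniform hf.
have H (P : R[i] -> R) : (forall z, `|P z| <= nrm z) -> (forall x y, P (x - y) = P x - P y) ->
    {within I, continuous (fun t => P (f t))}.
  move=> P1 PB; apply/subspace_continuousP => t tI; apply/cvgrPdist_le => e e0.
  have [d d0 hd] := hf e e0; rewrite near_withinE; apply/nbhs_ballP; exists d => //= s st sI.
  by rewrite -PB; apply: le_trans (P1 _) _; apply: hd.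
split; apply: H; [exact: Re_nrm| |exact: Im_nrm|].
  by move=> x y; rewrite ReD; case: y.
by move=> x y; rewrite ImD; case: y.
Qed.

Lemma cintegrableM_ac h g : cintegrable lam I h -> abs_continuous omega g ->
  cintegrable lam I (fun t => h t * g t).
Proof.
move=> [h1 h2] ag; have [c1 c2] := ac_within ag; have [M hM] := abs_continuous_bounded omega0 ag.
have H (r q : R -> R) : lam.-integrable I (EFin \o r) -> {within I, continuous q} ->
    (forall t, t \in `[0, omega] -> `|q t| <= M) -> lam.-integrable I (EFin \o (fun t => r t * q t)).
  move=> ir cq qM.
  have mq : measurable_fun (I : set (measurableTypeR R)) q by exact: subspace_continuous_measurable_fun.
  have bq : [bounded q x | x in I].
    by exists M; split; rewrite ?num_real// => K MK x xI; apply: le_trans (qM x xI) (ltW MK).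
  by have := integrableMl mI ir mq bq; apply: eq_integrable => // t _ /=; rewrite EFinM.
have bR t : t \in `[0, omega] -> `|Re (g t)| <= M by move=> tI; apply: le_trans (Re_nrm _) (hM t tI).
have bI t : t \in `[0, omega] -> `|Im (g t)| <= M by move=> tI; apply: le_trans (Im_nrm _) (hM t tI).
split.
  apply: (integrable_ext mI (f := fun t => 1 * (Re (h t) * Re (g t)) + (-1) * (Im (h t) * Im (g t)))).
    by move=> t _; rewrite ReM; ring.
  by apply: integrable_lin => //; exact: H.
apply: (integrable_ext mI (f := fun t => 1 * (Re (h t) * Im (g t)) + 1 * (Im (h t) * Re (g t)))).
  by move=> t _; rewrite ImM; ring.
by apply: integrable_lin => //; exact: H.
Qed.

Lemma cintegrable_cst (k : R[i]) : cintegrable lam I (fun=> k).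
Proof.
have H (r : R) : lam.-integrable I (EFin \o (fun=> r)).
  apply: continuous_compact_integrable; first exact: segment_compact.
  by apply: continuous_subspaceT => x; exact: cvg_cst.
by split; exact: H.
Qed.

Lemma cst_ac (k : R[i]) : abs_continuous omega (fun=> k).
Proof. by apply: (@lipschitz_abs_continuous _ _ _ 0) => // s t _ _; rewrite subrr nrm0 mul0r. Qed.

Lemma ac_cintegrable f : abs_continuous omega f -> cintegrable lam I f.
Proof.
move=> hf; apply: cintegrable_ext (cintegrableM_ac (cintegrable_cst 1) hf) => // t _.
by rewrite mul1r.
Qed.

Lemma cintegral_cst (k : R[i]) : cintegral lam I (fun=> k) = omega%:C * k.
Proof.
rewrite /cintegral !Rintegral_cst//= (_ : lam _ = omega%:E) ?lamI//=.
case: k => a b; by apply/eqP; rewrite eq_complex/=; apply/andP; split; apply/eqP; ring.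
Qed.

Definition ae_deriv f g := {ae lam, forall t, t \in `[0, omega] -> is_deriv omega f t (g t)}.

Lemma ibp f f' g g' : abs_continuous omega f -> cintegrable lam I f' -> ae_deriv f f' ->
  abs_continuous omega g -> cintegrable lam I g' -> ae_deriv g g' ->
  cintegral lam I (fun t => f' t * g t) =
  f omega * g omega - f 0 * g 0 - cintegral lam I (fun t => f t * g' t).
Proof.
move=> af f'i df ag g'i dg; have [M gM] := abs_continuous_bounded omega0 ag.
have i1 := cintegrableM_ac f'i ag.
have i2 : cintegrable lam I (fun t => f t * g' t).
  by apply: cintegrable_ext (cintegrableM_ac g'i af) => // t _; rewrite mulrC.
apply/eqP; rewrite eq_sym subr_eq -cintegralD//; apply/eqP/esym.
apply: (@ac_FTC _ _ omega0 (fun t => f t * g t)).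
- exact: abs_continuousM.
- exact: cintegrableD.
- apply: ae_lamS (ae_lamI df dg) => t [h1 h2] tI.
  by apply: (is_derivM tI gM); [exact: h1|exact: h2].
Qed.

Lemma ae_deriv_all f g : (forall t, t \in `[0, omega] -> is_deriv omega f t (g t)) -> ae_deriv f g.
Proof. by move=> h; apply: (ae_lamS (P := fun=> True)) => [t _|]; [exact: h|exact: (aeW lam)]. Qed.

Lemma is_deriv_uniq f t l l' : t \in `[0, omega] -> is_deriv omega f t l -> is_deriv omega f t l' -> l = l'.
Proof.
move=> tI /is_derivP h /is_derivP h'; apply/eqP; rewrite -subr_eq0; apply/eqP/nrm_le0.
apply/ler_addgt0Pl => e e0; rewrite addr0.
have e2 : 0 < e / 2 by rewrite divr_gt0.
have [d d0 hd] := h _ e2; have [d' d'0 hd'] := h' _ e2.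
(* Derivatives are taken within the closed interval, so s is chosen on the side of t where at least
   omega / 2 is left. *)
have [s [sI sd sd' st]] : exists s, [/\ s \in `[0, omega], `|s - t| < d, `|s - t| < d' & s != t].
  move: tI; rewrite in_itv/= => /andP[t0 tw].
  have [m m0 [md md' mw]] : exists2 m : R, 0 < m & [/\ m <= d, m <= d' & m <= omega].
    exists (Num.min (Num.min d d') omega); first by rewrite !lt_min d0 d'0.
    by rewrite !ge_min !lexx !orbT.
  pose r : R := m / 2.
  have rd : r < d by rewrite /r; lra.
  have rd' : r < d' by rewrite /r; lra.
  have rw : r <= omega / 2 by rewrite /r; lra.
  have r0 : 0 < r by rewrite divr_gt0.
  have [tl|tg] := leP t (omega / 2).
    exists (t + r); rewrite in_itv/= addrAC subrr add0r gtr0_norm//; split=> //.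
      by apply/andP; split; lra.
    by rewrite gt_eqF// ltrDl.
  exists (t - r); rewrite in_itv/= addrAC subrr add0r normrN gtr0_norm//; split=> //.
    by apply/andP; split; lra.
  by rewrite lt_eqF// ltrBlDr ltrDl.
have n0 : 0 < `|s - t| by rewrite normr_gt0 subr_eq0.
rewrite -(ler_pM2r n0) -nrm_real mulrC -nrmM.
have -> : (s - t)%:C * (l - l') = (f s - f t - (s - t)%:C * l') - (f s - f t - (s - t)%:C * l) by ring.
apply: le_trans (nrmB _ _) _; rewrite nrm_real [e]splitr mulrDl.
by apply: lerD; [exact: hd'|exact: hd].
Qed.

(** Here q stands for (c t - c s)^2 / 4 and b for membership in a small interval at s. On it the
    power is at least (1 + e / 2)^m; far from s the base is at most 1 and the loss at most |g|; in
    between g is positive. *)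
Lemma bump_pointwise (g gs q e : R) (m : nat) (b : bool) : 0 < e -> 0 < gs -> 0 <= q <= 1 ->
  (gs / 2 <= g /\ (b -> q <= e / 2)) \/ (e <= q /\ ~~ b) ->
  (1 + e / 2) ^+ m * (gs / 2) * b%:R + (-1) * `|g| <= g * (1 + e - q) ^+ m.
Proof.
move=> e0 gs0 /andP[q0 q1] hb; have q2 : 0 <= 1 + e - q by lra.
have X0 : 0 <= (1 + e - q) ^+ m by rewrite exprn_ge0.
case: hb => [[gg hb]|[eq /negbTE->]]; last first.
  rewrite mulr0 add0r mulN1r.
  have : `|g * (1 + e - q) ^+ m| <= `|g|.
    by rewrite normrM ler_piMr// normrX exprn_ile1// ger0_norm//; lra.
  by rewrite ler_norml => /andP[].
have g0 : 0 <= g by lra.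
rewrite ger0_norm// mulN1r; case: b hb => [/(_ isT) qe|_]; last first.
  by rewrite mulr0 add0r (@le_trans _ _ 0)// ?oppr_le0// mulr_ge0.
rewrite mulr1 (@le_trans _ _ ((1 + e / 2) ^+ m * (gs / 2)))//; first by rewrite lerBlDr lerDl.
rewrite mulrC; apply: ler_pM => //; first by lra.
  by rewrite exprn_ge0//; lra.
by apply: lerXn2r; rewrite ?nnegrE//; lra.
Qed.

Lemma bernoulli_unbounded (e K A : R) : 0 < e -> 0 < K -> 0 <= A ->
  exists m : nat, A < (1 + e) ^+ m * K.
Proof.
move=> e0 K0 A0; exists (Num.bound (A / K / e)); rewrite -ltr_pdivrMr//.
have : A / K / e < (Num.bound (A / K / e))%:R.
  by apply: archi_boundP; rewrite !divr_ge0 ?(ltW K0) ?(ltW e0).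
rewrite (ltr_pdivrMr _ _ e0) => /lt_le_trans; apply.
have bern k : 1 + k%:R * e <= (1 + e) ^+ k.
  elim: k => [|k IH]; first by rewrite mul0r addr0 expr0.
  rewrite exprS -natr1; have p0 : 0 <= k%:R * e * e by rewrite !mulr_ge0 ?(ltW e0).
  have : (1 + e) * (1 + k%:R * e) <= (1 + e) * (1 + e) ^+ k by rewrite ler_wpM2l//; lra.
  by lra.
by apply: le_trans (bern _); rewrite lerDr.
Qed.

(* If G s > 0, take b = c s and a > 1 close to 1: the powers of a - (c - c s)^2 / 4
   grow geometrically near s and are bounded elsewhere, so the integrals diverge. *)
Lemma bump_zero (G c : R -> R) (s : R) : {within I, continuous G} -> {within I, continuous c} ->
  0 < s < omega -> (forall t, t \in `[0, omega] -> `|c t| <= 1) ->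
  (forall t, t \in `[0, omega] -> c t = c s -> t = s) ->
  (forall a b m, \int[lam]_(t in I) (G t * (a - (c t - b) ^+ 2 / 4) ^+ m) = 0) -> G s <= 0.
Proof.
move=> cG cc /andP[s0 sw] c1 cs hz; rewrite leNgt; apply/negP => Gs.
have sI : s \in `[0, omega] by rewrite in_itv/= !ltW.
have near_s (q : R -> R) (e : R) : {within I, continuous q} -> 0 < e ->
    exists2 d : R, 0 < d & forall t, t \in `[0, omega] -> `|t - s| < d -> `|q t - q s| <= e.
  move=> /subspace_continuousP/(_ s sI)/cvgrPdist_le h /h.
  rewrite near_withinE => /nbhs_ballP[d /= d0 hd]; exists d => // t tI td.
  by rewrite distrC; apply: hd; rewrite ?distrC// /ball/= distrC.
have [d1 d10 h1] := near_s G (G s / 2) cG ltac:(by rewrite divr_gt0).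
pose d := Num.min (d1 / 2) (Num.min (s / 2) ((omega - s) / 2)).
have w0 : 0 < (omega - s) by rewrite subr_gt0.
have d0 : 0 < d by rewrite !lt_min !divr_gt0.
have dd1 : d <= d1 / 2 by rewrite !ge_min lexx.
have ds : d <= s / 2 by rewrite !ge_min lexx orbT.
have dw : d <= (omega - s) / 2 by rewrite !ge_min lexx !orbT.
pose Q t := (c t - c s) ^+ 2 / 4.
have cQ : {within I, continuous Q}.
  have cB : {within I, continuous (fun t => c t - c s)}.
    by move=> t; apply: cvgB; [exact: cc|exact: cvg_cst].
  by move=> t; rewrite /Q; apply: cvgM; [rewrite expr2; apply: cvgM; exact: cB|exact: cvg_cst].
have Q0 t : 0 <= Q t by rewrite divr_ge0// sqr_ge0.
have Q1 t : t \in `[0, omega] -> Q t <= 1.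
  move=> tI; rewrite ler_pdivrMr// mul1r; have := c1 t tI; have := c1 s sI.
  by rewrite !ler_norml => /andP[? ?] /andP[? ?]; nra.
have Qp t : t \in `[0, omega] -> t != s -> 0 < Q t.
  move=> tI ts; rewrite divr_gt0// lt_neqAle sqr_ge0 andbT eq_sym sqrf_eq0 subr_eq0.
  by apply: contra_neq ts; exact: cs.
(* The point s is the only zero of Q, so Q has a positive minimum on each compact piece that avoids
   s. *)
have inf_on a b : 0 <= a -> a <= b -> b <= omega -> (s < a \/ b < s) ->
    exists2 e : R, 0 < e & forall t, a <= t <= b -> e <= Q t.
  move=> a0 ab bw sab; have cab : {within `[a, b], continuous Q}.
    by apply: continuous_subspaceW cQ; apply: subset_itv; rewrite bnd_simp.
  have [t0] := EVT_min ab cab; rewrite in_itv/= => /andP[at0 t0b] ht.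
  exists (Q t0) => [|t tab]; last by apply: ht; rewrite in_itv.
  apply: Qp; first by rewrite in_itv/= (le_trans a0 at0) (le_trans t0b bw).
  by case: sab => h; apply/eqP => e; move: at0 t0b; rewrite e; lra.
have [e1 e10 he1] := inf_on 0 (s - d) (lexx _) ltac:(lra) ltac:(lra) ltac:(right; lra).
have [e2 e20 he2] := inf_on (s + d) omega ltac:(lra) ltac:(lra) (lexx _) ltac:(left; lra).
(* Q is at least e at distance d or more from s, so with a = 1 + e the base a - Q is at most 1
   there. *)
pose e := Num.min e1 e2.
have e0 : 0 < e by rewrite lt_min e10.
have far t : t \in `[0, omega] -> d <= `|t - s| -> e <= Q t.
  rewrite in_itv/= => /andP[t0 tw]; rewrite ler_normr => /orP[h|h].
    by apply: le_trans (he2 t _); [rewrite ge_min lexx orbT|lra].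
  by apply: le_trans (he1 t _); [rewrite ge_min lexx|lra].
have [d2 d20 h2] := near_s Q (e / 2) cQ ltac:(by rewrite divr_gt0).
pose d3 := Num.min d d2.
have d30 : 0 < d3 by rewrite lt_min d0.
have [d3d d3d2] : d3 <= d /\ d3 <= d2 by split; rewrite ge_min lexx ?orbT.
(* On J, to the right of s, the base is at least 1 + e / 2 and G is at least half of G s; its length
   d3 / 2 does not depend on the exponent. *)
pose J : set R := `[s, s + d3 / 2]%classic.
have JI : J `<=` I.
  move=> t; rewrite /J /= !in_itv/= => /andP[a1 a2].
  rewrite (le_trans (ltW s0) a1) /=; apply: le_trans a2 _.
  by rewrite -lerBrDl (le_trans (half_le (ltW d30)))// (le_trans d3d)// (le_trans dw)// half_le// ltW.
have mJ : measurable (J : set (measurableTypeR R)) by exact: measurable_itv.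
have J1 : lam J = (d3 / 2)%:E.
  by rewrite lebesgue_measure_itv/= lte_fin ltrDl divr_gt0// -EFinD addrAC subrr add0r.
have iG : lam.-integrable I (EFin \o G).
  by apply: continuous_compact_integrable => //; exact: segment_compact.
have iGa : lam.-integrable I (EFin \o (fun t => `|G t|)).
  by have := integrable_abse iG; apply: eq_integrable => // x _ /=.
have iJ : lam.-integrable I (EFin \o (\1_J : R -> R)).
  apply: measurable_bounded_integrable => //.
  - by rewrite [X in (X < _)%E](_ : _ = omega%:E) ?ltry//; exact: lamI.
  - exists 1; split; rewrite ?num_real// => K K1 x _; rewrite /= indicE.
    by case: (x \in J); rewrite ?normr1 ?normr0 ltW// (lt_trans ltr01).
set A := \int[lam]_(t in I) `|G t|.
have key m : (1 + e / 2) ^+ m * (G s / 2 * (d3 / 2)) <= A.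
  have EJ : \int[lam]_(t in I) (\1_J t : R) = d3 / 2.
    rewrite /Rintegral integral_indic// (_ : J `&` I = J); last by apply/setIidPl.
    by rewrite [X in fine X](_ : _ = (d3 / 2)%:E).
  set C := (1 + e / 2) ^+ m * (G s / 2).
  have C0 : 0 <= C by rewrite mulr_ge0 ?exprn_ge0 ?divr_ge0 ?addr_ge0 ?divr_ge0 ?(ltW e0) ?(ltW Gs).
  have cP : {within I, continuous (fun t => G t * (1 + e - (c t - c s) ^+ 2 / 4) ^+ m)}.
    have cB : {within I, continuous (fun t => 1 + e - Q t)}.
      by move=> u; apply: cvgB; [exact: cvg_cst|exact: cQ].
    have cX n : {within I, continuous (fun t => (1 + e - Q t) ^+ n)}.
      elim: n => [|n IH] u; first exact: cvg_cst.
      have -> : (fun t => (1 + e - Q t) ^+ n.+1) = (fun t => (1 + e - Q t) * (1 + e - Q t) ^+ n).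
        by apply/funext => t; rewrite exprS.
      by apply: cvgM; [exact: cB|exact: IH].
    by move=> t; apply: cvgM; [exact: cG|exact: cX].
  have iP : lam.-integrable I (EFin \o (fun t => G t * (1 + e - (c t - c s) ^+ 2 / 4) ^+ m)).
    by apply: continuous_compact_integrable => //; exact: segment_compact.
  have : \int[lam]_(t in I) (C * \1_J t + (-1) * `|G t|) <=
      \int[lam]_(t in I) (G t * (1 + e - (c t - c s) ^+ 2 / 4) ^+ m).
    apply: le_Rintegral => //; first exact: integrable_lin.
    move=> t tI; rewrite -/(Q t) indicE; apply: bump_pointwise => //; first by rewrite Q0 Q1.
    have [td|td] := ltP `|t - s| d; [left|right]; split.
    - have := h1 t tI (lt_le_trans td (le_trans dd1 (half_le (ltW d10)))).
      by rewrite ler_norml => /andP[+ _]; exact: half_le_sub.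
    - move=> /set_mem; rewrite /J /= in_itv/= => /andP[a1 a2].
      have : `|Q t - Q s| <= e / 2.
        by apply: h2 => //; exact: dist_right_half d30 a1 a2 d3d2.
      have -> : Q s = 0 by rewrite /Q subrr expr0n mul0r.
      by rewrite subr0 ger0_norm.
    - exact: far.
    - apply/negP => /set_mem; rewrite /J /= in_itv/= => /andP[a1 a2].
      by move: td; rewrite leNgt (dist_right_half d30 a1 a2 d3d).
  by rewrite hz Rintegral_lin// EJ -/A mulN1r subr_le0 /C -[X in X <= _]mulrA.
have B0 : 0 < G s / 2 * (d3 / 2) by rewrite mulr_gt0 ?divr_gt0.
have A0 : 0 <= A by apply: Rintegral_ge0 => t _.
have e20' : 0 < e / 2 by rewrite divr_gt0.
have [m hm] := bernoulli_unbounded e20' B0 A0.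
by have := key m; rewrite leNgt hm.
Qed.

End Trigonometric.

(** * Completeness of the trigonometric systems *)

Section Totality.
Variables (R : realType) (omega : R).
Hypothesis omega0 : 0 < omega.
Local Notation Re := complex.Re.
Local Notation lam := (@lebesgue_measure R).
Local Notation I := (`[0, omega]%classic : set R).
Local Notation ac := (abs_continuous omega).
Implicit Types (f g h : R -> R[i]) (t s a : R).

Let mI : measurable (I : set (measurableTypeR R)).
Proof. exact: measurable_itv. Qed.

Lemma cintegral_mulr1 f : cintegral lam I (fun t => f t * 1) = cintegral lam I f.
Proof. by apply: eq_cintegral => t _; rewrite mulr1. Qed.

Lemma acX f n : ac f -> ac (fun t => f t ^+ n).
Proof.
move=> hf; elim: n => [|n IH]; first exact: cst_ac.
rewrite (_ : (fun t => _) = (fun t => f t * f t ^+ n)); first exact: abs_continuousM.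
by apply/funext => t; rewrite exprS.
Qed.

Lemma acZ f (k : R[i]) : ac f -> ac (fun t => k * f t).
Proof. by move=> hf; apply: abs_continuousM => //; exact: cst_ac. Qed.

Lemma acD f g : ac f -> ac g -> ac (fun t => f t + g t).
Proof.
move=> hf hg; rewrite (_ : (fun t => _) = (fun t => 1 * f t + g t)); first exact: abs_continuous_lin.
by apply/funext => t; rewrite mul1r.
Qed.

(** The hypothesis extends from powers to all polynomials in c, in particular to the bumps of
    [bump_zero], which concentrate at s because c takes the value c s only there. *)
Lemma moments_zero (G : R -> R[i]) (c : R -> R) (s : R) : ac G -> ac (fun t => (c t)%:C) ->
  0 < s < omega -> (forall t, t \in `[0, omega] -> `|c t| <= 1) ->
  (forall t, t \in `[0, omega] -> c t = c s -> t = s) ->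
  (forall j, cintegral lam I (fun t => G t * (c t)%:C ^+ j) = 0) -> G s = 0.
Proof.
move=> aG ac_ s0 c1 cs hz.
have acp (p : {poly R}) : ac (fun t => (p.[c t])%:C).
  elim/poly_ind: p => [|p k IH].
    rewrite (_ : (fun t => _) = fun=> 0); first exact: cst_ac.
    by apply/funext => t; rewrite horner0.
  rewrite (_ : (fun t => _) = fun t => (p.[c t])%:C * (c t)%:C + k%:C).
    by apply: acD; [exact: abs_continuousM|exact: cst_ac].
  by apply/funext => t; rewrite hornerMXaddC rmorphD rmorphM.
have hp (p : {poly R}) j : cintegral lam I (fun t => G t * (c t)%:C ^+ j * (p.[c t])%:C) = 0.
  elim/poly_ind: p j => [|p k IH] j.
    rewrite -(cintegral0 lam mI); apply: eq_cintegral => t _.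
    by rewrite horner0 mulr0.
  rewrite (@eq_cintegral _ _ _ lam I _ ( fun t => G t * (c t)%:C ^+ j.+1 * (p.[c t])%:C +
      k%:C * (G t * (c t)%:C ^+ j))); last first.
    by move=> t _; rewrite hornerMXaddC rmorphD rmorphM exprS/=; ring.
  have i1 n : ac (fun t => G t * (c t)%:C ^+ n) by apply: abs_continuousM => //; exact: acX.
  rewrite cintegralD//; last 2 first.
    by apply: ac_cintegrable => //; apply: abs_continuousM.
    by apply: ac_cintegrable => //; exact: acZ.
  by rewrite IH cintegralZ ?hz ?mulr0 ?addr0//; exact: ac_cintegrable.
have H (k : R[i]) : Re (k * G s) <= 0.
  apply: (@bump_zero _ _ omega0 (fun t => Re (k * G t)) c s) => //.
  - exact: (ac_within (acZ k aG)).1.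
  - exact: (ac_within ac_).1.
  move=> a b m; pose p : {poly R} := (a%:P - ('X - b%:P) ^+ 2 * (4^-1)%:P) ^+ m.
  have pE t : p.[c t] = (a - (c t - b) ^+ 2 / 4) ^+ m.
    by rewrite /p horner_exp !(hornerE, horner_exp).
  have E : cintegral lam I (fun t => G t * (p.[c t])%:C) = 0.
    by rewrite -[RHS](hp p 0%N); apply: eq_cintegral => t _; rewrite expr0 mulr1.
  have : cintegral lam I (fun t => k * (G t * (p.[c t])%:C)) = 0.
    by rewrite cintegralZ ?E ?mulr0//; apply: ac_cintegrable => //; apply: abs_continuousM.
  rewrite /cintegral => /eqP; rewrite eq_complex/= => /andP[/eqP E' _]; rewrite -[RHS]E'.
  apply: eq_Rintegral => t _; rewrite -pE mulrA [in RHS]ReM/= mulr0 subr0//.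
(* The multipliers 1, -1, i and -i bound both parts of G s from above and from below. *)
have h1 := H 1; have h2 := H (-1); have h3 := H (0 +i* 1); have h4 := H (0 -i* 1).
apply/eqP; rewrite eq_complex; move: h1 h2 h3 h4; case: (G s) => x y.
rewrite !ReM /= !(mul1r, mul0r, mulN1r, subr0, sub0r, opprK) => h1 h2 h3 h4.
by apply/andP; split; apply/eqP; lra.
Qed.

Lemma prim_const_ae g (k : R[i]) : cintegrable lam I g ->
  (forall s, 0 < s < omega -> prim g s = k) -> {ae lam, forall t, t \in `[0, omega] -> g t = 0}.
Proof.
move=> gi hk; apply: ae_interior; apply: (ae_lamS _ (prim_deriv_ae gi)) => t ht tI.
have tI' : t \in `[0, omega] by move: tI; rewrite !in_itv/= => /andP[/ltW -> /ltW ->].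
apply: (is_deriv_uniq omega0 tI' (ht tI')); apply/is_derivP => e e0.
move: tI; rewrite in_itv/= => /andP[t0 tw].
exists (Num.min t (omega - t)) => [|s _]; first by rewrite lt_min t0 subr_gt0.
rewrite lt_min ltr_norml => /andP[/andP[s1 _]]; rewrite ltr_norml => /andP[_ s2].
have s0 : 0 < s < omega.
  by apply/andP; split; [lra|rewrite ltrD2r in s2].
by rewrite !hk ?t0// subrr mulr0 subr0 nrm0 mulr_ge0// ltW.
Qed.

Lemma expi_pi_nat (n : nat) : expi (pi * n%:R) = (-1) ^+ n :> R[i].
Proof.
elim: n => [|n IH]; first by rewrite mulr0 /expi cos0 sin0.
rewrite -natr1 mulrDr mulr1 expiD IH exprSr; congr (_ * _).
by rewrite /expi cospi sinpi; apply/eqP; rewrite eq_complex/= oppr0 !eqxx.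
Qed.

Lemma expi_pi_int (z : int) : expi (pi * z%:~R) = (-1) ^+ `|z|%N :> R[i].
Proof.
have expiN (x : R) : expi (- x) = (expi x)^* by rewrite /expi cosN sinN.
case: z => n; first exact: expi_pi_nat.
rewrite NegzE mulrNz mulrN expiN expi_pi_nat abszN absz_nat.
by rewrite rmorphXn rmorphN rmorph1.
Qed.

Lemma sin_pi_int (z : int) : sin (pi * z%:~R) = 0 :> R.
Proof.
have := expi_pi_int z; rewrite /expi => /eqP; rewrite eq_complex => /andP[_ /eqP/= ->].
by rewrite -signr_odd; case: odd; rewrite ?expr1 ?expr0//= oppr0.
Qed.

Lemma expi_2pi (z : int) : expi (2 * pi * z%:~R) = 1 :> R[i].
Proof.
have -> : 2 * pi * z%:~R = pi * (2 * z)%:~R :> R by rewrite intrM; ring.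
by rewrite expi_pi_int abszM exprM sqrrN !expr1n.
Qed.

Definition fr (z : int) : R := pi * z%:~R / omega.

Lemma fr_neq0 z : z != 0 -> fr z != 0.
Proof.
by move=> z0; rewrite /fr !mulf_neq0 ?invr_eq0 ?intr_eq0 ?z0// gt_eqF ?pi_gt0.
Qed.

Lemma frD y z : fr (y + z) = fr y + fr z.
Proof. by rewrite /fr intrD; ring. Qed.

Lemma frN z : fr (- z) = - fr z.
Proof. by rewrite /fr mulrNz; ring. Qed.

Lemma fr0 : fr 0 = 0. Proof. by rewrite /fr mulr0 mul0r. Qed.

Lemma fr_omega z : fr z * omega = pi * z%:~R.
Proof. by rewrite /fr divfK// gt_eqF. Qed.

Lemma phi_omega z : phi (fr (2 * z)) omega = 1.
Proof.
rewrite /phi fr_omega (_ : pi * _ = 2 * pi * z%:~R) ?expi_2pi// intrM; ring.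
Qed.

Lemma phi_at0 a : phi a 0 = 1.
Proof. by rewrite /phi mulr0 /expi cos0 sin0. Qed.

Lemma csin_omega z : csin (fr z) omega = 0.
Proof. by rewrite /csin fr_omega sin_pi_int. Qed.

Lemma csin_at0 a : csin a 0 = 0.
Proof. by rewrite /csin mulr0 sin0. Qed.

Lemma int_phi z : cintegral lam I (phi (fr (2 * z))) = if z == 0 then omega%:C else 0.
Proof.
have [->|z0] := eqVneq z 0.
  rewrite mulr0 fr0 (@eq_cintegral _ _ _ lam I _ ( fun=> 1)) ?cintegral_cst ?mulr1//.
  by move=> t _; rewrite phi0.
have f0 : (0 +i* fr (2 * z)) != 0 :> R[i].
  by rewrite eq_complex/= negb_and fr_neq0 ?orbT// mulf_neq0.
apply: (mulfI f0); rewrite mulr0 -cintegralZ//; last exact/ac_cintegrable/phi_ac.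
rewrite (@ac_FTC _ _ omega0 (phi (fr (2 * z)))); last 1 first.
- by apply: ae_deriv_all => // t _; exact: phi_deriv.
- by rewrite phi_omega phi_at0 subrr.
- exact: phi_ac.
- by apply: cintegrableZ => //; exact/ac_cintegrable/phi_ac.
Qed.

Lemma int_ccos z : cintegral lam I (ccos (fr z)) = if z == 0 then omega%:C else 0.
Proof.
have [->|z0] := eqVneq z 0.
  rewrite fr0 (@eq_cintegral _ _ _ lam I _ ( fun=> 1)) ?cintegral_cst ?mulr1//.
  by move=> t _; rewrite /ccos mul0r cos0.
have f0 : (fr z)%:C != 0 :> R[i] by rewrite eq_complex/= negb_and fr_neq0.
apply: (mulfI f0); rewrite mulr0 -cintegralZ//; last exact/ac_cintegrable/ccos_ac.
rewrite (@ac_FTC _ _ omega0 (csin (fr z))); last 1 first.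
- by apply: ae_deriv_all => // t _; exact: csin_deriv.
- by rewrite csin_omega csin_at0 subrr.
- exact: csin_ac.
- by apply: cintegrableZ => //; exact/ac_cintegrable/ccos_ac.
Qed.

Section Mean.
Variable F : R -> R[i].
Hypothesis aF : ac F.
Definition cmean : R[i] := (omega^-1)%:C * cintegral lam I F.
Definition cfluct t : R[i] := F t - cmean.

Lemma cfluct_ac : ac cfluct.
Proof. by apply: acD => //; exact: cst_ac. Qed.

Lemma int_cfluct g : ac g -> cintegral lam I (fun t => cfluct t * g t) =
  cintegral lam I (fun t => F t * g t) - cmean * cintegral lam I g.
Proof.
move=> ag; rewrite -mulNr -cintegralZ//; last exact: ac_cintegrable.
rewrite -cintegralD//.
- by apply: eq_cintegral => t _; rewrite /cfluct mulrBl mulNr.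
- by apply: ac_cintegrable => //; exact: abs_continuousM.
- by apply: ac_cintegrable => //; exact: acZ.
Qed.

Lemma int_cfluct1 : cintegral lam I cfluct = 0.
Proof.
have := int_cfluct (cst_ac omega 1); rewrite !cintegral_mulr1 => ->.
rewrite cintegral_cst// mulr1 /cmean mulrAC -rmorphM mulVf ?gt_eqF// mul1r subrr//.
Qed.
End Mean.

(** The primitive of g minus its mean is continuous and orthogonal to all the exponentials. Powers
    of a cosine centred at an interior point s are trigonometric polynomials, so [moments_zero]
    makes it vanish at s. The primitive is thus constant, and its derivative g is 0. *)
Lemma total_phi g : cintegrable lam I g ->
  (forall z : int, cintegral lam I (fun t => g t * phi (fr (2 * z)) t) = 0) ->
  {ae lam, forall t, t \in `[0, omega] -> g t = 0}.
Proof.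
move=> gi hg; have aF := prim_ac gi; set F := prim g in aF.
have g0 : cintegral lam I g = 0.
  by rewrite -(hg 0); apply: eq_cintegral => t _; rewrite mulr0 fr0 phi0 mulr1.
have Fw : F omega = 0 by rewrite -g0.
have F0 : F 0 = 0 by exact: prim0.
have hF z : z != 0 -> cintegral lam I (fun t => F t * phi (fr (2 * z)) t) = 0.
  move=> z0; have f0 : (0 +i* fr (2 * z)) != 0 :> R[i].
    by rewrite eq_complex/= negb_and fr_neq0 ?orbT// mulf_neq0.
  have pi_ : cintegrable lam I (fun t => (0 +i* fr (2 * z)) * phi (fr (2 * z)) t).
    by apply: cintegrableZ => //; exact/ac_cintegrable/phi_ac.
  have dp : ae_deriv omega (phi (fr (2 * z))) (fun t => (0 +i* fr (2 * z)) * phi (fr (2 * z)) t).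
    by apply: ae_deriv_all => // t _; exact: phi_deriv.
  have := ibp omega0 aF gi (prim_deriv_ae gi) (phi_ac omega0 _) pi_ dp.
  rewrite hg Fw F0 !mul0r subr0 sub0r => /eqP; rewrite eq_sym oppr_eq0 => /eqP E.
  apply: (mulfI f0); rewrite mulr0 -cintegralZ//; last first.
    by apply: ac_cintegrable => //; apply: abs_continuousM => //; exact: phi_ac.
  by rewrite -[RHS]E; apply: eq_cintegral => t _; ring.
pose G := cfluct F; have aG : ac G by exact: cfluct_ac.
have hG z : cintegral lam I (fun t => G t * phi (fr (2 * z)) t) = 0.
  have [->|z0] := eqVneq z 0.
    by rewrite -(int_cfluct1 aF); apply: eq_cintegral => t _; rewrite mulr0 fr0 phi0 mulr1.
  by rewrite int_cfluct ?hF ?int_phi ?(negbTE z0) ?mulr0 ?subrr//; exact: phi_ac.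
apply: (prim_const_ae (k := cmean F) gi) => s sI.
apply/eqP; rewrite -subr_eq0; apply/eqP.
(* The cosine has period omega and its maximum at s; another point t of the interval satisfies |t -
   s| < omega and cannot reach that value. *)
pose a := fr 2; pose c t := cos (a * (t - s)).
have cE t : (c t)%:C = 2^-1 * (phi a (- s) * phi a t + phi (- a) (- s) * phi (- a) t) :> R[i].
  rewrite /phi -!expiD /c (_ : - a * - s + - a * t = - (a * - s + a * t)); last ring.
  rewrite (_ : a * (t - s) = a * - s + a * t); last ring.
  set x := a * - s + a * t; rewrite /expi cosN sinN complexD subrr -mulr2n.
  rewrite (_ : (_ +i* 0) = 2 * (cos x)%:C) ?mulKf ?pnatr_eq0//.
  by rewrite mulr_natl mulr2n mulr2n complexD addr0.
have ac_ : ac (fun t => (c t)%:C).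
  rewrite (_ : (fun t => _) = fun t => 2^-1 * (phi a (- s) * phi a t + phi (- a) (- s) * phi (- a) t)).
    by apply: acZ; apply: acD; apply: acZ; exact: phi_ac.
  by apply/funext => t; rewrite cE.
apply: (moments_zero aG ac_ sI).
- by move=> t _; rewrite ler_norml cos_geN1 cos_le1.
- move=> t tI; rewrite /c subrr mulr0 cos0 => ct.
  have st : `|t - s| < omega.
    by move: sI tI; rewrite in_itv/= ltr_norml => /andP[? ?] /andP[? ?]; apply/andP; split; lra.
  apply/eqP; rewrite -subr_eq0 -normr_eq0; apply: contraTT isT => n0.
  pose x := pi * (`|t - s| / omega).
  have xI : 0 < x < pi.
    have n1 : 0 < `|t - s| by rewrite lt_neqAle normr_ge0 andbT eq_sym.
    apply/andP; split; first by rewrite mulr_gt0 ?pi_gt0 ?divr_gt0.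
    by rewrite /x -[X in _ < X]mulr1 ltr_pM2l ?pi_gt0// ltr_pdivrMr// mul1r.
  have sx := sin_gt0_pi xI.
  have : cos (a * (t - s)) = 1 - sin x ^+ 2 *+ 2.
    have -> : cos (a * (t - s)) = cos (x *+ 2).
      have -> : x *+ 2 = a * `|t - s| by rewrite /x /a /fr; ring.
      by have [h|h] := ger0P (t - s); rewrite // mulrN cosN.
    by rewrite mulr2n cosD -(cos2Dsin2 x); ring.
  rewrite ct => /eqP; rewrite eq_sym subr_eq addrC -subr_eq subrr eq_sym mulrn_eq0/=.
  by rewrite sqrf_eq0 gt_eqF.
(* All frequencies are treated at once, because a factor c t moves the index z to z + 1 and to z -
   1. *)
- move=> j; suff Z z : cintegral lam I (fun t => G t * (c t)%:C ^+ j * phi (fr (2 * z)) t) = 0.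
    by rewrite -[RHS](Z 0); apply: eq_cintegral => t _; rewrite mulr0 fr0 phi0 mulr1.
  elim: j z => [|j IH] z.
    by rewrite -[RHS](hG z); apply: eq_cintegral => t _; rewrite mulr1.
  have ai y : ac (fun t => G t * (c t)%:C ^+ j * phi (fr (2 * y)) t).
    by apply: abs_continuousM => //; [apply: abs_continuousM => //; exact: acX|exact: phi_ac].
  rewrite (@eq_cintegral _ _ _ lam I _ ( fun t =>
     2^-1 * phi a (- s) * (G t * (c t)%:C ^+ j * phi (fr (2 * (z + 1))) t) +
     2^-1 * phi (- a) (- s) * (G t * (c t)%:C ^+ j * phi (fr (2 * (z - 1))) t))).
    rewrite cintegralD//; try by apply: ac_cintegrable => //; exact: acZ.
    by rewrite !cintegralZ// ?IH ?mulr0 ?addr0//; exact: ac_cintegrable.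
  move=> t _; rewrite exprS {1}cE.
  rewrite (_ : 2 * (z + 1) = 2 * z + 2); last by rewrite mulrDr mulr1.
  rewrite (_ : 2 * (z - 1) = 2 * z + - 2); last by rewrite mulrDr mulrN mulr1.
  by rewrite (frD (2 * z) 2) (frD (2 * z) (- 2)) (frN 2) !phiD -/a; ring.
Qed.

(** As for the exponentials, except that integration by parts turns sines into cosines; the boundary
    terms vanish with the sines. *)
Lemma total_csin g : cintegrable lam I g ->
  (forall n : nat, cintegral lam I (fun t => g t * csin (fr n.+1%:Z) t) = 0) ->
  {ae lam, forall t, t \in `[0, omega] -> g t = 0}.
Proof.
move=> gi hg; have aF := prim_ac gi; set F := prim g in aF.
have hF (n : nat) : cintegral lam I (fun t => F t * ccos (fr n.+1%:Z) t) = 0.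
  have f0 : (fr n.+1%:Z)%:C != 0 :> R[i] by rewrite eq_complex/= negb_and fr_neq0.
  have pi_ : cintegrable lam I (fun t => (fr n.+1%:Z)%:C * ccos (fr n.+1%:Z) t).
    by apply: cintegrableZ => //; exact/ac_cintegrable/ccos_ac.
  have dp : ae_deriv omega (csin (fr n.+1%:Z)) (fun t => (fr n.+1%:Z)%:C * ccos (fr n.+1%:Z) t).
    by apply: ae_deriv_all => // t _; exact: csin_deriv.
  have := ibp omega0 aF gi (prim_deriv_ae gi) (csin_ac omega0 _) pi_ dp.
  rewrite hg csin_omega csin_at0 !mulr0 subr0 sub0r => /eqP; rewrite eq_sym oppr_eq0 => /eqP E.
  apply: (mulfI f0); rewrite mulr0 -cintegralZ//; last first.
    by apply: ac_cintegrable => //; apply: abs_continuousM => //; exact: ccos_ac.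
  by rewrite -[RHS]E; apply: eq_cintegral => t _; ring.
pose G := cfluct F; have aG : ac G by exact: cfluct_ac.
have cosN' z : ccos (fr (- z)) = ccos (fr z) :> (R -> R[i]).
  by apply/funext => t; rewrite /ccos frN mulNr cosN.
have hGn (n : nat) : cintegral lam I (fun t => G t * ccos (fr n) t) = 0.
  case: n => [|n].
    rewrite -(int_cfluct1 aF); apply: eq_cintegral => t _.
    by rewrite fr0 /ccos mul0r cos0 mulr1.
  by rewrite int_cfluct ?hF ?int_ccos ?mulr0 ?subrr//; exact: ccos_ac.
have hG (z : int) : cintegral lam I (fun t => G t * ccos (fr z) t) = 0.
  by case: z => n; [exact: hGn|rewrite NegzE cosN'; exact: hGn].
apply: (prim_const_ae (k := cmean F) gi) => s sI.
apply/eqP; rewrite -subr_eq0; apply/eqP.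
(* This cosine is injective on the whole interval, so it needs no centring at s. *)
pose c t := cos (fr 1 * t).
have cC t : (c t)%:C = ccos (fr 1) t by [].
have ac_ : ac (fun t => (c t)%:C) by exact: ccos_ac.
have fI t : t \in `[0, omega] -> fr 1 * t \in `[0, pi].
  rewrite !in_itv/= => /andP[t0 tw]; have p0 := pi_gt0 R.
  have f1 : 0 < fr 1 by rewrite divr_gt0 ?mulr1.
  by rewrite mulr_ge0 ?(ltW f1)//= (le_trans (ler_wpM2l (ltW f1) tw))// fr_omega mulr1.
apply: (moments_zero aG ac_ sI).
- by move=> t _; rewrite ler_norml cos_geN1 cos_le1.
- have sI' : s \in `[0, omega] by move: sI => /andP[a b]; rewrite in_itv/= !ltW.
  move=> t tI ct; have := cos_inj (fI t tI) (fI s sI') ct; apply: mulfI.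
  exact: fr_neq0.
- move=> j; suff Z z : cintegral lam I (fun t => G t * (c t)%:C ^+ j * ccos (fr z) t) = 0.
    rewrite -[RHS](Z 0); apply: eq_cintegral => t _.
    by rewrite fr0 /ccos mul0r cos0 mulr1.
  elim: j z => [|j IH] z.
    by rewrite -[RHS](hG z); apply: eq_cintegral => t _; rewrite mulr1.
  have ai y : ac (fun t => G t * (c t)%:C ^+ j * ccos (fr y) t).
    by apply: abs_continuousM => //; [apply: abs_continuousM => //; exact: acX|exact: ccos_ac].
  rewrite (@eq_cintegral _ _ _ lam I _ ( fun t =>
     2^-1 * (G t * (c t)%:C ^+ j * ccos (fr (z + 1)) t) +
     2^-1 * (G t * (c t)%:C ^+ j * ccos (fr (z - 1)) t))).
    rewrite cintegralD//; try by apply: ac_cintegrable => //; exact: acZ.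
    by rewrite !cintegralZ// ?IH ?mulr0 ?addr0//; exact: ac_cintegrable.
  move=> t _; rewrite exprS.
  have -> : ccos (fr (z + 1)) t = (cos (fr z * t) * c t - sin (fr z * t) * sin (fr 1 * t))%:C.
    by rewrite /ccos frD mulrDl cosD.
  have -> : ccos (fr (z - 1)) t = (cos (fr z * t) * c t + sin (fr z * t) * sin (fr 1 * t))%:C.
    by rewrite /ccos frD frN mulrDl mulNr cosB.
  by rewrite !(rmorphB, rmorphD, rmorphM)/= /ccos; field.
Qed.

End Totality.

Section MoreL2.
Variables (R : realType) (omega : R).
Hypothesis omega0 : 0 < omega.
Local Notation Re := complex.Re.
Local Notation Im := complex.Im.
Local Notation lam := (@lebesgue_measure R).
Local Notation I := (`[0, omega]%classic : set R).
Local Notation mu := (itv_measure omega).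
Local Notation H := (L2 omega).

Lemma inner_cs (x y : H) : nrm (inner x y) <= nrm x * nrm y.
Proof.
have lin := @cinner_lin _ _ _ mu; have conj := @cinner_conj _ _ _ mu; have nm := @cinner_nrm _ _ _ mu.
have [y0|y0] := eqVneq (nrm y) 0.
  have -> : y = 0 by apply/nrm_le0; rewrite y0.
  have -> : inner x 0 = 0 by rewrite -[inner x 0]/(cinner x 0) conj (ip0 lin) conjC0.
  by rewrite !nrm0 mulr0.
have y1 : 0 < nrm y by rewrite lt_neqAle eq_sym y0 nrm_ge0.
pose a := inner x y * ((nrm y ^+ 2)^-1)%:C.
have n2 : (nrm y ^+ 2)%:C != 0 :> R[i] by rewrite eq_complex/= eqxx andbT expf_neq0.
have o : cinner (x - a *: y) (a *: y) = 0.
  rewrite (ipZr lin conj) (ipD lin) (ipN lin) (ipZ lin) nm /a -mulrA -rmorphM mulVf ?expf_neq0// mulr1.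
  by rewrite subrr mulr0.
have := pythagoras lin conj nm o; rewrite subrK => E.
have : nrm (a *: y) ^+ 2 <= nrm x ^+ 2 by rewrite E lerDr sqr_ge0.
rewrite ler_pXn2r ?nnegrE ?nrm_ge0// nrmZ /a nrmM nrm_real ger0_norm ?invr_ge0 ?sqr_ge0//.
by rewrite expr2 invfM mulrA divfK// ler_pdivrMr.
Qed.

Lemma inner_tends (u : nat -> H) x y : tends u x -> tends (fun n => inner (u n) y) (inner x y).
Proof.
move=> ux; apply: (tends_squeeze (M := nrm y) _ ux) => n.
have := inner_cs (u n - x) y; rewrite mulrC.
rewrite (_ : inner (u n - x) y = inner (u n) y - inner x y)//.
have lin := @cinner_lin _ _ _ mu.
by rewrite -[LHS]/(cinner _ _) (ipD lin) (ipN lin).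
Qed.

Lemma represents_lin f g (x y : H) (k : R[i]) : represents f x -> represents g y ->
  represents (fun t => k * f t + g t) (k *: x + y).
Proof.
move=> hf hg; have E : k *: x + y = cL2_class (k *: cL2_repr x + cL2_repr y).
  by rewrite cL2_classD cL2_classZ !cL2_reprK.
have := repr_class (k *: cL2_repr x + cL2_repr y); rewrite -E => hr.
by apply: filterS3 hf hg hr => t h1 h2 h3; rewrite h3 -[LHS]/(k * cL2_repr x t + cL2_repr y t) h1 h2.
Qed.

Lemma representsZ f (x : H) (k : R[i]) : represents f x -> represents (fun t => k * f t) (k *: x).
Proof.
move=> hf; have := represents_lin k hf (represents_repr 0); rewrite addr0 => h.
have h0 : {ae mu, forall t, cL2_repr (0 : H) t = 0}.
  have -> : (0 : H) = cL2_class (0 : sqint_fun mu).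
    rewrite -[0 in RHS](scale0r (cL2_repr (0 : H))) cL2_classZ.
    exact: (esym (scale0r (cL2_class (cL2_repr (0 : H))))).
  exact: repr_class.
by apply: filterS2 h h0 => t -> ->; rewrite addr0.
Qed.

Lemma representsB f g (x y : H) : represents f x -> represents g y ->
  represents (fun t => f t - g t) (x - y).
Proof.
move=> hf hg; have := represents_lin (-1) hg hf; rewrite scaleN1r addrC.
by apply: filterS => t ->; rewrite mulN1r addrC.
Qed.

Lemma sqintM_bounded f g (M : R) : f \in sqint mu -> cmeas g -> (forall t, nrm (g t) <= M) ->
  (fun t => f t * g t) \in sqint mu.
Proof.
move=> hf mg gM; have [m1 m2] := cmeasM (sqint_cmeas hf) mg.
have M0 : 0 <= M by apply: le_trans (gM 0).
have fin := sq_norm_sqr (SqintFun hf).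
have [mr mi] := sqint_cmeas hf.
have mS : measurable_fun (setT : set (measurableTypeR R)) (fun x => ((Re (f x)) ^+ 2 + (Im (f x)) ^+ 2)%:E).
  by apply/measurable_EFinP; apply: measurable_funD; exact: measurable_funX.
have K (r : R -> R) : measurable_fun (setT : set (measurableTypeR R)) r ->
    (forall t, `|r t| <= nrm (f t * g t)) -> r \in Lfun mu 2%:E.
  move=> hr rb; apply: Lfun2P => //.
  apply: (@le_lt_trans _ _ (\int[mu]_x ((M ^+ 2)%:E * ((Re (f x)) ^+ 2 + (Im (f x)) ^+ 2)%:E))%E).
    apply: ge0_le_integral => //.
    - by move=> x _; rewrite lee_fin sqr_ge0.
    - by apply/measurable_EFinP; exact: measurable_funX.
    - by apply: measurable_funeM.
    move=> t _; rewrite -EFinM lee_fin -real_normK ?num_real//.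
    have -> : Re (f t) ^+ 2 + Im (f t) ^+ 2 = nrm (f t) ^+ 2.
      by rewrite nrm_sqr.
    rewrite -exprMn ler_pXn2r ?nnegrE ?mulr_ge0//; apply: le_trans (rb t) _.
    by rewrite nrmM mulrC ler_wpM2r.
  rewrite ge0_integralZl//; last first.
  - by rewrite lee_fin sqr_ge0.
  - by move=> x _; rewrite lee_fin addr_ge0 ?sqr_ge0.
  by rewrite -[X in (_ * X)%E]fin -EFinM ltry.
by apply/andP; split; apply: K => // t; [exact: Re_nrm|exact: Im_nrm].
Qed.

Lemma sq_normM_le f g (M : R) (hf : f \in sqint mu) (hfg : (fun t => f t * g t) \in sqint mu) :
  (forall t, nrm (g t) <= M) -> sq_norm (SqintFun hfg) <= M * sq_norm (SqintFun hf).
Proof.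
move=> gM; have M0 : 0 <= M by apply: le_trans (gM 0).
have <- : sq_norm (M%:C *: SqintFun hf) = M * sq_norm (SqintFun hf).
  rewrite sq_normZ; congr (_ * _); have := @nrm_real R M; rewrite /nrm => ->.
  by rewrite ger0_norm.
rewrite -lee_fin !sq_normE; apply: le_Lnorm2; [exact: measurable_modulus|exact: measurable_modulus|].
move=> t; rewrite modulus_ge0/= -[X in X <= _]/(nrm (f t * g t)) -[X in _ <= X]/(nrm (M%:C * f t)).
by rewrite !nrmM nrm_real (ger0_norm M0) mulrC ler_wpM2r.
Qed.

End MoreL2.

(** * The orthonormal basis attached to the boundary condition *)

Section TrigBasis.
Variables (R : realType) (bc : boundary_condition) (omega : R).
Hypothesis omega0 : 0 < omega.
Local Notation Re := complex.Re.
Local Notation Im := complex.Im.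
Local Notation lam := (@lebesgue_measure R).
Local Notation I := (`[0, omega]%classic : set R).
Local Notation mu := (itv_measure omega).
Local Notation H := (L2 omega).
Local Notation fr := (fr omega).

(* The bijection 0, -1, 1, -2, 2, ... of nat with int. *)
Definition zidx (i : nat) : int := if odd i then - (i./2)%:Z - 1 else (i./2)%:Z.

Lemma zidx_inj : injective zidx.
Proof.
move=> i j; have := odd_double_half i; have := odd_double_half j; rewrite /zidx.
by case: (odd i); case: (odd j) => /= ? ? ?; lia.
Qed.

Lemma zidx_surj (z : int) : exists i, zidx i = z.
Proof.
case: z => n.
  by exists n.*2; rewrite /zidx odd_double doubleK.
by exists n.*2.+1; rewrite /zidx/= odd_double/= uphalf_double NegzE; lia.
Qed.

(** The signed frequency in units of pi / omega. Dirichlet frequencies start at 1, so basis vector i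
    is [e_dir] of i + 1. *)
Definition nf (i : nat) : int :=
  if bc is dir then i.+1%:Z else 2 * zidx i + theta bc.

(* [tf i] is the complex conjugate of a representative of [be i]. *)
Definition tf (i : nat) (t : R) : R[i] :=
  if bc is dir then (Num.sqrt 2)%:C * csin (fr (nf i)) t else phi (fr (nf i)) t.

Definition be (i : nat) : H := if bc is dir then e_dir omega i.+1 else e_ bc omega (zidx i).

Lemma sqrt2_sqr : Num.sqrt 2 * Num.sqrt 2 = 2 :> R.
Proof. by rewrite -expr2 sqr_sqrtr. Qed.

Lemma sqrt2_le2 : Num.sqrt 2 <= 2 :> R.
Proof. by rewrite -[leRHS]ger0_norm// -sqrtr_sqr ler_sqrt; lra. Qed.

Lemma tf_cmeas i : cmeas (tf i).
Proof.
rewrite /tf; case: bc; [exact: phi_cmeas|exact: phi_cmeas|].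
apply: cmeasM; last exact: csin_cmeas.
by apply: cmeas_cont => t; exact: cvg_cst.
Qed.

Lemma tf_ac i : abs_continuous omega (tf i).
Proof.
rewrite /tf; case: bc; [exact: phi_ac|exact: phi_ac|].
by apply: acZ => //; exact: csin_ac.
Qed.

Lemma tf_le2 i t : nrm (tf i t) <= 2.
Proof.
have n1 : (1 : R) <= 2 by rewrite ler1n.
rewrite /tf; case: bc; rewrite ?nrm_phi//.
rewrite nrmM !nrm_real ger0_norm ?sqrtr_ge0//.
apply: le_trans sqrt2_le2; rewrite ler_piMr ?sqrtr_ge0//.
by rewrite ler_norml sin_le1 sin_geN1.
Qed.

Lemma nrm_conjC (z : R[i]) : nrm (z^*) = nrm z. Proof. exact: nrm_conj. Qed.

Lemma conj_tf_sqint i : (fun t => (tf i t)^*) \in sqint mu.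
Proof.
apply: (bounded_sqint omega0 (M := 2)); first exact/cmeas_conj/tf_cmeas.
by move=> t; rewrite nrm_conjC tf_le2.
Qed.

Lemma be_rep i : represents (fun t => (tf i t)^*) (be i).
Proof.
suff -> : be i = L2_of omega (fun t => (tf i t)^*) by apply: L2_of_repr; exact: conj_tf_sqint.
rewrite /be /tf /e_ /e_dir /nf; case: bc; congr L2_of; apply/funext => t.
- by rewrite phi_conj /phi /fr; congr expi; ring.
- by rewrite phi_conj /phi /fr; congr expi; ring.
- rewrite /csin -rmorphM (_ : ((_)%:C)^* = (Num.sqrt 2 * sin (fr i.+1 * t))%:C); last exact: conjc_real.
  rewrite /fr; congr ((_ * sin _)%:C); rewrite -pmulrn; ring.
Qed.

Lemma inner_be f (x : H) i : represents f x -> cintegrable lam I (fun t => f t * tf i t) ->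
  inner x (be i) = (omega^-1)%:C * cintegral lam I (fun t => f t * tf i t).
Proof.
move=> fx hi; rewrite (innerE omega0 fx (be_rep i)).
  by congr (_ * _); apply: eq_cintegral => t _; rewrite conjCK.
by apply: cintegrable_ext hi => // t _; rewrite conjCK.
Qed.

Lemma repr_tf_int (x : H) i : cintegrable lam I (fun t => cL2_repr x t * tf i t).
Proof.
have := sqint_cintegrableM omega0 (repr_sqint x) (conj_tf_sqint i).
by apply: cintegrable_ext => // t _; rewrite conjCK.
Qed.

Lemma inner_be_repr (x : H) i :
  inner x (be i) = (omega^-1)%:C * cintegral lam I (fun t => cL2_repr x t * tf i t).
Proof. exact: inner_be (represents_repr x) (repr_tf_int x i). Qed.

Lemma omegaVK : (omega^-1)%:C * omega%:C = 1 :> R[i].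
Proof. by rewrite -rmorphM mulVf ?gt_eqF. Qed.

Lemma be_orth i j : inner (be i) (be j) = (i == j)%:R.
Proof.
have hi : cintegrable lam I (fun t => (tf i t)^* * tf j t).
  have := sqint_cintegrableM omega0 (conj_tf_sqint i) (conj_tf_sqint j).
  by apply: cintegrable_ext => // t _; rewrite conjCK.
rewrite (inner_be (be_rep i) hi) {hi}.
have phase (th : int) : cintegral lam I (fun t => (phi (fr (2 * zidx i + th)) t)^* *
    phi (fr (2 * zidx j + th)) t) = if i == j then omega%:C else 0.
  rewrite (@eq_cintegral _ _ _ lam I _ (phi (fr (2 * (zidx j - zidx i))))); last first.
    by move=> t _; rewrite phi_conj -phiD -frN -frD; congr (phi (fr _) t); ring.
  by rewrite int_phi// subr_eq0 (inj_eq zidx_inj) eq_sym.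
rewrite /tf /nf; case: bc; rewrite ?phase; try by case: eqP => _; rewrite ?omegaVK ?mulr0.
rewrite (@eq_cintegral _ _ _ lam I _ (fun t => ccos (fr (i%:Z - j%:Z)) t +
    (-1) * ccos (fr (i.+1%:Z + j.+1%:Z)) t)); last first.
  move=> t _; rewrite /csin -rmorphM (_ : ((_)%:C)^* = (Num.sqrt 2 * sin (fr i.+1 * t))%:C); last exact: conjc_real.
  rewrite -!rmorphM /ccos mulN1r -rmorphN -rmorphD; congr (_%:C).
  have -> : i%:Z - j%:Z = i.+1%:Z - j.+1%:Z by lia.
  rewrite !frD frN mulrDl mulNr cosB mulrDl cosD.
  set a := sin _; set b := sin _; set c := cos _; set d := cos _.
  by transitivity (Num.sqrt 2 * Num.sqrt 2 * (a * b)); [ring|rewrite sqrt2_sqr; ring].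
have i1 z : cintegrable lam I (ccos (fr z)) by apply/ac_cintegrable/ccos_ac.
rewrite cintegralD//; last by apply: cintegrableZ.
rewrite cintegralZ// !int_ccos// (_ : (i.+1%:Z + j.+1%:Z == 0) = false); last by lia.
rewrite mulr0 addr0 (_ : (i%:Z - j%:Z == 0) = (i == j)); last by lia.
by case: eqP => _; rewrite ?omegaVK ?mulr0.
Qed.

(** A fixed factor [phi (fr th)], which has no zeros, reduces the antiperiodic system to the
    periodic one. *)
Lemma tf_total (f : R -> R[i]) : cintegrable lam I f ->
  (forall i, cintegral lam I (fun t => f t * tf i t) = 0) ->
  {ae lam, forall t, t \in `[0, omega] -> f t = 0}.
Proof.
move=> fi; have per_ap (th : int) : (forall i, cintegral lam I (fun t => f t * phi (fr (2 * zidx i + th)) t) = 0) ->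
    {ae lam, forall t, t \in `[0, omega] -> f t = 0}.
  move=> h; have gi : cintegrable lam I (fun t => f t * phi (fr th) t).
    by apply: cintegrableM_ac => //; exact: phi_ac.
  have := total_phi omega0 gi; move=> T; apply: (ae_lamS _ (T _)) => [t ft0 tI|z].
    have := ft0 tI => /eqP; rewrite mulf_eq0 => /orP[/eqP //|].
    by move=> /eqP p0; have := nrm_phi (fr th) t; rewrite p0 nrm0 => /eqP; rewrite eq_sym oner_eq0.
  have [i <-] := zidx_surj z; rewrite -[RHS](h i); apply: eq_cintegral => t _.
  by rewrite frD phiD; ring.
rewrite /tf /nf; case: bc => h; [exact: (per_ap _ h)|exact: (per_ap _ h)|].
apply: total_csin => // n.
have s2 : (Num.sqrt 2)%:C != 0 :> R[i] by rewrite eq_complex/= eqxx andbT gt_eqF ?sqrtr_gt0.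
apply: (mulfI s2); rewrite mulr0 -(h n) -cintegralZ//.
  by apply: eq_cintegral => t _; ring.
by apply: cintegrableM_ac => //; exact: csin_ac.
Qed.

Lemma be_total (x : H) : (forall i, inner x (be i) = 0) -> x = 0.
Proof.
move=> h; apply: (@represents_inj _ _ omega0 (fun=> 0)).
  apply: (represents_eq omega0 (represents_repr x)); apply: tf_total => [|i].
    exact/sqint_cintegrable/repr_sqint.
  have w0 : (omega^-1)%:C != 0 :> R[i] by rewrite eq_complex/= eqxx andbT invr_eq0 gt_eqF.
  by apply: (mulfI w0); rewrite mulr0 -inner_be_repr.
by have := representsZ 0 (represents_repr (0 : H)); rewrite scaler0; apply: filterS => t ->; rewrite mul0r.
Qed.

Definition co (i : nat) (x : H) : R[i] := inner x (be i).

Lemma co_l2coord : l2coord co.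
Proof.
apply: (@basis_l2coord _ _ (@cinner _ _ _ mu)).
- exact: cinner_lin.
- exact: cinner_conj.
- exact: cinner_nrm.
- exact: cL2_complete.
- exact: be_orth.
- exact: be_total.
Qed.

Lemma ee_be i : ee co i = be i.
Proof. by apply: (c_inj co_l2coord) => j; rewrite (c_ee co_l2coord) /co be_orth eq_sym. Qed.

End TrigBasis.

(** * The operator in Fourier coordinates *)

Section Derivatives.
Variables (R : realType) (omega : R).
Hypothesis omega0 : 0 < omega.
Local Notation lam := (@lebesgue_measure R).
Local Notation I := (`[0, omega]%classic : set R).
Local Notation ac := (abs_continuous omega).

Lemma prim_deriv g t : ac g -> t \in `[0, omega] -> is_deriv omega (prim g) t (g t).
Proof.
move=> ag tI; have gi := ac_cintegrable omega0 ag; apply/is_derivP => e e0.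
have e2 : 0 < e / 2 by rewrite divr_gt0.
have [d d0 hd] := abs_continuous_uniform ag e2; exists d => // s sI sd.
have H (a b : R) : 0 <= a -> a <= b -> b <= omega -> (forall x, a < x <= b -> nrm (g x - g t) <= e / 2) ->
    nrm (prim g b - prim g a - (b - a)%:C * g t) <= e * `|b - a|.
  move=> a0 ab bw hx.
  have sub : `]a, b] `<=` I by apply: subset_itv; rewrite bnd_simp.
  have m' : measurable (`]a, b]%classic : set (measurableTypeR R)) by exact: measurable_itv.
  have l' : fine (lam `]a, b]%classic) = b - a.
    rewrite lebesgue_measure_itv/= lte_fin; case: ltgtP ab => // ->; last by rewrite subrr.
  have i1 : cintegrable lam `]a, b] g by exact: (cintegrable_sub m' sub gi).
  have i2 : cintegrable lam `]a, b] (fun=> - g t).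
    by apply: (cintegrable_sub m' sub); exact: cintegrable_cst.
  rewrite (primB gi a0 ab bw).
  have -> : - ((b - a)%:C * g t) = cintegral lam `]a, b] (fun=> - g t).
    rewrite /cintegral !Rintegral_cst// l'; case: (g t) => x y.
    by apply/eqP; rewrite eq_complex/=; apply/andP; split; apply/eqP; ring.
  rewrite -cintegralD//; apply: le_trans (nrm_cintegral_le (M := e / 2) m' sub _ _) _.
  - exact: cintegrableD.
  - by move=> x /=; rewrite in_itv/= => xab; exact: hx.
  - by rewrite [fine _]l' ger0_norm ?subr_ge0// mulrC (mulrC 2) divfK// mulrC.
move: (sI) (tI); rewrite !in_itv/= => /andP[s0 sw] /andP[t0 tw].
have near x : 0 <= x <= omega -> `|x - t| <= `|s - t| -> nrm (g x - g t) <= e / 2.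
  by move=> xI xt; apply: hd; rewrite ?in_itv//; apply: le_lt_trans sd.
have [ts|/ltW st] := leP t s.
  apply: H => // x /andP[tx xs]; apply: near.
    by rewrite (le_trans t0 (ltW tx)) (le_trans xs sw).
  by rewrite (ger0_norm (x := x - t)) ?subr_ge0 ?(ltW tx)// (ger0_norm (x := s - t)) ?subr_ge0// lerD2r.
have -> : prim g s - prim g t - (s - t)%:C * g t = - (prim g t - prim g s - (t - s)%:C * g t).
  by rewrite -[t - s]opprB rmorphN; ring.
rewrite nrmN distrC; apply: H => // x /andP[sx xt]; apply: near.
  by rewrite (le_trans s0 (ltW sx)) (le_trans xt tw).
by rewrite (ler0_norm (x := x - t)) ?subr_le0// (ler0_norm (x := s - t)) ?subr_le0// lerN2 lerD2r ltW.
Qed.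

(* y 0, ..., y N is a chain of antiderivatives. *)
Definition chain (N : nat) (y : nat -> R -> R[i]) := forall j, (j < N)%N ->
  [/\ ac (y j), cintegrable lam I (y j.+1) & ae_deriv omega (y j) (y j.+1)].

(** The top derivative is known only almost everywhere and need not be measurable, so it is replaced
    by the chosen representative of its class. The lower ones are absolutely continuous: from the
    top downwards, each has a bounded derivative. *)
Lemma chain_of_sobolev N y (g : L2 omega) : sobolev omega N.+1 y -> represents (y N.+1) g ->
  chain N.+1 (fun j => if j == N.+1 then cL2_repr g : R -> R[i] else y j).
Proof.
move=> [yd ya yae _] yg.
have acy j : (j <= N)%N -> ac (y (N - j)%N).
  elim: j => [|j IH] jN; first by rewrite subn0.
  have e : (N - j)%N = (N - j.+1).+1 by rewrite subnSK.
  have [M hM] := abs_continuous_bounded omega0 (IH (ltnW jN)).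
  apply: (bounded_deriv_ac omega0 (f' := y (N - j)%N) _ hM) => t tI.
  by rewrite e; apply: yd => //=; rewrite -e leq_subr.
have acy' j : (j <= N)%N -> ac (y j) by move=> jN; have := acy (N - j)%N; rewrite subKn//; apply; rewrite leq_subr.
have ci1 : cintegrable lam I (cL2_repr g : R -> R[i]) by exact/sqint_cintegrable/repr_sqint.
move=> j; rewrite ltnS => jN; rewrite [j == _]ltn_eqF ?ltnS// eqSS; split.
- exact: acy'.
- have [_|jn] := eqVneq j N; first exact: ci1.
  by apply: ac_cintegrable => //; apply: acy'; rewrite ltn_neqAle jn.
- have [->|jn] := eqVneq j N.
    move: yae yg => /(ae_itvP omega0) h1 /(ae_itvP omega0) h2.
    by apply: ae_lamS (ae_lamI h1 h2) => t [a b] tI; rewrite b//; exact: a.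
  by apply: ae_deriv_all => t tI; apply: yd => //=; rewrite ltn_neqAle jn.
Qed.

End Derivatives.

(** * The differential operator as a diagonal operator minus multiplication by q *)

Section HighOrderOperator.
Variables (R : realType) (bc : boundary_condition) (k : nat) (omega : R) (q : R -> R[i]).
Hypothesis omega0 : 0 < omega.
Hypothesis k1 : (0 < k)%N.
Hypothesis qL2 : q \in sqint (itv_measure omega).
Local Notation Re := complex.Re.
Local Notation Im := complex.Im.
Local Notation lam := (@lebesgue_measure R).
Local Notation I := (`[0, omega]%classic : set R).
Local Notation mu := (itv_measure omega).
Local Notation H := (L2 omega).
Local Notation ac := (abs_continuous omega).
Local Notation tf := (tf bc omega).
Local Notation co := (@co R bc omega).
Local Notation nf := (nf bc).

Let mI : measurable (I : set (measurableTypeR R)).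
Proof. exact: measurable_itv. Qed.

Definition ev (i : nat) : R := fr omega (nf i) ^+ (2 * k).

(** Integration by parts 2k times. Under periodic and antiperiodic conditions the boundary terms
    cancel in each step. Under Dirichlet conditions the steps go in pairs: the sine vanishes at the
    ends beside an odd derivative, and the even derivative beside a cosine. *)
Lemma chain_coef y i : chain omega (2 * k) y -> satisfies_bc bc k omega y ->
  cintegral lam I (fun t => (-1) ^+ k * y (2 * k)%N t * tf i t) =
  (ev i)%:C * cintegral lam I (fun t => y 0%N t * tf i t).
Proof.
move=> hy hbc; have iy j : (j <= 2 * k)%N -> cintegrable lam I (y j).
  case: j => [_|j /hy[]//]; apply: ac_cintegrable => //.
  by have [] := hy 0%N; rewrite ?muln_gt0.
have iyf j f : (j <= 2 * k)%N -> ac f -> cintegrable lam I (fun t => y j t * f t).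
  by move=> jk af; apply: cintegrableM_ac => //; exact: iy.
have step j f f' : (j < 2 * k)%N -> ac f -> ac f' -> (forall t, is_deriv omega f t (f' t)) ->
    y j omega * f omega = y j 0 * f 0 ->
    cintegral lam I (fun t => y j.+1 t * f t) = - cintegral lam I (fun t => y j t * f' t).
  move=> jk af af' df e; have [h1 h2 h3] := hy j jk.
  rewrite (ibp omega0 h1 h2 h3 af (ac_cintegrable omega0 af')) ?e ?subrr ?sub0r//.
  exact: ae_deriv_all.
set x := fr omega (nf i).
have -> : cintegral lam I (fun t => (-1) ^+ k * y (2 * k)%N t * tf i t) =
    (-1) ^+ k * cintegral lam I (fun t => y (2 * k)%N t * tf i t).
  rewrite -cintegralZ//; first by apply: eq_cintegral => t _; rewrite mulrA.
  by apply: iyf => //; exact: tf_ac.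
suff -> : cintegral lam I (fun t => y (2 * k)%N t * tf i t) =
    (-1) ^+ k * (x ^+ (2 * k))%:C * cintegral lam I (fun t => y 0%N t * tf i t).
  by rewrite /ev -/x !mulrA -exprD addnn -mul2n exprM sqrrN !expr1n mul1r.
have per_ap : bc <> dir -> cintegral lam I (fun t => y (2 * k)%N t * phi x t) =
    (-1) ^+ k * (x ^+ (2 * k))%:C * cintegral lam I (fun t => y 0%N t * phi x t).
  move=> nd; have bd j : (j < 2 * k)%N -> y j omega * phi x omega = y j 0 * phi x 0.
    move=> jk; rewrite phi_at0 mulr1 /x /nf; move: hbc; rewrite /satisfies_bc.
    case: bc nd => // _ /(_ j jk) ->; rewrite ?addr0 ?phi_omega ?mulr1//.
    rewrite frD phiD phi_omega// mul1r /phi (fr_omega omega0 1) expi_pi_int expr1 mulrN1 //.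
  have hj j : (j <= 2 * k)%N -> cintegral lam I (fun t => y j t * phi x t) =
      (- (0 +i* x)) ^+ j * cintegral lam I (fun t => y 0%N t * phi x t).
    elim: j => [|j IH] jk; first by rewrite expr0 mul1r.
    rewrite (step j (phi x) (fun t => (0 +i* x) * phi x t) jk).
    - have jk' := ltnW jk; have iyj := iyf j (phi x) jk' (phi_ac omega0 x).
      rewrite exprS -mulrA -(IH jk') mulNr -(cintegralZ mI _ iyj); congr (- _).
      by apply: eq_cintegral => t _; ring.
    - exact: phi_ac.
    - by apply: acZ => //; exact: phi_ac.
    - exact: phi_deriv.
    - exact: bd.
  rewrite hj// exprM; congr (_ * _).
  have -> : (- (0 +i* x)) ^+ 2 = (-1) * (x ^+ 2)%:C :> R[i].
    by rewrite sqrrN expr2; apply/eqP; rewrite eq_complex/=; apply/andP; split; apply/eqP; ring.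
  by rewrite exprMn -rmorphXn -exprM.
rewrite /tf -/x; move: per_ap hbc; rewrite /satisfies_bc; case E : bc => [||] pa hbc; try by apply: pa.
have xE : x = fr omega i.+1%:Z by rewrite /x /nf E.
have f1 j : cintegrable lam I (y j) -> cintegral lam I (fun t => y j t * ((Num.sqrt 2)%:C * csin x t)) =
    (Num.sqrt 2)%:C * cintegral lam I (fun t => y j t * csin x t).
  move=> yi; rewrite -cintegralZ//; first by apply: eq_cintegral => t _; ring.
  by apply: cintegrableM_ac => //; exact: csin_ac.
rewrite !f1; [|exact: iy|exact: iy].
rewrite mulrCA; congr (_ * _).
have hj j : (j <= k)%N -> cintegral lam I (fun t => y (2 * j)%N t * csin x t) =
    (- (x ^+ 2)%:C) ^+ j * cintegral lam I (fun t => y 0%N t * csin x t).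
  elim: j => [|j IH] jk; first by rewrite expr0 mul1r.
  have jk2 : (2 * j < 2 * k)%N by rewrite ltn_mul2l.
  have jk3 : ((2 * j).+1 < 2 * k)%N by lia.
  rewrite mulnS -[(2 + 2 * j)%N]/((2 * j).+2).
  rewrite (step _ (csin x) (fun t => x%:C * ccos x t) jk3); first last.
  - by rewrite csin_at0 xE csin_omega// !mulr0.
  - exact: csin_deriv.
  - by apply: acZ => //; exact: ccos_ac.
  - exact: csin_ac.
  have [b0 b1] := hbc j jk.
  rewrite (@eq_cintegral _ _ _ lam I _ (fun t => x%:C * (y (2 * j).+1 t * ccos x t))); last by move=> t _; ring.
  rewrite cintegralZ//; last by apply: iyf; [exact: ltnW|exact: ccos_ac].
  rewrite (step _ (ccos x) (fun t => - x%:C * csin x t) jk2); first last.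
  - by rewrite b0 b1 !mul0r.
  - exact: ccos_deriv.
  - by apply: acZ => //; exact: csin_ac.
  - exact: ccos_ac.
  rewrite (@eq_cintegral _ _ _ lam I _ (fun t => - x%:C * (y (2 * j)%N t * csin x t))); last by move=> t _; ring.
  rewrite cintegralZ//; last by apply: iyf; [exact: ltnW|exact: csin_ac].
  rewrite (IH (ltnW jk)) [_ ^+ j.+1]exprS; have -> : (x ^+ 2)%:C = x%:C * x%:C :> R[i] by rewrite -rmorphM expr2.
  by set A := _ ^+ j; ring.
rewrite hj//; congr (_ * _); rewrite -[- _]mulN1r exprMn -rmorphXn -exprM//.
Qed.

Definition bq (i : nat) : H := L2_of omega (fun t => q t * (tf i t)^*).

Lemma bq_sqint i : (fun t => q t * (tf i t)^*) \in sqint mu.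
Proof.
apply: (sqintM_bounded (M := 2)) => //; first exact/cmeas_conj/tf_cmeas.
by move=> t; rewrite nrm_conjC tf_le2.
Qed.

Lemma bq_rep i : represents (fun t => q t * (tf i t)^*) (bq i).
Proof. by apply: L2_of_repr; exact: bq_sqint. Qed.

Definition bq_bound : R := 2 * @sq_norm _ (measurableTypeR R) R (itv_measure omega) (SqintFun qL2).

Lemma nrm_bq i : nrm (bq i) <= bq_bound.
Proof.
rewrite /bq (L2_ofE (bq_sqint i)) cL2_nrm_class; apply: sq_normM_le => t.
by rewrite nrm_conjC tf_le2.
Qed.

Lemma qtf_sqint i : (fun t => (q t * tf i t)^*) \in sqint mu.
Proof.
have h : (fun t => q t * tf i t) \in sqint mu.
  by apply: (sqintM_bounded (M := 2)) => //; [exact: tf_cmeas|exact: tf_le2].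
move: h => /andP[h1 h2]; apply/andP; split.
  by rewrite (_ : (fun t => _) = fun t => Re (q t * tf i t))//; apply/funext => t; case: (q t * tf i t).
rewrite (_ : (fun t => _) = (-1) \*: (fun t => Im (q t * tf i t))).
  have one2 : (1 <= 2%:E :> \bar R)%E by rewrite lee_fin ler1n.
  have [L0 LD] := Lfun_submod_closed mu one2.
  by rewrite -[X in X \in _]addr0; apply: LD.
by apply/funext => t; rewrite /= /GRing.scale/= mulN1r; case: (q t * tf i t).
Qed.

(** The product q x is not known to be square integrable, so its pairing with a basis function is
    rewritten as an inner product of x with [eta]. The two sides agree on truncations of x and pass
    to the limit. *)
Lemma q_coef (x : H) M i : Wb co x M -> cintegrable lam I (fun t => q t * cL2_repr x t * tf i t) /\
  co i (colop co bq x) = (omega^-1)%:C * cintegral lam I (fun t => q t * cL2_repr x t * tf i t).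
Proof.
move=> hW; have C := co_l2coord bc omega0; pose eta := L2_of omega (fun t => (q t * tf i t)^*).
have eta_rep : represents (fun t => (q t * tf i t)^*) eta by apply: L2_of_repr; exact: qtf_sqint.
have int_x (f : R -> R[i]) : f \in sqint mu -> cintegrable lam I (fun t => f t * (q t * tf i t)).
  move=> fL; have := sqint_cintegrableM omega0 fL (qtf_sqint i).
  by apply: cintegrable_ext => // t _; rewrite conjCK.
have inn (f : R -> R[i]) (z : H) : f \in sqint mu -> represents f z ->
    inner z eta = (omega^-1)%:C * cintegral lam I (fun t => f t * (q t * tf i t)).
  move=> fL fz; rewrite (innerE omega0 fz eta_rep).
    by congr (_ * _); apply: eq_cintegral => t _; rewrite conjCK.
  by apply: cintegrable_ext (int_x _ fL) => // t _; rewrite conjCK.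
split.
  by apply: cintegrable_ext (int_x _ (repr_sqint x)) => // t _; ring.
have hb j : nrm (bq j) <= bq_bound by exact: nrm_bq.
have t1 := c_tends C i (colopW_tends C hb hW).
have t2 := inner_tends eta (trunc_tends C x).
rewrite (@eq_cintegral _ _ _ lam I _ (fun t => cL2_repr x t * (q t * tf i t))); last by move=> t _; ring.
rewrite -(inn _ _ (repr_sqint x) (represents_repr x)).
apply: (tends_uniq t1); apply: tends_eq t2 => N.
have lin := @cinner_lin _ _ _ mu.
rewrite (c_sum C) /trunc -[LHS]/(cinner _ _) (ip_sum lin); apply: eq_bigr => j _.
rewrite (ipZ lin) (cZ C); congr (_ * _); rewrite -[LHS]/(inner _ _) ee_be//.
rewrite (inn _ _ (conj_tf_sqint bc omega0 j) (be_rep bc omega0 j)).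
rewrite /co (inner_be omega0 (bq_rep j)).
  by congr (_ * _); apply: eq_cintegral => t _; ring.
by apply: cintegrable_ext (int_x _ (conj_tf_sqint bc omega0 j)) => // t _; ring.
Qed.

Hypothesis ArelW : forall x w, Arel co ev x w -> exists M, Wb co x M.

(** By [chain_coef] the coordinates of w = (-1)^k y^(2k) are mu_i times those of x. This places x in
    the domain, and [q_coef] then identifies q x = w - z with B x. *)
Lemma L_bc_Lrel x z : L_bc bc k omega q (x, z) -> Lrel co ev bq x z.
Proof.
have C := co_l2coord bc omega0.
move=> [y [/= sy hbc y0 yz]]; have [_ _ _ [g yg]] := sy.
have k2 : (2 * k)%N = (2 * k).-1.+1 by rewrite prednK// muln_gt0.
rewrite k2 in sy; have hc := chain_of_sobolev omega0 sy; rewrite -k2 in hc.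
have {}hc := hc g yg; set y' := fun j => _ in hc.
have y'0 : y' 0%N = y 0%N by rewrite /y' eq_sym gtn_eqF// muln_gt0.
have y'k : y' (2 * k)%N = cL2_repr g by rewrite /y' eqxx.
have hbc' : satisfies_bc bc k omega y'.
  move: hbc; rewrite /satisfies_bc /y'; case: bc => h j jk.
  - by rewrite ltn_eqF// h.
  - by rewrite ltn_eqF// h.
  - by have [h1 h2] := h j jk; rewrite ltn_eqF ?ltn_mul2l// h1 h2.
pose w : H := (-1) ^+ k *: g.
have w_rep : represents (fun t => (-1) ^+ k * cL2_repr g t) w by apply: representsZ; exact: represents_repr.
have xw i : co i w = (ev i)%:C * co i x.
  rewrite /co (inner_be omega0 w_rep) -1?y'k; last first.
    apply: cintegrableM_ac => //; last exact: tf_ac.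
    by apply: cintegrableZ => //; rewrite y'k; exact/sqint_cintegrable/repr_sqint.
  rewrite chain_coef// y'0 (inner_be omega0 y0); first by ring.
  apply: cintegrableM_ac => //; last exact: tf_ac.
  have /hc[ac0 _ _] : (0 < 2 * k)%N by rewrite muln_gt0.
  by rewrite -y'0; exact: ac_cintegrable.
have [M hM] := ArelW xw; split; first by exists M.
have u_rep : represents (fun t => q t * cL2_repr x t) (w - z).
  by apply: filterS3 (representsB w_rep yz) y0 yg => t -> a b; rewrite a b; ring.
move=> i; have [h1 h2] := q_coef i hM.
rewrite h2 -(inner_be omega0 u_rep h1) -/(co i _) (cB C) xw; ring.
Qed.

(** Mean zero makes the next antiderivative periodic; half the end value makes this one
    antiperiodic. For Dirichlet conditions the odd antiderivatives get mean zero, so that the even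
    ones, started at 0, vanish at both ends. *)
Definition anti_cst (s : nat) (F : R -> R[i]) : R[i] :=
  match bc with
  | per => cmean omega F
  | ap => 2^-1 * F omega
  | dir => if odd s then 0 else cmean omega F
  end.

(* Iterated antiderivatives; the constants make all of them satisfy bc. *)
Fixpoint anti (g : R -> R[i]) (s : nat) : R -> R[i] :=
  if s is s'.+1 then fun t => prim (anti g s') t - anti_cst s' (prim (anti g s')) else g.

Section Antiderivatives.
Variable g : R -> R[i].
Hypothesis gi : cintegrable lam I g.
Hypothesis g_per : bc = per -> cintegral lam I g = 0.

Lemma anti_int s : cintegrable lam I (anti g s).
Proof.
elim: s => // s IH; apply: ac_cintegrable => //=.
by apply: acD => //; [exact: prim_ac|exact: cst_ac].
Qed.

Lemma anti_ac s : ac (anti g s.+1).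
Proof. by apply: acD => //; [exact/prim_ac/anti_int|exact: cst_ac]. Qed.

Lemma is_deriv_addc f t l (c : R[i]) : is_deriv omega f t l -> is_deriv omega (fun s => f s + c) t l.
Proof.
move=> /is_derivP h; apply/is_derivP => e /h[d d0 hd]; exists d => // s sI sd.
by rewrite (_ : f s + c - (f t + c) = f s - f t); [exact: hd|ring].
Qed.

Lemma anti_deriv s t : t \in `[0, omega] -> is_deriv omega (anti g s.+2) t (anti g s.+1 t).
Proof. by move=> tI; apply: is_deriv_addc; apply: prim_deriv => //; exact: anti_ac. Qed.

Lemma anti_deriv_ae : ae_deriv omega (anti g 1) g.
Proof. by apply: ae_lamS (prim_deriv_ae gi) => t h tI; apply: is_deriv_addc; exact: h. Qed.

Lemma anti_mean s : bc = per \/ (bc = dir /\ odd s) -> cintegral lam I (anti g s) = 0.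
Proof.
case: s => [[/g_per //|[]//]|s] h; have aF := prim_ac (anti_int s).
rewrite /= /anti_cst; move: h; case: bc => [_|[//|[]//]|[//|[_ /= /negbTE ->]]]; exact: int_cfluct1.
Qed.

Lemma prim_omega f : prim f omega = cintegral lam I f. Proof. by []. Qed.

Lemma anti_per s : bc = per -> anti g s.+1 0 = anti g s.+1 omega.
Proof. by move=> h; rewrite /= prim0 prim_omega anti_mean//; left. Qed.

Lemma anti_ap s : bc = ap -> anti g s.+1 0 = - anti g s.+1 omega.
Proof. by move=> h; rewrite /= /anti_cst h prim0; field. Qed.

Lemma anti_dir s : bc = dir -> odd s -> anti g s.+1 0 = 0 /\ anti g s.+1 omega = 0.
Proof.
move=> h os; rewrite /= /anti_cst h os prim0 subr0 prim_omega anti_mean ?subr0//.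
by right.
Qed.

End Antiderivatives.

Lemma nf_eq0 i : nf i = 0 -> bc = per.
Proof. by rewrite /nf; case: bc => //= h; lia. Qed.

(** The 2k-fold antiderivative of (-1)^k (z + B x) has the coordinates of x, hence equals x almost
    everywhere by totality. It is bounded, so q x is square integrable and can be compared with B x
    coordinate by coordinate. *)
Lemma Lrel_L_bc x z : Lrel co ev bq x z -> L_bc bc k omega q (x, z).
Proof.
have C := co_l2coord bc omega0.
move=> [[M hM] hz]; pose v := colop co bq x; pose w := z + v.
have xw i : co i w = (ev i)%:C * co i x by rewrite /w (cD C) hz subrK.
have k2 : (0 < 2 * k)%N by rewrite muln_gt0.
pose g t : R[i] := (-1) ^+ k * cL2_repr w t.
have wi : cintegrable lam I (cL2_repr w : R -> R[i]) by exact/sqint_cintegrable/repr_sqint.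
have gi : cintegrable lam I g by apply: cintegrableZ.
have w0 : (omega^-1)%:C != 0 :> R[i] by rewrite eq_complex/= eqxx andbT invr_eq0 gt_eqF.
(* For periodic conditions mu_0 = 0, so w has mean 0, as periodicity of the antiderivatives
   demands. *)
have g_per : bc = per -> cintegral lam I g = 0.
  move=> hbc; have n0 : nf 0 = 0 by rewrite /nf hbc.
  rewrite cintegralZ// (_ : cintegral _ _ _ = 0) ?mulr0//.
  apply: (mulfI w0); rewrite mulr0; have := xw 0%N.
  rewrite /ev n0 fr0 expr0n gtn_eqF// mul0r => <-; rewrite /co inner_be_repr//.
  congr (_ * _); apply: eq_cintegral => t _.
  by rewrite /tf n0 fr0 hbc phi0 mulr1.
(* Periodic antiderivatives have mean 0; the mean of x, lost in w since mu_0 = 0, is restored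
   here. *)
pose kap := if bc is per then co 0%N x else 0.
pose y j : R -> R[i] := if j is j'.+1 then anti g (2 * k - j)%N else fun t => anti g (2 * k) t + kap.
have yE j : (0 < j)%N -> y j = anti g (2 * k - j)%N by case: j.
have y0_ac : ac (y 0%N).
  by apply: acD => //; [rewrite -(prednK k2); exact: anti_ac|exact: cst_ac].
have y2k : y (2 * k)%N = g by rewrite yE// subnn.
have yd j t : (j < (2 * k).-1)%N -> t \in `[0, omega] -> is_deriv omega (y j) t (y j.+1 t).
  move=> jk tI; rewrite [y j.+1]yE//.
  have e : (2 * k - j.+1 = (2 * k - j.+2).+1)%N by lia.
  have [j0|j0] := posnP j; last first.
    by rewrite yE// (_ : (2 * k - j = (2 * k - j.+2).+2)%N) ?e; [exact: anti_deriv|lia].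
  rewrite j0 /y in e *; apply: is_deriv_addc.
  have e2 : (2 * k = (2 * k - 2).+2)%N by lia.
  by rewrite e [X in anti g X]e2; exact: anti_deriv.
have yl : y (2 * k).-1 = anti g 1.
  have e1 : (2 * k - (2 * k).-1 = 1)%N by lia.
  have e0 : (0 < (2 * k).-1)%N by lia.
  by rewrite (yE _ e0) e1.
have hc : chain omega (2 * k) y.
  move=> j jk; have [jl|jl] := eqVneq j (2 * k).-1.
    by rewrite jl (prednK k2) yl y2k; split; [exact: anti_ac|exact: gi|exact: anti_deriv_ae].
  have jl' : (j < (2 * k).-1)%N by lia.
  split; last by apply: ae_deriv_all => t; exact: yd.
    case: j jk {jl} jl' => [_ _|j jk jl']; first exact: y0_ac.
    have e : (2 * k - j.+1 = (2 * k - j.+2).+1)%N by lia.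
    by rewrite (yE _ (ltn0Sn j)) e; exact: anti_ac.
  by rewrite (yE _ (ltn0Sn j)); exact: anti_int.
have hbc : satisfies_bc bc k omega y.
  have sE j : (j < 2 * k)%N -> (2 * k - j = (2 * k - j.+1).+1)%N by lia.
  rewrite /satisfies_bc; case E : bc => j jk.
  - have e := sE j jk; case: j jk e => [|j] jk e.
      by move: e; rewrite subn0 /y => ->; rewrite (anti_per gi g_per).
    by rewrite (yE _ (ltn0Sn j)) e (anti_per gi g_per).
  - have e := sE j jk; case: j jk e => [|j] jk e.
      by move: e; rewrite subn0 /y /kap E !addr0 => ->; rewrite anti_ap.
    by rewrite (yE _ (ltn0Sn j)) e anti_ap.
  - have jk2 : (2 * j < 2 * k)%N by rewrite ltn_mul2l.
    have e := sE _ jk2; have os : odd (2 * k - (2 * j).+1) by rewrite oddB// !mul2n /= !odd_double.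
    case: j jk jk2 e os => [|j] jk jk2 e os.
      move: e; rewrite muln0 subn0 /y /kap E !addr0 => ->; exact: (anti_dir gi g_per).
    have j0 : (0 < 2 * j.+1)%N by rewrite muln_gt0.
    by rewrite (yE _ j0) e; exact: (anti_dir gi g_per).
have y0x : {ae lam, forall t, t \in `[0, omega] -> cL2_repr x t = y 0%N t}.
  have xi : cintegrable lam I (cL2_repr x : R -> R[i]) by exact/sqint_cintegrable/repr_sqint.
  have yi := ac_cintegrable omega0 y0_ac.
  have di : cintegrable lam I (fun t => cL2_repr x t + (-1) * y 0%N t).
    by apply: cintegrableD => //; exact: cintegrableZ.
  have ti f i : cintegrable lam I f -> cintegrable lam I (fun t => f t * tf i t).
    by move=> fi; apply: cintegrableM_ac => //; exact: tf_ac.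
  suff T : {ae lam, forall t, t \in `[0, omega] -> cL2_repr x t + (-1) * y 0%N t = 0}.
    by apply: ae_lamS T => t h tI; apply/eqP; rewrite -subr_eq0 -mulN1r h.
  apply: (tf_total omega0 di (bc := bc)) => i.
  rewrite (@eq_cintegral _ _ _ lam I _ (fun t => cL2_repr x t * tf i t + (-1) * (y 0%N t * tf i t))); last by move=> t _; ring.
  rewrite cintegralD ?cintegralZ//; [|exact: ti|exact: ti|by apply: cintegrableZ => //; exact: ti].
  rewrite mulN1r; apply/eqP; rewrite subr_eq0; apply/eqP.
  have [e0|e0] := eqVneq (nf i) 0.
    have hp := nf_eq0 e0; have i0 : i = 0%N.
      by apply: zidx_inj; move: e0; rewrite /nf hp /zidx/=; lia.
    have tE t : tf i t = 1 by rewrite /tf e0 fr0 hp phi0.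
    transitivity (cintegral lam I (cL2_repr x)); first by apply: eq_cintegral => t _; rewrite tE mulr1.
    transitivity (cintegral lam I (y 0%N)); last by apply: eq_cintegral => t _; rewrite tE mulr1.
    have ai := anti_int gi (2 * k); rewrite /y cintegralD//; last exact: cintegrable_cst.
    rewrite (anti_mean gi g_per); last by left.
    have kE : kap = co 0%N x by rewrite /kap {1}hp.
    rewrite cintegral_cst// add0r kE /co inner_be_repr// mulrA -rmorphM mulfV ?gt_eqF// mul1r.
    by apply: eq_cintegral => t _; rewrite -i0 tE mulr1.
  have ev0 : (ev i)%:C != 0 :> R[i] by rewrite eq_complex/= eqxx andbT expf_neq0// fr_neq0.
  have E1 : cintegral lam I (fun t => (-1) ^+ k * g t * tf i t) =
      cintegral lam I (fun t => cL2_repr w t * tf i t).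
    apply: eq_cintegral => t _.
    by rewrite /g mulrA -exprD addnn -mul2n exprM sqrrN !expr1n mul1r.
  apply: (mulfI ev0); rewrite -(chain_coef i hc hbc) y2k E1.
  by apply: (mulfI w0); rewrite mulrCA -!inner_be_repr// -xw.
have [My hMy] := abs_continuous_bounded omega0 y0_ac.
have zI : 0 \in `[0, omega] by rewrite in_itv/= lexx ltW.
have My0 : 0 <= My by apply: le_trans (hMy 0 zI).
(* Only the values on [0, omega] are controlled; the cut-off function is bounded and measurable on
   the whole line. *)
pose y0p t : R[i] := if t \in `[0, omega] then y 0%N t else 0.
have y0p_le t : nrm (y0p t) <= My by rewrite /y0p; case: ifP => [|_]; [exact: hMy|rewrite nrm0].
have y0p_meas : cmeas y0p.
  have [c1 c2] := ac_within y0_ac.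
  have m (r : R -> R) : {within I, continuous r} -> measurable_fun (setT : set (measurableTypeR R)) (r \_ I).
    by move=> hr; apply/(measurable_restrictT _ mI); exact: subspace_continuous_measurable_fun.
  split; [rewrite (_ : (fun t => _) = (fun t => Re (y 0%N t)) \_ I)|rewrite (_ : (fun t => _) = (fun t => Im (y 0%N t)) \_ I)]; try exact: m.
    by apply/funext => t; rewrite patchE /y0p mem_setE; case: ifP.
  by apply/funext => t; rewrite patchE /y0p mem_setE; case: ifP.
have qy : (fun t => q t * y0p t) \in sqint mu by exact: (sqintM_bounded qL2 y0p_meas y0p_le).
have u_rep := L2_of_repr qy; set u := L2_of omega _ in u_rep.
have uv : u = v.
  apply: (c_inj C) => i; have [h1 h2] := q_coef i hM; rewrite h2.
  have hi : cintegrable lam I (fun t => q t * y0p t * tf i t).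
    by apply: cintegrableM_ac; [|exact: sqint_cintegrable|exact: tf_ac].
  rewrite /co (inner_be omega0 u_rep hi); congr (_ * _); apply: cintegral_ae => //.
  by apply: ae_lamS y0x => t h tI; rewrite (h tI) /y0p tI.
have v_rep : represents (fun t => q t * y 0%N t) v.
  rewrite -uv; apply: (represents_eq omega0 u_rep); apply: (ae_lamS (P := fun=> True)) => [t _ tI|].
    by rewrite /y0p tI.
  exact: (aeW lam).
exists y; split => //=.
- split => //.
  + by rewrite yl; exact: anti_ac.
  + by apply/(ae_itvP omega0); rewrite yl y2k; exact: anti_deriv_ae.
  + by exists ((-1) ^+ k *: w); rewrite y2k; apply: representsZ; exact: represents_repr.
- by apply/(ae_itvP omega0).
- have -> : z = w - v by rewrite /w addrK.
  apply: filterS (representsB (represents_repr w) v_rep) => t ->.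
  by rewrite y2k /g mulrA -exprD addnn -mul2n exprM sqrrN !expr1n mul1r.
Qed.

Lemma L_bcE x z : L_bc bc k omega q (x, z) <-> Lrel co ev bq x z.
Proof. by split; [exact: L_bc_Lrel|exact: Lrel_L_bc]. Qed.

End HighOrderOperator.

(** * Gaps between the frequencies *)

Section PowerSums.
Variable R : realType.
Implicit Types (x y : R) (a b n : nat).

Lemma inv_sq_telescope x : 1 <= x -> (x ^+ 2)^-1 <= 2 / x - 2 / (x + 1).
Proof.
move=> x1; have x0 : 0 < x by lra.
have x2 : 0 < x + 1 by lra.
rewrite -subr_ge0 (_ : _ - _ = (x - 1) / (x ^+ 2 * (x + 1))); last first.
  by field; rewrite !gt_eqF.
by rewrite divr_ge0 ?mulr_ge0 ?sqr_ge0//; lra.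
Qed.

Lemma sbd_dist_sq a : sbd (fun i => ((`|i%:R - a%:R| + 1) ^+ 2)^-1 : R) 3.
Proof.
have P1 d : (d <= a)%N -> \sum_(0 <= i < a - d) ((`|i%:R - a%:R| + 1) ^+ 2)^-1 <= 2 / (d%:R + 2) :> R.
  move=> da; rewrite -{2}(subKn da); move: (leq_subr d a); set n := (a - d)%N.
  elim: n => [|n IH] na; first by rewrite big_geq// subn0 divr_ge0// addr_ge0.
  rewrite big_nat_recr//=; apply: le_trans (lerD (IH (ltnW na)) (lexx _)) _.
  have -> : `|n%:R - a%:R| + 1 = (a - n.+1)%:R + 2 :> R.
    rewrite distrC ger0_norm ?subr_ge0 ?ler_nat 1?ltnW// natrB// -natr1; ring.
  have x1 : 1 <= (a - n.+1)%:R + 2 :> R by have := ler0n R (a - n.+1); lra.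
  have := inv_sq_telescope x1.
  rewrite (_ : (a - n)%:R + 2 = (a - n.+1)%:R + 2 + 1 :> R); last first.
    by rewrite -(subnSK na) -natr1; ring.
  by lra.
have P2 d : \sum_(0 <= i < a + d) ((`|i%:R - a%:R| + 1) ^+ 2)^-1 <= 3 - 2 / (d%:R + 1) :> R.
  elim: d => [|d IH].
    have := P1 0%N isT; rewrite subn0 addn0 !mulr0n !add0r divff ?pnatr_eq0// divr1.
    by lra.
  rewrite addnS big_nat_recr//=; apply: le_trans (lerD IH (lexx _)) _.
  have -> : `|(a + d)%:R - a%:R| = d%:R :> R by rewrite natrD addrC addKr ger0_norm.
  rewrite -[d.+1%:R]natr1.
  have x1 : 1 <= d%:R + 1 :> R by have := ler0n R d; lra.
  by have := inv_sq_telescope x1; lra.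
move=> n; have [na|an] := leqP n a.
  have := P1 (a - n)%N (leq_subr _ _); rewrite subKn// => /le_trans; apply.
  by rewrite ler_pdivrMr; have := ler0n R (a - n); lra.
have := P2 (n - a)%N; rewrite subnKC 1?ltnW// => /le_trans; apply.
by rewrite lerBlDr lerDl divr_ge0// addr_ge0.
Qed.

Lemma sbd_max_sq n : (0 < n)%N -> sbd (fun j => ((maxn n j)%:R ^+ 2)^-1 : R) (3 / n%:R).
Proof.
move=> n0; have n1 : 1 <= n%:R :> R by rewrite ler1n.
have np : 0 < n%:R :> R by lra.
have P1 m : (m <= n)%N -> \sum_(0 <= j < m) ((maxn n j)%:R ^+ 2)^-1 <= 1 / n%:R :> R.
  move=> mn; apply: (@le_trans _ _ (\sum_(0 <= j < m) (n%:R ^+ 2)^-1)).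
    rewrite big_nat [leRHS]big_nat; apply: ler_sum => j /andP[_ jm].
    by rewrite (maxn_idPl _)// (leq_trans (ltnW jm)).
  rewrite sumr_const_nat subn0 -[leLHS]mulr_natr ler_pdivrMl ?exprn_gt0// mul1r expr2.
  by rewrite mulfK ?gt_eqF// ler_nat.
have P2 d : \sum_(0 <= j < n + d) ((maxn n j)%:R ^+ 2)^-1 <= 3 / n%:R - 2 / (n + d)%:R :> R.
  elim: d => [|d IH].
    by have := P1 n (leqnn n); rewrite addn0; lra.
  rewrite addnS big_nat_recr//=; apply: le_trans (lerD IH (lexx _)) _.
  rewrite (maxn_idPr _) ?leq_addr// -[(n + d).+1%:R]natr1.
  have x1 : 1 <= (n + d)%:R :> R by rewrite ler1n ltn_addr.
  by have := inv_sq_telescope x1; lra.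
move=> m; have [mn|nm] := leqP m n.
  by apply: le_trans (P1 m mn) _; rewrite ler_pM2r ?invr_gt0//; lra.
have := P2 (m - n)%N; rewrite subnKC 1?ltnW// => /le_trans; apply.
by rewrite lerBlDr lerDl divr_ge0.
Qed.

Lemma pow_gap_ge x y k : (0 < k)%N -> 0 <= y -> y <= x -> 1 <= x -> x - y <= x ^+ k - y ^+ k.
Proof.
case: k => // k _ y0 yx x1; elim: k => [|k IH]; first by rewrite !expr1.
rewrite !(exprS _ k.+1); set a := x ^+ k.+1 in IH *; set c := y ^+ k.+1 in IH *.
have c0 : 0 <= c by rewrite exprn_ge0.
have p1 : 0 <= (x - 1) * (a - c) by rewrite mulr_ge0 ?subr_ge0//; lra.
have p2 : 0 <= (x - y) * c by rewrite mulr_ge0 ?subr_ge0.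
by lra.
Qed.

(** For b < a, the difference of the squares is (a - b) (a + b) >= (a - b) a; raising integer
    squares to the power k does not decrease their distance. *)
Lemma pow_gap a b k : (0 < k)%N -> a != b ->
  `|a%:R - b%:R| * (maxn a b)%:R <= `|a%:R ^+ (2 * k) - b%:R ^+ (2 * k)| :> R.
Proof.
move=> k0; wlog ba : a b / (b < a)%N.
  move=> H ab; have [h|h|h] := ltngtP a b; last by rewrite h eqxx in ab.
    have := H b a h; rewrite (maxn_idPl (ltnW h)) eq_sym => /(_ ab).
    by rewrite distrC [leRHS]distrC.
  by have := H a b h ab; rewrite (maxn_idPl (ltnW h)).
move=> _; rewrite (maxn_idPl (ltnW ba)).
have ab : b%:R + 1 <= a%:R :> R by rewrite natr1 ler_nat.
have b0 := ler0n R b; rewrite ger0_norm; last lra.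
rewrite !exprM; have h : a%:R ^+ 2 - b%:R ^+ 2 <= (a%:R ^+ 2) ^+ k - (b%:R ^+ 2) ^+ k :> R.
  by apply: pow_gap_ge => //; nra.
by apply: le_trans (ler_norm _); apply: le_trans h; nra.
Qed.

End PowerSums.

Section FrequencyGaps.
Variables (R : realType) (nn : nat -> nat) (kap : R) (k : nat).
Hypothesis kap0 : 0 < kap.
Hypothesis k0 : (0 < k)%N.
Hypothesis nn_lb : forall i, (i <= nn i <= i.+1)%N.

Definition mun (i : nat) : R := kap * (nn i)%:R ^+ (2 * k).

Definition same_block (m : nat) (i j : nat) : bool := ((i < m) && (j < m))%N || (nn i == nn j).

Lemma mun_ge0 i : 0 <= mun i.
Proof. by rewrite mulr_ge0 ?exprn_ge0// ltW. Qed.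

Lemma mun_gap i j : nn i != nn j ->
  kap * `|(nn i)%:R - (nn j)%:R| * (maxn (nn i) (nn j))%:R <= `|mun i - mun j|.
Proof.
by move=> h; rewrite /mun -mulrBr normrM (gtr0_norm kap0) -mulrA ler_pM2l// pow_gap.
Qed.

(** As n_i >= i, one has 1 + mu_i >= min(1, kap) (1 + i^2) >= min(1, kap) (i + 1)^2 / 2. *)
Lemma mun_sum : sbd (fun i => (1 + mun i)^-1) (2 / Num.min 1 kap * 3).
Proof.
have m0 : 0 < Num.min 1 kap by rewrite lt_min ltr01.
have h := sbdZ (ltac:(by rewrite divr_ge0// ltW) : 0 <= 2 / Num.min 1 kap) (@sbd_dist_sq R 0).
apply: sbd_le h => i; rewrite subr0 ger0_norm//.
have q0 : 0 < (i%:R + 1) ^+ 2 :> R by rewrite exprn_gt0// natr1.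
rewrite -[leRHS]invrK invfM invrK invf_div lef_pV2 ?posrE ?mulr_gt0 ?divr_gt0//; last first.
  by have := mun_ge0 i; lra.
have mi : kap * i%:R ^+ 2 <= mun i.
  rewrite /mun ler_pM2l// exprM; have /andP[a _] := nn_lb i.
  have [->|i0] := posnP i; first by rewrite expr0n/= exprn_ge0// sqr_ge0.
  have n1 : 1 <= (nn i)%:R :> R by rewrite ler1n (leq_trans i0).
  apply: (@le_trans _ _ ((nn i)%:R ^+ 2)); first by rewrite ler_pXn2r ?nnegrE// ler_nat.
  by rewrite ler_eXnr// exprn_ege1.
have [ma mb] : Num.min 1 kap <= 1 /\ Num.min 1 kap <= kap by rewrite !ge_min !lexx ?orbT.
have i0 := ler0n R i; set m := Num.min 1 kap in m0 ma mb *.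
have h1 : m * i%:R ^+ 2 <= kap * i%:R ^+ 2 by rewrite ler_wpM2r ?sqr_ge0.
have h2 : 0 <= m * (i%:R - 1) ^+ 2 by rewrite mulr_ge0 ?sqr_ge0 ?(ltW m0).
by move: h2 h1 mi ma; rewrite !expr2; lra.
Qed.

Variable m : nat.
Hypothesis m0 : (0 < m)%N.
Hypothesis aligned : forall i j, (i < m)%N -> (m <= j)%N -> nn i != nn j.

Lemma same_refl : reflexive (same_block m).
Proof. by move=> i; rewrite /same_block eqxx orbT. Qed.

Lemma same_sym : symmetric (same_block m).
Proof. by move=> i j; rewrite /same_block andbC eq_sym. Qed.

Lemma same_ltn i j : same_block m i j -> (i < m)%N = (j < m)%N.
Proof.
rewrite /same_block => /orP[/andP[-> ->]//|/eqP e].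
have [im|mi] := ltnP i m; have [jm|mj] := ltnP j m => //.
  by have := aligned im mj; rewrite e eqxx.
by have := aligned jm mi; rewrite e eqxx.
Qed.

Lemma same_trans : transitive (same_block m).
Proof.
move=> j i l hij hjl; have e1 := same_ltn hij; have e2 := same_ltn hjl.
move: hij hjl; rewrite /same_block e1 e2; case: ltnP => //= _.
by move=> /eqP -> /eqP ->; rewrite eqxx.
Qed.

Lemma same_near i j : same_block m i j -> (i < j + (m + 2))%N.
Proof.
rewrite /same_block => /orP[/andP[im _]|/eqP e]; first by lia.
by have /andP[a b] := nn_lb i; have /andP[c d] := nn_lb j; lia.
Qed.

Lemma notsame_nn i j : ~~ same_block m i j -> nn i != nn j.
Proof. by rewrite /same_block negb_or => /andP[]. Qed.

Lemma mun_same i j : ~~ same_block m i j -> mun i != mun j.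
Proof.
move=> /notsame_nn h; apply: contraTneq (mun_gap h) => ->; rewrite subrr normr0 -ltNge.
rewrite !mulr_gt0 ?normr_gt0 ?subr_eq0 ?eqr_nat// ltr0n leq_max !lt0n.
by move: h; case: (nn i) => //; case: (nn j).
Qed.

Definition gapb (j : nat) : R := Num.sqrt 27 / kap / (maxn m j)%:R.

Lemma gapb_ge0 j : 0 <= gapb j.
Proof. by rewrite !divr_ge0 ?sqrtr_ge0 ?(ltW kap0). Qed.

Lemma gapb_sqr j : gapb j ^+ 2 = 27 / kap ^+ 2 * ((maxn m j)%:R ^+ 2)^-1.
Proof. by rewrite /gapb !expr_div_n sqr_sqrtr. Qed.

(** Indices in different blocks have distinct frequencies with maximum at least max(m, j), and |i -
    j| + 1 <= 3 |n_i - n_j|. Each term is thus at most 9 / (kap max(m, j) (|i - j| + 1))^2, and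
    [sbd_dist_sq] contributes the factor 3 that turns 9 into the 27 of [gapb]. *)
Lemma mun_gap_sum j :
  sbd (fun i => if same_block m i j then 0 else ((mun i - mun j)^-1) ^+ 2) (gapb j ^+ 2).
Proof.
have mx0 : 0 < (maxn m j)%:R :> R by rewrite ltr0n leq_max m0.
have h := sbdZ (ltac:(by rewrite !mulr_ge0 ?invr_ge0 ?sqr_ge0) : 0 <= 9 / kap ^+ 2 * ((maxn m j)%:R ^+ 2)^-1 :> R) (@sbd_dist_sq R j).
rewrite gapb_sqr (_ : 27 / kap ^+ 2 * _ = 9 / kap ^+ 2 * ((maxn m j)%:R ^+ 2)^-1 * 3); last by ring.
apply: sbd_le h => i; case: ifPn => [_|ns]; first by rewrite !mulr_ge0 ?invr_ge0 ?sqr_ge0.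
have nij := notsame_nn ns; have hg := mun_gap nij.
have mx : (maxn m j <= maxn (nn i) (nn j))%N.
  have /andP[a _] := nn_lb i; have /andP[c _] := nn_lb j.
  move: ns; rewrite /same_block negb_or negb_and -!leqNgt => /andP[/orP[h1|h1] _]; lia.
have d3 : `|i%:R - j%:R| + 1 <= 3 * `|(nn i)%:R - (nn j)%:R| :> R.
  have /andP[a b] := nn_lb i; have /andP[c d] := nn_lb j.
  have : (i + 1 <= j + 3 * (nn i - nn j) /\ j < i \/ j + 1 <= i + 3 * (nn j - nn i) /\ i < j \/
     i = j)%N by move: nij => /eqP nij; lia.
  have D (u v : nat) : (v <= u)%N -> `|u%:R - v%:R| = (u - v)%:R :> R.
    by move=> vu; rewrite natrB// ger0_norm// subr_ge0 ler_nat.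
  case=> [[e ij]|[[e ij]|e]].
  - by rewrite !D; [rewrite natr1 -natrM ler_nat; lia|lia|lia].
  - rewrite distrC [X in _ <= 3 * X]distrC.
    by rewrite !D; [rewrite natr1 -natrM ler_nat; lia|lia|lia].
  - by move: nij; rewrite e eqxx.
have dp : 0 < `|i%:R - j%:R| + 1 :> R by rewrite ltr_wpDl.
have low : kap * (maxn m j)%:R * (`|i%:R - j%:R| + 1) <= 3 * `|mun i - mun j|.
  apply: (@le_trans _ _ (3 * (kap * `|(nn i)%:R - (nn j)%:R| * (maxn (nn i) (nn j))%:R))); last by rewrite ler_pM2l.
  have -> : 3 * (kap * `|(nn i)%:R - (nn j)%:R| * (maxn (nn i) (nn j))%:R) =
     kap * ((maxn (nn i) (nn j))%:R * (3 * `|(nn i)%:R - (nn j)%:R|)) by ring.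
  by rewrite -mulrA ler_pM2l//; apply: ler_pM; rewrite ?ler_nat// ltW.
have p0 : 0 < kap * (maxn m j)%:R * (`|i%:R - j%:R| + 1) by rewrite !mulr_gt0.
have q0 : 0 < `|mun i - mun j| by lra.
rewrite -real_normK ?num_real// normfV exprVn.
have -> : 9 / kap ^+ 2 * ((maxn m j)%:R ^+ 2)^-1 * ((`|i%:R - j%:R| + 1) ^+ 2)^-1 =
   ((kap * (maxn m j)%:R * (`|i%:R - j%:R| + 1) / 3) ^+ 2)^-1.
  by field; rewrite !gt_eqF.
rewrite lef_pV2 ?posrE ?exprn_gt0 ?divr_gt0//.
rewrite ler_pXn2r ?nnegrE ?normr_ge0//; last by rewrite divr_ge0// ltW.
by rewrite ler_pdivrMr// [leRHS]mulrC.
Qed.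

Definition gapG : R := Num.sqrt (81 / (kap ^+ 2 * m%:R)).

Lemma gapG_ge0 : 0 <= gapG. Proof. exact: sqrtr_ge0. Qed.

Lemma gapb_sum : sbd (fun j => gapb j ^+ 2) (gapG ^+ 2).
Proof.
have h := sbdZ (ltac:(by rewrite !mulr_ge0 ?invr_ge0 ?sqr_ge0) : 0 <= 27 / kap ^+ 2 :> R) (sbd_max_sq R m0).
have mp : 0 < m%:R :> R by rewrite ltr0n.
rewrite sqr_sqrtr; last by rewrite divr_ge0// mulr_ge0// sqr_ge0.
rewrite (_ : 81 / _ = 27 / kap ^+ 2 * (3 / m%:R)); last by field; rewrite !gt_eqF.
by apply: sbd_le h => j; rewrite gapb_sqr.
Qed.

(** The square of [gapG] is 81 / (kap^2 m), and 81 * 64 = 72^2. *)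
Lemma gapG_small (beta : R) : 0 <= beta -> 72 ^+ 2 * beta ^+ 2 / kap ^+ 2 <= m%:R -> beta * gapG <= 8^-1.
Proof.
move=> b0 h; have mp : 0 < m%:R :> R by rewrite ltr0n.
have k2 : 0 < kap ^+ 2 by rewrite exprn_gt0.
rewrite -(ler_pXn2r (n := 2)) ?nnegrE ?mulr_ge0 ?gapG_ge0 ?invr_ge0//.
rewrite exprMn sqr_sqrtr; last by rewrite divr_ge0// mulr_ge0// sqr_ge0.
rewrite mulrA ler_pdivrMr ?mulr_gt0//; move: h; rewrite ler_pdivrMr//.
by rewrite exprVn; set x := beta ^+ 2; set y := kap ^+ 2; lra.
Qed.

End FrequencyGaps.

(** * Block diagonalization for the frequencies of the operator *)

Section BlockDiagonalModel.
Variables (R : realType) (V : normedModType R[i]) (c : nat -> V -> R[i]).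
Hypothesis C : l2coord c.
Variables (nn : nat -> nat) (kap : R) (k : nat).
Hypothesis kap0 : 0 < kap.
Hypothesis k0 : (0 < k)%N.
Hypothesis nn_lb : forall i, (i <= nn i <= i.+1)%N.
Variables (b : nat -> V) (beta : R).
Hypothesis hb : forall j, nrm (b j) <= beta.
Variable m : nat.
Hypothesis m0 : (0 < m)%N.
Hypothesis aligned : forall i j, (i < m)%N -> (m <= j)%N -> nn i != nn j.
Hypothesis m_large : 72 ^+ 2 * beta ^+ 2 / kap ^+ 2 <= m%:R.

Local Notation mu := (mun nn kap k).
Local Notation same := (same_block nn m).
Local Notation D := (m + 2)%N.
Local Notation g := (gapb kap m).
Local Notation G := (gapG kap m).

Let beta0 : 0 <= beta. Proof. exact: beta_ge0 hb. Qed.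
Let betaG : beta * G <= 8^-1. Proof. exact: gapG_small. Qed.
Let refl : reflexive same. Proof. exact: same_refl. Qed.
Let sym : symmetric same. Proof. exact: same_sym. Qed.
Let trans : transitive same. Proof. exact: same_trans. Qed.
Let near i j : same i j -> (i < j + D)%N. Proof. exact: (same_near kap0 k0 nn_lb m0). Qed.
Let g0 j : 0 <= g j. Proof. exact: gapb_ge0. Qed.
Let gap j : sbd (fun i => if same i j then 0 else (mu i - mu j)^-1 ^+ 2) (g j ^+ 2).
Proof. exact: mun_gap_sum. Qed.
Let G0 : 0 <= G. Proof. exact: gapG_ge0. Qed.
Let gG : sbd (fun j => g j ^+ 2) (G ^+ 2). Proof. exact: gapb_sum. Qed.

Definition mU := Uop c mu same D b.
Definition mK0 := Kop c mu same D b.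
(* The finite part of A is moved into K, so that what is left of A commutes with K. *)
Definition mnu (i : nat) : R := if (i < m)%N then 0 else mu i.
Definition mA (i : nat) : R[i] := if (i < m)%N then (mu i)%:C else 0.
Definition mK (x : V) := mK0 x + dg c mA x.
Definition mP := dg c (fun i => (i < m)%N%:R).

Lemma mU_blin : blin mU (1 + 2^-1).
Proof. have h := (Uop_blin C _ g0 gap G0 gG hb betaG). exact: h. Qed.

Lemma mU_inv : exists J, [/\ blin J 2, cancel mU J & cancel J mU].
Proof. exact: (Uop_inv C _ g0 gap G0 gG hb betaG). Qed.

Lemma mK0_blin : blin mK0 (Kbound D beta).
Proof. exact: (Kop_blin C refl sym near g0 gap G0 gG hb betaG). Qed.

Lemma mnu_ge0 i : 0 <= mnu i.
Proof. by rewrite /mnu; case: ifP => // _; exact: mun_ge0. Qed.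

Lemma mA_bd : exists2 M : R, 0 <= M & forall i, nrm (mA i) <= M.
Proof.
exists (\sum_(0 <= i < m) mu i) => [|i].
  by rewrite big_nat sumr_ge0// => i _; exact: mun_ge0.
rewrite /mA; case: ifP => im; last by rewrite nrm0 big_nat sumr_ge0// => j _; exact: mun_ge0.
rewrite nrm_real ger0_norm ?mun_ge0// big_mkord (bigD1 (Ordinal im))//= lerDl.
by rewrite sumr_ge0// => j _; exact: mun_ge0.
Qed.

Lemma mK_blin : exists kb, blin mK kb.
Proof.
have [M M0 hM] := mA_bd; exists (Kbound D beta + M).
have h := bl_add mK0_blin (dg_blin C M0 hM); exact: h.
Qed.

Lemma mP_blin : blin mP 1.
Proof. by apply: (dg_blin C) => // i; case: (i < m)%N; rewrite ?nrm1 ?nrm0. Qed.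

Lemma c_mP i x : c i (mP x) = (i < m)%N%:R * c i x.
Proof. by rewrite (c_dg C (M := 1))// => j; case: (j < m)%N; rewrite ?nrm1 ?nrm0. Qed.

Lemma mP_trunc x : mP x = trunc c m x.
Proof.
apply: (c_inj C) => i; rewrite c_mP (c_trunc C).
by case: ifP; rewrite ?mul1r ?mul0r.
Qed.

Lemma mP_idem x : mP (mP x) = mP x.
Proof. by apply: (c_inj C) => i; rewrite !c_mP; case: (i < m)%N; rewrite ?mul1r ?mul0r. Qed.

Lemma dg_comm (a a' : nat -> R[i]) (M M' : R) x : 0 <= M -> (forall i, nrm (a i) <= M) ->
  0 <= M' -> (forall i, nrm (a' i) <= M') -> dg c a (dg c a' x) = dg c a' (dg c a x).
Proof.
move=> M0 aM M'0 aM'; apply: (c_inj C) => i.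
by rewrite !(c_dg C M0 aM, c_dg C M'0 aM') mulrCA.
Qed.

Lemma same_comm (a : nat -> R[i]) (M : R) x : 0 <= M -> (forall i, nrm (a i) <= M) ->
  (forall i j, same i j -> a i = a j) -> dg c a (mK x) = mK (dg c a x).
Proof.
move=> M0 aM as_; have [M' M'0 hM'] := mA_bd.
rewrite /mK (blD (dg_blin C M0 aM)) (dg_comm _ M0 aM M'0 hM').
by rewrite (Kop_comm C refl sym near g0 gap G0 gG hb betaG M0 aM as_).
Qed.

Lemma same_mnu i j : same i j -> mnu i = mnu j.
Proof.
move=> h; have e := same_ltn aligned h; rewrite /mnu e; case: ifP => // jm.
by move: h; rewrite /same_block e jm/= => /eqP e'; rewrite /mun e'.
Qed.

Lemma mK_comm (f : R -> R[i]) (M : R) : 0 <= M -> (forall i, nrm (f (mnu i)) <= M) ->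
  forall x, dg c (fun i => f (mnu i)) (mK x) = mK (dg c (fun i => f (mnu i)) x).
Proof.
move=> M0 fM x; apply: (same_comm x M0 fM) => i j h; by rewrite (same_mnu h).
Qed.

Lemma mP_comm x : mP (mK x) = mK (mP x).
Proof.
apply: (same_comm x (M := 1)) => // [i|i j h]; first by case: (i < m)%N; rewrite ?nrm1 ?nrm0.
by rewrite (same_ltn aligned h).
Qed.

Lemma Lrel_mUE v h : Lrel c mu b (mU v) (mU h) <-> Arel c mu v (h - mK0 v).
Proof.
exact: (Lrel_UopE C refl sym trans near (mun_same kap0 k0 (m := m)) g0 gap G0 gG hb betaG
  (mun_ge0 nn k kap0) (mun_sum kap0 k0 nn_lb)).
Qed.

Lemma Lrel_Grel v h : Lrel c mu b (mU v) (mU h) <-> Grel c mnu mK v h.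
Proof.
have [M M0 hM] := mA_bd.
have E i : c i (h - mK v) = (mnu i)%:C * c i v <-> c i (h - mK0 v) = (mu i)%:C * c i v.
  rewrite /mK opprD addrA (cB C i (h - mK0 v)) (c_dg C M0 hM) /mnu /mA.
  case: ifP => im; last by rewrite mul0r subr0.
  by rewrite mul0r; split=> [/eqP|->]; [rewrite subr_eq0 => /eqP|rewrite subrr].
by split=> [/Lrel_mUE h1 i|h1]; [apply/E; exact: h1|apply/Lrel_mUE => i; apply/E; exact: h1].
Qed.

Section Simple.
Hypothesis nn_inj : injective nn.

(** The diagonal entry of K on a block of size one; [mrho] is the eigenvalue of A + K, and so of A -
    B, on it. *)
Definition mkap (i : nat) : R[i] := - c i (zcol c b (Yfix c mu same D b) i).
Definition mrho (i : nat) : R[i] := (mu i)%:C + mkap i.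

Lemma mkap_le i : nrm (mkap i) <= 2 * beta.
Proof. rewrite nrmN; exact: (c_zc_le C _ g0 gap G0 gG hb betaG). Qed.

Lemma c_mK0 v i : (m <= i)%N -> c i (mK0 v) = mkap i * c i v.
Proof.
move=> mi; apply: (c_Kop_single C refl sym near g0 gap G0 gG hb betaG) => j.
by rewrite /same_block [(i < m)%N]ltnNge mi andbF => /eqP/nn_inj.
Qed.

Lemma c_mK v i : (m <= i)%N -> c i (mK v) = mkap i * c i v.
Proof.
move=> mi; have [M M0 hM] := mA_bd.
by rewrite /mK (cD C) c_mK0// (c_dg C M0 hM) /mA ltnNge mi mul0r addr0.
Qed.

Lemma c_Tz (t : R) v i : 0 <= t -> (m <= i)%N ->
  c i (Tz c mnu mK t%:C v) = cexp (- mrho i * t%:C) * c i v.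
Proof.
move=> t0 mi; have [kb hK] := mK_blin; rewrite /Tz (c_Ez C mnu_ge0)//.
rewrite (c_fexp C (bl_opp hK) (kappa := - mkap i)); last first.
  by move=> y; rewrite (cN C) (c_mK _ mi); exact: (esym (mulNr _ _)).
rewrite mulrA -cexpD /mnu ltnNge mi /= /mrho; congr (cexp _ * _); ring.
Qed.

(** The columns have norm at most 2 beta, and Cauchy-Schwarz over m of them costs sqrt m. The
    general bound [Kbound] is of order m, like the gap at the cutoff, and would not suffice in
    [simple_resolvent]. *)
Lemma mK0P_le v : nrm (mK0 (mP v)) <= 2 * beta * Num.sqrt m%:R * nrm v.
Proof.
rewrite mP_trunc /trunc (bl_sum mK0_blin).
apply: le_trans (nrm_sum _ _ _) _.
apply: (@le_trans _ _ (2 * beta * \sum_(0 <= i < m) nrm (c i v) * 1)).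
  rewrite mulr_sumr; apply: ler_sum => i _.
  rewrite (blZ mK0_blin) nrmZ mulr1 mulrC ler_wpM2r//.
  exact: (nrm_Kop_ee C refl sym near g0 gap G0 gG hb betaG).
rewrite -[leRHS]mulrA ler_wpM2l ?mulr_ge0//.
rewrite [leRHS]mulrC; apply: cauchy_schwarz_sum; rewrite ?sqrtr_ge0//.
  exact: (c_bessel C).
by rewrite sqr_sqrtr//; under eq_bigr do rewrite expr1n; rewrite sumr_const_nat subn0.
Qed.

(** Beyond the cutoff A + K is diagonal. All its entries but that of i0, and all mu_i below the
    cutoff, stay at a distance of order kap m from z, which dominates the finite block of K, of size
    2 beta sqrt m; the entry of i0 differs from z by assumption. *)
Lemma simple_resolvent (z : R[i]) (Cz : R) i0 : (m <= i0)%N -> nrm (z - (mu i0)%:C) <= Cz ->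
  z != mrho i0 -> 4 * beta * Num.sqrt m%:R + 1 <= kap * m%:R - Cz - 2 * beta ->
  exists S M, blin S M /\ forall x y, S y = x <-> Lrel c mu b x (z *: x - y).
Proof.
move=> mi0 zC zr hm; set del := 4 * beta * Num.sqrt m%:R + 1 in hm.
have s0 : 0 <= 4 * beta * Num.sqrt m%:R by rewrite !mulr_ge0 ?sqrtr_ge0.
have d1 : 1 <= del by rewrite lerDr.
pose d i : R[i] := z - (mu i)%:C - (if (i < m)%N then 0 else mkap i).
pose K v := - mK0 (mP v).
have hKP : blin K (Kbound D beta * 1) by have h := bl_opp (bl_comp mK0_blin mP_blin); exact: h.
have dlow i : i != i0 -> del <= nrm (d i).
  move=> ii; have n1 : nn i != nn i0 by rewrite (inj_eq nn_inj).
  have hg := mun_gap kap0 k0 n1.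
  have gl : kap * m%:R <= `|mu i - mu i0|.
    apply: le_trans hg; rewrite -mulrA ler_pM2l//.
    have h1 : 1 <= `|(nn i)%:R - (nn i0)%:R| :> R.
      have D' (u v : nat) : (v < u)%N -> 1 <= `|u%:R - v%:R| :> R.
        by move=> vu; rewrite -natrB ?(ltnW vu)// normr_nat ler1n subn_gt0.
      have [h|h|h] := ltngtP (nn i) (nn i0); last by rewrite h eqxx in n1.
        by rewrite distrC; exact: D'.
      exact: D'.
    have h2 : m%:R <= (maxn (nn i) (nn i0))%:R :> R.
      by have /andP[a _] := nn_lb i0; rewrite ler_nat (leq_trans mi0)// (leq_trans a)// leq_maxr.
    by rewrite -[m%:R]mul1r; apply: ler_pM.
  have e : d i = (mu i0 - mu i)%:C + (z - (mu i0)%:C) - (if (i < m)%N then 0 else mkap i).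
    by rewrite /d rmorphB; ring.
  have k2 : nrm (if (i < m)%N then 0 else mkap i) <= 2 * beta.
    by case: ifP => _; [rewrite nrm0 mulr_ge0|exact: mkap_le].
  have t1 := nrm_diff ((mu i0 - mu i)%:C) (d i).
  have t2 : nrm ((mu i0 - mu i)%:C - d i) <= Cz + 2 * beta.
    rewrite e opprD opprD opprK addrA addrA subrr add0r.
    by apply: le_trans (nrmD _ _) _; rewrite nrmN lerD.
  have t3 : nrm ((mu i0 - mu i)%:C) = `|mu i - mu i0| by rewrite nrm_real distrC.
  by move: t1 t2 t3 gl hm; set X := nrm (_ - d i); set Y := nrm (d i); set Z := nrm _; lra.
have d0 : d i0 = z - mrho i0 by rewrite /d ltnNge mi0 /= /mrho opprD addrA.
pose rho := Num.min 1 (nrm (z - mrho i0)).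
have r0 : 0 < nrm (z - mrho i0) by rewrite lt_neqAle nrm_ge0 andbT eq_sym nrm_eq0 subr_eq0.
have rho0 : 0 < rho by rewrite lt_min ltr01.
have hd i : rho <= nrm (d i).
  have [->|ii] := eqVneq i i0; first by rewrite d0 ge_min lexx orbT.
  by rewrite ge_min (le_trans d1)// dlow.
have del0 : 0 < del by lra.
(* The range of K lies below the cutoff, so only these inverses enter d^-1 K. They are bounded by 1
   / del even if z is very close to [mrho i0]. *)
pose a i : R[i] := if (i < m)%N then (d i)^-1 else 0.
have a_le i : nrm (a i) <= del^-1.
  rewrite /a; case: ifP => im; last by rewrite nrm0 invr_ge0 ltW.
  have dl : del <= nrm (d i) by apply: dlow; rewrite ltn_eqF// (leq_trans im).
  by rewrite nrmV lef_pV2// posrE// (lt_le_trans del0).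
have hRK : blin (fun x => dg c (fun i => (d i)^-1) (K x)) 2^-1.
  have E x : dg c (fun i => (d i)^-1) (K x) = dg c a (K x).
    have iv i : nrm ((d i)^-1) <= rho^-1.
      by rewrite nrmV lef_pV2// posrE// (lt_le_trans rho0).
    apply: (c_inj C) => i; rewrite (c_dg C _ iv) ?invr_ge0 ?(ltW rho0)//.
    rewrite (c_dg C _ a_le) ?invr_ge0 ?(ltW del0)// /a; case: ifPn => // im.
    have mi : (m <= i)%N by rewrite leqNgt.
    have -> : c i (K x) = 0 by rewrite /K (cN C) (c_mK0 _ mi) c_mP (negbTE im) mul0r mulr0 oppr0.
    by rewrite !mulr0.
  have Da := dg_blin C (ltW (ltac:(by rewrite invr_gt0) : 0 < del^-1)) a_le.
  split; last 2 first.
  - by [].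
  - move=> x; rewrite E; apply: le_trans (bl_bd Da (K x)) _.
    rewrite /K nrmN; apply: le_trans (ler_wpM2l _ (mK0P_le x)) _; first by rewrite invr_ge0 ltW.
    rewrite mulrA ler_wpM2r// mulrC ler_pdivrMr// /del; lra.
  - by move=> k' x y; rewrite !E (bl_lin hKP) (bl_lin Da).
have [S0 [hS0 S0E]] := dg_resolvent C hKP rho0 hd hRK.
have [J [hJ UJ JU]] := mU_inv.
have h1 := bl_comp mU_blin (bl_comp hS0 hJ).
exists (fun x => mU (S0 (J x))); eexists; split; first exact: h1.
have key v y : S0 y = v <-> Arel c mu v (z *: v - y - mK0 v).
  rewrite S0E; have ci i : c i (mK0 v) = c i (mK0 (mP v)) + (if (i < m)%N then 0 else mkap i) * c i v.
    have [im|mi] := ltnP i m; last first.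
      by rewrite !c_mK0// c_mP ltnNge mi mul0r mulr0 add0r.
    have z0 : c i (mK0 (v - mP v)) = 0.
      have [M M0 hM] := mA_bd.
      have : c i (mP (mK0 (v - mP v))) = c i (mK0 (v - mP v)) by rewrite c_mP im mul1r.
      move=> <-; have p1 j : nrm ((j < m)%N%:R : R[i]) <= 1 by case: (j < m)%N; rewrite ?nrm1 ?nrm0.
      rewrite /mP (Kop_comm C refl sym near g0 gap G0 gG hb betaG ler01 p1); last first.
        by move=> j l h; rewrite (same_ltn aligned h).
      by rewrite -/(mP (v - mP v)) (blB mP_blin) mP_idem subrr -/(mK0 0) (bl0 mK0_blin) (c0 C).
    by move: z0; rewrite (blB mK0_blin) (cB C) => /eqP; rewrite subr_eq0 => /eqP ->; rewrite mul0r addr0.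
  split=> h i.
    have := h i; rewrite /K opprK (cD C) /d => e.
    rewrite !(cB C) (cZ C) ci; move: e; set X := c i y; set Y := c i (mK0 (mP v)).
    move=> e; have -> : X = (z - (mu i)%:C - (if (i < m)%N then 0 else mkap i)) * c i v - Y by rewrite -e addrK.
    ring.
  have e := h i; rewrite !(cB C) (cZ C) ci in e; rewrite /K opprK (cD C) /d.
  move: e; set X := c i y; set Y := c i (mK0 (mP v)); move=> e.
  have -> : X = z * c i v - (mu i)%:C * c i v - (Y + (if (i < m)%N then 0 else mkap i) * c i v).
    by rewrite -e; ring.
  ring.
move=> x y; have lhs : (mU (S0 (J y)) = x) <-> (S0 (J y) = J x).
  by split=> [<-|->]; rewrite ?UJ ?JU.
rewrite lhs key.
have := Lrel_mUE (J x) (z *: J x - J y); rewrite JU (blB mU_blin) (blZ mU_blin) !JU => ->.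
by [].
Qed.

End Simple.

End BlockDiagonalModel.

(** * The spectral description *)

Section FiniteCardinality.
Variable T : choiceType.

(** With covering lists, adding finitely many eigenvalues to the exceptional set is a
    concatenation. *)
Lemma card_le_seqP (A : set T) n :
  (A #<= `I_n)%card <-> exists2 s : seq T, (size s <= n)%N & A `<=` [set x | x \in s].
Proof.
split=> [h|[s sn As]].
  have fA : finite_set A by apply: card_le_finite h _; exact: finite_II.
  have /finite_fsetP[X AX] := fA; exists (enum_fset X); last by rewrite AX.
  have E : ([set` X] #= `I_(size (enum_fset X)))%card by apply/card_eq_fsetP.
  by move: h; rewrite AX (card_le_eql E) card_le_II.
pose X := seq_fset tt s.
have E : ([set` X] #= `I_(size (enum_fset X)))%card by apply/card_eq_fsetP.
apply: (card_le_trans (B := [set` X])).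
  by apply: subset_card_le => x /As /= xs; rewrite /X seq_fsetE.
rewrite (card_le_eql E) card_le_II (leq_trans _ sn)//.
by rewrite -[size _]/(#|` X|)%fset /X size_seq_fset size_undup.
Qed.

End FiniteCardinality.

(** * Bounds for the explicit terms of the eigenvalues *)

Section ComplexSeries.
Variable R : realType.
Local Notation Re := complex.Re.
Local Notation Im := complex.Im.

Lemma rsum_le (P : pred nat) (u r : nat -> R) M : (forall j, 0 <= r j) ->
  (forall j, P j -> `|u j| <= r j) -> sbd r M ->
  `|limn (fun N => \sum_(0 <= j < N | P j) u j)| <= M.
Proof.
move=> r0 ur hM; pose v j := if P j then u j else 0.
have E : (fun N => \sum_(0 <= j < N | P j) u j) = series v.
  by apply/funext => N; rewrite /series/= big_mkcond.
have vr j : `|v j| <= r j by rewrite /v; case: ifP => [/ur //|_]; rewrite normr0.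
have cv : cvgn (series v).
  apply: normed_cvg; apply: nondecreasing_is_cvgn.
    apply/nondecreasing_seqP => n.
    change (\sum_(0 <= j < n) `|v j| <= \sum_(0 <= j < n.+1) `|v j|).
    by rewrite big_nat_recr//= lerDl.
  exists M => _ [n _ <-]; apply: le_trans (hM n).
  change (\sum_(0 <= j < n) `|v j| <= \sum_(0 <= j < n) r j).
  by apply: ler_sum.
have b n : `|series v n| <= M.
  by apply: le_trans (ler_norm_sum _ _ _) _; apply: le_trans (hM n); exact: ler_sum.
rewrite E ler_norml; apply/andP; split.
  by apply: limr_ge => //; apply: nearW => n; have := b n; rewrite ler_norml => /andP[].
by apply: limr_le => //; apply: nearW => n; have := b n; rewrite ler_norml => /andP[].
Qed.

Lemma csum_le (P : pred nat) (f : nat -> R[i]) (r : nat -> R) M : (forall j, 0 <= r j) ->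
  (forall j, P j -> nrm (f j) <= r j) -> sbd r M -> nrm (csum P f) <= 2 * M.
Proof.
move=> r0 fr hM; apply: le_trans (nrm_ReIm _) _; rewrite mulr_natl mulr2n /=.
apply: lerD; apply: rsum_le hM => // j /fr; apply: le_trans; [exact: Re_nrm|exact: Im_nrm].
Qed.

(** With x = |j - n| >= 1, the gap is at least x^2 >= (x + 1)^2 / 4; hence 12 is 4 times the bound
    of [sbd_dist_sq]. *)
Lemma sbd_offdiag (n k : nat) : (0 < k)%N -> sbd (fun j => if j == n then 0
  else `|j%:R ^+ (2 * k) - n%:R ^+ (2 * k)|^-1 : R) 12.
Proof.
move=> k0; have h := sbdZ (ler0n R 4) (@sbd_dist_sq R n).
rewrite (_ : 12 = 4 * 3); last by rewrite -natrM.
apply: sbd_le h => j; case: eqVneq => [_|jn]; first by rewrite mulr_ge0 ?invr_ge0 ?sqr_ge0.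
have hA := pow_gap R k0 jn; set A := `|j%:R ^+ (2 * k) - n%:R ^+ (2 * k)| in hA *.
have D : 1 <= `|j%:R - n%:R| :> R.
  have D' (u v : nat) : (v < u)%N -> 1 <= `|u%:R - v%:R| :> R.
    by move=> vu; rewrite -natrB ?(ltnW vu)// normr_nat ler1n subn_gt0.
  have [h1|h1|h1] := ltngtP j n; last by rewrite h1 eqxx in jn.
    by rewrite distrC; exact: D'.
  exact: D'.
have Dm : `|j%:R - n%:R| <= (maxn j n)%:R :> R.
  have [h1|h1|h1] := ltngtP j n; last by rewrite h1 eqxx in jn.
    by rewrite ler0_norm ?subr_le0 ?ler_nat ?(ltnW h1)// opprB gerBl.
  by rewrite ger0_norm ?subr_ge0 ?ler_nat ?(ltnW h1)// gerBl.
set x := `|j%:R - n%:R| in hA D Dm *.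
have x0 : 0 < x by apply: lt_le_trans D.
have xx : x ^+ 2 <= A by apply: le_trans hA; rewrite expr2 ler_pM2l.
have p : 0 < (x + 1) ^+ 2 by rewrite exprn_gt0//; lra.
have A0 : 0 < A by apply: lt_le_trans xx; rewrite exprn_gt0.
rewrite -[leRHS]invrK invfM invrK lef_pV2 ?posrE//; last by rewrite mulr_gt0 ?invr_gt0.
rewrite mulrC ler_pdivrMr//; have : 0 <= (x - 1) * (3 * x + 1) by rewrite mulr_ge0; lra.
by move: xx; rewrite !expr2; lra.
Qed.

End ComplexSeries.

Section SpectralDescription.
Variables (R : realType) (omega : R) (q : R -> R[i]) (k : nat).
Hypothesis omega0 : 0 < omega.
Hypothesis k1 : (1 < k)%N.
Hypothesis qL2 : q \in sqint (itv_measure omega).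
Local Notation Re := complex.Re.
Local Notation Im := complex.Im.
Local Notation lam := (@lebesgue_measure R).
Local Notation I := (`[0, omega]%classic : set R).

Let mI : measurable (I : set (measurableTypeR R)).
Proof. exact: measurable_itv. Qed.

Definition qabs : R := \int[lam]_(t in I) `|Re (q t)| + \int[lam]_(t in I) `|Im (q t)|.

Lemma int_q_le (f : R -> R) : abs_continuous omega (fun t => (f t)%:C) -> (forall t, `|f t| <= 1) ->
  nrm (cintegral lam I (fun t => q t * (f t)%:C)) <= qabs.
Proof.
move=> af f1; have qi := sqint_cintegrable omega0 qL2.
have [h1 h2] := cintegrableM_ac omega0 qi af; have [q1 q2] := qi.
apply: le_trans (nrm_ReIm _) _; rewrite /qabs /=.
have B (r r' : R -> R) : lam.-integrable I (EFin \o r) -> lam.-integrable I (EFin \o r') ->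
    (forall t, `|r t| <= `|r' t|) -> `|\int[lam]_(t in I) r t| <= \int[lam]_(t in I) `|r' t|.
  move=> ir ir' rr; apply: le_trans (le_normr_Rintegral mI ir) _; apply: le_Rintegral => //.
    by have := integrable_abse ir; apply: eq_integrable => // x _ /=.
  by have := integrable_abse ir'; apply: eq_integrable => // x _ /=.
apply: lerD; apply: B => // t.
  by rewrite ReM/= mulr0 subr0 normrM ler_piMr.
by rewrite ImM/= mulr0 add0r normrM ler_piMr.
Qed.

Lemma nrm_fourier_cos_le l : nrm (fourier_cos omega q l) <= Num.sqrt 2 / omega * qabs.
Proof.
have s0 : 0 <= Num.sqrt 2 / omega by rewrite divr_ge0 ?sqrtr_ge0 ?ltW.
rewrite /fourier_cos nrmM nrm_real ger0_norm// ler_wpM2l//.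
apply: int_q_le => [|t]; last by rewrite ler_norml cos_le1 cos_geN1.
rewrite (_ : (fun t => _) = ccos (fr omega l)); first exact: ccos_ac.
by apply/funext => t; rewrite /ccos /fr -pmulrn; congr ((cos _)%:C); ring.
Qed.

Lemma qabs_ge0 : 0 <= qabs.
Proof. by rewrite addr_ge0// Rintegral_ge0. Qed.

(** Fourier coefficients of q are bounded by its L^1 norm, and the inverse gaps have sums bounded
    independently of n. The explicit eigenvalues therefore stay at bounded distance from the mu. *)
Lemma lambda_dir_bounded : exists B : R, forall n,
  nrm (lambda_dir k omega q n - ((pi * n%:R / omega) ^+ (2 * k))%:C) <= B.
Proof.
pose F := Num.sqrt 2 / omega * qabs; pose c0 : R := omega ^+ (2 * k) / (2 * pi ^+ (2 * k)).
have F0 : 0 <= F by rewrite mulr_ge0 ?qabs_ge0 ?divr_ge0 ?sqrtr_ge0 ?ltW.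
have w0 : 0 <= omega^-1 by rewrite invr_ge0 ltW.
exists (omega^-1 * qabs + omega^-1 * qabs + `|c0| * (2 * ((2 * F) ^+ 2 * 12))) => n.
have four (X Y Z W : R[i]) (a b c : R) : nrm Y <= a -> nrm Z <= b -> nrm W <= c ->
    nrm (X - Y + Z - W - X) <= a + b + c.
  move=> hY hZ hW; have -> : X - Y + Z - W - X = Z - Y - W by ring.
  apply: le_trans (nrmB _ _) _; apply: lerD => //.
  by apply: le_trans (nrmB _ _) _; rewrite [leRHS]addrC; apply: lerD.
rewrite /lambda_dir; apply: four.
- rewrite nrmM nrm_real ger0_norm// ler_wpM2l//.
  have -> : cintegral lam I q = cintegral lam I (fun t => q t * (cst 1 t : R)%:C).
    by apply: eq_cintegral => t _; rewrite /= mulr1.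
  by apply: int_q_le => [|t]; [exact: (cst_ac omega (1 : R)%:C)|rewrite /= normr1].
- rewrite nrmM nrm_real ger0_norm// ler_wpM2l//.
  apply: int_q_le => [|t]; last by rewrite ler_norml cos_le1 cos_geN1.
  by rewrite (_ : (fun t => _) = ccos (2 * pi * n%:R / omega))//; exact: ccos_ac.
- rewrite nrmM nrm_real ler_wpM2l//.
  have k0 : (0 < k)%N by apply: ltnW.
  apply: (csum_le (r := fun j => (2 * F) ^+ 2 * (if j == n then 0 else `|j%:R ^+ (2 * k) - n%:R ^+ (2 * k)|^-1))).
  + by move=> j; rewrite mulr_ge0 ?sqr_ge0//; case: ifP => // _; rewrite invr_ge0.
  + move=> j /andP[_ jn]; rewrite (negbTE jn) nrmM nrmX; apply: ler_pM => //.
    * by rewrite exprn_ge0.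
    * apply: lerXn2r; [exact: nrm_ge0|by rewrite nnegrE mulr_ge0|].
      apply: le_trans (nrmB _ _) _.
      by rewrite mulr_natl mulr2n; apply: lerD; exact: nrm_fourier_cos_le.
    * rewrite nrmV (_ : _ - _ = (j%:R ^+ (2 * k) - n%:R ^+ (2 * k) : R)%:C) ?nrm_real//.
      by rewrite rmorphB !rmorphXn !rmorph_nat.
  + by apply: sbdZ; [exact: sqr_ge0|exact: sbd_offdiag].
Qed.

Lemma small_remainder_bounded m (rem : nat -> R[i]) : small_remainder k m rem ->
  exists B : R, forall n, (m < n)%N -> nrm (rem n) <= B.
Proof.
move=> [D [alpha [D0 cv h]]].
have a2 n : alpha n ^+ 2 <= limn (series (fun n => alpha n ^+ 2)).
  have nd : {homo series (fun n => alpha n ^+ 2) : i j / (i <= j)%N >-> i <= j}.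
    by apply/nondecreasing_seqP => j; rewrite /series/= big_nat_recr//= lerDl sqr_ge0.
  apply: le_trans (nondecreasing_cvgn_le nd cv n.+1).
  by rewrite /series/= big_nat_recr//= lerDr sumr_ge0// => j _; rewrite sqr_ge0.
set L : R := limn _ in a2.
exists (D * (1 + L)) => n mn; have := h n mn; rewrite nrmE lecR => /le_trans; apply.
have n1 : 1 <= n%:R ^+ (4 * k - 3) :> R by rewrite exprn_ege1// ler1n (leq_trans _ mn).
have np : 0 < n%:R ^+ (4 * k - 3) :> R by lra.
have aL : alpha n <= 1 + L.
  have h1 := a2 n; have h2 := sqr_ge0 (alpha n - 1); have h3 := sqr_ge0 (alpha n).
  by rewrite !expr2 in h1 h2 h3; lra.
have L0 : 0 <= 1 + L by rewrite addr_ge0//; exact: le_trans (sqr_ge0 (alpha 0%N)) (a2 0%N).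
rewrite ler_pdivrMr//; apply: (@le_trans _ _ (D * (1 + L))); first by rewrite ler_pM2l.
by rewrite ler_peMr// mulr_ge0// ltW.
Qed.

Lemma small_remainderS m m' (rem : nat -> R[i]) : (m <= m')%N -> small_remainder k m rem -> small_remainder k m' rem.
Proof.
move=> mm [D [alpha [D0 cv h]]]; exists D, alpha; split=> // n mn.
by apply: h; exact: leq_ltn_trans mn.
Qed.

(** The eigenvalues with m < n <= m' join the exceptional set: one for each n under Dirichlet
    conditions, otherwise two, and 2 m + 1 + 2 (m' - m) = 2 m' + 1. *)
Lemma spectral_descriptionS bc m m' lm : (m <= m')%N -> (0 < m')%N ->
  spectral_description bc k omega q m lm -> spectral_description bc k omega q m' lm.
Proof.
move=> mm m0; have seg (f : nat -> R[i]) : [set f n | n in [set n | (m < n)%N]] =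
    [set f n | n in [set n | (m < n <= m')%N]] `|` [set f n | n in [set n | (m' < n)%N]].
  apply/seteqP; split=> x.
    move=> [n /= mn <-]; have [nm|mn'] := leqP n m'; [left|right]; exists n => //=.
    by rewrite mn.
  by move=> [[n /= /andP[mn _] <-]|[n /= mn <-]]; exists n => //=; exact: leq_ltn_trans mn.
have segs (f : nat -> R[i]) x : [set f n | n in [set n | (m < n <= m')%N]] x ->
    x \in [seq f n | n <- iota m.+1 (m' - m)].
  by move=> [n /= hn <-]; apply: map_f; rewrite mem_iota; lia.
have perap : bc <> dir -> (exists lam2 : bool -> nat -> R[i],
    [/\ forall b, small_remainder k m (fun n => lam2 b n - lambda_per_ap bc k omega q b n) &
        exists2 sigma_m : set R[i], (sigma_m #<= `I_(2 * m + 1))%card &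
          spectrum (L_bc bc k omega q) = sigma_m `|`
            [set lam2 b n | b in [set: bool] & n in [set n | (m < n)%N]]]) ->
    (exists lam2 : bool -> nat -> R[i],
    [/\ forall b, small_remainder k m' (fun n => lam2 b n - lambda_per_ap bc k omega q b n) &
        exists2 sigma_m : set R[i], (sigma_m #<= `I_(2 * m' + 1))%card &
          spectrum (L_bc bc k omega q) = sigma_m `|`
            [set lam2 b n | b in [set: bool] & n in [set n | (m' < n)%N]]]).
  move=> _ [l2 [hr [sg csg E]]]; exists l2; split; first by move=> b; exact: small_remainderS (hr b).
  exists (sg `|` [set l2 b n | b in [set: bool] & n in [set n | (m < n <= m')%N]]).
    move/card_le_seqP: csg => [s sm sgs]; apply/card_le_seqP.
    exists (s ++ [seq l2 true n | n <- iota m.+1 (m' - m)] ++ [seq l2 false n | n <- iota m.+1 (m' - m)]).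
      by rewrite !size_cat !size_map !size_iota; lia.
    move=> x [/sgs /= xs|[b _ [n /= hn <-]]]; rewrite /= !mem_cat; first by rewrite xs.
    have nI : n \in iota m.+1 (m' - m) by rewrite mem_iota; lia.
    by case: b; rewrite (map_f (l2 _) nI) ?orbT.
  rewrite E -setUA; congr (_ `|` _); apply/seteqP; split=> x.
    move=> [b _ [n /= mn <-]]; have [nm|mn'] := leqP n m'; [left|right]; exists b => //; exists n => //=.
    by rewrite mn.
  move=> [[b _ [n /= /andP[mn _] <-]]|[b _ [n /= mn <-]]]; exists b => //; exists n => //=.
  exact: leq_ltn_trans mn.
case: bc perap => pa h; [exact: pa h|exact: pa h|].
move: h => [h0 hr [sg csg E]]; split=> //; first exact: small_remainderS hr.
exists (sg `|` [set lm n | n in [set n | (m < n <= m')%N]]).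
  move/card_le_seqP: csg => [s sm sgs]; apply/card_le_seqP.
  exists (s ++ [seq lm n | n <- iota m.+1 (m' - m)]).
    by rewrite size_cat size_map size_iota; lia.
  by move=> x [/sgs /= xs|/segs h]; rewrite /= mem_cat ?xs// h orbT.
by rewrite E seg setUA.
Qed.

End SpectralDescription.

(** * The semigroup generated by - L *)

Section Main.
Variables (R : realType) (bc : boundary_condition) (k : nat) (omega : R) (q : R -> R[i]).
Hypothesis k1 : (1 < k)%N.
Hypothesis omega0 : 0 < omega.
Hypothesis qL2 : q \in sqint (itv_measure omega).
Local Notation H := (L2 omega).
Local Notation co := (@co R bc omega).
Local Notation be := (be bc omega).
Local Notation bq := (bq bc omega q).
Local Notation beta := (bq_bound qL2).
Local Notation C := (co_l2coord bc omega0).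

Definition nn (i : nat) : nat := `|nf bc i|%N.
Definition kap : R := (pi / omega) ^+ (2 * k).

Lemma k0 : (0 < k)%N. Proof. exact: ltnW. Qed.

Lemma kap_gt0 : 0 < kap.
Proof. by rewrite exprn_gt0// divr_gt0// pi_gt0. Qed.

Lemma nn_lb i : (i <= nn i <= i.+1)%N.
Proof.
rewrite /nn /nf /zidx; have := odd_double_half i.
by case: bc; case: (odd i) => /= ?; lia.
Qed.

Lemma ev_mun : ev bc k omega = mun nn kap k.
Proof.
apply/funext => i; rewrite /ev /mun /kap /fr /nn.
have -> : pi * (nf bc i)%:~R / omega = pi / omega * (nf bc i)%:~R by ring.
rewrite exprMn; congr (_ * _).
have -> : (`|nf bc i|%N)%:R = `|(nf bc i)%:~R| :> R by rewrite -intr_norm natr_absz.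
by rewrite !(exprM _ 2) real_normK ?num_real.
Qed.

Lemma bq_le j : nrm (bq j) <= beta. Proof. exact: nrm_bq. Qed.

(** The number of basis vectors that span the range of [P_upto m]; vectors of equal absolute
    frequency are never separated. *)
Definition cutoff (m : nat) : nat :=
  match bc with per => (2 * m).+1 | ap => (2 * m).+2 | dir => m end.

Lemma cutoff_ge m : (m <= cutoff m)%N.
Proof. by rewrite /cutoff; case: bc; lia. Qed.

Lemma cutoff_aligned m i j : (i < cutoff m)%N -> (cutoff m <= j)%N -> nn i != nn j.
Proof.
rewrite /cutoff /nn /nf /zidx; have := odd_double_half i; have := odd_double_half j.
by case: bc; case: (odd i); case: (odd j) => /= ? ? ? ?; lia.
Qed.

Lemma zidx_double j : zidx (2 * j) = j%:Z.
Proof. by rewrite /zidx mul2n odd_double doubleK. Qed.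

Lemma zidx_doubleS j : zidx (2 * j).+1 = - j%:Z - 1.
Proof. by rewrite /zidx mul2n /= odd_double /= uphalf_double. Qed.

(** The enumeration [zidx] lists the two vectors of each [PP j] next to each other; only the
    periodic [PP 0] consists of a single vector. *)
Lemma P_upto_trunc m (x : H) : P_upto bc m x = trunc co (cutoff m) x.
Proof.
have E n : trunc co n x = \sum_(0 <= i < n) line_proj (be i) x.
  by rewrite /trunc; apply: eq_bigr => i _; rewrite ee_be.
rewrite E /P_upto /cutoff; case: bc.
- elim: m => [|m IH].
    by rewrite !big_nat1 /PP /be /= /zidx.
  rewrite big_nat_recr//= {}IH mulnS -[(2 + 2 * m).+1]/((2 * m).+3) [RHS]big_nat_recr//= [X in _ = X + _]big_nat_recr//= -addrA; congr (_ + _).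
  rewrite /PP /be /= -[(2 * m).+2]/(2 + 2 * m)%N -mulnS zidx_double zidx_doubleS.
  by rewrite (_ : - m.+1%:Z - 0 = - m%:Z - 1)//; lia.
- elim: m => [|m IH].
    rewrite big_nat1 big_nat_recr//= big_nat1 /PP /be /=.
    by rewrite /zidx /= addrC.
  rewrite big_nat_recr//= {}IH mulnS -[(2 + 2 * m).+2]/((2 * m).+4).
  rewrite [RHS]big_nat_recr//= [X in _ = X + _]big_nat_recr//= -addrA; congr (_ + _).
  rewrite /PP /be /= -[(2 * m).+2]/(2 + 2 * m)%N -mulnS zidx_double zidx_doubleS.
  exact: addrC.
- by rewrite big_add1 /=; apply: eq_bigr => i _.
Qed.

Lemma tends_cvg (V : normedModType R[i]) (u : nat -> V) l : tends u l -> u N @[N --> \oo] --> l.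
Proof.
move=> h; apply/cvgrPdist_le => e e0.
have e1 : e = (complex.Re e)%:C by move: e0; case: e => a b; rewrite ltcE/= => /andP[/eqP -> _].
have e2 : 0 < complex.Re e by move: e0; rewrite e1 ltcR.
have [N hN] := h _ e2; exists N => // n /= Nn.
by rewrite distrC nrmE e1 lecR; exact: hN.
Qed.

Section Cutoff.
Variable m : nat.
Hypothesis m0 : (0 < cutoff m)%N.
Hypothesis m_large : 72 ^+ 2 * beta ^+ 2 / kap ^+ 2 <= (cutoff m)%:R.
Local Notation M := (cutoff m).
Local Notation U := (mU co nn kap k bq M).
Local Notation K := (mK co nn kap k bq M).
Local Notation nu := (mnu nn kap k M).
Local Notation rho := (mrho co nn kap k bq M).

Let aligned i j : (i < M)%N -> (M <= j)%N -> nn i != nn j.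
Proof. exact: cutoff_aligned. Qed.

Lemma L_bc_mun x z : L_bc bc k omega q (x, z) <-> Lrel co (mun nn kap k) bq x z.
Proof.
rewrite -ev_mun; apply: L_bcE => //; first exact: k0.
rewrite ev_mun => v w; apply: (Arel_W C) => [i|]; first exact/mun_ge0/kap_gt0.
exact: (mun_sum kap_gt0 k0 nn_lb).
Qed.

Lemma L_bc_Grel v h : L_bc bc k omega q (U v, U h) <-> Grel co nu K v h.
Proof.
rewrite L_bc_mun.
exact: (Lrel_Grel C kap_gt0 k0 nn_lb bq_le m0 aligned m_large).
Qed.

Let U_blin := mU_blin C kap_gt0 k0 nn_lb bq_le m0 m_large.
Let K_comm := mK_comm C kap_gt0 k0 nn_lb bq_le m0 aligned m_large.

Lemma P_uptoE : P_upto bc m = mP co M :> (H -> H).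
Proof. by apply/funext => x; rewrite P_upto_trunc (mP_trunc C). Qed.

Lemma semigroup_properties :
  sectorial (graph_opp (L_bc bc k omega q)) /\
  exists T : R -> H -> H,
    [/\ analytic_semigroup T,
        generator T = graph_opp (L_bc bc k omega q),
        similar_semigroups T (fun t => Tz co nu K t%:C),
        semigroup (fun t => Tz co nu K t%:C) &
        semigroup_direct_sum (P_upto bc m) (fun t => Tz co nu K t%:C)
          (fun t => Tz co nu K t%:C) (fun t => Tz co nu K t%:C)].
Proof.
have [kb K_blin] := mK_blin C kap_gt0 k0 nn_lb bq_le m0 m_large.
have [J [J_blin UJ JU]] := mU_inv C kap_gt0 k0 nn_lb bq_le m0 m_large.
have nu0 : forall i, 0 <= nu i by move=> i; exact/mnu_ge0/kap_gt0.
split; first exact: (sectorial_sim C nu0 K_blin U_blin J_blin UJ JU L_bc_Grel).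
exists (Tsim co nu K U J); split.
- exact: (analytic_Tsim C nu0 K_blin K_comm U_blin J_blin UJ JU).
- exact: (generator_Tsim C nu0 K_blin U_blin J_blin UJ JU L_bc_Grel).
- exact: (similar_Tsim _ _ _ U_blin J_blin UJ JU).
- exact: (semigroup_Tz C nu0 K_blin K_comm).
rewrite P_uptoE; apply: (direct_sum_Tz C nu0 K_blin K_comm (mP_blin C M)).
- exact: (mP_idem C).
- exact: (mP_comm C kap_gt0 k0 nn_lb bq_le m0 aligned m_large).
- move=> a b b0 ab x; apply: (dg_comm C x b0 ab ler01) => i.
  by case: (i < M)%N; rewrite ?nrm1 ?nrm0.
Qed.

Section Dirichlet.
Hypothesis hdir : bc = dir.

Lemma nn_inj : injective nn.
Proof. by move=> i j; rewrite /nn /nf hdir => /= -[]. Qed.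

Lemma cutoff_dir : M = m. Proof. by rewrite /cutoff hdir. Qed.

(** The partial sums are the truncations of v. Its coordinates vanish below the cutoff because the
    semigroup preserves the range of 1 - P, and beyond it they are multiplied by exponentials; s is
    one more than the basis index. *)
Lemma Tz_dir (lam : nat -> R[i]) (t : R) (x : H) : (forall s, (m < s)%N -> lam s = rho s.-1) ->
  0 <= t -> \sum_(m.+1 <= s < N) cexp (- lam s * t%:C) *: P_dir s x
    @[N --> \oo] --> Tz co nu K t%:C (x - P_upto bc m x).
Proof.
move=> hlam t0; set v := Tz _ _ _ _ _.
have [_ [T [_ _ _ _ [_ [W2 _ _ _] _]]]] := semigroup_properties.
have Wx : range (fun x : H => x - P_upto bc m x) (x - P_upto bc m x) by exists x.
have [hW _ _] := W2 t t0; have [y _ yv] := hW _ Wx.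
have c_low i : (i < M)%N -> co i v = 0.
  by move=> iM; rewrite -[v]yv P_uptoE (cB C) (c_mP C) iM mul1r subrr.
have c_high i : (M <= i)%N -> co i v = cexp (- rho i * t%:C) * co i x.
  move=> Mi; rewrite /v (c_Tz C kap_gt0 k0 nn_lb bq_le m0 m_large nn_inj _ t0 Mi) P_uptoE.
  by rewrite (cB C) (c_mP C) ltnNge Mi mul0r subr0.
rewrite -(cvg_shiftn 1); apply: tends_cvg.
apply: tends_eq (trunc_tends C v) => N; rewrite /trunc addn1.
have [mN|Nm] := leqP M N; last first.
  rewrite [RHS]big_geq; last by rewrite ltnS; move: (ltnW Nm); rewrite cutoff_dir.
  by rewrite big_nat big1// => i /andP[_ iN]; rewrite c_low ?scale0r// (ltn_trans iN).
rewrite (big_cat_nat (n := M))//= big_nat big1 ?add0r; last first.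
  by move=> i /andP[_ iM]; rewrite c_low ?scale0r.
rewrite [RHS]big_add1 /=.
rewrite (_ : \sum_(m <= s < N) _ = \sum_(M <= s < N) cexp (- lam s.+1 * t%:C) *: P_dir s.+1 x); last first.
  by rewrite cutoff_dir.
rewrite big_nat [RHS]big_nat; apply: eq_bigr => i /andP[Mi _].
rewrite c_high// ee_be// hlam; last by rewrite ltnS -cutoff_dir.
rewrite /= -scalerA; congr (_ *: _).
by rewrite /P_dir /line_proj /co /be hdir.
Qed.

(** Any other point within distance Cz of mu_i is in the resolvent set by [simple_resolvent]. *)
Lemma spectrum_rho (z : R[i]) (Cz : R) i : (M <= i)%N ->
  nrm (z - (mun nn kap k i)%:C) <= Cz ->
  4 * beta * Num.sqrt M%:R + 1 <= kap * M%:R - Cz - 2 * beta ->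
  spectrum (L_bc bc k omega q) z -> z = rho i.
Proof.
move=> Mi zC hM hz; apply/eqP; apply: contraT => zr; exfalso; apply: hz.
have [S [B [hS SE]]] := simple_resolvent C kap_gt0 k0 nn_lb bq_le m0 aligned m_large nn_inj Mi zC zr hM.
exists S; split; first exact: bounded_blin hS.
by move=> x y; rewrite SE L_bc_mun.
Qed.

End Dirichlet.
End Cutoff.

Lemma bq_bound_ge0 : 0 <= beta. Proof. exact: le_trans (nrm_ge0 _) (bq_le 0). Qed.

(** Half of kap times the cutoff dominates Cz + 2 beta + 1 by the choice of y; the other half
    dominates the square root term, because the cutoff is at least 72^2 beta^2 / kap^2. *)
Lemma large_cutoff (Cz : R) m' : exists m, [/\ (m' <= m)%N, (0 < m)%N,
  72 ^+ 2 * beta ^+ 2 / kap ^+ 2 <= (cutoff m)%:R &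
  4 * beta * Num.sqrt (cutoff m)%:R + 1 <= kap * (cutoff m)%:R - Cz - 2 * beta].
Proof.
have kp := kap_gt0; have b0 := bq_bound_ge0.
pose x := 72 ^+ 2 * beta ^+ 2 / kap ^+ 2; pose y := 2 * (`|Cz| + 2 * beta + 1) / kap.
have x0 : 0 <= x by rewrite /x divr_ge0 ?sqr_ge0// mulr_ge0 ?sqr_ge0.
have y0 : 0 <= y by rewrite divr_ge0 ?(ltW kp)// mulr_ge0// !addr_ge0// mulr_ge0.
exists (maxn m' (Num.bound (x + y)).+1).
set m := maxn _ _; have mM : (m%:R : R) <= (cutoff m)%:R by rewrite ler_nat cutoff_ge.
have xy : x + y <= (cutoff m)%:R.
  apply: le_trans mM; apply: (@le_trans _ _ (Num.bound (x + y))%:R).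
    by apply/ltW/archi_boundP; rewrite addr_ge0.
  by rewrite ler_nat /m leq_max leqnSn orbT.
split; [exact: leq_maxl|by rewrite leq_max orbT|by apply: le_trans xy; rewrite lerDl|].
set z : R := (cutoff m)%:R in xy *; have z0 : 0 <= z by rewrite /z.
have h1 : 4 * beta * Num.sqrt z <= kap * z / 2.
  have a0 : 0 <= 4 * beta * Num.sqrt z by apply: mulr_ge0; rewrite ?sqrtr_ge0//; apply: mulr_ge0.
  have c0 : 0 <= kap * z / 2 by rewrite divr_ge0// mulr_ge0// ltW.
  rewrite -(ler_pXn2r (n := 2)) ?nnegrE//.
  rewrite exprMn sqr_sqrtr// (_ : (kap * z / 2) ^+ 2 = kap ^+ 2 / 4 * z * z); last by field.
  rewrite ler_wpM2r//; have : x <= z by apply: le_trans xy; rewrite lerDl.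
  have kp2 : 0 < kap ^+ 2 by rewrite exprn_gt0.
  move=> xz; have : 72 ^+ 2 * beta ^+ 2 <= z * kap ^+ 2 by rewrite -ler_pdivrMr.
  by have := sqr_ge0 beta; clear; set w := kap ^+ 2; rewrite !exprMn; set u := beta ^+ 2; lra.
have h2 : `|Cz| + 2 * beta + 1 <= kap * z / 2.
  have : y <= z by lra.
  by rewrite /y ler_pdivrMr//; lra.
have := ler_norm Cz; lra.
Qed.

Lemma theorem8_of_cutoff m (lam : nat -> R[i]) :
  (0 < m)%N -> 72 ^+ 2 * beta ^+ 2 / kap ^+ 2 <= (cutoff m)%:R ->
  ((exists m' lam', spectral_description bc k omega q m' lam') ->
     spectral_description bc k omega q m lam) ->
  (bc = dir -> forall s, (m < s)%N -> lam s = mrho co nn kap k bq (cutoff m) s.-1) ->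
  sectorial (graph_opp (L_bc bc k omega q)) /\
  exists T : R -> L2 omega -> L2 omega,
    [/\ analytic_semigroup T,
        generator T = graph_opp (L_bc bc k omega q) &
        exists (m : nat) (lam : nat -> R[i]),
          [/\ bc = dir -> (0 < m)%N,
              (exists m' lam', spectral_description bc k omega q m' lam') ->
                spectral_description bc k omega q m lam &
              exists T' T1 T2 : R -> L2 omega -> L2 omega,
                [/\ semigroup T',
                    similar_semigroups T T',
                    semigroup_direct_sum (P_upto bc m) T1 T2 T' &
                    bc = dir -> forall (t : R) (x : L2 omega), 0 <= t ->
                      \sum_(m.+1 <= s < N) cexp (- lam s * t%:C) *: P_dir s x
                        @[N --> \oo] --> T2 t (x - P_upto bc m x)]]].
Proof.
move=> mp ml hs hl.
have m0 : (0 < cutoff m)%N := leq_trans mp (cutoff_ge m).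
have [hsec [T [h1 h2 h3 h4 h5]]] := semigroup_properties m0 ml.
split=> //; exists T; split=> //; exists m, lam; split=> //.
exists (fun t => Tz co (mnu nn kap k (cutoff m)) (mK co nn kap k bq (cutoff m)) t%:C).
exists (fun t => Tz co (mnu nn kap k (cutoff m)) (mK co nn kap k bq (cutoff m)) t%:C).
exists (fun t => Tz co (mnu nn kap k (cutoff m)) (mK co nn kap k bq (cutoff m)) t%:C).
split=> // hd t x t0; apply: Tz_dir => //; exact: hl.
Qed.

Lemma theorem8_aux :
  sectorial (graph_opp (L_bc bc k omega q)) /\
  exists T : R -> L2 omega -> L2 omega,
    [/\ analytic_semigroup T,
        generator T = graph_opp (L_bc bc k omega q) &
        exists (m : nat) (lam : nat -> R[i]),
          [/\ bc = dir -> (0 < m)%N,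
              (exists m' lam', spectral_description bc k omega q m' lam') ->
                spectral_description bc k omega q m lam &
              exists T' T1 T2 : R -> L2 omega -> L2 omega,
                [/\ semigroup T',
                    similar_semigroups T T',
                    semigroup_direct_sum (P_upto bc m) T1 T2 T' &
                    bc = dir -> forall (t : R) (x : L2 omega), 0 <= t ->
                      \sum_(m.+1 <= s < N) cexp (- lam s * t%:C) *: P_dir s x
                        @[N --> \oo] --> T2 t (x - P_upto bc m x)]]].
Proof.
(* Without a spectral description the condition on m and lam is void, and the exponents of the
   semigroup itself serve as lam. *)
have [[m' [lam' hsp]]|nsp] := pselect (exists m' lam', spectral_description bc k omega q m' lam'); last first.
  have [m [_ mp ml _]] := large_cutoff 0 0.
  by apply: (theorem8_of_cutoff (m := m) (lam := fun s => mrho co nn kap k bq (cutoff m) s.-1)).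
(* The constant adds the bound on the remainders to the distance of the explicit eigenvalues from
   the mu; the n-th Dirichlet eigenvalue belongs to basis index n - 1. *)
have [Cz hC] : exists Cz : R, bc = dir -> forall n, (m' < n)%N ->
    nrm (lam' n - (mun nn kap k n.-1)%:C) <= Cz /\ spectrum (L_bc bc k omega q) (lam' n).
  have [hd|nd] := pselect (bc = dir); last by exists 0 => /nd.
  move: hsp; rewrite /spectral_description hd => -[_ hr [sg _ E]].
  have [B1 h1] := small_remainder_bounded hr.
  have [B2 h2] := lambda_dir_bounded omega0 k1 qL2.
  exists (B1 + B2) => _ n mn; split; last by rewrite E; right; exists n.
  have -> : mun nn kap k n.-1 = (pi * n%:R / omega) ^+ (2 * k).
    rewrite -ev_mun /ev /fr /nf hd prednK// (leq_ltn_trans _ mn)//.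
  apply: le_trans (nrm_tri (lambda_dir k omega q n) _ _) _.
  by apply: lerD; [exact: h1|exact: h2].
have [m [mm mp ml mC]] := large_cutoff Cz m'.
apply: (theorem8_of_cutoff (m := m) (lam := lam')) => //; first by move=> _; exact: spectral_descriptionS hsp.
move=> hd s ms; have [hz hs] := hC hd s (leq_ltn_trans mm ms).
apply: (spectrum_rho _ ml hd _ hz mC hs); first exact: leq_trans mp (cutoff_ge m).
by rewrite cutoff_dir// -ltnS prednK// (leq_ltn_trans _ ms).
Qed.

End Main.

Theorem theorem8 (R : realType) (bc : boundary_condition) (k : nat)
    (omega : R) (q : R -> R[i]) :
  (1 < k)%N -> 0 < omega -> q \in sqint (itv_measure omega) ->
  sectorial (graph_opp (L_bc bc k omega q)) /\
  exists T : R -> L2 omega -> L2 omega,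
    [/\ analytic_semigroup T,
        generator T = graph_opp (L_bc bc k omega q) &
        exists (m : nat) (lam : nat -> R[i]),
          [/\ bc = dir -> (0 < m)%N,
              (exists m' lam', spectral_description bc k omega q m' lam') ->
                spectral_description bc k omega q m lam &
              exists T' T1 T2 : R -> L2 omega -> L2 omega,
                [/\ semigroup T',
                    similar_semigroups T T',
                    semigroup_direct_sum (P_upto bc m) T1 T2 T' &
                    bc = dir -> forall (t : R) (x : L2 omega), 0 <= t ->
                      \sum_(m.+1 <= s < N) cexp (- lam s * t%:C) *: P_dir s x
                        @[N --> \oo] --> T2 t (x - P_upto bc m x)]]].
Proof. by move=> k1 omega0 qL2; exact: theorem8_aux. Qed.
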